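(* For any plane curve singularity, that is, for any germ of a holomorphic function $f:(\mathbb{C}^2,x)\to(\mathbb{C},0)$ (not necessarily reduced or irreducible), the order of a pole of the local motivic zeta function $Z_{\mathrm{mot},x}(f;s)$ is at most its multiplicity as a root of the local Bernstein–Sato polynomial $b_{f,x}(s)$.
   Context: $b_{f,x}(s)$ is the local Bernstein–Sato polynomial: the monic polynomial of smallest degree in $\mathbb{C}[s]$ such that $P(s)\cdot f^{s+1}=b_{f,x}(s)f^s$ for some differential operator $P(s)$ with coefficients in $\mathscr{O}_{\mathbb{C}^2,x}\otimes\mathbb{C}[s]$. Local motivic zeta function: $Z_{\mathrm{mot},x}(f;s)=\int_{\mathcal{L}_x(\mathbb{C}^2)}\mathbb{L}^{-s\,\mathrm{ord}_tf}\,d\mu$, a motivic integral over the space of arcs centered at $x$. If $\pi:Y\to(\mathbb{C}^2,x)$ is a log resolution of $f$, with $\mathrm{Div}(\pi^*f)=\sum_{i\in T}N_iE_i$ and $\mathrm{Div}(\det\mathrm{Jac}\,\pi)=\sum_{i\in T}(k_i-1)E_i$, it equals $\mathbb{L}^{-2}\sum_{J\subseteq T}[E_J^\circ\cap\pi^{-1}(x)]\prod_{i\in J}\frac{\mathbb{L}-1}{\mathbb{L}^{N_is+k_i}-1}$, where $E_J^\circ=\bigcap_{i\in J}E_i\setminus\bigcup_{j\notin J}E_j$, $[\cdot]$ is the class in the Grothendieck ring $K_0(\mathrm{Var}_{\mathbb{C}})$ and $\mathbb{L}=[\mathbb{A}^1]$. Order of a pole: writing $U=\mathbb{L}^{-s}$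 and $\mathcal{M}=K_0(\mathrm{Var}_{\mathbb{C}})[\mathbb{L}^{-1}]$, $Z_{\mathrm{mot},x}(f;s)$ has a pole of order at most $m$ at $s_0\in\mathbb{Q}$ if it lies in the $\mathcal{M}[U]$-module generated by elements $\prod_{(a,b)\in P}(1-\mathbb{L}^aU^b)^{-1}$, for multisets $P$ in $\mathbb{Z}\times\mathbb{Z}_{>0}$ each containing at most $m$ elements with $a/b=s_0$; the order of the pole is the least such $m$ (a pole meaning order $\ge1$). *)

(* Defs.v *)
From HB Require Import structures.
From mathcomp Require Import all_boot all_order all_algebra.
From mathcomp Require Import mpoly.
From mathcomp Require Import boolp classical_sets.

Set Implicit Arguments.
Unset Strict Implicit.
Unset Printing Implicit Defensive.
Import Order.TTheory GRing.Theory Num.Theory.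
Local Open Scope classical_set_scope.
Local Open Scope ring_scope.
Local Open Scope quotient_scope.

(* A[[t]]; fps (fps A) is A[[z1, z2]], f i j being the coefficient of z1^i z2^j.
   The ring structures below only require possibly trivial rings (comPzRingType), since
   the Grothendieck ring of varieties is not shown here to be nontrivial. *)
Record fps (A : Type) := Fps { fps_coef :> nat -> A }.

HB.instance Definition _ (A : Type) := gen_eqMixin (fps A).
HB.instance Definition _ (A : Type) := gen_choiceMixin (fps A).

Lemma fpsP (A : Type) (f g : fps A) : f =1 g -> f = g.
Proof. by case: f => f; case: g => g /= /funext ->. Qed.

Section FpsRing.
Variable A : comPzRingType.
Implicit Types f g h : fps A.

Definition fps_add f g := Fps (fun n => f n + g n).
Definition fps_opp f := Fps (fun n => - f n).
(* a t^d *)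
Definition fps_mono (a : A) (d : nat) := Fps (fun n => if n == d then a else 0).
Definition fps_mul f g := Fps (fun n => \sum_(i < n.+1) f i * g (n - i)%N).

Lemma fps_addA : associative fps_add.
Proof. by move=> f g h; apply: fpsP => n /=; rewrite addrA. Qed.
Lemma fps_addC : commutative fps_add.
Proof. by move=> f g; apply: fpsP => n /=; rewrite addrC. Qed.
Lemma fps_add0 : left_id (Fps (fun=> 0)) fps_add.
Proof. by move=> f; apply: fpsP => n /=; rewrite add0r. Qed.
Lemma fps_addN : left_inverse (Fps (fun=> 0)) fps_opp fps_add.
Proof. by move=> f; apply: fpsP => n /=; rewrite addNr. Qed.

HB.instance Definition _ :=
  GRing.isZmodule.Build (fps A) fps_addA fps_addC fps_add0 fps_addN.

Lemma fps_mulC : commutative fps_mul.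
Proof.
move=> f g; apply: fpsP => n /=; rewrite (reindex_inj rev_ord_inj) /=.
by apply: eq_bigr => i _; rewrite subSS subKn ?leq_ord // mulrC.
Qed.

Lemma fps_mulA : associative fps_mul.
Proof.
move=> p q r; apply: fpsP => i; rewrite (fps_mulC (fps_mul p q)) (fps_mulC q) /=.
pose c3 j k := p j * (q (i - j - k)%N * r k).
transitivity (\sum_(j < i.+1) \sum_(k < i.+1 | (k <= i - j)%N) c3 j k).
  apply: eq_bigr => /= j _; rewrite big_distrr /=.
  rewrite (big_ord_narrow_leq (leq_subr _ _)) /=.
  by apply: eq_bigr => k _; rewrite /c3 (mulrC (r k)).
rewrite (exchange_big_dep predT) //=; apply: eq_bigr => k _.
transitivity (\sum_(j < i.+1 | (j <= i - k)%N) c3 j k).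
  apply: eq_bigl => j; rewrite -ltnS -(ltnS j) -!subSn ?leq_ord //.
  by rewrite -subn_gt0 -(subn_gt0 j) -!subnDA addnC.
rewrite (big_ord_narrow_leq (leq_subr _ _)) big_distrr /=.
apply: eq_bigr => j _; rewrite /c3 -!subnDA addnC mulrA.
by rewrite (mulrC (r k)).
Qed.

Lemma fps_mul1 : left_id (fps_mono 1 0) fps_mul.
Proof.
move=> f; apply: fpsP => n /=; rewrite big_ord_recl /= mul1r subn0.
by rewrite big1 ?addr0 // => i _; rewrite mul0r.
Qed.

Lemma fps_mulDl : left_distributive fps_mul fps_add.
Proof.
move=> f g h; apply: fpsP => n /=; rewrite -big_split /=.
by apply: eq_bigr => i _; rewrite mulrDl.
Qed.

HB.instance Definition _ := GRing.Zmodule_isComPzRing.Build (fps A)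
  fps_mulA fps_mulC fps_mul1 fps_mulDl.

Definition fps_const (a : A) : fps A := fps_mono a 0.
Definition fps_deriv f : fps A := Fps (fun n => f n.+1 *+ n.+1).
End FpsRing.

Lemma fps_one_neq0 (A : comNzRingType) : (1 : fps A) != 0.
Proof.
by apply/eqP => /(congr1 (fun f : fps A => f 0%N)) /= /eqP; rewrite oner_eq0.
Qed.
HB.instance Definition _ (A : comNzRingType) :=
  GRing.PzSemiRing_isNonZero.Build (fps A) (@fps_one_neq0 A).

(* Algebraic varieties over C (reduced, separated, of finite type, possibly
   reducible) in the sense of Serre's FAC: a set with a finite atlas of charts
   onto locally closed subsets of affine spaces, with regular coordinate changes
   on open overlaps, and with closed diagonal. *)
Section Varieties.
Variable C : numClosedFieldType.

Definition peval (n : nat) (p : {mpoly C[n]}) (v : 'rV[C]_n) : C :=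
  meval (fun i => v 0 i) p.

(* Here u : D -> C^n is a chart domain D with its coordinates. A set is Zariski
   closed in D if it is cut out there by polynomials in u; a function is regular
   on D if near every point it is a quotient of polynomials in u (the
   neighbourhood can be taken to be all of {q != 0}: multiply p and q by an
   equation of the complement of a smaller principal neighbourhood). *)
Section InCoordinates.
Variables (T : Type) (n : nat) (u : T -> 'rV[C]_n) (D : set T).

Definition zclosed_in (Z : set T) : Prop :=
  exists I : set ({mpoly C[n]}),
    forall x, D x -> (Z x <-> forall p, I p -> peval p (u x) = 0).

Definition zopen_in (U : set T) : Prop := zclosed_in (~` U).

Definition regular_in (h : T -> C) : Prop :=
  forall x, D x -> exists p q : {mpoly C[n]}, peval q (u x) != 0 /\
    forall y, D y -> peval q (u y) != 0 -> h y = peval p (u y) / peval q (u y).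
End InCoordinates.

Definition zclosed_affine (n : nat) (Z : set 'rV[C]_n) : Prop :=
  zclosed_in id setT Z.

Definition locally_closed (n : nat) (S : set 'rV[C]_n) : Prop :=
  exists Z W, [/\ zclosed_affine Z, zclosed_affine W & S = Z `\` W].

(* An atlas lives on its support, the union of the chart domains; T is only an
   ambient type. Values of coordinates and of maps outside are irrelevant. *)
Record chart (T : Type) := Chart {
  cdim : nat;
  cdom : set T;
  coord : T -> 'rV[C]_cdim }.

HB.instance Definition _ (T : Type) := gen_eqMixin (chart T).

Definition atlas (T : Type) := seq (chart T).

Definition support (T : Type) (X : atlas T) : set T :=
  [set x | exists2 c, c \in X & cdom c x].

Definition restr (T : Type) (X : atlas T) (S : set T) : atlas T :=
  [seq Chart (cdom c `&` S) (coord c) | c <- X].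

Definition prod_atlas (T T' : Type) (X : atlas T) (Y : atlas T') :
    atlas (T * T') :=
  [seq Chart (cdom c `*` cdom d) (fun xy => row_mx (coord c xy.1) (coord d xy.2))
    | c <- X, d <- Y].

Definition zclosed (T : Type) (X : atlas T) (Z : set T) : Prop :=
  forall c, c \in X -> zclosed_in (coord c) (cdom c) Z.

Definition regular_map (T T' : Type) (X : atlas T) (Y : atlas T')
    (phi : T -> T') : Prop :=
  (forall x, support X x -> support Y (phi x)) /\
  forall c d, c \in X -> d \in Y ->
    zopen_in (coord c) (cdom c) (phi @^-1` cdom d) /\
    forall k, regular_in (coord c) (cdom c `&` phi @^-1` cdom d)
                (fun x => coord d (phi x) 0 k).

Definition isomorphic (T T' : Type) (X : atlas T) (Y : atlas T') : Prop :=
  exists (phi : T -> T') (psi : T' -> T),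
    [/\ regular_map X Y phi, regular_map Y X psi,
        forall x, support X x -> psi (phi x) = x &
        forall y, support Y y -> phi (psi y) = y].

Record is_variety (T : Type) (X : atlas T) : Prop := IsVariety {
  variety_inj : forall c x y, c \in X -> cdom c x -> cdom c y ->
    coord c x = coord c y -> x = y;
  variety_local : forall c, c \in X -> locally_closed (coord c @` cdom c);
  variety_change : regular_map X X id;
  variety_separated : zclosed (prod_atlas X X) [set xy | xy.1 = xy.2] }.

(* Points are taken in the fixed type seq C, the disjoint union of all C^n. Every
   variety is isomorphic to one of these, so that isomorphism classes are the
   same; without a fixed ambient type the varieties would form a type too large
   to be quotiented by a mathcomp quotient. *)
Record variety := Variety {
  variety_atlas :> atlas (seq C);
  varietyP : is_variety variety_atlas }.

Definition row_of_seq (n : nat) (s : seq C) : 'rV[C]_n := \row_i s`_i.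

Definition quasi_affine_atlas (n : nat) (S : set 'rV[C]_n) : atlas (seq C) :=
  [:: Chart [set s | size s = n /\ S (row_of_seq n s)] (row_of_seq n)].

Lemma zclosed_in_set0 T n (u : T -> 'rV[C]_n) D : zclosed_in u D set0.
Proof.
exists [set (1 : {mpoly C[n]})] => x _; split=> // /(_ 1 erefl) /eqP.
by rewrite /peval meval1 oner_eq0.
Qed.

Lemma row_of_seq_inj n (s t : seq C) : size s = n -> size t = n ->
  row_of_seq n s = row_of_seq n t -> s = t.
Proof.
move=> ss st e; apply: (@eq_from_nth _ 0); first by rewrite ss st.
move=> i; rewrite ss => lt_in.
by have := congr1 (fun v : 'rV_n => v 0 (Ordinal lt_in)) e; rewrite !mxE.
Qed.

Lemma quasi_affineP n (S : set 'rV[C]_n) :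
  locally_closed S -> is_variety (quasi_affine_atlas S).
Proof.
move=> lcS; split.
- move=> c x y; rewrite mem_seq1 => /eqP -> /= [sx _] [sy _]; exact: row_of_seq_inj.
- move=> c; rewrite mem_seq1 => /eqP -> /=.
  rewrite (_ : _ @` _ = S) //; apply/seteqP; split=> [v [s [_ Ss] <- //]|v Sv].
  have rv : row_of_seq n [seq v 0 i | i <- enum 'I_n] = v.
    apply/rowP => i; rewrite mxE (nth_map i) ?size_enum_ord //.
    by rewrite nth_ord_enum.
  by exists [seq v 0 i | i <- enum 'I_n]; rewrite // /= size_map size_enum_ord rv.
- split=> // c d; rewrite !mem_seq1 => /eqP -> /eqP -> /=; split.
    exists [set 1] => x Dx; split=> [/(_ Dx) //|/(_ 1 erefl) /eqP].
    by rewrite /peval meval1 oner_eq0.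
  move=> k x _; exists 'X_k, 1.
  by rewrite /peval meval1 oner_neq0; split=> // y _ _;
     rewrite meval1 mevalXU divr1.
- move=> c; rewrite mem_seq1 => /eqP -> /=; exists [set p | exists k : 'I_n,
    p = 'X_(lshift n k) - 'X_(rshift n k)].
  move=> [x y] [/= [sx Sx] [sy Sy]]; split=> [exy p [k ->]|exy].
    by rewrite /peval mevalB !mevalXU row_mxEl row_mxEr exy subrr.
  apply: row_of_seq_inj sx sy _.
  apply/rowP => k; apply/eqP; rewrite -subr_eq0; apply/eqP.
  have := exy _ (ex_intro _ k erefl).
  by rewrite /peval mevalB !mevalXU row_mxEl row_mxEr.
Qed.

Definition quasi_affine n (S : set 'rV[C]_n) (lcS : locally_closed S) :=
  Variety (quasi_affineP lcS).

Lemma locally_closedT n : locally_closed [set: 'rV[C]_n].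
Proof.
exists setT, set0; split; last by rewrite setD0.
  by exists set0.
exact: zclosed_in_set0.
Qed.

Definition affine_variety (n : nat) : variety :=
  quasi_affine (locally_closedT n).

(* M = K_0(Var_C)[L^-1] is the commutative ring presented by the generators [X]
   (X a variety) and L^-1 and the relations: isomorphism invariance, scissor
   relations [X] = [S] + [X \ S] for S closed in X, [X x Y] = [X] [Y], [pt] = 1,
   and L * L^-1 = 1. Formal ring expressions are quotiented by the congruence
   generated by the ring axioms and these relations. *)
Inductive mexpr : Type :=
| MClass of variety
| MZero | MOne | MLinv
| MOpp of mexpr
| MAdd of mexpr & mexpr
| MMul of mexpr & mexpr.

Inductive meq : mexpr -> mexpr -> Prop :=
| meq_refl a : meq a a
| meq_sym a b : meq a b -> meq b a
| meq_trans a b c : meq a b -> meq b c -> meq a c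
| meq_opp a b : meq a b -> meq (MOpp a) (MOpp b)
| meq_add a b c d : meq a b -> meq c d -> meq (MAdd a c) (MAdd b d)
| meq_mul a b c d : meq a b -> meq c d -> meq (MMul a c) (MMul b d)
| meq_addA a b c : meq (MAdd a (MAdd b c)) (MAdd (MAdd a b) c)
| meq_addC a b : meq (MAdd a b) (MAdd b a)
| meq_add0 a : meq (MAdd MZero a) a
| meq_addN a : meq (MAdd (MOpp a) a) MZero
| meq_mulA a b c : meq (MMul a (MMul b c)) (MMul (MMul a b) c)
| meq_mulC a b : meq (MMul a b) (MMul b a)
| meq_mul1 a : meq (MMul MOne a) a
| meq_mulD a b c : meq (MMul (MAdd a b) c) (MAdd (MMul a c) (MMul b c))
| meq_iso (X Y : variety) : isomorphic X Y -> meq (MClass X) (MClass Y)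
| meq_scissor (X Y Z : variety) (S : set (seq C)) :
    zclosed X S ->
    isomorphic Y (restr X S) -> isomorphic Z (restr X (~` S)) ->
    meq (MClass X) (MAdd (MClass Y) (MClass Z))
| meq_point : meq (MClass (affine_variety 0)) MOne
| meq_prod (X Y P : variety) : isomorphic P (prod_atlas X Y) ->
    meq (MClass P) (MMul (MClass X) (MClass Y))
| meq_Linv : meq (MMul (MClass (affine_variety 1)) MLinv) MOne.

HB.instance Definition _ := gen_eqMixin mexpr.
HB.instance Definition _ := gen_choiceMixin mexpr.

Definition meqb (a b : mexpr) : bool := `[< meq a b >].

Lemma meqb_refl : reflexive meqb.
Proof. by move=> a; apply/asboolP/meq_refl. Qed.
Lemma meqb_sym : ssrbool.symmetric meqb.
Proof. by move=> a b; apply/asboolP/asboolP; apply: meq_sym. Qed.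
Lemma meqb_trans : transitive meqb.
Proof. by move=> b a c /asboolP ab /asboolP bc; apply/asboolP/(meq_trans ab). Qed.

Canonical meqb_equiv := EquivRel meqb meqb_refl meqb_sym meqb_trans.

Definition motring : Type := {eq_quot meqb}.
HB.instance Definition _ := Choice.on motring.

Definition mot_of (a : mexpr) : motring := \pi_({eq_quot meqb}) a.
Definition mot_repr (x : motring) : mexpr := repr (x : {eq_quot meqb}).

Lemma mot_reprK x : mot_of (mot_repr x) = x.
Proof. exact: reprK. Qed.

Lemma mot_ofP a b : meq a b <-> mot_of a = mot_of b.
Proof.
split=> [ab|/eqmodP/asboolP //]; exact/eqmodP/asboolP.
Qed.

Lemma mot_of_repr a : meq (mot_repr (mot_of a)) a.
Proof. by apply/mot_ofP; rewrite mot_reprK. Qed.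

Definition mot_add x y := mot_of (MAdd (mot_repr x) (mot_repr y)).
Definition mot_mul x y := mot_of (MMul (mot_repr x) (mot_repr y)).
Definition mot_opp x := mot_of (MOpp (mot_repr x)).

Lemma mot_ofD a b : mot_of (MAdd a b) = mot_add (mot_of a) (mot_of b).
Proof. by apply/mot_ofP/meq_add; apply/meq_sym/mot_of_repr. Qed.
Lemma mot_ofM a b : mot_of (MMul a b) = mot_mul (mot_of a) (mot_of b).
Proof. by apply/mot_ofP/meq_mul; apply/meq_sym/mot_of_repr. Qed.
Lemma mot_ofN a : mot_of (MOpp a) = mot_opp (mot_of a).
Proof. by apply/mot_ofP/meq_opp; apply/meq_sym/mot_of_repr. Qed.

Lemma mot_addA : associative mot_add.
Proof.
move=> x y z; rewrite -(mot_reprK x) -(mot_reprK y) -(mot_reprK z) -!mot_ofD.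
exact/mot_ofP/meq_addA.
Qed.
Lemma mot_addC : commutative mot_add.
Proof.
move=> x y; rewrite -(mot_reprK x) -(mot_reprK y) -!mot_ofD.
exact/mot_ofP/meq_addC.
Qed.
Lemma mot_add0 : left_id (mot_of MZero) mot_add.
Proof. by move=> x; rewrite -(mot_reprK x) -mot_ofD; exact/mot_ofP/meq_add0. Qed.
Lemma mot_addN : left_inverse (mot_of MZero) mot_opp mot_add.
Proof.
move=> x; rewrite -(mot_reprK x) -mot_ofN -mot_ofD; exact/mot_ofP/meq_addN.
Qed.
Lemma mot_mulA : associative mot_mul.
Proof.
move=> x y z; rewrite -(mot_reprK x) -(mot_reprK y) -(mot_reprK z) -!mot_ofM.
exact/mot_ofP/meq_mulA.
Qed.
Lemma mot_mulC : commutative mot_mul.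
Proof.
move=> x y; rewrite -(mot_reprK x) -(mot_reprK y) -!mot_ofM.
exact/mot_ofP/meq_mulC.
Qed.
Lemma mot_mul1 : left_id (mot_of MOne) mot_mul.
Proof. by move=> x; rewrite -(mot_reprK x) -mot_ofM; exact/mot_ofP/meq_mul1. Qed.
Lemma mot_mulD : left_distributive mot_mul mot_add.
Proof.
move=> x y z; rewrite -(mot_reprK x) -(mot_reprK y) -(mot_reprK z).
rewrite -!(mot_ofD, mot_ofM); exact/mot_ofP/meq_mulD.
Qed.

HB.instance Definition _ :=
  GRing.isZmodule.Build motring mot_addA mot_addC mot_add0 mot_addN.
HB.instance Definition _ := GRing.Zmodule_isComPzRing.Build motring
  mot_mulA mot_mulC mot_mul1 mot_mulD.

Definition mclass (X : variety) : motring := mot_of (MClass X).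
(* L = [A^1]. *)
Definition Lef : motring := mclass (affine_variety 1).
Definition Lef_inv : motring := mot_of MLinv.

Lemma Lef_mulV : Lef * Lef_inv = 1.
Proof. by rewrite [LHS](esym (mot_ofM _ _)); exact/mot_ofP/meq_Linv. Qed.

Definition Lef_pow (a : int) : motring :=
  match a with Posz n => Lef ^+ n | Negz n => Lef_inv ^+ n.+1 end.
End Varieties.

Section Substitution.
Variable A : comPzRingType.

(* f(g, h), for g and h without constant term: the coefficient of t^k then only
   involves the monomials z1^i z2^j of f with i, j <= k. *)
Definition fps_subst (f : fps (fps A)) (g h : fps A) : fps A :=
  Fps (fun k => \sum_(i < k.+1) \sum_(j < k.+1)
                  f i j * fps_coef (g ^+ i * h ^+ j) k).

Definition has_order (h : fps A) (n : nat) : Prop :=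
  (forall k, (k < n)%N -> h k = 0) /\ h n <> 0.

Definition agree_upto (n : nat) (g h : fps A) : Prop :=
  forall k, (k <= n)%N -> g k = h k.

Lemma agree_mul n g h g' h' : agree_upto n g h -> agree_upto n g' h' ->
  agree_upto n (g * g') (h * h').
Proof.
move=> gh gh' k le_kn /=; apply: eq_bigr => i _.
rewrite gh ?gh' //; first exact: leq_trans (leq_subr _ _) le_kn.
by apply: leq_trans le_kn; rewrite -ltnS.
Qed.

Lemma agree_exp n g h i : agree_upto n g h -> agree_upto n (g ^+ i) (h ^+ i).
Proof.
move=> gh; elim: i => [|i IHi]; first by rewrite !expr0.
by rewrite !exprS; apply: agree_mul.
Qed.

Lemma agree_subst n f g h g' h' : agree_upto n g h -> agree_upto n g' h' ->
  agree_upto n (fps_subst f g g') (fps_subst f h h').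
Proof.
move=> gh gh' k le_kn /=; apply: eq_bigr => i _; apply: eq_bigr => j _.
by congr (_ * _); apply: agree_mul le_kn; apply: agree_exp.
Qed.

End Substitution.

Section SubstMap.
Variables (A B : comPzRingType) (phi : {rmorphism A -> B}).

Definition fps_map (g : fps A) : fps B := Fps (fun k => phi (g k)).

Lemma fps_mapM g h : fps_map (g * h) = fps_map g * fps_map h.
Proof.
by apply: fpsP => k /=; rewrite rmorph_sum; apply: eq_bigr => i _; rewrite rmorphM.
Qed.

Lemma fps_mapX g i : fps_map (g ^+ i) = fps_map g ^+ i.
Proof.
elim: i => [|i IHi]; last by rewrite !exprS fps_mapM IHi.
rewrite !expr0; apply: fpsP => k /=.
by case: eqP => _; rewrite ?rmorph1 ?rmorph0.
Qed.

Lemma fps_subst_map f g h k :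
  phi (fps_subst f g h k) =
  fps_subst (Fps (fun i => fps_map (f i))) (fps_map g) (fps_map h) k.
Proof.
transitivity (\sum_(i < k.+1) \sum_(j < k.+1)
    phi (f i j) * fps_map (g ^+ i * h ^+ j) k); last first.
  by apply: eq_bigr => i _; apply: eq_bigr => j _; rewrite fps_mapM !fps_mapX.
by rewrite [LHS]rmorph_sum; apply: eq_bigr => i _; rewrite rmorph_sum;
   apply: eq_bigr => j _; rewrite rmorphM.
Qed.
End SubstMap.

Section Zeta.
Variable C : numClosedFieldType.

(* Arcs of C^2, in coordinates centered at x. *)
Definition arc : Type := (fps C * fps C)%type.

Definition jet (m : nat) (gamma : arc) : 'rV[C]_(m.+1 + m.+1) :=
  row_mx (\row_i gamma.1 i) (\row_i gamma.2 i).

(* The arcs centered at x along which f has order exactly n. *)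
Definition contact_locus (f : fps (fps C)) (n : nat) : set arc :=
  [set gamma : arc | [/\ gamma.1 0%N = 0, gamma.2 0%N = 0 &
                   has_order (fps_subst f gamma.1 gamma.2) n]].

Lemma contact_jets_locally_closed f n :
  locally_closed (jet n @` contact_locus f n).
Proof.
pose N := (n.+1 + n.+1)%N.
pose G1 : fps {mpoly C[N]} :=
  Fps (fun k => if (k <= n)%N then 'X_(lshift n.+1 (inord k)) else 0).
pose G2 : fps {mpoly C[N]} :=
  Fps (fun k => if (k <= n)%N then 'X_(rshift n.+1 (inord k)) else 0).
pose F : fps (fps {mpoly C[N]}) := Fps (fun i => Fps (fun j => (f i j)%:MP)).
pose P k : {mpoly C[N]} := fps_subst F G1 G2 k.
pose ev (v : 'rV[C]_N) : {mpoly C[N]} -> C := meval (fun i => v 0 i).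
pose g1 (v : 'rV[C]_N) := fps_map (ev v) G1.
pose g2 (v : 'rV[C]_N) := fps_map (ev v) G2.
have evP v k : peval (P k) v = fps_subst f (g1 v) (g2 v) k.
  rewrite /P /peval fps_subst_map; congr (fps_coef (fps_subst _ _ _) k).
  by apply: fpsP => i; apply: fpsP => j /=; rewrite mevalC.
have g1E gamma : agree_upto n (g1 (jet n gamma)) gamma.1.
  by move=> k le_kn; rewrite /= le_kn /ev mevalXU row_mxEl mxE inordK.
have g2E gamma : agree_upto n (g2 (jet n gamma)) gamma.2.
  by move=> k le_kn; rewrite /= le_kn /ev mevalXU row_mxEr mxE inordK.
have jetK v : jet n (g1 v, g2 v) = v.
  apply/rowP => i; rewrite -(splitK i); case: (fintype.split i) => j /=.
    by rewrite row_mxEl mxE /= -ltnS ltn_ord /ev mevalXU inord_val.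
  by rewrite row_mxEr mxE /= -ltnS ltn_ord /ev mevalXU inord_val.
pose I : set {mpoly C[N]} := [set p |
  [\/ p = 'X_(lshift n.+1 ord0), p = 'X_(rshift n.+1 ord0) |
      exists2 k, (k < n)%N & p = P k]].
exists [set v | forall p, I p -> peval p v = 0], [set v | peval (P n) v = 0].
split.
- by exists I.
- by exists [set P n] => v _ /=; split=> [Pv p -> //|]; apply.
apply/seteqP; split=> [v [gamma [c1 c2 [ord_lt ord_n]] <-]|v [Iv Pv]].
  have sub := agree_subst f (g1E gamma) (g2E gamma); split=> /=.
    move=> p [->|->|[k lt_kn ->]].
    - by rewrite /peval mevalXU row_mxEl mxE.
    - by rewrite /peval mevalXU row_mxEr mxE.
    - by rewrite evP sub ?ord_lt // ltnW.
  by rewrite evP sub.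
exists (g1 v, g2 v) => //; split=> /=.
- by rewrite [X in meval _ 'X_(_ X)](_ : _ = ord0);
    [apply: Iv; apply: Or31 | apply/val_inj; rewrite /= inordK].
- by rewrite [X in meval _ 'X_(_ X)](_ : _ = ord0);
    [apply: Iv; apply: Or32 | apply/val_inj; rewrite /= inordK].
- split=> [k lt_kn|].
    by rewrite -evP; apply: Iv; apply: Or33; exists k.
  by rewrite -evP.
Qed.

(* Motivic measure of a set S of arcs that is a cylinder over its m-jets:
   [pi_m S] L^-(2(m+1)), so that the space of all arcs of C^2 has measure 1. *)
Definition cylinder_measure (m : nat) (S : set arc)
    (lcS : locally_closed (jet m @` S)) : motring C :=
  mclass (quasi_affine lcS) * Lef_inv C ^+ (2 * m.+1).

(* The integral of L^(-s ord f) = U^(ord f) over the arcs centered at x, as an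
   element of M[[U]]: the sum over n of mu(ord f = n) U^n. The set of arcs with
   ord f = n is a cylinder over its n-jets. *)
Definition motivic_zeta (f : fps (fps C)) : fps (motring C) :=
  Fps (fun n => cylinder_measure (contact_jets_locally_closed f n)).

(* M[U] inside M[[U]]. *)
Definition is_polynomial (p : fps (motring C)) : Prop :=
  exists N, forall n, (N <= n)%N -> p n = 0.

Definition pole_factor (ab : int * nat) : fps (motring C) :=
  1 - fps_mono (Lef_pow C ab.1) ab.2.

(* The inverse of a product of factors 1 - L^a U^b with b > 0, at most m of which
   (counted with multiplicity) have a / b = s0. Such a product has constant
   coefficient 1, hence a unique inverse in M[[U]]. *)
Definition pole_generator (s0 : rat) (m : nat) : set (fps (motring C)) :=
  [set g | exists P : seq (int * nat),
     [/\ all (fun ab : int * nat => 0 < ab.2)%N P,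
         (count (fun ab : int * nat => ab.1%:~R / ab.2%:R == s0) P <= m)%N &
         g * \prod_(ab <- P) pole_factor ab = 1]].

Definition pole_order_at_most (Z : fps (motring C)) (s0 : rat) (m : nat) : Prop :=
  exists (N : nat) (p g : 'I_N -> fps (motring C)),
    [/\ forall i, is_polynomial (p i),
        forall i, pole_generator s0 m (g i) &
        Z = \sum_(i < N) p i * g i].

Definition is_pole_order (Z : fps (motring C)) (s0 : rat) (m : nat) : Prop :=
  pole_order_at_most Z s0 m /\
  forall m', pole_order_at_most Z s0 m' -> (m <= m')%N.
End Zeta.

Section BernsteinSato.
Variable C : numClosedFieldType.

(* C{z1, z2}, by Cauchy estimates. *)
Definition convergent (f : fps (fps C)) : Prop :=
  exists M r : C, forall i j, `|f i j| <= M * r ^+ (i + j).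

Definition fps_d1 (f : fps (fps C)) : fps (fps C) := fps_deriv f.
Definition fps_d2 (f : fps (fps C)) : fps (fps C) := Fps (fun i => fps_deriv (f i)).

(* Elements of O[s][1/f] f^s: the pair (g, k) stands for g f^(s - k), and
     d (g f^(s-k)) = ((d g) f + (s - k) g (d f)) f^(s-(k+1)).
   In particular f^(s+1) is (f, 0) and f^s is (1, 0). Polynomials in s have
   variable 'X. *)
Definition fs_elt : Type := ({poly fps (fps C)} * nat)%type.

Variable f : fps (fps C).

Definition fs_eq (u v : fs_elt) : Prop :=
  u.1 * f%:P ^+ v.2 = v.1 * f%:P ^+ u.2.

Definition fs_add (u v : fs_elt) : fs_elt :=
  (u.1 * f%:P ^+ v.2 + v.1 * f%:P ^+ u.2, (u.2 + v.2)%N).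

Definition fs_scale (c : {poly fps (fps C)}) (u : fs_elt) : fs_elt :=
  (c * u.1, u.2).

Definition fs_deriv (d : fps (fps C) -> fps (fps C)) (u : fs_elt) : fs_elt :=
  (map_poly d u.1 * f%:P + ('X - u.2%:R) * u.1 * (d f)%:P, u.2.+1).

(* The operator sum_(i,j) P_ij(z, s) d1^i d2^j. *)
Definition fs_apply (N : nat) (P : 'I_N -> 'I_N -> {poly fps (fps C)})
    (u : fs_elt) : fs_elt :=
  \big[fs_add/(0, 0%N)]_(i < N) \big[fs_add/(0, 0%N)]_(j < N)
    fs_scale (P i j) (iter i (fs_deriv fps_d1) (iter j (fs_deriv fps_d2) u)).

Definition cst_poly (b : {poly C}) : {poly fps (fps C)} :=
  map_poly (fun c => fps_const (fps_const c)) b.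

Definition bernstein_equation (b : {poly C}) : Prop :=
  exists (N : nat) (P : 'I_N -> 'I_N -> {poly fps (fps C)}),
    (forall i j k, convergent (P i j)`_k) /\
    fs_eq (fs_apply P (f%:P, 0%N)) (cst_poly b, 0%N).

Definition is_bernstein_sato (b : {poly C}) : Prop :=
  [/\ b \is monic, bernstein_equation b &
      forall b' : {poly C}, b' \is monic -> bernstein_equation b' ->
        (size b <= size b')%N].
End BernsteinSato.

(* Main.v *)
(** Motivic side: after shears [w -> w + psi(u)], the swap of coordinates, and charts
    [(u, w) -> (u^p (c + w)^al, u^q (c + w)^be)] at roots [c] of face polynomials of the Newton polygon,
    [f] becomes a series [F] and the Jacobian is [u^(k-1)] times a unit. Sort the arcs by the orders of
    their coordinates. On the cone of orders dual to a vertex [(a, h)] the order of [F] is linear, and the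
    two rays [(p, q)] bounding the cone give the denominators [1 - L^-(pk+q) U^(pa+qh)]. On the ray of an
    edge only the denominator of that ray occurs, except along the roots of the edge polynomial, where a
    chart leads back to the same situation with a smaller height [h]. A suitable shear makes all these
    roots of multiplicity at most [h/2].

    Bernstein side: moving the derivatives in [P f^(s+1) = b f^s] to the other factor writes [b(s) f^s],
    up to a multiple of [f^(s+1)], as a divergence. Pulled back to the chart of an edge with polynomial [g],
    at [s0 = -(pk+q)/(pa+qh)] with [b(s0) <> 0], its coefficient along the exceptional divisor is an
    equation [(T g^s0)' = c g^s0] with [T] rational and [c <> 0], which is impossible for degree reasons
    when [g] has two distinct roots. Hence each denominator corresponds to a root of [b].

    Two denominators with the same [s0] occur only at a vertex [(h, h)] with [k = 1], where [s0 = -1/h].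
    In a chart where [f] has normal crossings there, the residues of the primitive along both divisors are
    flat, and vanish because [f^s0] has monodromy (or because the divisor is an axis); so [b] has a double
    root at [s0]. *)

From HB Require Import structures.
Require Import Defs.
From mathcomp Require Import all_boot all_order all_algebra.
From mathcomp Require Import reals complex.
From mathcomp Require Import ring lra zify.
From mathcomp Require Import mpoly boolp classical_sets.

Set Implicit Arguments.
Unset Strict Implicit.
Unset Printing Implicit Defensive.
Import Order.TTheory GRing.Theory Num.Theory.
Local Open Scope classical_set_scope.
Local Open Scope ring_scope.

(** * Power series in one and two variables *)

Arguments fps_coef : simpl never.

(** The bound [h/2] on root multiplicities is what closes the induction. At a vertex with [k h < a],
    or with [k = 1] and further edges of slope above 1, every further edge satisfies
    [h (pk + q) < 2 (pa + qh)]. For [s0 = -(pk + q)/(pa + qh)] this says [2 + s0 h > 0], the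
    positivity that the degree argument needs once the edge polynomial has two roots. It also says
    that a root of multiplicity at most [h/2] satisfies [k h < a] in its own chart, where [pk + q],
    [pa + qh] and the multiplicity take the places of [k], [a] and [h]. The exponent stays a
    variable until the end: all numerators are polynomials in [s], so that the residue identity can
    be divided by [s - s0] and a double root follows when both residues vanish at [s0]. On the
    Bernstein side a chart may be ramified, which allows [(u^p, u^q w)] and toric substitutions; the
    measure of arcs needs bijections, hence Bezout exponents. The first blowup is peculiar: with at
    most two tangent lines its divisor need not give a root of [b], so the arcs are then not cut at
    the ray [(1, 1)]. *)

Lemma fpsE (A : Type) (F : nat -> A) n : Fps F n = F n. Proof. by []. Qed.

Section Fps1.
Variable A : comPzRingType.
Implicit Types f g : fps A.

Lemma fpsD f g n : (f + g) n = f n + g n. Proof. by []. Qed.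
Lemma fpsN f n : (- f) n = - f n. Proof. by []. Qed.
Lemma fpsB f g n : (f - g) n = f n - g n. Proof. by []. Qed.
Lemma fps0 n : (0 : fps A) n = 0. Proof. by []. Qed.
Lemma fps1 n : (1 : fps A) n = (n == 0%N)%:R.
Proof. by rewrite /fps_coef /=; case: (n == 0%N). Qed.
Lemma fpsM f g n : (f * g) n = \sum_(i < n.+1) f i * g (n - i)%N. Proof. by []. Qed.
Lemma fps_sum I (r : seq I) (P : pred I) (F : I -> fps A) n :
  (\sum_(i <- r | P i) F i) n = \sum_(i <- r | P i) F i n.
Proof. by elim/big_rec2: _ => // i y x _ <-. Qed.

Lemma fpsMn f k n : (f *+ k) n = f n *+ k.
Proof. by elim: k => // k IH; rewrite !mulrS fpsD IH. Qed.

Lemma fps_monoE (a : A) d n : fps_mono a d n = a *+ (n == d).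
Proof. by rewrite /fps_coef /=; case: eqP. Qed.

Lemma fps_constE (a : A) n : fps_const a n = a *+ (n == 0%N).
Proof. exact: fps_monoE. Qed.
Lemma fps_derivE f n : fps_deriv f n = f n.+1 *+ n.+1. Proof. by []. Qed.

Lemma fps_monoM (a : A) d f n :
  (fps_mono a d * f) n = if (d <= n)%N then a * f (n - d)%N else 0.
Proof.
rewrite fpsM; case: leqP => dn.
  rewrite (bigD1 (Ordinal (dn : d < n.+1)%N)) //= fps_monoE eqxx big1 ?addr0 // => i ne; rewrite fps_monoE.
  by case: eqP => [e|]; rewrite ?mul0r //; case/eqP: ne; apply: val_inj.
rewrite big1 // => i _; rewrite fps_monoE; case: eqP => [e|]; rewrite ?mul0r //.
by have := ltn_ord i; rewrite e; lia.
Qed.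

Lemma fps_constM (a : A) f n : (fps_const a * f) n = a * f n.
Proof. by rewrite fps_monoM subn0. Qed.

Lemma fps_const_zmod : zmod_morphism (@fps_const A).
Proof. by move=> a b; apply: fpsP => n; rewrite fpsB !fps_constE mulrnBl. Qed.
HB.instance Definition _ := GRing.isZmodMorphism.Build A (fps A) (@fps_const A)
  fps_const_zmod.
Lemma fps_const_monoid : monoid_morphism (@fps_const A).
Proof.
split=> // a b; apply: fpsP => n; by rewrite fps_constM !fps_constE mulrnAr.
Qed.
HB.instance Definition _ := GRing.isMonoidMorphism.Build A (fps A) (@fps_const A)
  fps_const_monoid.

Lemma fps_derivD f g : fps_deriv (f + g) = fps_deriv f + fps_deriv g.
Proof. by apply: fpsP => n; rewrite fpsD !fps_derivE fpsD mulrnDl. Qed.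
Lemma fps_deriv_const a : fps_deriv (fps_const a) = 0 :> fps A.
Proof. by apply: fpsP => n; rewrite fps_derivE fps_constE mul0rn. Qed.

Lemma fps_derivM f g : fps_deriv (f * g) = fps_deriv f * g + f * fps_deriv g.
Proof.
apply: fpsP => n; rewrite fpsD !fpsM.
have -> : fps_deriv (f * g) n = (\sum_(i < n.+2) f i * g (n.+1 - i)%N) *+ n.+1 by [].
transitivity (\sum_(i < n.+2) (f i * g (n.+1 - i)%N *+ i + f i * g (n.+1 - i)%N *+ (n.+1 - i))).
  rewrite -sumrMnl; apply: eq_bigr => i _; rewrite -mulrnDr; congr (_ *+ _).
  by have := ltn_ord i; lia.
rewrite big_split /=; congr (_ + _).
  rewrite big_ord_recl mulr0n add0r; apply: eq_bigr => i _ /=.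
  by rewrite /bump leq0n add1n subSS mulrnAl.
rewrite big_ord_recr /= subnn mulr0n addr0; apply: eq_bigr => i _.
by rewrite -mulrnAr subSn // -ltnS.
Qed.

Lemma fps_eq0P f : f <> 0 -> exists2 n, f n != 0 & forall k, (k < n)%N -> f k = 0.
Proof.
move=> f0; have ex : exists n, f n != 0.
  apply: contrapT => H; apply: f0; apply: fpsP => n; apply/eqP; apply: contrapT => /negP Hn.
  by apply: H; exists n.
case: (ex_minnP ex) => n fn min; exists n => // k kn; apply/eqP; apply: contraTT kn => fk.
by rewrite -leqNgt min.
Qed.

Lemma fps_low f g m n : (forall k, (k < m)%N -> f k = 0) -> (forall k, (k < n)%N -> g k = 0) ->
  (forall k, (k < m + n)%N -> (f * g) k = 0) /\ (f * g) (m + n)%N = f m * g n.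
Proof.
move=> fm gn; have vanish k (i : 'I_k.+1) : (k <= m + n)%N -> (i : nat) != m \/ (k < m + n)%N ->
    f i * g (k - i)%N = 0.
  move=> kmn H; have [im|im] := ltnP i m; first by rewrite fm ?mul0r.
  rewrite (gn (k - i)%N) ?mulr0 //.
  have := ltn_ord i; case: H => [/eqP H|H]; lia.
split=> [k kmn|]; first by rewrite fpsM big1 // => i _; apply: vanish; [lia|right].
have mlt : (m < (m + n).+1)%N by lia.
rewrite fpsM (bigD1 (Ordinal mlt)) //= big1 ?addr0 ?addKn //.
by move=> i ne; apply: vanish => //; left; apply: contra_neq ne => e; apply: val_inj.
Qed.

(* Nonzero divisors are tracked by a property of the base ring so that the argument can be
   iterated in two variables. *)
Lemma fps_domain : (forall a b : A, a * b = 0 -> a = 0 \/ b = 0) ->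
  forall f g, f * g = 0 -> f = 0 \/ g = 0.
Proof.
move=> dom f g fg; have [->|f0] := pselect (f = 0); first by left.
have [->|g0] := pselect (g = 0); first by right.
have [m fm fl] := fps_eq0P f0; have [n gn gl] := fps_eq0P g0.
have [_ E] := fps_low fl gl; move: E; rewrite fg fps0 => /esym/dom [] E.
  by rewrite E eqxx in fm.
by rewrite E eqxx in gn.
Qed.
End Fps1.

Section Fps2.
Variable C : numClosedFieldType.
Notation S := (fps (fps C)).
Implicit Types f g h : S.

Lemma fps2P f g : (forall i j, f i j = g i j) -> f = g.
Proof. by move=> H; apply: fpsP => i; apply: fpsP => j; exact: H. Qed.

Lemma fps2D f g i j : (f + g) i j = f i j + g i j. Proof. by []. Qed.
Lemma fps2N f i j : (- f) i j = - f i j. Proof. by []. Qed.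
Lemma fps20 i j : (0 : S) i j = 0. Proof. by []. Qed.
Lemma fps2M f g i j : (f * g) i j =
  \sum_(a < i.+1) \sum_(b < j.+1) f a b * g (i - a)%N (j - b)%N.
Proof. by rewrite fpsM fps_sum. Qed.
Lemma fps2_sum I (r : seq I) (P : pred I) (F : I -> S) i j :
  (\sum_(k <- r | P k) F k) i j = \sum_(k <- r | P k) F k i j.
Proof. by rewrite !fps_sum. Qed.

Lemma fps2_domain f g : f * g = 0 -> f = 0 \/ g = 0.
Proof.
apply: fps_domain; apply: fps_domain => a b /eqP; rewrite mulf_eq0.
by case/orP=> /eqP; [left|right].
Qed.

Lemma fps2_mulI f g h : f <> 0 -> f * g = f * h -> g = h.
Proof.
move=> f0 /eqP; rewrite -subr_eq0 -mulrBr => /eqP/fps2_domain [//|] /eqP.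
by rewrite subr_eq0 => /eqP.
Qed.

Definition cst (c : C) : S := fps_const (fps_const c).
Definition mono2 (a b : nat) : S := fps_mono (fps_mono 1 b) a.

Lemma cstM c f i j : (cst c * f) i j = c * f i j.
Proof. by rewrite !fps_constM. Qed.
Lemma cstE c i j : cst c i j = c *+ (i == 0%N) *+ (j == 0%N).
Proof. by rewrite fps_constE; case: eqP => _; rewrite ?fps_constE // fps0 mul0rn. Qed.
Lemma cst_zmod : zmod_morphism cst. Proof. by move=> a b; rewrite /cst !rmorphB. Qed.
HB.instance Definition _ := GRing.isZmodMorphism.Build C S cst cst_zmod.
Lemma cst_monoid : monoid_morphism cst.
Proof. by split=> [//|a b]; rewrite /cst !rmorphM. Qed.
HB.instance Definition _ := GRing.isMonoidMorphism.Build C S cst cst_monoid.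

Lemma mono2E a b i j : mono2 a b i j = ((i == a) && (j == b))%:R.
Proof. by rewrite fps_monoE; case: eqP => _; rewrite /= ?mulr0n // mulr1n fps_monoE. Qed.
Lemma mono2M a b f i j :
  (mono2 a b * f) i j = if (a <= i)%N && (b <= j)%N then f (i - a)%N (j - b)%N else 0.
Proof.
rewrite fps_monoM; case: leqP => //= _; rewrite fps_monoM.
by case: leqP => //; rewrite mul1r.
Qed.
Lemma mono2MM a b c d : mono2 a b * mono2 c d = mono2 (a + c) (b + d).
Proof.
apply: fps2P => i j; rewrite mono2M !mono2E; case: ifP => [/andP[ai bj]|].
  by congr (_%:R); congr (nat_of_bool _); apply/andP/andP => -[/eqP ? /eqP ?]; split; apply/eqP; lia.
by move=> H; case: andP => // -[/eqP e1 /eqP e2]; move: H; rewrite e1 e2 !leq_addr.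
Qed.
Lemma mono200 : mono2 0 0 = 1. Proof. by []. Qed.
Lemma mono2X a b n : mono2 a b ^+ n = mono2 (a * n) (b * n).
Proof.
elim: n => [|n IH]; first by rewrite !muln0 expr0.
by rewrite exprS IH mono2MM !mulnS.
Qed.
Lemma mono2_neq0 a b : mono2 a b <> 0.
Proof.
by move/(congr1 (fun f : S => f a b)); rewrite mono2E !eqxx /=; move/eqP; rewrite oner_eq0.
Qed.

(** Order at least [n] for the total degree: the topology in which substitutions and derivations are
    continuous. *)
Definition tge n f := forall i j, (i + j < n)%N -> f i j = 0.
Lemma tgeW m n f : (m <= n)%N -> tge n f -> tge m f.
Proof. by move=> mn H i j ij; apply: H; lia. Qed.
Lemma tgeD n f g : tge n f -> tge n g -> tge n (f + g).
Proof. by move=> Hf Hg i j ij; rewrite fps2D Hf // Hg // addr0. Qed.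
Lemma tgeN n f : tge n f -> tge n (- f).
Proof. by move=> Hf i j ij; rewrite fps2N Hf // oppr0. Qed.
Lemma tgeM m n f g : tge m f -> tge n g -> tge (m + n) (f * g).
Proof.
move=> Hf Hg i j ij; rewrite fps2M big1 // => -[a ai] _; rewrite big1 // => -[b bj] _ /=.
have [H|H] := ltnP (a + b) m; first by rewrite Hf ?mul0r.
by rewrite Hg ?mulr0 //; lia.
Qed.
Lemma tgeMl n f g : tge n g -> tge n (f * g).
Proof. by move=> H; rewrite -(add0n n); apply: tgeM. Qed.
Lemma tgeMr n f g : tge n f -> tge n (f * g).
Proof. by move=> H; rewrite mulrC; apply: tgeMl. Qed.
Lemma tgeX n f : tge 1 f -> tge n (f ^+ n).
Proof. by move=> H; elim: n => // n IH; rewrite exprS -add1n; apply: tgeM. Qed.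
Lemma tge_mono2 a b : tge (a + b) (mono2 a b).
Proof. by move=> i j ij; rewrite mono2E; case: andP => // -[/eqP ? /eqP ?]; lia. Qed.
Lemma tge_eq f g : (forall n, tge n (f - g)) -> f = g.
Proof.
move=> H; apply: fps2P => i j; apply/eqP; rewrite -subr_eq0.
by apply/eqP; apply: (H (i + j).+1).
Qed.

Definition trunc n f : S := \sum_(i < n) \sum_(j < n) cst (f i j) * mono2 i j.
Lemma truncE n f i j : (i < n)%N -> (j < n)%N -> trunc n f i j = f i j.
Proof.
move=> ni nj; rewrite fps2_sum (bigD1 (Ordinal ni)) //= fps2_sum (bigD1 (Ordinal nj)) //=.
rewrite cstM mono2E !eqxx mulr1 big1 ?addr0.
  rewrite big1 ?addr0 // => k ne; rewrite fps2_sum big1 // => l _.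
  rewrite cstM mono2E; case: andP; rewrite ?mulr0 // => -[/eqP e].
  by case/eqP: ne; apply: val_inj.
move=> k ne; rewrite cstM mono2E; case: andP; rewrite ?mulr0 // => -[_ /eqP e].
by case/eqP: ne; apply: val_inj.
Qed.
Lemma tge_trunc n f : tge n (f - trunc n f).
Proof. by move=> i j ij; rewrite fps2D fps2N truncE ?subrr //; lia. Qed.

(** Reduction to monomials: modulo total degree [n + c] a series is the finite sum [trunc], and both
    maps send the rest to order at least [n]. The loss [c] is 0 for substitutions and 1 for
    derivations. *)
Lemma fps2_dense (c : nat) (P Q : S -> S) : {morph P : f g / f + g} -> {morph Q : f g / f + g} ->
  (forall n f, tge (n + c) f -> tge n (P f)) -> (forall n f, tge (n + c) f -> tge n (Q f)) ->
  (forall a i j, P (cst a * mono2 i j) = Q (cst a * mono2 i j)) -> forall f, P f = Q f.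
Proof.
move=> PD QD Pc Qc PQ f; apply: tge_eq => n.
have add0 (R : S -> S) : {morph R : f g / f + g} -> R (0 : S) = 0.
  by move=> RD; apply: (addrI (R 0)); rewrite -RD !addr0.
have Rsum (R : S -> S) I (r : seq I) (F : I -> S) : {morph R : f g / f + g} ->
    R (\sum_(i <- r) F i) = \sum_(i <- r) R (F i).
  by move=> RD; apply: big_morph => //; apply: add0.
have Et : P (trunc (n + c) f) = Q (trunc (n + c) f).
  rewrite !(Rsum _ _ _ _ PD, Rsum _ _ _ _ QD); apply: eq_bigr => i _.
  by rewrite !(Rsum _ _ _ _ PD, Rsum _ _ _ _ QD); apply: eq_bigr => j _.
rewrite -(subrK (trunc (n + c) f) f) PD QD Et opprD addrACA subrr addr0.
by apply: tgeD; [apply: Pc|apply: tgeN; apply: Qc]; apply: tge_trunc.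
Qed.

Record subst2 := Subst2 { sX : S; sY : S; sX1 : tge 1 sX; sY1 : tge 1 sY }.

(* As sX and sY have no constant term, only the monomials with i, j <= k + l contribute. *)
Definition pull (s : subst2) f : S := Fps (fun k => Fps (fun l =>
  \sum_(i < (k + l).+1) \sum_(j < (k + l).+1) f i j * fps_coef (fps_coef (sX s ^+ i * sY s ^+ j) k) l)).

Implicit Types s t : subst2.

Lemma tge_XY s i j : tge (i + j) (sX s ^+ i * sY s ^+ j).
Proof. by apply: tgeM; apply: tgeX; [apply: sX1|apply: sY1]. Qed.

Lemma pullE M s f k l : (k + l <= M)%N -> pull s f k l =
  \sum_(i < M.+1) \sum_(j < M.+1) f i j * (sX s ^+ i * sY s ^+ j) k l.
Proof.
move=> klM; have ext (F : nat -> C) : (forall i, (k + l < i)%N -> F i = 0) ->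
    \sum_(i < (k + l).+1) F i = \sum_(i < M.+1) F i.
  move=> F0; rewrite (big_ord_widen M.+1 F) ?ltnS // [RHS](bigID (fun i : 'I__ => (i < (k + l).+1)%N)) /=.
  by rewrite [X in _ = _ + X]big1 ?addr0 // => i; rewrite -leqNgt => H; apply: F0.
rewrite /pull !fpsE (ext (fun i => \sum_(j < (k + l).+1) f i j * (sX s ^+ i * sY s ^+ j) k l)).
  apply: eq_bigr => i _; apply: (ext (fun j => f i j * (sX s ^+ i * sY s ^+ j) k l)) => j kj.
  by rewrite tge_XY ?mulr0 //; lia.
by move=> i ki; rewrite big1 // => j _; rewrite tge_XY ?mulr0 //; lia.
Qed.

Lemma pull_zmod s : zmod_morphism (pull s).
Proof.
move=> f g; apply: fps2P => k l; rewrite fps2D fps2N !(@pullE (k + l)) // -sumrB.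
apply: eq_bigr => i _; rewrite -sumrB; apply: eq_bigr => j _.
by rewrite fps2D fps2N mulrBl.
Qed.
HB.instance Definition _ s := GRing.isZmodMorphism.Build S S (pull s) (pull_zmod s).

Lemma pull_tge n s f : tge n f -> tge n (pull s f).
Proof.
move=> H k l kl; rewrite (@pullE (k + l)) // big1 // => i _; rewrite big1 // => j _.
have [ij|ij] := ltnP (i + j) n; first by rewrite H ?mul0r.
by rewrite tge_XY ?mulr0 //; lia.
Qed.

Lemma pull_mono2 s a i j : pull s (cst a * mono2 i j) = cst a * (sX s ^+ i * sY s ^+ j).
Proof.
apply: fps2P => k l; rewrite (@pullE (k + l + i + j)); last lia.
have Hi : (i < (k + l + i + j).+1)%N by lia.
have Hj : (j < (k + l + i + j).+1)%N by lia.
rewrite (bigD1 (Ordinal Hi)) //= (bigD1 (Ordinal Hj)) //= cstM mono2E !eqxx mulr1.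
rewrite [RHS]cstM big1 ?addr0; last first.
  move=> b ne; rewrite cstM mono2E; case: andP; rewrite ?mulr0 ?mul0r // => -[_ /eqP e].
  by case/eqP: ne; apply: val_inj.
rewrite big1 ?addr0 // => c ne; rewrite big1 // => b _; rewrite cstM mono2E.
case: andP; rewrite ?mulr0 ?mul0r // => -[/eqP e].
by case/eqP: ne; apply: val_inj.
Qed.

Lemma pull_monoid s : monoid_morphism (pull s).
Proof.
split=> [|f g].
  by rewrite -[1 in LHS]mono200 -[mono2 0 0]mul1r -[1 in X in pull s X](rmorph1 cst) pull_mono2 rmorph1 !expr0 !mul1r.
apply: (@fps2_dense 0 (fun f => pull s (f * g)) (fun f => pull s f * pull s g)).
- by move=> x y /=; rewrite mulrDl raddfD.
- by move=> x y /=; rewrite raddfD mulrDl.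
- by move=> n x; rewrite addn0 => H; apply/pull_tge/tgeMr.
- by move=> n x; rewrite addn0 => H; apply/tgeMr/pull_tge.
move=> a i j.
apply: (@fps2_dense 0 (fun g => pull s (cst a * mono2 i j * g))
  (fun g => pull s (cst a * mono2 i j) * pull s g)).
- by move=> x y /=; rewrite mulrDr raddfD.
- by move=> x y /=; rewrite raddfD mulrDr.
- by move=> n x; rewrite addn0 => H; apply/pull_tge/tgeMl.
- by move=> n x; rewrite addn0 => H; apply/tgeMl/pull_tge.
move=> b k l; rewrite mulrACA -rmorphM mono2MM !pull_mono2 rmorphM !exprD; ring.
Qed.
HB.instance Definition _ s := GRing.isMonoidMorphism.Build S S (pull s) (pull_monoid s).

Lemma pull_mono s i j : pull s (mono2 i j) = sX s ^+ i * sY s ^+ j.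
Proof. by have := pull_mono2 s 1 i j; rewrite !rmorph1 !mul1r. Qed.
Lemma pull_cst s a : pull s (cst a) = cst a.
Proof. by have := pull_mono2 s a 0 0; rewrite mono200 !expr0 !mulr1. Qed.

Definition scomp s t : subst2 :=
  Subst2 (@pull_tge 1 t _ (@sX1 s)) (@pull_tge 1 t _ (@sY1 s)).

Lemma pull_comp s t f : pull t (pull s f) = pull (scomp s t) f.
Proof.
move: f; apply: (@fps2_dense 0 (fun f => pull t (pull s f)) (pull (scomp s t))).
- by move=> x y /=; rewrite !raddfD.
- by move=> x y /=; rewrite !raddfD.
- by move=> n x; rewrite addn0 => H; do 2! apply: pull_tge.
- by move=> n x; rewrite addn0 => H; apply: pull_tge.
by move=> a i j; rewrite !pull_mono2 !rmorphM /= pull_cst !rmorphXn.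
Qed.

Lemma d1E f i j : fps_d1 f i j = f i.+1 j *+ i.+1.
Proof. by rewrite fps_derivE fpsMn. Qed.
Lemma d2E f i j : fps_d2 f i j = f i j.+1 *+ j.+1. Proof. by []. Qed.

(** The last clause is continuity, with a loss of one degree; it is what [fps2_dense] asks for in
    [chain_rule]. *)
Definition derivation (d : S -> S) := [/\ {morph d : f g / f + g},
  forall f g, d (f * g) = d f * g + f * d g, forall a, d (cst a) = 0 &
  forall n f, tge n.+1 f -> tge n (d f)].

Lemma d1_der : derivation (@fps_d1 C).
Proof.
split; [exact: fps_derivD|exact: fps_derivM|by move=> a; exact: fps_deriv_const|].
by move=> n f H i j ij; rewrite d1E H ?mul0rn //; lia.
Qed.
Lemma d2_der : derivation (@fps_d2 C).
Proof.
split.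
- by move=> f g; apply: fps2P => i j; rewrite fps2D !d2E fps2D mulrnDl.
- move=> f g; apply: fpsP => i; rewrite fpsD !fpsM.
  transitivity (fps_deriv (\sum_(a < i.+1) f a * g (i - a)%N)) => //.
  rewrite (big_morph _ (@fps_derivD _) (_ : fps_deriv 0 = 0)); last first.
    by apply: fpsP => j; rewrite fps_derivE mul0rn.
  by rewrite -big_split; apply: eq_bigr => a _; rewrite fps_derivM.
- by move=> a; apply: fps2P => i j; rewrite d2E cstE /= mulr0n mul0rn.
by move=> n f H i j ij; rewrite d2E H ?mul0rn //; lia.
Qed.

Lemma d1D f g : fps_d1 (f + g) = fps_d1 f + fps_d1 g. Proof. by case: d1_der. Qed.
Lemma d1M f g : fps_d1 (f * g) = fps_d1 f * g + f * fps_d1 g. Proof. by case: d1_der. Qed.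
Lemma d1C a : fps_d1 (cst a) = 0. Proof. by case: d1_der. Qed.
Lemma d2D f g : fps_d2 (f + g) = fps_d2 f + fps_d2 g. Proof. by case: d2_der. Qed.
Lemma d2M f g : fps_d2 (f * g) = fps_d2 f * g + f * fps_d2 g. Proof. by case: d2_der. Qed.
Lemma d2C a : fps_d2 (cst a) = 0. Proof. by case: d2_der. Qed.
Lemma d1N f : fps_d1 (- f) = - fps_d1 f.
Proof. by apply: fps2P => i j; rewrite fps2N !d1E fps2N mulNrn. Qed.
Lemma d2N f : fps_d2 (- f) = - fps_d2 f.
Proof. by apply: fps2P => i j; rewrite fps2N !d2E fps2N mulNrn. Qed.
Lemma d12 f : fps_d1 (fps_d2 f) = fps_d2 (fps_d1 f).
Proof. by apply: fps2P => i j; rewrite d1E !d2E d1E -!mulrnA mulnC. Qed.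

Lemma derX d f n : derivation d -> d (f ^+ n.+1) = f ^+ n * d f *+ n.+1.
Proof.
case=> _ dM _ _; elim: n => [|n IH]; first by rewrite expr0 mul1r.
by rewrite exprS dM IH mulrnAr mulrA -exprS mulrC -mulrS.
Qed.

Lemma d1_mono2 i j : fps_d1 (mono2 i j) = mono2 i.-1 j *+ i.
Proof.
apply: fps2P => a b; rewrite d1E mono2E; case: i => [|i] /=.
  by rewrite mulr0n mul0rn.
transitivity (mono2 i j a b *+ i.+1); last first.
  by elim: i.+1 => [|m IH]; rewrite ?mulr0n // !mulrS fps2D -IH.
rewrite mono2E eqSS; case: eqP => [->|] //=.
by rewrite !mul0rn.
Qed.
Lemma d2_mono2 i j : fps_d2 (mono2 i j) = mono2 i j.-1 *+ j.
Proof.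
apply: fps2P => a b; rewrite d2E mono2E; case: j => [|j] /=.
  by rewrite andbF mulr0n mul0rn.
transitivity (mono2 i j a b *+ j.+1); last first.
  by elim: j.+1 => [|m IH]; rewrite ?mulr0n // !mulrS fps2D -IH.
rewrite mono2E eqSS andbC; case: eqP => [->|] /=; rewrite ?andbT ?andbF //.
by rewrite !mul0rn.
Qed.

Lemma chain_rule d s f : derivation d ->
  d (pull s f) = pull s (fps_d1 f) * d (sX s) + pull s (fps_d2 f) * d (sY s).
Proof.
move=> [dD dM dC dt]; have dd : derivation d by [].
have [d1D d1M d1C d1t] := d1_der; have [d2D d2M d2C d2t] := d2_der.
apply: (@fps2_dense 1 (fun f => d (pull s f))
  (fun f => pull s (fps_d1 f) * d (sX s) + pull s (fps_d2 f) * d (sY s))).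
- by move=> x y /=; rewrite raddfD dD.
- by move=> x y /=; rewrite d1D d2D !raddfD; ring.
- by move=> n x; rewrite addn1 => H; apply/dt/pull_tge.
- move=> n x; rewrite addn1 => H; apply: tgeD; apply/tgeMr/pull_tge.
    exact: d1t.
  exact: d2t.
move=> a i j; rewrite pull_mono2 !(dM, d1M, d2M) d1C d2C dC !mul0r !add0r.
rewrite d1_mono2 d2_mono2 !(rmorphM, rmorphMn) /= pull_cst !pull_mono.
have dX k g : d (g ^+ k) = g ^+ k.-1 * d g *+ k.
  by case: k => [|k]; rewrite ?derX // expr0 -(rmorph1 cst) dC mulr0n.
by rewrite !dX -!mulrnAl; ring.
Qed.
End Fps2.

(** * Series defined by recursion: inverses, linear differential equations, complex powers *)

Lemma course_of_values (T : Type) (x0 : T) (step : nat -> (nat -> T) -> T) :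
  (forall n g h, (forall k, (k < n)%N -> g k = h k) -> step n g = step n h) ->
  exists g, forall n, g n = step n g.
Proof.
(* [G n] is the table of the first [n] values, with the default [x0] from index [n] on. *)
move=> loc; pose G := fix G n := if n is m.+1 then
  (fun k => if k == m then step m (G m) else G m k) else fun=> x0.
pose g n := G n.+1 n; have Gg n k : (k < n)%N -> G n k = g k.
  elim: n k => // n IH k kn; rewrite [LHS]/=; case: eqP => [->|ne].
    by rewrite /g /= eqxx.
  by apply: IH; lia.
exists g => n; rewrite /g /= eqxx; apply: loc => k kn; exact: Gg.
Qed.

Lemma eqDB (V : zmodType) (a b c : V) : a + b = c -> a = c - b.
Proof. by move=> <-; rewrite addrK. Qed.

Section Ode.
Variable A : comPzRingType.
Implicit Types f g h : fps A.

Lemma fpsM_recl f g n : (f * g) n = f 0%N * g n + \sum_(i < n) f i.+1 * g (n - i.+1)%N.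
Proof. by rewrite fpsM big_ord_recl subn0. Qed.

Lemma fps_inv f a : f 0%N * a = 1 -> exists g, f * g = 1.
Proof.
move=> fa; have [|g Hg] := @course_of_values A 0 (fun n (g : nat -> A) =>
    a * ((n == 0%N)%:R - \sum_(i < n) f i.+1 * g (n - i.+1)%N)).
  move=> n g h E; congr (_ * (_ - _)); apply: eq_bigr => i _; rewrite E //.
  by have := ltn_ord i; lia.
exists (Fps g); apply: fpsP => n; rewrite fps1 fpsM_recl !fpsE Hg mulrA fa mul1r.
by rewrite addrNK.
Qed.

Lemma ode_exists f v (w : nat -> A) e E0 : f 0%N * v = 1 -> (forall n, n.+1%:R * w n = 1) ->
  exists E : fps A, E 0%N = E0 /\ f * fps_deriv E = fps_const e * (fps_deriv f * E).
Proof.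
move=> fv nw; pose st n (g : nat -> A) := if n is m.+1 then
   v * (w m * (e * (fps_deriv f * Fps g) m - \sum_(i < m) f i.+1 * fps_deriv (Fps g) (m - i.+1)%N))
   else E0.
have [|g Hg] := @course_of_values A 0 st.
  case=> [//|m] g h E; rewrite /st; congr (_ * (_ * (_ * _ - _))).
    rewrite !fpsM; apply: eq_bigr => i _; congr (_ * _); apply: E.
    by have := ltn_ord i; lia.
  apply: eq_bigr => i _; congr (_ * _); rewrite !fps_derivE !fpsE E //.
  by have := ltn_ord i; lia.
exists (Fps g); split; first by rewrite fpsE Hg.
apply: fpsP => n; rewrite fpsM_recl fps_constM [fps_deriv (Fps g) n]fps_derivE.
rewrite fpsE Hg /st; set X := _ - _.
have -> : f 0%N * (v * (w n * X) *+ n.+1) = f 0%N * v * (n.+1%:R * w n) * X.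
  by rewrite -mulr_natr; ring.
by rewrite fv nw !mul1r addrNK.
Qed.

Lemma ode_zero f v h (D : fps A) : f 0%N * v = 1 -> (forall (a : A) n, a *+ n.+1 = 0 -> a = 0) ->
  D 0%N = 0 -> f * fps_deriv D = h * D -> D = 0.
Proof.
move=> fv ch D0 E; apply: fpsP; elim/ltn_ind => -[|n] IH; first by rewrite D0.
have := congr1 (fun f : fps A => f n) E; rewrite fpsM_recl [(h * D) n]fpsM.
rewrite !big1 ?addr0 => [H|i _|i _]; last 2 first.
- by rewrite IH ?fps0 ?mulr0 //; have := ltn_ord i; lia.
- by rewrite fps_derivE IH ?fps0 ?mul0rn ?mulr0 //; have := ltn_ord i; lia.
apply: (ch _ n); rewrite -fps_derivE -[LHS]mul1r -fv mulrAC H mul0r //.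
Qed.
End Ode.

Section Pow.
Variable C : numClosedFieldType.
Notation S := (fps (fps C)).
Implicit Types F E : S.

Lemma fpsC_mulrn0 (a : C) n : a *+ n.+1 = 0 -> a = 0.
Proof. by move/eqP; rewrite mulrn_eq0 => /eqP. Qed.
Lemma fps1_mulrn0 (a : fps C) n : a *+ n.+1 = 0 -> a = 0.
Proof.
by move=> H; apply: fpsP => i; apply: (@fpsC_mulrn0 _ n); rewrite -fpsMn H.
Qed.

(* E = (F / F(0))^e, for F(0) <> 0, through its logarithmic derivatives. *)
Definition is_pow F (e : C) E :=
  [/\ E 0%N 0%N = 1, F * fps_d1 E = cst e * (fps_d1 F * E) &
      F * fps_d2 E = cst e * (fps_d2 F * E)].

(** The equation in [z2] is solved on the row [z1 = 0], and the result is the initial value for the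
    equation in [z1]. The defect [D] of the equation in [z2] then satisfies
    [F d1 D = (1 + e) (d1 F) D] and vanishes for [z1 = 0], hence is zero. *)
Lemma pow_exists F e : F 0%N 0%N != 0 -> exists E, is_pow F e E.
Proof.
move=> F0; have [v Hv] := @fps_inv _ (F 0%N) (F 0%N 0%N)^-1 (mulfV F0).
have [E0 [E00 HE0]] := @ode_exists _ (F 0%N) (F 0%N 0%N)^-1 (fun n => n.+1%:R^-1) e 1
  (mulfV F0) (fun n => mulfV (lt0r_neq0 (ltr0Sn _ _))).
have [E [HE HdE]] := @ode_exists _ F v (fun n => fps_const n.+1%:R^-1) (fps_const e) E0
  Hv (fun n => ltac:(by rewrite -(rmorph_nat (@fps_const C)) -rmorphM mulfV ?rmorph1 ?lt0r_neq0)).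
exists E; split=> //; first by rewrite HE.
apply/eqP; rewrite -subr_eq0; apply/eqP.
apply: (@ode_zero _ F v ((1 + cst e) * fps_d1 F) _ Hv); first exact: fps1_mulrn0.
  rewrite fpsB /cst fps_constM 2!fpsM_recl !big_ord0 !addr0.
  by rewrite HE [fps_d2 E 0%N]/fps_coef /= HE HE0 subrr.
have {}HdE : F * fps_d1 E = cst e * (fps_d1 F * E) := HdE.
change (F * fps_d1 (F * fps_d2 E - cst e * (fps_d2 F * E)) =
  (1 + cst e) * fps_d1 F * (F * fps_d2 E - cst e * (fps_d2 F * E))).
have H2 : fps_d2 F * fps_d1 E + F * fps_d1 (fps_d2 E) =
     cst e * (fps_d1 (fps_d2 F) * E + fps_d1 F * fps_d2 E).
  by rewrite !d12 -!d2M HdE d2M d2C mul0r add0r.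
have H3 : F * fps_d1 (fps_d2 E) =
     cst e * (fps_d1 (fps_d2 F) * E + fps_d1 F * fps_d2 E) - fps_d2 F * fps_d1 E.
  by rewrite -H2; ring.
rewrite d1D d1N !d1M d1C H3.
transitivity ((1 + cst e) * (fps_d1 F * (F * fps_d2 E) - fps_d2 F * (F * fps_d1 E))); first by ring.
by rewrite HdE; ring.
Qed.

(** Polynomial dependence on the exponent. It is a property of functions because a power is chosen
    separately for each exponent; [poly_ext] turns pointwise identities back into identities of
    polynomials. *)
Definition poly_fun (h : C -> C) := exists p : {poly C}, forall x, h x = p.[x].

Lemma poly_funC c : poly_fun (fun=> c).
Proof. by exists c%:P => x; rewrite hornerC. Qed.
Lemma poly_funX : poly_fun id.
Proof. by exists 'X => x; rewrite hornerX. Qed.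
Lemma poly_funD f g : poly_fun f -> poly_fun g -> poly_fun (fun x => f x + g x).
Proof. by move=> [p Hp] [q Hq]; exists (p + q) => x; rewrite hornerD Hp Hq. Qed.
Lemma poly_funM f g : poly_fun f -> poly_fun g -> poly_fun (fun x => f x * g x).
Proof. by move=> [p Hp] [q Hq]; exists (p * q) => x; rewrite hornerM Hp Hq. Qed.
Lemma poly_funN f : poly_fun f -> poly_fun (fun x => - f x).
Proof. by move=> [p Hp]; exists (- p) => x; rewrite hornerN Hp. Qed.
Lemma poly_funMn f n : poly_fun f -> poly_fun (fun x => f x *+ n).
Proof. by move=> [p Hp]; exists (p *+ n) => x; rewrite hornerMn Hp. Qed.
Lemma poly_fun_sum I (r : seq I) (P : pred I) (F : I -> C -> C) : (forall i, P i -> poly_fun (F i)) ->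
  poly_fun (fun x => \sum_(i <- r | P i) F i x).
Proof.
move=> H; elim: r => [|i r IH].
  have -> : (fun x => \sum_(i <- [::] | P i) F i x) = fun=> 0.
    by apply: funext => x; rewrite big_nil.
  exact: poly_funC.
case: (boolP (P i)) => Pi; last first.
  by have -> : (fun x => \sum_(j <- i :: r | P j) F j x) = (fun x => \sum_(j <- r | P j) F j x);
    [apply: funext => x; rewrite big_cons (negbTE Pi)|exact: IH].
have -> : (fun x => \sum_(j <- i :: r | P j) F j x) = (fun x => F i x + \sum_(j <- r | P j) F j x).
  by apply: funext => x; rewrite big_cons Pi.
by apply: poly_funD; [exact: H|exact: IH].
Qed.
Lemma poly_fun_eq f g : (forall x, f x = g x) -> poly_fun g -> poly_fun f.
Proof. by move=> H [p Hp]; exists p => x; rewrite H. Qed.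

(** The two differential equations determine the coefficients recursively, and the only divisions
    are by [F(0)] and by integers, so the exponent enters polynomially. *)
Lemma pow_poly_fun F (l : C -> C) (E : C -> S) : F 0%N 0%N != 0 -> poly_fun l ->
  (forall x, is_pow F (l x) (E x)) -> forall i j, poly_fun (fun x => E x i j).
Proof.
move=> F0 Hl HE i j; elim/ltn_ind: i j => i IHi; elim/ltn_ind=> j IHj.
case: i IHi IHj => [|i] IHi IHj; first case: j IHj => [|j] IHj.
- by apply: poly_fun_eq (poly_funC 1) => x; case: (HE x).
- apply: (@poly_fun_eq _ (fun x => (F 0%N 0%N)^-1 * j.+1%:R^-1 *
     (l x * (\sum_(b < j.+1) F 0%N b.+1 *+ b.+1 * E x 0%N (j - b)%N)
      - \sum_(b < j) F 0%N b.+1 * (E x 0%N (j - b.+1).+1 *+ (j - b.+1).+1)))) => [x|].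
    have [_ _ H] := HE x; have := congr1 (fun f : S => f 0%N j) H.
    rewrite /cst !fps_constM !fpsM_recl !big_ord0 !addr0 fpsM_recl !fpsM.
    have -> : fps_d2 F 0%N = fps_deriv (F 0%N) by [].
    have -> : fps_d2 (E x) 0%N = fps_deriv (E x 0%N) by [].
    move/eqDB; rewrite fps_derivE => H1.
    transitivity ((F 0%N 0%N)^-1 / j.+1%:R * (F 0%N 0%N * (E x 0%N j.+1 *+ j.+1))).
      rewrite -mulr_natr; field.
      by rewrite F0 /= addrC natr1 pnatr_eq0.
    by rewrite H1.
  apply: poly_funM; first exact: poly_funC.
  apply: poly_funD; [apply: poly_funM => //|apply: poly_funN]; apply: poly_fun_sum => b _.
    by apply: poly_funM; [exact: poly_funC|apply: IHj; have := ltn_ord b; lia].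
  apply: poly_funM; [exact: poly_funC|apply/poly_funMn/IHj; have := ltn_ord b; lia].
apply: (@poly_fun_eq _ (fun x => (F 0%N 0%N)^-1 * i.+1%:R^-1 *
     (l x * (\sum_(a < i.+1) \sum_(b < j.+1) F a.+1 b *+ a.+1 * E x (i - a)%N (j - b)%N)
      - (\sum_(b < j) F 0%N b.+1 * (E x i.+1 (j - b.+1)%N *+ i.+1) +
         \sum_(a < i) \sum_(b < j.+1) F a.+1 b * (E x (i - a.+1).+1 (j - b)%N *+ (i - a.+1).+1))))) => [x|].
  have [_ H _] := HE x; have := congr1 (fun f : S => f i j) H.
  rewrite cstM !fps2M big_ord_recl big_ord_recl !subn0 d1E -addrA => /eqDB.
  have -> : \sum_(a < i.+1) \sum_(b < j.+1) F a.+1 b *+ a.+1 * E x (i - a)%N (j - b)%N =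
    \sum_(a < i.+1) \sum_(b < j.+1) fps_d1 F a b * E x (i - a)%N (j - b)%N.
    by apply: eq_bigr => a _; apply: eq_bigr => b _; rewrite d1E.
  move=> H1.
  transitivity ((F 0%N 0%N)^-1 / i.+1%:R * (F 0%N 0%N * (E x i.+1 j *+ i.+1))).
    by rewrite -mulr_natr; field; rewrite F0 /= addrC natr1 pnatr_eq0.
  rewrite H1; congr (_ * (_ - (_ + _))).
    by apply: eq_bigr => b _; rewrite d1E.
  by apply: eq_bigr => a _; apply: eq_bigr => b _; rewrite d1E.
apply: poly_funM; first exact: poly_funC.
apply: poly_funD; [apply: poly_funM => //|apply/poly_funN/poly_funD]; apply: poly_fun_sum => b _.
- apply: poly_fun_sum => c _; apply: poly_funM; [exact: poly_funC|apply: IHi; have := ltn_ord b; lia].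
- by apply: poly_funM; [exact: poly_funC|apply/poly_funMn/IHj; have := ltn_ord b; lia].
apply: poly_fun_sum => c _; apply: poly_funM; [exact: poly_funC|].
by apply/poly_funMn/IHi; have := ltn_ord b; lia.
Qed.
End Pow.

(** * Integration by parts in the functional equation *)

Section Parts.
Variables (C : numClosedFieldType) (f : fps (fps C)).
Notation S := (fps (fps C)).
Notation T := {poly S}.
Local Notation fP := (f%:P : T).

Section OneDer.
Variable d : S -> S.
Hypothesis dder : derivation d.
Local Notation D := (map_poly d : T -> T).

Lemma der0 : d 0 = 0.
Proof. by case: dder => _ _ dC _; have := dC 0; rewrite rmorph0. Qed.
Lemma derN x : d (- x) = - d x.
Proof.
case: dder => dD _ _ _; apply: (addIr (d x)).
by rewrite -dD !addNr der0.
Qed.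
Lemma der_sum I (r : seq I) (F : I -> S) : d (\sum_(i <- r) F i) = \sum_(i <- r) d (F i).
Proof. by case: dder => dD _ _ _; apply: big_morph => //; apply: der0. Qed.
Lemma coef_der (p : T) i : (D p)`_i = d p`_i. Proof. exact: coef_map_id0 der0. Qed.
Lemma polyDD p q : D (p + q) = D p + D q.
Proof. by case: dder => dD _ _ _; apply/polyP => i; rewrite coefD !coef_der coefD dD. Qed.
Lemma polyDM p q : D (p * q) = D p * q + p * D q.
Proof.
case: dder => dD dM _ _; apply/polyP => i; rewrite coef_der coefM der_sum coefD !coefM -big_split.
by apply: eq_bigr => j _; rewrite dM !coef_der.
Qed.
Lemma polyDC c : D c%:P = (d c)%:P.
Proof. by apply/polyP => i; rewrite coef_der !coefC; case: eqP => // _; exact: der0. Qed.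

(* d (h f^(s-n)) = Delta n h f^(s-n-1) *)
Definition Delta (n : nat) (h : T) : T := D h * fP + ('X - n%:R) * h * (d f)%:P.

Lemma Delta_f n h : Delta n.+1 (h * fP) = fP * Delta n h.
Proof. by rewrite /Delta polyDM polyDC -natr1; ring. Qed.
Lemma DeltaD n h k : Delta n (h + k) = Delta n h + Delta n k.
Proof. by rewrite /Delta polyDD; ring. Qed.
Lemma Delta0 n : Delta n 0 = 0.
Proof. by rewrite /Delta -(polyC0 S) polyDC der0 polyC0; ring. Qed.
Lemma Delta_scale n c w : c * Delta n w = Delta n (c * w) - D c * w * fP.
Proof. by rewrite /Delta polyDM; ring. Qed.
End OneDer.

Local Notation De1 := (Delta (@fps_d1 C)).
Local Notation De2 := (Delta (@fps_d2 C)).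

(* Q n stands for a submodule of numerators of f ^ (s - n): the families closed under the
   operations that produce D f^(s+1) from f^(s+1). *)
Record stable_family (Q : nat -> T -> Prop) : Prop := StableFamily {
  stabD : forall n x y, Q n x -> Q n y -> Q n (x + y);
  stabZ : forall n c x, Q n x -> Q n (c * x);
  stab_f : Q 0%N fP;
  stab1 : forall n x, Q n x -> Q n.+1 (De1 n x);
  stab2 : forall n x, Q n x -> Q n.+1 (De2 n x);
  stabM : forall n x, Q n x -> Q n.+1 (x * fP) }.

Lemma stabX Q n m x : stable_family Q -> Q n x -> Q (n + m)%N (x * fP ^+ m).
Proof.
move=> SQ Qx; elim: m => [|m IH]; first by rewrite addn0 mulr1.
by rewrite addnS exprSr mulrA; apply: stabM.
Qed.

Definition num i j := iter i (fs_deriv f (@fps_d1 C)) (iter j (fs_deriv f (@fps_d2 C)) (fP, 0%N)).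

Lemma num2 i j : (num i j).2 = (i + j)%N.
Proof. by rewrite /num; elim: i => [|i /= -> //]; elim: j => //= j ->. Qed.
Lemma num0S j : (num 0 j.+1).1 = De2 j (num 0 j).1.
Proof. by rewrite /Delta -[X in 'X - X%:R](num2 0 j). Qed.
Lemma numS i j : (num i.+1 j).1 = De1 (i + j) (num i j).1.
Proof. by rewrite /Delta -[X in 'X - X%:R](num2 i j). Qed.

Lemma stab_num Q i j : stable_family Q -> Q (i + j)%N (num i j).1.
Proof.
move=> SQ; elim: i => [|i IH]; last by rewrite numS addSn; apply: stab1.
by elim: j => [|j IH]; [apply: stab_f|rewrite num0S; apply: stab2].
Qed.

(** With numerators read as in [Delta], [u f^(s-n-1)] is the divergence of [(h1, h2) f^(s-n)] plus
    [g f^(s+1)]. Membership of [h1] and [h2] in all stable families is recorded for the divisors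
    along which the Jacobian does not vanish. *)
Definition by_parts n (u : T) := exists h1 h2 g : T,
  u = De1 n h1 + De2 n h2 + g * fP ^+ n.+2 /\
  forall Q, stable_family Q -> Q n h1 /\ Q n h2.

Lemma by_parts_f n u : by_parts n u -> by_parts n.+1 (u * fP).
Proof.
move=> [h1 [h2 [g [-> HQ]]]]; exists (h1 * fP), (h2 * fP), g; split.
  by rewrite !(Delta_f (d1_der C), Delta_f (d2_der C)) [fP ^+ n.+3]exprS; ring.
by move=> Q SQ; have [] := HQ _ SQ; split; apply: stabM.
Qed.
Lemma by_partsD n u v : by_parts n u -> by_parts n v -> by_parts n (u + v).
Proof.
move=> [h1 [h2 [g [-> HQ]]]] [k1 [k2 [l [-> HR]]]].
exists (h1 + k1), (h2 + k2), (g + l); split.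
  by rewrite !(DeltaD (d1_der C), DeltaD (d2_der C)); ring.
by move=> Q SQ; have [? ?] := HQ _ SQ; have [? ?] := HR _ SQ; split; apply: stabD.
Qed.
Lemma map_derN (d : S -> S) p : derivation d -> map_poly d (- p) = - map_poly d p.
Proof. by move=> dd; apply/polyP => i; rewrite coefN !coef_der // coefN derN. Qed.
Lemma by_partsN n u : by_parts n u -> by_parts n (- u).
Proof.
move=> [h1 [h2 [g [-> HQ]]]]; exists (- h1), (- h2), (- g); split.
  by rewrite /Delta (map_derN _ (d1_der C)) (map_derN _ (d2_der C)); ring.
by move=> Q SQ; have [? ?] := HQ _ SQ; rewrite -mulN1r -[- h2]mulN1r; split; apply: stabZ.
Qed.
Lemma by_parts1 n h : (forall Q, stable_family Q -> Q n h) -> by_parts n (De1 n h).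
Proof.
move=> H; exists h, 0, 0; split; last first.
  by move=> Q SQ; split; [exact: H|rewrite -(mul0r h); apply: stabZ => //; exact: H].
by rewrite (Delta0 (d2_der C)); ring.
Qed.
Lemma by_parts2 n h : (forall Q, stable_family Q -> Q n h) -> by_parts n (De2 n h).
Proof.
move=> H; exists 0, h, 0; split; last first.
  by move=> Q SQ; split; [rewrite -(mul0r h); apply: stabZ => //; exact: H|exact: H].
by rewrite (Delta0 (d1_der C)); ring.
Qed.

(** The rule [c (d w) = d (c w) - (d c) w] removes one derivative at a time. The term left without
    derivatives is a multiple of [f^(s+1)] and goes into [g]. *)
Lemma by_parts_num i j c : by_parts (i + j) (c * (num i j).1 * fP).
Proof.
elim: i c => [|i IH] c.
  elim: j c => [|j IH] c.
    exists 0, 0, c; split; last first.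
      by move=> Q SQ; have := stabZ SQ 0 (stab_f SQ); rewrite mul0r.
    by rewrite (Delta0 (d1_der C)) (Delta0 (d2_der C)) /=; ring.
  rewrite num0S (Delta_scale (d2_der C)) mulrBl; apply: by_partsD; last first.
    exact/by_partsN/by_parts_f/IH.
  rewrite mulrC -(Delta_f (d2_der C)); apply: by_parts2 => Q SQ.
  by apply/(stabM SQ)/(stabZ SQ)/(stab_num 0 j SQ).
rewrite numS (Delta_scale (d1_der C)) mulrBl addSn; apply: by_partsD; last first.
  exact/by_partsN/by_parts_f/IH.
rewrite mulrC -(Delta_f (d1_der C)); apply: by_parts1 => Q SQ.
by apply/(stabM SQ)/(stabZ SQ)/(stab_num i j SQ).
Qed.

Lemma by_partsX n m u : by_parts n u -> by_parts (n + m) (u * fP ^+ m).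
Proof.
move=> H; elim: m => [|m IH]; first by rewrite addn0 mulr1.
by rewrite addnS exprSr mulrA; apply: by_parts_f.
Qed.

(* u.1 f^(s - u.2) = v f^(s - K) *)
Definition at_level K (u : fs_elt C) (v : T) := u.1 * fP ^+ K = v * fP ^+ u.2.

Lemma at_level_add K u u' v v' : at_level K u v -> at_level K u' v' ->
  at_level K (fs_add f u u') (v + v').
Proof.
rewrite /at_level /fs_add /= => H H'; rewrite exprD mulrDl mulrAC H mulrAC.
by rewrite -[X in _ + X]mulrAC H'; ring.
Qed.
Lemma at_level0 K : at_level K (0, 0%N) 0.
Proof. by rewrite /at_level !mul0r. Qed.

Lemma polyC_mulI : f <> 0 -> forall p q : T, fP * p = fP * q -> p = q.
Proof.
move=> f0 p q E; apply/polyP => i; apply: (fps2_mulI f0).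
by have := congr1 (fun r : T => r`_i) E; rewrite !coefCM.
Qed.
Lemma polyC_mulXI n : f <> 0 -> forall p q : T, fP ^+ n * p = fP ^+ n * q -> p = q.
Proof.
move=> f0; elim: n => [|n IH] p q; first by rewrite !expr0 !mul1r.
by rewrite exprS -!mulrA => /(polyC_mulI f0)/IH.
Qed.

(** The operator has order less than [N] in each variable, so all its terms can be written over the
    level [K = N + N]; powers of [f] cancel because [f] is not zero. The two statements concern the
    numerators of [b f^s] at the levels [K + 1] and [K]. *)
Lemma bernstein_by_parts b : f <> 0 -> bernstein_equation f b -> exists K,
  by_parts K (cst_poly b * fP ^+ K.+1) /\
  forall Q, stable_family Q -> Q K (cst_poly b * fP ^+ K).
Proof.
move=> f0 [N [P [_ E]]]; pose K := (N + N)%N; exists K.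
pose w (i j : 'I_N) := P i j * (num i j).1 * fP ^+ (K - (i + j)).
have wl i j : at_level K (fs_scale (P i j) (num i j)) (w i j).
  rewrite /at_level /= num2 /w -[in RHS]mulrA -exprD subnK //.
  by have := ltn_ord i; have := ltn_ord j; rewrite /K; lia.
have H : at_level K (fs_apply f P (fP, 0%N)) (\sum_i \sum_j w i j).
  apply: (big_ind2 (at_level K)); [exact: at_level0|by move=> *; apply: at_level_add|].
  move=> i _; apply: (big_ind2 (at_level K)); [exact: at_level0|by move=> *; apply: at_level_add|].
  by move=> j _; exact: wl.
have {H} bK : cst_poly b * fP ^+ K = \sum_i \sum_j w i j.
  move: H E; case: (fs_apply f P (fP, 0%N)) => G n; rewrite /at_level /fs_eq /= expr0 mulr1 => H G1.
  by apply: (@polyC_mulXI n f0); rewrite ![fP ^+ n * _]mulrC -H G1; ring.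
have ij (i j : 'I_N) : (i + j <= K)%N by have := ltn_ord i; have := ltn_ord j; rewrite /K; lia.
have z n : by_parts n 0.
  exists 0, 0, 0; split; last first.
    move=> Q SQ; have := stabX n SQ (stabZ SQ 0 (stab_f SQ)).
    by rewrite !mul0r add0n.
  by rewrite (Delta0 (d1_der C)) (Delta0 (d2_der C)); ring.
rewrite exprSr mulrA bK; split.
  rewrite mulr_suml; apply: (big_ind (by_parts K)) => [|u v|i _]; [exact: z|exact: by_partsD|].
  rewrite mulr_suml; apply: (big_ind (by_parts K)) => [|u v|j _]; [exact: z|exact: by_partsD|].
  have -> : w i j * fP = P i j * (num i j).1 * fP * fP ^+ (K - (i + j)) by rewrite /w; ring.
  by rewrite -{1}(subnKC (ij i j)); apply/by_partsX/by_parts_num.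
move=> Q SQ; have Q0 : Q K 0.
  by have := stabX K SQ (stabZ SQ 0 (stab_f SQ)); rewrite !mul0r add0n.
apply: (big_ind (Q K)) => [//|u v|i _]; first exact: stabD.
apply: (big_ind (Q K)) => [//|u v|j _]; first exact: stabD.
rewrite /w -{1}(subnKC (ij i j)); apply: stabX => //; apply: stabZ => //.
exact: stab_num.
Qed.
End Parts.

(** * Orders of vanishing of polynomial solutions of first-order equations *)

Section PolyOrder.
Variable C : numClosedFieldType.
Implicit Types (p q g : {poly C}) (a : C).

Lemma mup_decomp p a : p != 0 -> exists2 q, q.[a] != 0 & p = ('X - a%:P) ^+ mup a p * q.
Proof.
move=> p0; have [m [q]] := multiplicity_XsubC p a; rewrite p0 /= => qa pE.
have -> : mup a p = m by rewrite pE mupMr // mup_XsubCX eqxx.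
by exists q; rewrite // mulrC.
Qed.

Lemma XsubC_deriv a q n : ('X - a%:P) * (('X - a%:P) ^+ n * q)^`() =
  ('X - a%:P) ^+ n * (n%:R *: q + ('X - a%:P) * q^`()).
Proof.
rewrite derivM deriv_exp derivXsubC mul1r; case: n => [|n].
  by rewrite mulr0n mul0r add0r expr0 scale0r add0r !mul1r.
by rewrite /= exprS -mulr_natr scaler_nat -mulr_natr; ring.
Qed.

Lemma dvdp_mup p q : p != 0 -> q != 0 -> (forall a, (mup a q <= mup a p)%N) -> q %| p.
Proof.
have [n] := ubnP (size q); elim: n q p => // n IH q p sq p0 q0 H.
have [s1|s1] := leqP (size q) 1.
  have /size_poly1P [c c0 ->] : size q == 1%N by rewrite eqn_leq s1 size_poly_gt0.
  by rewrite -mul_polyC -[c%:P]mulr1 mul_polyC dvdpZl // dvd1p || rewrite -alg_polyC dvdpZl // dvd1p.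
have /closed_rootP [a ra] : size q != 1%N by rewrite neq_ltn s1 orbT.
have qp : (0 < mup a p)%N by apply: leq_trans (H a); rewrite -XsubC_dvd // dvdp_XsubCl.
move: qp (ra); rewrite -XsubC_dvd // -dvdp_XsubCl => /dvdpP [p' pE] /dvdpP [q' qE].
have p'0 : p' != 0 by apply: contraNneq p0 => p'0; rewrite pE p'0 mul0r.
have q'0 : q' != 0 by apply: contraNneq q0 => q'0; rewrite qE q'0 mul0r.
rewrite pE qE dvdp_mul2r ?polyXsubC_eq0 //; apply: IH => //.
  by move: sq; rewrite qE size_Mmonic ?monicXsubC // size_XsubC addn2 /=; lia.
move=> c; have := H c; rewrite pE qE !mupM ?polyXsubC_eq0 //.
by rewrite leq_add2r.
Qed.

Lemma coef_top p q m n : (size p <= m.+1)%N -> (size q <= n.+1)%N ->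
  (p * q)`_(m + n) = p`_m * q`_n.
Proof.
move=> sp sq; have mlt : (m < (m + n).+1)%N by lia.
rewrite coefM (bigD1 (Ordinal mlt)) //= addKn big1 ?addr0 // => i ne.
have ne' : (i : nat) != m by apply: contra_neq ne => e; apply: val_inj.
have [im|im] := ltnP m i; first by rewrite [p`_i]nth_default ?mul0r // (leq_trans sp).
rewrite [q`__]nth_default ?mulr0 // (leq_trans sq) //.
by move: ne' im (ltn_ord i) => /eqP; lia.
Qed.

Definition roots_of g (rs : seq C) := uniq rs /\ forall a, root g a = (a \in rs).

Lemma mup_prod_XsubC a (rs : seq C) : uniq rs -> mup a (\prod_(x <- rs) ('X - x%:P)) = (a \in rs).
Proof.
elim: rs => [|x rs IH] /=; first by rewrite big_nil mupNroot // root1.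
move=> /andP[xr ur]; rewrite big_cons mupM ?polyXsubC_eq0 //; last first.
  by rewrite monic_neq0 // monic_prod_XsubC.
rewrite -[X in mup a X]expr1 mup_XsubCX IH // inE eq_sym; case: eqP => [->|] //=.
by rewrite (negbTE xr).
Qed.

Lemma mupX a p n : p != 0 -> mup a (p ^+ n) = (n * mup a p)%N.
Proof.
move=> p0; elim: n => [|n IH]; first by rewrite expr0 mupNroot // root1.
by rewrite exprS mupM ?expf_neq0 // IH mulSn.
Qed.

(* With T = p / g^L the equation reads T' + s (g' / g) T = c, i.e. (T g^s)' = c g^s.
   Locally, T has to vanish at the roots of g and to be regular elsewhere; then its degree
   is too large. *)
Lemma no_primitive g p s c L rs : g != 0 -> roots_of g rs -> (1 < size rs)%N -> c != 0 ->
  s < 0 -> 0 < (size rs)%:R + s * (size g).-1%:R ->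
  g * p^`() + (s - L%:R) *: (g^`() * p) = c *: g ^+ L.+1 -> False.
Proof.
move=> g0 [urs rsP] rs2 c0 s0 pos E.
have p0 : p != 0.
  apply/eqP => p0; move: E; rewrite p0 deriv0 !mulr0 scaler0 addr0 => /esym/eqP.
  by rewrite scaler_eq0 (negbTE c0) expf_eq0 (negbTE g0).
(* If [p] had order [o <= L m] at a root of multiplicity [m], the left side would have order
   [m + o - 1] there, with lowest coefficient a nonzero multiple of [o + (s - L) m < 0], while the
   right side has order [m (L + 1)], which is larger. *)
have ord a : root g a -> (L * mup a g < mup a p)%N.
  move=> ra; have mg : (0 < mup a g)%N by rewrite -XsubC_dvd // dvdp_XsubCl.
  rewrite ltnNge; apply/negP => le.
  have [g1 g1a gE] := mup_decomp a g0; have [p1 p1a pE] := mup_decomp a p0.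
  set u := 'X - a%:P; set m := mup a g in mg le gE; set o := mup a p in le pE.
  have dg : u * g^`() = u ^+ m * (m%:R *: g1 + u * g1^`()) by rewrite {1}gE XsubC_deriv.
  have dp : u * p^`() = u ^+ o * (o%:R *: p1 + u * p1^`()) by rewrite {1}pE XsubC_deriv.
  have u0 : u ^+ (m + o) != 0 by rewrite expf_neq0 // polyXsubC_eq0.
  have ua : u.[a] = 0 by rewrite !hornerE subrr.
  rewrite -/u in gE pE; clearbody m o u.
  pose br := (o%:R + (s - L%:R) * m%:R) *: (g1 * p1) +
     u * (g1 * p1^`() + (s - L%:R) *: (g1^`() * p1)).
  have E1 : u ^+ (m + o) * br = u ^+ (m + o) * (c *: (u ^+ ((L * m).+1 - o) * g1 ^+ L.+1)).
    transitivity (u * (g * p^`() + (s - L%:R) *: (g^`() * p))).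
      have -> : u * (g * p^`() + (s - L%:R) *: (g^`() * p)) =
          g * (u * p^`()) + (s - L%:R) *: (u * g^`() * p).
        by rewrite -!mul_polyC; ring.
      rewrite dg dp gE pE /br exprD -!mul_polyC.
      by rewrite !(rmorphD, rmorphB, rmorphM) /=; ring.
    rewrite E gE -!mul_polyC exprMn -exprM.
    have -> : (m * L.+1)%N = (m + (L * m))%N by rewrite mulnS mulnC.
    rewrite !exprD; have -> : u * (c%:P * (u ^+ m * u ^+ (L * m) * g1 ^+ L.+1)) =
      u ^+ m * c%:P * g1 ^+ L.+1 * u ^+ (L * m).+1 by rewrite [u ^+ (L * m).+1]exprS; ring.
    set e := (_ - o)%N; have eE : (L * m).+1 = (o + e)%N by rewrite /e subnKC // leqW.
    by clearbody e; rewrite eE exprD; ring.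
  move/(mulfI u0): E1 => /(congr1 (fun q => q.[a])).
  rewrite /br !(hornerE, horner_exp) ua ?mul0r ?addr0 subSn // exprS ?mul0r ?mulr0.
  move=> H1; have {H1} : (o%:R + (s - L%:R) * m%:R) * g1.[a] * p1.[a] = c * 0 * g1.[a] ^+ L.+1 := H1.
  rewrite mulr0 mul0r => /eqP; rewrite !mulf_eq0 (negbTE g1a) (negbTE p1a) !orbF => /eqP H.
  have : o%:R + (s - L%:R) * m%:R < 0 :> C.
    have -> : o%:R + (s - L%:R) * m%:R = s * m%:R - ((L * m) - o)%:R.
      by rewrite natrB // natrM; ring.
    rewrite subr_lt0; apply: (@lt_le_trans _ _ 0) => //.
    by rewrite nmulr_rlt0 ?ltr0n.
  by rewrite H ltxx.
(* So [deg p] is at least [L h] plus the number of roots. With two roots the degree of the left side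
   exceeds that of [g^(L+1)], and its top coefficient, a multiple of [d + 1 + (s - L) h], would have
   to vanish although [pos] makes it positive. *)
have : g ^+ L * \prod_(x <- rs) ('X - x%:P) %| p.
  apply: dvdp_mup => // [|a].
    by rewrite mulf_neq0 ?expf_neq0 // monic_neq0 // monic_prod_XsubC.
  rewrite mupM ?expf_neq0 ?(monic_neq0 (monic_prod_XsubC _ _ _)) //.
  rewrite mupX // mup_prod_XsubC //; case: (boolP (a \in rs)) => ar; rewrite -rsP in ar.
    by rewrite addn1 ord.
  by rewrite (mupNroot ar) muln0.
move/(dvdp_leq p0); rewrite size_Mmonic ?expf_neq0 ?monic_prod_XsubC // size_prod_XsubC.
have -> : size (g ^+ L) = ((size g).-1 * L).+1.
  by rewrite -size_exp prednK // size_poly_gt0 expf_neq0.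
rewrite addnS /= => sp.
set h := (size g).-1 in sp pos *; have sg : size g = h.+1.
  by rewrite prednK // size_poly_gt0.
have [d sd] : exists d, size p = d.+2.
  have : (1 < size p)%N by apply: leq_trans rs2 _; apply: leq_trans sp; rewrite leq_addl.
  by case: (size p) => [|[|d]] // _; exists d.
rewrite sd in sp.
have := congr1 (fun q => q`_(h + d)) E.
rewrite coefD !coefZ coef_top ?sg //; last by rewrite (leq_trans (size_poly _ _)) // sd.
have -> : (g^`() * p)`_(h + d) = h%:R * g`_h * p`_d.+1.
  case: (posnP h) => [h0|hp].
    have -> : g^`() = 0 by apply: size_poly_leq0 || (apply/eqP; rewrite -size_poly_leq0 (leq_trans (size_poly _ _)) // sg h0).
    by rewrite mul0r coef0 h0 !mul0r.
  have -> : (h + d = h.-1 + d.+1)%N by lia.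
  rewrite coef_top ?sd //; last by rewrite (leq_trans (size_poly _ _)) // sg /=; lia.
  by rewrite coef_deriv prednK // mulr_natl.
rewrite coef_deriv [X in c * X]nth_default ?mulr0; last first.
  have -> : size (g ^+ L.+1) = (h * L.+1).+1.
    by rewrite -size_exp prednK // size_poly_gt0 expf_neq0.
  by rewrite mulnS; lia.
have -> : g`_h * (p`_d.+1 *+ d.+1) + (s - L%:R) * (h%:R * g`_h * p`_d.+1) =
   (d.+1%:R + (s - L%:R) * h%:R) * (g`_h * p`_d.+1) by rewrite -mulr_natr; ring.
have gh : g`_h != 0 by rewrite -lead_coefE lead_coef_eq0.
have pd : p`_d.+1 != 0 by rewrite -[d.+1]/(d.+2.-1) -sd -lead_coefE lead_coef_eq0.
move/eqP; rewrite !mulf_eq0 (negbTE gh) (negbTE pd) !orbF => /eqP H.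
suff : 0 < d.+1%:R + (s - L%:R) * h%:R :> C by rewrite H ltxx.
apply: (lt_le_trans pos); rewrite mulrBl addrCA [X in X <= _]addrC lerD2l.
rewrite lerBrDr -natrM -natrD ler_nat; lia.
Qed.

(** The equation is [q'/q = (s - K) g'/g + P'/P]. Comparing residues at [a] gives
    [n = (s - K) m + o], where [n], [m], [o] are the multiplicities of [q], [g], [P]. *)
Lemma integral_exponent g q P s (M K m : nat) a b : g != 0 -> P != 0 -> b != 0 -> root g a -> a != 0 ->
  q = b *: (g ^+ M * 'X ^+ m) ->
  g * q^`() * P = ((s - K%:R) *: (g^`() * P) + g * P^`()) * q ->
  exists i : int, s * (mup a g)%:R = i%:~R.
Proof.
move=> g0 P0 b0 ra a0 qE E.
have q0 : q != 0.
  by rewrite qE scaler_eq0 (negbTE b0) mulf_neq0 ?expf_neq0 ?polyX_eq0.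
have [g1 g1a gE] := mup_decomp a g0; have [P1 P1a PE] := mup_decomp a P0.
have [q1 q1a q1E] := mup_decomp a q0.
have mq : mup a q = (M * mup a g)%N.
  rewrite qE -mul_polyC mupMr ?rootC // mupM ?expf_neq0 ?polyX_eq0 // mupX // mupX ?polyX_eq0 //.
  by rewrite [mup a 'X]mupNroot ?muln0 ?addn0 // rootX.
set u := 'X - a%:P in gE PE q1E; set m1 := mup a g in gE mq *; set o := mup a P in PE.
set n := mup a q in q1E mq.
have dg : u * g^`() = u ^+ m1 * (m1%:R *: g1 + u * g1^`()) by rewrite {1}gE XsubC_deriv.
have dP : u * P^`() = u ^+ o * (o%:R *: P1 + u * P1^`()) by rewrite {1}PE XsubC_deriv.
have dq : u * q^`() = u ^+ n * (n%:R *: q1 + u * q1^`()) by rewrite {1}q1E XsubC_deriv.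
have un0 : u ^+ (m1 + n + o) != 0 by rewrite expf_neq0 // polyXsubC_eq0.
have ua : u.[a] = 0 by rewrite !hornerE subrr.
clear qE; clearbody m1 o n u.
have E1 : u ^+ (m1 + n + o) * ((n%:R - (s - K%:R) * m1%:R - o%:R) *: (g1 * q1 * P1) +
   u * (g1 * q1^`() * P1 - (s - K%:R) *: (g1^`() * P1 * q1) - g1 * P1^`() * q1)) = 0.
  transitivity (u * (g * q^`() * P - ((s - K%:R) *: (g^`() * P) + g * P^`()) * q)); last first.
    by rewrite E subrr mulr0.
  have -> : u * (g * q^`() * P - ((s - K%:R) *: (g^`() * P) + g * P^`()) * q) =
     g * (u * q^`()) * P - ((s - K%:R) *: (u * g^`() * P) + g * (u * P^`())) * q.
    by rewrite -!mul_polyC; ring.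
  rewrite dg dP dq gE PE q1E !exprD -!mul_polyC.
  rewrite !(rmorphB, rmorphM) /=; ring.
move/eqP: E1; rewrite mulf_eq0 (negbTE un0) /= => /eqP/(congr1 (fun q => q.[a])).
rewrite !hornerE ua mul0r addr0 => /eqP.
rewrite !mulf_eq0 (negbTE g1a) (negbTE q1a) (negbTE P1a) !orbF => /eqP H.
exists (Posz n + Posz K * Posz m1 - Posz o); rewrite !(rmorphB, rmorphD, rmorphM) /= !pmulrn.
by apply/eqP; rewrite -subr_eq0; apply/eqP; rewrite -[RHS]oppr0 -H; ring.
Qed.
End PolyOrder.

(** * Roots of b along the divisors of a chart *)

Section Rows.
Variable C : numClosedFieldType.
Notation S := (fps (fps C)).
Implicit Types (p q : {poly C}) (F G : S).

Definition pol p : fps C := Fps (fun i => p`_i).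
Lemma polE p i : pol p i = p`_i. Proof. by []. Qed.
Lemma pol_inj p q : pol p = pol q -> p = q.
Proof. by move=> E; apply/polyP => i; rewrite -polE E. Qed.
Lemma pol_zmod : zmod_morphism pol.
Proof. by move=> p q; apply: fpsP => i; rewrite fpsB !polE coefB. Qed.
HB.instance Definition _ := GRing.isZmodMorphism.Build {poly C} (fps C) pol pol_zmod.
Lemma pol_monoid : monoid_morphism pol.
Proof.
split=> [|p q]; apply: fpsP => i; first by rewrite fps1 polE coef1.
by rewrite fpsM polE coefM.
Qed.
HB.instance Definition _ := GRing.isMonoidMorphism.Build {poly C} (fps C) pol pol_monoid.
Lemma polC c : pol c%:P = fps_const c.
Proof. by apply: fpsP => i; rewrite polE coefC fps_constE; case: eqP. Qed.
Lemma pol_deriv p : fps_deriv (pol p) = pol p^`().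
Proof. by apply: fpsP => i; rewrite fps_derivE !polE coef_deriv. Qed.

(** Each coefficient of a power of [z1] is a polynomial in [z2]: these are functions on a formal
    neighbourhood of the whole affine line [z1 = 0]. This makes all the zeros of [f] along an
    exceptional divisor visible, not only the one at the origin of the chart. *)
Definition zpoly G := forall n, exists p, G n = pol p.

Lemma zpolyD F G : zpoly F -> zpoly G -> zpoly (F + G).
Proof.
by move=> HF HG n; have [p pE] := HF n; have [q qE] := HG n; exists (p + q); rewrite fpsD pE qE rmorphD.
Qed.
Lemma zpolyN F : zpoly F -> zpoly (- F).
Proof. by move=> HF n; have [p pE] := HF n; exists (- p); rewrite fpsN pE rmorphN. Qed.
Lemma zpoly_sumM (a b : nat -> fps C) n : (forall i, exists p, a i = pol p) ->
  (forall i, exists p, b i = pol p) -> exists p, \sum_(i < n) a i * b i = pol p.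
Proof.
move=> /boolp.choice[p pE] /boolp.choice[q qE]; exists (\sum_(i < n) p i * q i).
by rewrite rmorph_sum; apply: eq_bigr => i _; rewrite rmorphM /= -pE -qE.
Qed.
Lemma zpolyM F G : zpoly F -> zpoly G -> zpoly (F * G).
Proof. by move=> HF HG n; rewrite fpsM; apply: (zpoly_sumM (b := fun i => G (n - i)%N)). Qed.
Lemma zpolyX F n : zpoly F -> zpoly (F ^+ n).
Proof.
move=> HF; elim: n => [|n IH]; last by rewrite exprS; apply: zpolyM.
by move=> i; exists (i == 0%N)%:R; rewrite expr0 fps1 rmorph_nat.
Qed.
Lemma zpoly_d1 F : zpoly F -> zpoly (fps_d1 F).
Proof.
by move=> HF n; have [p pE] := HF n.+1; exists (p *+ n.+1); rewrite fps_derivE pE rmorphMn.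
Qed.
Lemma pol_shift (g : fps C) k p : (forall j, g j = p`_(j + k)) -> exists q, g = pol q.
Proof.
move=> H; exists (\poly_(j < size p) p`_(j + k)); apply: fpsP => j.
rewrite polE coef_poly H; case: ltnP => // sp.
by rewrite nth_default // (leq_trans sp) ?leq_addr.
Qed.
Lemma zpoly_div a b F G : F = mono2 C a b * G -> zpoly F -> zpoly G.
Proof.
move=> -> H n; have [p pE] := H (n + a)%N; apply: (@pol_shift _ b p) => j.
by rewrite -polE -pE mono2M !leq_addl !addnK.
Qed.

(* Substituting series divisible by z1 makes each z1-coefficient a finite sum. *)
Lemma zpoly_pull (t : subst2 C) F : zpoly (sX t) -> zpoly (sY t) -> sX t 0%N = 0 -> sY t 0%N = 0 ->
  zpoly (pull t F).
Proof.
move=> HX HY X0 Y0 n; have low i j k : (k < i + j)%N -> (sX t ^+ i * sY t ^+ j) k = 0.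
  have lowX (G : S) m l : G 0%N = 0 -> (l < m)%N -> (G ^+ m) l = 0.
    move=> G0; elim: m l => // m IH l lm; rewrite exprS.
    have G1 : forall k, (k < 1)%N -> G k = 0 by case.
    by have [H _] := @fps_low _ G (G ^+ m) 1 m G1 (fun k => IH k); apply: H.
  move=> kij; have [H _] := @fps_low _ (sX t ^+ i) (sY t ^+ j) i j
    (fun l => lowX _ _ l X0) (fun l => lowX _ _ l Y0).
  exact: H.
have H i j : exists p, (sX t ^+ i * sY t ^+ j) n = pol p.
  by apply: zpolyM; apply: zpolyX.
have {}H : forall ij : nat * nat, exists p, (sX t ^+ ij.1 * sY t ^+ ij.2) n = pol p by move=> [i j]; exact: H.
have [p pE] := boolp.choice H.
exists (\sum_(i < n.+1) \sum_(j < n.+1) F i j *: p (i : nat, j : nat)); apply: fpsP => l.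
rewrite (@pullE C (n + l)) // polE coef_sum.
have ext (G : nat -> C) : (forall i, (n < i)%N -> G i = 0) ->
    \sum_(i < (n + l).+1) G i = \sum_(i < n.+1) G i.
  move=> G0; rewrite [RHS](big_ord_widen (n + l).+1 G) ?ltnS ?leq_addr //.
  rewrite [LHS](bigID (fun i : 'I__ => (i < n.+1)%N)) /=.
  by rewrite [X in _ + X = _]big1 ?addr0 // => i; rewrite -leqNgt => Hi; apply: G0.
rewrite (ext (fun i => \sum_(j < (n + l).+1) F i j * (sX t ^+ i * sY t ^+ j) n l)); last first.
  by move=> i ni; rewrite big1 // => j _; rewrite low ?fps0 ?mulr0 //; lia.
apply: eq_bigr => i _; rewrite coef_sum.
rewrite (ext (fun j => F i j * (sX t ^+ i * sY t ^+ j) n l)); last first.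
  by move=> j nj; rewrite low ?fps0 ?mulr0 //; lia.
by apply: eq_bigr => j _; rewrite coefZ -polE -pE.
Qed.

(** Every row of [F^e] is its row of index 0 times a rational function of [z2] whose poles are zeros
    of [F(0, z2)]: the recursion in [z1] divides by [F(0, z2)] once for each row. *)
Lemma pow_row F e E : zpoly F -> is_pow F e E -> forall n, exists p, F 0%N ^+ n * E n = E 0%N * pol p.
Proof.
move=> HF [_ HE _]; elim/ltn_ind => -[|n] IH; first by exists 1; rewrite rmorph1 mulrC.
have Hn := congr1 (fun f : S => f n) HE; move: Hn.
rewrite /cst fps_constM [X in X = _]fpsM_recl [X in _ = _ * X]fpsM => /eqDB; rewrite fps_derivE => Hn.
have {}IH : forall k, exists p, (k <= n)%N -> F 0%N ^+ n * E k = E 0%N * pol p.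
  move=> k; case: (leqP k n) => kn; last by exists 0.
  have [p pE] := IH k kn; have [q qE] := HF 0%N; exists (q ^+ (n - k) * p) => _.
  by rewrite -{1}(subnK kn) exprD -mulrA pE qE rmorphM rmorphXn /=; ring.
have [p pE] := boolp.choice IH; have [q qE] := boolp.choice HF.
exists (n.+1%:R^-1 *: (e *: (\sum_(i < n.+1) q i.+1 *+ i.+1 * p (n - i)%N)
   - \sum_(i < n) q i.+1 * (p (n - i)%N *+ (n - i)%N))).
have nz : n.+1%:R != 0 :> C by rewrite pnatr_eq0.
have -> : F 0%N ^+ n.+1 * E n.+1 = fps_const n.+1%:R^-1 * (F 0%N ^+ n * (F 0%N * (E n.+1 *+ n.+1))).
  have -> : E n.+1 *+ n.+1 = fps_const n.+1%:R * E n.+1 by rewrite rmorph_nat mulr_natl.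
  rewrite exprS.
  transitivity ((fps_const n.+1%:R^-1 * fps_const n.+1%:R) * (F 0%N ^+ n * (F 0%N * E n.+1))).
    by rewrite -rmorphM mulVf // rmorph1; ring.
  by ring.
rewrite Hn -!mul_polyC !(rmorphM, rmorphB, rmorph_sum) /= !polC.
rewrite [RHS]mulrCA; congr (_ * _); rewrite mulrBr mulrBr; congr (_ - _).
  rewrite mulrCA [in RHS]mulrCA; congr (_ * _); rewrite !mulr_sumr.
  apply: eq_bigr => i _; rewrite rmorphM rmorphMn /= -qE fps_derivE mulrCA pE ?leq_subr //.
  by ring.
rewrite !mulr_sumr; apply: eq_bigr => i _; rewrite rmorphM rmorphMn /= -qE fps_derivE.
have := ltn_ord i; move=> lin; rewrite -subSn // subSS mulrCA.
have -> : F 0%N ^+ n * (E (n - i)%N *+ (n - i)) = (F 0%N ^+ n * E (n - i)%N) *+ (n - i).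
  by rewrite mulrnAr.
by rewrite pE ?leq_subr // -mulrnAr; ring.
Qed.

Lemma pow_row_mul V F e E n : zpoly V -> zpoly F -> is_pow F e E ->
  exists p, F 0%N ^+ n * (V * E) n = E 0%N * pol p.
Proof.
move=> HV HF HE; have H : forall k, exists p, (k <= n)%N -> F 0%N ^+ n * E k = E 0%N * pol p.
  move=> k; case: (leqP k n) => kn; last by exists 0.
  have [p pE] := pow_row HF HE k; have [q qE] := HF 0%N; exists (q ^+ (n - k) * p) => _.
  by rewrite -{1}(subnK kn) exprD -mulrA pE qE rmorphM rmorphXn /=; ring.
have [p pE] := boolp.choice H; have [q qE] := boolp.choice HV.
exists (\sum_(i < n.+1) q i * p (n - i)%N); rewrite fpsM !mulr_sumr rmorph_sum mulr_sumr.
apply: eq_bigr => i _; rewrite mulrCA pE ?leq_subr // qE rmorphM /=; ring.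
Qed.

Lemma row0M F G : (F * G) 0%N = F 0%N * G 0%N.
Proof. by rewrite fpsM_recl big_ord0 addr0. Qed.
Lemma row0X F n : (F ^+ n) 0%N = F 0%N ^+ n.
Proof. by elim: n => [|n IH]; rewrite ?expr0 // !exprS row0M IH. Qed.
Lemma pow_row0 F e E : is_pow F e E -> F 0%N * fps_deriv (E 0%N) = fps_const e * (fps_deriv (F 0%N) * E 0%N).
Proof.
by case=> _ _ H; have := congr1 (fun f : S => f 0%N) H; rewrite /cst fps_constM !row0M.
Qed.
Lemma fps_unitI (g h k : fps C) : g 0%N != 0 -> g * h = g * k -> h = k.
Proof.
move=> g0 E; have [v Hv] := @fps_inv _ g _ (mulfV g0).
by rewrite -[h]mul1r -Hv mulrAC E mulrAC Hv mul1r.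
Qed.
End Rows.

(** * Pulling numerators back to a chart; divisors without Jacobian *)

Section Charts.
Variables (C : numClosedFieldType) (f : fps (fps C)).
Notation S := (fps (fps C)).
Notation T := {poly S}.
Implicit Types (s : subst2 C) (p q h : T).

Definition Jac s : S := fps_d1 (sX s) * fps_d2 (sY s) - fps_d2 (sX s) * fps_d1 (sY s).

Definition at_s (x : C) p : S := p.[cst x].

Lemma at_sD x p q : at_s x (p + q) = at_s x p + at_s x q. Proof. exact: hornerD. Qed.
Lemma at_sM x p q : at_s x (p * q) = at_s x p * at_s x q. Proof. exact: hornerM. Qed.
Lemma at_sC x (c : S) : at_s x c%:P = c. Proof. exact: hornerC. Qed.
Lemma at_sX x p n : at_s x (p ^+ n) = at_s x p ^+ n. Proof. exact: horner_exp. Qed.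
Lemma at_s_cst x (b : {poly C}) : at_s x (cst_poly b) = cst b.[x].
Proof. by rewrite -[cst_poly b]/(map_poly (@cst C) b) /at_s horner_map. Qed.

Lemma at_s_der d x p : derivation d -> at_s x (map_poly d p) = d (at_s x p).
Proof.
move=> dd; have [dD dM dC _] := dd; elim/poly_ind: p => [|p c IH].
  by rewrite -(polyC0 S) polyDC // !at_sC.
rewrite polyDD // polyDM // polyDC // !(at_sD, at_sM, at_sC) IH dD dM.
have -> : map_poly d 'X = 0.
  apply/polyP => i; rewrite coef_der // coefX coef0.
  by case: eqP => _; rewrite ?der0 // -(rmorph1 (@cst C)) dC.
have -> : at_s x 0 = 0 by exact: horner0.
have -> : at_s x 'X = cst x by exact: hornerX.
by rewrite dC.
Qed.

Lemma at_s_Delta d n x p : derivation d ->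
  at_s x (Delta f d n p) = d (at_s x p) * f + cst (x - n%:R) * at_s x p * d f.
Proof.
move=> dd; rewrite /Delta at_sD !at_sM at_s_der // [at_s x f%:P]at_sC [at_s x (d f)%:P]at_sC.
have -> : at_s x ('X - n%:R) = cst (x - n%:R).
  by rewrite /at_s hornerD hornerX hornerN -(rmorph_nat (@polyC S)) hornerC -(rmorph_nat (@cst C)) rmorphB.
by [].
Qed.

Definition theta s x p : S := pull s (at_s x p).

Lemma theta_poly_fun s p i j : poly_fun (fun x => theta s x p i j).
Proof.
have -> : (fun x => theta s x p i j) = fun x => \sum_(k < size p) pull s p`_k i j * x ^+ k.
  apply: funext => x; rewrite /theta /at_s horner_coef rmorph_sum fps2_sum.
  apply: eq_bigr => k _; rewrite rmorphM -rmorphXn /= pull_cst mulrC cstM mulrC.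
  by [].
apply: poly_fun_sum => k _; apply: poly_funM; first exact: poly_funC.
elim: (nat_of_ord k) => [|n IH]; first by apply: poly_fun_eq (poly_funC 1) => x; rewrite expr0.
apply: (@poly_fun_eq _ _ (fun x => x * x ^+ n)) => [x|]; first by rewrite exprS.
by apply: poly_funM => //; exact: poly_funX.
Qed.

(** The chain rule solved by Cramer's rule. The Jacobian is kept as a factor because it may vanish
    along the divisor. *)
Lemma Jac_d1 s F : Jac s * pull s (fps_d1 F) = fps_d2 (sY s) * fps_d1 (pull s F) - fps_d1 (sY s) * fps_d2 (pull s F).
Proof. by rewrite (chain_rule s F (d1_der C)) (chain_rule s F (d2_der C)) /Jac; ring. Qed.
Lemma Jac_d2 s F : Jac s * pull s (fps_d2 F) = fps_d1 (sX s) * fps_d2 (pull s F) - fps_d2 (sX s) * fps_d1 (pull s F).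
Proof. by rewrite (chain_rule s F (d1_der C)) (chain_rule s F (d2_der C)) /Jac; ring. Qed.

(** The operation [Delta] in the coordinates of the chart: with [phi = pull s f], it is the
    numerator of [d (F phi^c)] over [phi^(c-1)]. *)
Definition twisted (d : S -> S) s (c : C) (F : S) : S := d F * pull s f + cst c * F * d (pull s f).

Lemma Jac_Delta1 s x m p : Jac s * theta s x (Delta f (@fps_d1 C) m p) =
  fps_d2 (sY s) * twisted (@fps_d1 C) s (x - m%:R) (theta s x p) -
  fps_d1 (sY s) * twisted (@fps_d2 C) s (x - m%:R) (theta s x p).
Proof.
rewrite /theta at_s_Delta; last exact: d1_der.
set c := x - m%:R; rewrite (rmorphD (pull s)) !(rmorphM (pull s)) /= pull_cst mulrDr mulrA Jac_d1 [Jac s * _]mulrCA Jac_d1.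
by rewrite /twisted; ring.
Qed.
Lemma Jac_Delta2 s x m p : Jac s * theta s x (Delta f (@fps_d2 C) m p) =
  fps_d1 (sX s) * twisted (@fps_d2 C) s (x - m%:R) (theta s x p) -
  fps_d2 (sX s) * twisted (@fps_d1 C) s (x - m%:R) (theta s x p).
Proof.
rewrite /theta at_s_Delta; last exact: d2_der.
set c := x - m%:R; rewrite (rmorphD (pull s)) !(rmorphM (pull s)) /= pull_cst mulrDr mulrA Jac_d2 [Jac s * _]mulrCA Jac_d2.
by rewrite /twisted; ring.
Qed.

Definition row_ge n (G : S) := forall i, (i < n)%N -> G i = 0.
Lemma row_geD n F G : row_ge n F -> row_ge n G -> row_ge n (F + G).
Proof. by move=> HF HG i ni; rewrite fpsD HF // HG // addr0. Qed.
Lemma row_geB n F G : row_ge n F -> row_ge n G -> row_ge n (F - G).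
Proof. by move=> HF HG i ni; rewrite fpsB HF // HG // subr0. Qed.
Lemma row_geMM m n F G : row_ge m F -> row_ge n G -> row_ge (m + n) (F * G).
Proof. by move=> HF HG; have [] := fps_low HF HG. Qed.
Lemma row_geM n F G : row_ge n G -> row_ge n (F * G).
Proof. by move=> HG; apply: (@row_geMM 0). Qed.
Lemma row_ge_cancel n (F G : S) : F 0%N <> 0 -> row_ge n (F * G) -> row_ge n G.
Proof.
move=> F0 H; have [-> //|G0] := pselect (G = 0).
have [m Gm Gl] := fps_eq0P G0; case: (leqP n m) => nm i ni; first by apply: Gl; lia.
have F1 : forall k, (k < 0)%N -> F k = 0 by [].
have [_ E] := fps_low F1 Gl; move: E; rewrite add0n H //.
have dom (a b : C) : a * b = 0 -> a = 0 \/ b = 0.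
  by move/eqP; rewrite mulf_eq0 => /orP[] /eqP; [left|right].
by move/esym/(fps_domain dom) => [//|E]; rewrite E eqxx in Gm.
Qed.
Lemma row_geP n G : row_ge n G -> exists H, G = mono2 C n 0 * H.
Proof.
move=> H; exists (Fps (fun i => G (i + n)%N)); apply: fps2P => i j.
rewrite mono2M subn0 andbT fpsE; case: leqP => ni; first by rewrite subnK.
by rewrite H.
Qed.
Lemma row_ge_mono n G : row_ge n (mono2 C n 0 * G).
Proof. by move=> i ni; apply: fpsP => j; rewrite mono2M leqNgt ni. Qed.

(* Along the divisor z1 = 0, at s0 = -1/n, the function f^(s0+1) is holomorphic, and this is
   preserved by differential operators. *)
Lemma axis_stable s n G x : (0 < n)%N -> pull s f = mono2 C n 0 * G -> Jac s 0%N <> 0 ->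
  1 + x * n%:R = 0 -> stable_family f (fun m h => row_ge (1 + n * m) (theta s x h)).
Proof.
move=> n0 fE J0 xn.
have key m h : row_ge (1 + n * m) (theta s x h) ->
   row_ge (1 + n * m.+1) (twisted (@fps_d1 C) s (x - m%:R) (theta s x h)) /\
   row_ge (1 + n * m.+1) (twisted (@fps_d2 C) s (x - m%:R) (theta s x h)).
  move=> /row_geP [H ->]; rewrite /twisted fE; split.
    rewrite !d1M !d1_mono2 add1n succnK -add1n mulnS.
    have -> : (mono2 C (n * m) 0 *+ (1 + n * m) * H + mono2 C (1 + n * m) 0 * fps_d1 H) * (mono2 C n 0 * G) +
      cst (x - m%:R) * (mono2 C (1 + n * m) 0 * H) * (mono2 C n.-1 0 *+ n * G + mono2 C n 0 * fps_d1 G) =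
      mono2 C (1 + (n + n * m)) 0 * (fps_d1 H * G + cst (x - m%:R) * H * fps_d1 G); last exact: row_ge_mono.
    have e1 : mono2 C (1 + n * m) 0 = mono2 C 1 0 * mono2 C (n * m) 0 by rewrite mono2MM.
    have e2 : mono2 C n 0 = mono2 C 1 0 * mono2 C n.-1 0 by rewrite mono2MM add1n prednK.
    have e3 : mono2 C (1 + (n + n * m)) 0 = mono2 C 1 0 * mono2 C n 0 * mono2 C (n * m) 0 by rewrite !mono2MM addnA.
    (* The resonance [1 + x n = 0] makes the two contributions of [d1] on powers of [z1] cancel, so
       one more power of [z1] survives. *)
    have e4 : cst (x - m%:R) * (n%:R : S) = - cst (1 + n * m)%:R.
      rewrite -(rmorph_nat (@cst C)) -rmorphM -rmorphN; congr cst.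
      by rewrite natrD natrM mulrBl -[x * _]addr0 -(subrr 1) addrA [_ + 1]addrC xn; ring.
    rewrite e3 e1 e2 -[mono2 C (n * m) 0 *+ _]mulr_natr -[mono2 C n.-1 0 *+ _]mulr_natr.
    have e5 : (1 + n * m)%:R = - (cst (x - m%:R) * (n%:R : S)).
      by rewrite e4 opprK rmorph_nat.
    by rewrite e5; ring.
  rewrite !d2M !d2_mono2 !mulr0n !mul0r !add0r mulnS.
  have -> : mono2 C (1 + n * m) 0 * fps_d2 H * (mono2 C n 0 * G) + cst (x - m%:R) * (mono2 C (1 + n * m) 0 * H) * (mono2 C n 0 * fps_d2 G) =
      mono2 C (1 + (n + n * m)) 0 * (fps_d2 H * G + cst (x - m%:R) * H * fps_d2 G); last exact: row_ge_mono.
  have -> : mono2 C (1 + (n + n * m)) 0 = mono2 C (1 + n * m) 0 * mono2 C n 0.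
    by rewrite mono2MM addn0; congr (mono2 C _ _); lia.
  by ring.
split.
- by move=> m p q; rewrite /theta at_sD raddfD; apply: row_geD.
- by move=> m c p; rewrite /theta at_sM rmorphM; apply: row_geM.
- rewrite /theta at_sC fE muln0 addn0 => i i1; apply: row_ge_mono; lia.
- move=> m p Hp; have [K1 K2] := key m p Hp; apply: (row_ge_cancel J0).
  by rewrite Jac_Delta1; apply: row_geB; apply: row_geM.
- move=> m p Hp; have [K1 K2] := key m p Hp; apply: (row_ge_cancel J0).
  by rewrite Jac_Delta2; apply: row_geB; apply: row_geM.
move=> m p Hp; rewrite /theta at_sM at_sC rmorphM /= fE mulnS addnCA addnC.
by apply: row_geMM => //; apply: row_ge_mono.
Qed.

(** By [axis_stable] every numerator at level [K] has order at least [n K + 1] along [z1 = 0]. But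
    [b(x) f^K] is one of them, and its order is exactly [n K] unless [b(x) = 0]. *)
Lemma axis_root s n G x b : f <> 0 -> bernstein_equation f b -> (0 < n)%N ->
  pull s f = mono2 C n 0 * G -> G 0%N <> 0 -> Jac s 0%N <> 0 -> 1 + x * n%:R = 0 -> b.[x] = 0.
Proof.
move=> f0 Hb n0 fE G0 J0 xn; have [K [_ HQ]] := bernstein_by_parts f0 Hb.
have := HQ _ (axis_stable n0 fE J0 xn).
rewrite /theta at_sM at_s_cst at_sX at_sC rmorphM rmorphXn /= pull_cst fE exprMn mono2X mul0n.
move=> H; apply/eqP/negPn/negP => bx.
have {}H : row_ge 1 (G ^+ K * cst b.[x]).
  move=> i; rewrite ltnS leqn0 => /eqP ->.
  have := H (n * K)%N (ltac:(by [])); rewrite mulrCA [cst _ * _]mulrC => E.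
  apply: fpsP => j; have := congr1 (fun g : fps C => g j) E.
  by rewrite mono2M leqnn subnn subn0.
have : row_ge 1 (cst b.[x]).
  elim: K H {HQ} => [|K IH] H; first by rewrite expr0 mul1r in H.
  by apply: IH; apply: (row_ge_cancel G0); rewrite mulrA -exprS.
move/(_ 0%N isT)/(congr1 (fun g : fps C => g 0%N)); rewrite cstE /= => /eqP.
by rewrite (negbTE bx).
Qed.
End Charts.

(** * Exchange of the two coordinates *)

Section Transpose.
Variable C : numClosedFieldType.
Notation S := (fps (fps C)).
Implicit Types F G : S.

Lemma tge_mono2_1 a b : (0 < a + b)%N -> tge 1 (mono2 C a b).
Proof. by move=> ab; apply: tgeW ab _; apply: tge_mono2. Qed.

Definition swap2 : subst2 C := Subst2 (@tge_mono2_1 0 1 isT) (@tge_mono2_1 1 0 isT).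
Definition tr F := pull swap2 F.

Lemma trE F i j : tr F i j = F j i.
Proof.
rewrite /tr (@pullE C (i + j)) //=.
have ji : (j < (i + j).+1)%N by lia.
have ij : (i < (i + j).+1)%N by lia.
rewrite (bigD1 (Ordinal ji)) //= (bigD1 (Ordinal ij)) //= !mono2X mono2MM mono2E.
have aux a c : (mono2 C 0 1 ^+ a * mono2 C 1 0 ^+ c) i j = ((i == c) && (j == a))%:R.
  by rewrite !mono2X mono2MM mono2E !mul0n !mul1n addn0 add0n.
rewrite !mul0n !mul1n addn0 add0n !eqxx mulr1 big1 ?addr0 => [|k ne].
  rewrite big1 ?addr0 // => k ne; rewrite big1 // => l _; rewrite aux.
  case: andP; rewrite ?mulr0 // => -[_ /eqP e].
  by case/eqP: ne; apply: val_inj.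
rewrite -[0%N]/((0 * j)%N) -[X in mono2 C _ X](mul1n j) -mono2X aux; case: andP; rewrite ?mulr0 // => -[/eqP e _].
by case/eqP: ne; apply: val_inj.
Qed.
Lemma d1_tr F : fps_d1 (tr F) = tr (fps_d2 F).
Proof. by apply: fps2P => i j; rewrite trE d1E d2E trE. Qed.
Lemma d2_tr F : fps_d2 (tr F) = tr (fps_d1 F).
Proof. by apply: fps2P => i j; rewrite trE d1E d2E trE. Qed.
Lemma tr_mono2 i j : tr (mono2 C i j) = mono2 C j i.
Proof. by apply: fps2P => a b; rewrite trE !mono2E andbC. Qed.
Lemma trM F G : tr (F * G) = tr F * tr G. Proof. exact: rmorphM. Qed.
Lemma trB F G : tr (F - G) = tr F - tr G. Proof. exact: rmorphB. Qed.
Lemma trN F : tr (- F) = - tr F. Proof. exact: rmorphN. Qed.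
Lemma tr_pow F e E : is_pow F e E -> is_pow (tr F) e (tr E).
Proof.
move=> [E0 H1 H2]; split; first by rewrite trE.
- by rewrite !d1_tr -!trM H2 !trM /tr pull_cst.
- by rewrite !d2_tr -!trM H1 !trM /tr pull_cst.
Qed.
End Transpose.

(** The identity behind [chart_identity], with the series replaced by ring variables: [M] is the
    monomial factor of the pulled back [f], [F] its other factor and [E] the power of [F]. *)
Lemma chart_algebra (R : comNzRingType) (z1 z2 E L J1 M F e b v1 v2 d1v1 d2v2 d1M d2M d1F d2F d1E d2E G n1 n2 : R) K :
  z1 * d1M = n1 * M -> z2 * d2M = n2 * M -> F * d1E = e * (d1F * E) -> F * d2E = e * (d2F * E) ->
  L * J1 * (b * (M ^+ K.+1 * F ^+ K.+1)) = M * F * (d1v1 + d2v2) +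
    e * (v1 * (d1M * F + M * d1F) + v2 * (d2M * F + M * d2F)) + L * J1 * (G * (M ^+ K.+2 * F ^+ K.+2)) ->
  M * F * (M ^+ K * (z1 * z2 * L) * (b * (J1 * F ^+ K * E))) = M * F * (z1 * z2 *
   ((d1v1 * E + v1 * d1E) + (d2v2 * E + v2 * d2E)) + e * (n1 * (z2 * (v1 * E)) + n2 * (z1 * (v2 * E))) +
   M ^+ K.+1 * (z1 * z2 * L) * (J1 * G * F ^+ K.+1 * E)).
Proof.
move=> ZM1 ZM2 HE1 HE2 PP.
transitivity (z1 * z2 * E * (L * J1 * (b * (M ^+ K.+1 * F ^+ K.+1)))); first by rewrite !exprS; ring.
rewrite PP.
transitivity (z1 * z2 * E * (M * F * (d1v1 + d2v2)) +
  e * E * F * (z2 * v1 * (z1 * d1M) + z1 * v2 * (z2 * d2M)) +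
  z1 * z2 * M * (v1 * (e * (d1F * E)) + v2 * (e * (d2F * E))) +
  z1 * z2 * E * (L * J1 * (G * (M ^+ K.+2 * F ^+ K.+2)))); first by ring.
by rewrite ZM1 ZM2 -HE1 -HE2 [M ^+ K.+2]exprS [F ^+ K.+2]exprS; ring.
Qed.

Section PolyFun.
Variable C : numClosedFieldType.

Lemma poly_fun2M (G H : C -> fps (fps C)) : (forall i j, poly_fun (fun y => G y i j)) ->
  (forall i j, poly_fun (fun y => H y i j)) -> forall i j, poly_fun (fun y => (G y * H y) i j).
Proof.
move=> HG HH i j; apply: (@poly_fun_eq C _ (fun y => \sum_(a < i.+1) \sum_(b < j.+1) G y a b * H y (i - a)%N (j - b)%N)).
  by move=> y; rewrite fps2M.
by apply: poly_fun_sum => a _; apply: poly_fun_sum => b _; apply: poly_funM.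
Qed.

Lemma poly_ext (p q : {poly C}) : (forall y, p.[y] = q.[y]) -> p = q.
Proof.
move=> H; apply/eqP; rewrite -subr_eq0; apply/negPn/negP => /closed_nonrootP [y].
by rewrite /root hornerD hornerN H subrr eqxx.
Qed.
End PolyFun.

(** * Residues of the primitive along the divisors of a chart *)

Section Residues.
Variables (C : numClosedFieldType) (f : fps (fps C)).
Notation S := (fps (fps C)).
Notation T := {poly S}.
Implicit Types (s : subst2 C) (h g : T).

Section Identity.
Variables (b : {poly C}) (K : nat) (h1 h2 g : T).
Hypothesis parts : cst_poly b * f%:P ^+ K.+1 =
  Delta f (@fps_d1 C) K h1 + Delta f (@fps_d2 C) K h2 + g * f%:P ^+ K.+2.

(** [(V1, V2)] is the vector field with components [h1], [h2] pulled back and multiplied by the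
    Jacobian: the adjugate of the derivative of the chart is applied to it. With this weight a
    divergence pulls back to a divergence. *)
Definition V1 s x := fps_d2 (sY s) * theta s x h1 - fps_d2 (sX s) * theta s x h2.
Definition V2 s x := fps_d1 (sX s) * theta s x h2 - fps_d1 (sY s) * theta s x h1.

Lemma pulled_parts s x : Jac s * (cst b.[x] * pull s f ^+ K.+1) =
  pull s f * (fps_d1 (V1 s x) + fps_d2 (V2 s x)) +
  cst (x - K%:R) * (V1 s x * fps_d1 (pull s f) + V2 s x * fps_d2 (pull s f)) +
  Jac s * (theta s x g * pull s f ^+ K.+2).
Proof.
have := congr1 (theta s x) parts.
rewrite {1}/theta at_sM at_s_cst at_sX at_sC (rmorphM (pull s)) (rmorphXn (pull s)) /= pull_cst => ->.
rewrite {1}/theta at_sD at_sD at_sM at_sX at_sC !(rmorphD (pull s)) (rmorphM (pull s)) (rmorphXn (pull s)).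
rewrite -!/(theta _ _ _) !mulrDr Jac_Delta1 Jac_Delta2 /V1 /V2 /twisted.
rewrite !(d1D, d2D, d1N, d2N, d1M, d2M) !d12; ring.
Qed.

Lemma z1d1 N1 N2 : mono2 C 1 0 * fps_d1 (mono2 C N1 N2) = N1%:R * mono2 C N1 N2.
Proof.
rewrite d1_mono2 mulrnAr mulr_natl; case: N1 => [|n]; first by rewrite !mulr0n.
by rewrite mono2MM add1n add0n.
Qed.
Lemma z2d2 N1 N2 : mono2 C 0 1 * fps_d2 (mono2 C N1 N2) = N2%:R * mono2 C N1 N2.
Proof.
rewrite d2_mono2 mulrnAr mulr_natl; case: N2 => [|n]; first by rewrite !mulr0n.
by rewrite mono2MM add1n add0n.
Qed.

Variables (s : subst2 C) (x : C) (N1 N2 l1 l2 : nat) (F J1 E : S).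
Hypotheses (fE : pull s f = mono2 C N1 N2 * F) (F0 : F 0%N 0%N != 0).
Hypotheses (JE : Jac s = mono2 C l1 l2 * J1) (EE : is_pow F (x - K%:R) E).
Let W1 := V1 s x * E.
Let W2 := V2 s x * E.

Lemma nz_of_coef (G : S) i j : G i j != 0 -> G <> 0.
Proof. by move=> H e; rewrite e fps20 eqxx in H. Qed.

(** [pulled_parts] multiplied by [z1 z2 E] and divided by the pulled back [f]. The derivatives of
    [F] are absorbed into those of [W1] and [W2], and only the exponents of the monomial factor
    remain. *)
Lemma chart_identity :
  mono2 C (N1 * K + l1.+1) (N2 * K + l2.+1) * (cst b.[x] * (J1 * F ^+ K * E)) =
  mono2 C 1 1 * (fps_d1 W1 + fps_d2 W2) +
  cst (x - K%:R) * (N1%:R * (mono2 C 0 1 * W1) + N2%:R * (mono2 C 1 0 * W2)) +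
  mono2 C (N1 * K.+1 + l1.+1) (N2 * K.+1 + l2.+1) * (J1 * theta s x g * F ^+ K.+1 * E).
Proof.
have [_ HE1 HE2] := EE; set e := cst (x - K%:R) in HE1 HE2 *.
have MF0 : mono2 C N1 N2 * F <> 0.
  by move=> /fps2_domain [|F0']; [exact: mono2_neq0|case: (nz_of_coef F0)].
apply: (fps2_mulI MF0).
have monE n a c : mono2 C (N1 * n + a.+1) (N2 * n + c.+1) =
   mono2 C N1 N2 ^+ n * (mono2 C 1 0 * mono2 C 0 1 * mono2 C a c).
  by rewrite mono2X !mono2MM; congr (mono2 C _ _); lia.
have Z : mono2 C 1 1 = mono2 C 1 0 * mono2 C 0 1 by rewrite mono2MM.
have PP := pulled_parts s x; rewrite JE fE !exprMn -/e in PP.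
have ZM1 := z1d1 N1 N2; have ZM2 := z2d2 N1 N2.
rewrite !monE Z /W1 /W2 !(d1M, d2M).
rewrite !(d1M, d2M) in PP.
exact: (chart_algebra ZM1 ZM2 HE1 HE2 PP).
Qed.

Lemma natM2 n (G : S) i j : (n%:R * G) i j = n%:R * G i j.
Proof. by rewrite !mulr_natl !fpsMn. Qed.

(** The factor of [W1] is the exponent of [z1] in [z1^i (z1^N1)^(x-K)]. For [i = N1 K + l1 + 1] it
    equals [l1 + 1 + x N1]: at a candidate root [W1] drops out, and if [N1 > 0] the term with [g]
    has not yet begun. *)
Lemma chart_coef i j :
  (if (N1 * K + l1.+1 <= i)%N && (N2 * K + l2.+1 <= j)%N then
     b.[x] * (J1 * F ^+ K * E) (i - (N1 * K + l1.+1))%N (j - (N2 * K + l2.+1))%N else 0) =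
  (if j is j'.+1 then W1 i j' else 0) * (i%:R + (x - K%:R) * N1%:R) +
  (if i is i'.+1 then W2 i' j else 0) * (j%:R + (x - K%:R) * N2%:R) +
  (if (N1 * K.+1 + l1.+1 <= i)%N && (N2 * K.+1 + l2.+1 <= j)%N then
     (J1 * theta s x g * F ^+ K.+1 * E) (i - (N1 * K.+1 + l1.+1))%N (j - (N2 * K.+1 + l2.+1))%N else 0).
Proof.
have := congr1 (fun G : S => G i j) chart_identity.
rewrite mono2M cstM !fps2D mono2M cstM !fps2D mono2M => ->; congr (_ + _).
rewrite (natM2 N1) (natM2 N2) (mono2M 0 1) (mono2M 1 0) !subn0.
case: i j => [|i] [|j] /=.
- ring.
- by rewrite subn1; move: (W1 _ _) => a; ring.
- by rewrite subn1; move: (W2 _ _) => a; ring.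
rewrite !subn1 /= d1E d2E; move: (W1 _ _) (W2 _ _) => a c.
by rewrite -[a *+ _]mulr_natr -[c *+ _]mulr_natr; ring.
Qed.
End Identity.

Lemma fps_derivX (F : fps C) n : fps_deriv (F ^+ n) * F = n%:R * (fps_deriv F * F ^+ n).
Proof.
elim: n => [|n IH].
  rewrite expr0 mul0r -(rmorph1 (@fps_const C)) (fps_deriv_const (1 : C)) mul0r //.
by rewrite exprS fps_derivM mulrDl -[F * _ * F]mulrA IH -natr1; ring.
Qed.

Definition bernstein_chart s := forall G : S, zpoly (pull s G).

Lemma zpoly_chart s : bernstein_chart s -> zpoly (sX s) /\ zpoly (sY s).
Proof.
by move=> H; split; [have := H (mono2 C 1 0)|have := H (mono2 C 0 1)]; rewrite pull_mono expr1 expr0 ?mulr1 ?mul1r.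
Qed.

(** At the resonant row the identity reads [R' = b(x) c1 F0^K E0], where [F0^K E0] is [g^x] up to a
    constant and [R] is the row of [W2] below it. By [pow_row_mul], [R] is [T g^x] up to a constant
    with [T = p / g^(n+K)] rational, so [no_primitive] excludes [b(x) <> 0]. *)
Lemma simple_root s b x N l (F J1 : S) (g : {poly C}) rs c1 : f <> 0 -> bernstein_equation f b ->
  bernstein_chart s -> pull s f = mono2 C N 0 * F -> Jac s = mono2 C l 0 * J1 -> (0 < N)%N ->
  F 0%N = pol g -> g.[0] != 0 -> J1 0%N = fps_const c1 -> c1 != 0 ->
  l.+1%:R + x * N%:R = 0 -> roots_of g rs -> (1 < size rs)%N -> x < 0 ->
  0 < (size rs)%:R + x * (size g).-1%:R -> b.[x] = 0.
Proof.
move=> f0 Hb Hz fE JE N0 Fg g0 J1c c10 xN rsg rs2 x0 pos.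
have [K [[h1 [h2 [h3 [parts _]]]] _]] := bernstein_by_parts f0 Hb.
have F00 : F 0%N 0%N != 0 by rewrite Fg polE -horner_coef0.
have [E EE] := pow_exists (x - K%:R) F00.
pose n := (N * K + l)%N; pose R := (V2 h1 h2 s x * E) n.
have [zX zY] := zpoly_chart Hz.
have zV : zpoly (V2 h1 h2 s x).
  by apply: zpolyD; [|apply: zpolyN]; apply: zpolyM; (try exact: Hz); exact: zpoly_d1.
have zF : zpoly F by apply: zpoly_div fE _.
have [p pE] := pow_row_mul n zV zF EE; rewrite -/R in pE.
have dR : fps_deriv R = fps_const (b.[x] * c1) * (F 0%N ^+ K * E 0%N).
  apply: fpsP => j; rewrite fps_derivE fps_constM.
  have := chart_coef parts fE F00 JE EE n.+1 j.+1.
  have -> : (N * K + l.+1 = n.+1)%N by rewrite addnS.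
  rewrite leqnn !mul0n !add0n /= subnn subn1 /=.
  have -> : (N * K.+1 + l.+1 <= n.+1)%N = false by rewrite /n mulnS; lia.
  have -> : n.+1%:R + (x - K%:R) * N%:R = 0 :> C.
    by rewrite /n -addnS natrD natrM mulrBl addrCA addrAC -xN; ring.
  rewrite /= mulr0 add0r addr0 mulr0 addr0 mulr_natr => <-.
  by rewrite !row0M row0X J1c -mulrA fps_constM mulrA.
have E00 : E 0%N 0%N != 0 by case: EE => ->; rewrite oner_eq0.
have HE0 := pow_row0 EE.
apply/eqP/negPn/negP => bx.
apply: (@no_primitive C g p x (b.[x] * c1) (n + K) rs) => //.
- by apply: contraNneq g0 => ->; rewrite horner0.
- by rewrite mulf_neq0.
apply: pol_inj; rewrite -!mul_polyC !(rmorphD (@pol C)) !(rmorphM (@pol C)) !(rmorphXn (@pol C)) /= !polC -!pol_deriv -!Fg.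
apply: (fps_unitI E00); have := congr1 (fun G => F 0%N * fps_deriv G) pE.
rewrite !fps_derivM dR.
have -> : F 0%N * (fps_deriv (F 0%N ^+ n) * R + F 0%N ^+ n * (fps_const (b.[x] * c1) * (F 0%N ^+ K * E 0%N)))
  = (fps_deriv (F 0%N ^+ n) * F 0%N) * R + E 0%N * (fps_const (b.[x] * c1) * (F 0%N ^+ (n + K).+1)).
  by rewrite exprS exprD; ring.
rewrite fps_derivX.
have -> : n%:R * (fps_deriv (F 0%N) * F 0%N ^+ n) * R = n%:R * fps_deriv (F 0%N) * (F 0%N ^+ n * R) by ring.
rewrite pE.
have -> : F 0%N * (fps_deriv (E 0%N) * pol p + E 0%N * fps_deriv (pol p)) =
  (F 0%N * fps_deriv (E 0%N)) * pol p + E 0%N * (F 0%N * fps_deriv (pol p)) by ring.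
rewrite HE0 rmorphM /= => H.
have -> : fps_const (x - (n + K)%:R) = fps_const (x - K%:R) - n%:R.
  by rewrite -(rmorph_nat (@fps_const C)) -rmorphB natrD; congr fps_const; ring.
have {}H := eqDB (etrans (addrC _ _) H); rewrite -rmorphM in H *; rewrite H; ring.
Qed.

(* Along z1 = 0, either the Jacobian does not vanish or f^x has nontrivial monodromy. *)
Definition side_ok s (x : C) (l : nat) (F : S) := l = 0%N \/ (bernstein_chart s /\
  exists (g : {poly C}) r, [/\ F 0%N = pol g, root g r, r != 0 & forall i : int, x * (mup r g)%:R <> i%:~R]).

(* The residue of the primitive along z1 = 0 is a flat section; it vanishes if f^s0 has nontrivial
   monodromy there, or if f^(s0+1) is holomorphic along z1 = 0. *)
Lemma flat_residue s b K h1 h2 g x N1 N2 l1 l2 (F J1 E : S) :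
  cst_poly b * f%:P ^+ K.+1 =
    Delta f (@fps_d1 C) K h1 + Delta f (@fps_d2 C) K h2 + g * f%:P ^+ K.+2 ->
  (forall Q, stable_family f Q -> Q K h1 /\ Q K h2) ->
  pull s f = mono2 C N1 N2 * F -> F 0%N 0%N != 0 -> Jac s = mono2 C l1 l2 * J1 ->
  J1 0%N 0%N != 0 -> (0 < N1)%N -> is_pow F (x - K%:R) E ->
  l1.+1%:R + x * N1%:R = 0 -> l2.+1%:R + x * N2%:R = 0 -> b.[x] = 0 -> side_ok s x l1 F ->
  (V2 h1 h2 s x * E) (N1 * K + l1)%N (N2 * K + l2.+1)%N = 0.
Proof.
move=> parts stab fE F0 JE J0 N10 EE xN1 xN2 bx [l0|[Hz [q [r [Fq rq r0 Hr]]]]].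
  have J00 : Jac s 0%N <> 0.
    move=> /(congr1 (fun h : fps C => h l2)) /eqP.
    by rewrite JE mono2M l0 !leqnn !subnn fps0 (negbTE J0).
  have fE' : pull s f = mono2 C N1 0 * (mono2 C 0 N2 * F) by rewrite mulrA mono2MM addn0 add0n.
  have xN : 1 + x * N1%:R = 0 by rewrite -xN1 l0.
  have [R1 R2] := stab _ (axis_stable N10 fE' J00 xN).
  rewrite l0 addn0; have H : row_ge (1 + N1 * K) (V2 h1 h2 s x * E).
    by rewrite mulrC; apply/row_geM/row_geB; apply: row_geM.
  by rewrite H ?fps0 ?add1n.
pose n := (N1 * K + l1)%N; pose m0 := (N2 * K + l2.+1)%N; pose R := (V2 h1 h2 s x * E) n.
have [zX zY] := zpoly_chart Hz.
have zV : zpoly (V2 h1 h2 s x).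
  by apply: zpolyD; [|apply: zpolyN]; apply: zpolyM; (try exact: Hz); exact: zpoly_d1.
have zF : zpoly F by apply: zpoly_div fE _.
(* As [b(x) = 0], the resonant row says [(j + (x - K) N2) R_j = 0]. The factor vanishes only for
   [j = m0], so [R] is a constant times [z2^m0]. *)
have R0 j : j != m0 -> R j = 0.
  move=> jm; have := chart_coef parts fE F0 JE EE n.+1 j.
  have -> : (N1 * K.+1 + l1.+1 <= n.+1)%N = false by rewrite /n mulnS; lia.
  have -> : n.+1%:R + (x - K%:R) * N1%:R = 0 :> C.
    by rewrite /n -addnS natrD natrM mulrBl addrCA addrAC -xN1; ring.
  rewrite bx !mul0r if_same mulr0 add0r addr0 => /esym/eqP.
  rewrite mulf_eq0 => /orP[/eqP //|/eqP Hj]; case/eqP: jm; apply/eqP.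
  rewrite -(@eqr_nat C) /m0 natrD natrM -subr_eq0 -Hj; apply/eqP.
  have e2 : l2.+1%:R = - (x * N2%:R) by apply/eqP; rewrite -addr_eq0 xN2.
  by rewrite e2; ring.
have [p pE] := pow_row_mul n zV zF EE; rewrite -/R in pE.
apply/eqP/negPn/negP => Rm; have RE : R = pol (R m0 *: 'X^m0).
  apply: fpsP => j; rewrite polE coefZ coefXn; case: eqP => [->|/eqP/R0 ->]; first by rewrite mulr1.
  by rewrite mulr0.
have E00 : E 0%N 0%N != 0 by case: EE => ->; rewrite oner_eq0.
have q0 : q != 0 by apply: contraNneq F0 => q0; rewrite Fq q0 polE coef0.
have HE0 := pow_row0 EE.
(* If [R] is not zero, [E0 = Q / p] is a rational function although it is [q^(x-K)] up to a
   constant. Its logarithmic derivative then makes [x] times the multiplicity of [r] an integer. *)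
pose Q := R m0 *: (q ^+ n * 'X^m0).
have QE : pol Q = E 0%N * pol p.
  by rewrite -pE RE Fq -rmorphXn -rmorphM /Q scalerAr.
have Q0 : Q != 0 by rewrite scaler_eq0 (negbTE Rm) mulf_neq0 ?expf_neq0 ?polyX_eq0.
have p0 : p != 0.
  by apply: contraNneq Q0 => p0; apply/eqP/(@pol_inj C); rewrite QE p0 !rmorph0 mulr0.
have [i Hi] : exists i : int, x * (mup r q)%:R = i%:~R; last exact: (Hr i).
apply: (integral_exponent (q := Q) (P := p) (M := n) (K := K) (m := m0) (b := R m0) (a := r)) => //.
apply: pol_inj; rewrite -!mul_polyC !(rmorphM (@pol C)) (rmorphD (@pol C)) !(rmorphM (@pol C)) /= !polC -!pol_deriv -!Fq QE.
rewrite fps_derivM.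
transitivity ((F 0%N * fps_deriv (E 0%N)) * pol p * pol p + F 0%N * E 0%N * fps_deriv (pol p) * pol p); first by ring.
by rewrite HE0; ring.
Qed.

(** Both resonance factors are multiples of [y - x], so the lowest coefficient of the chart identity
    is [b(y) c = (y - x) (N1 W1(y) + N2 W2(y))], an identity of polynomials in [y]. It gives
    [b(x) = 0]; then both residues vanish at [x] by [flat_residue], which supplies the second factor
    [y - x]. *)
Lemma double_root s b x N1 N2 l1 l2 (F J1 : S) : f <> 0 -> bernstein_equation f b -> b != 0 ->
  pull s f = mono2 C N1 N2 * F -> F 0%N 0%N != 0 -> Jac s = mono2 C l1 l2 * J1 -> J1 0%N 0%N != 0 ->
  (0 < N1)%N -> (0 < N2)%N -> l1.+1%:R + x * N1%:R = 0 -> l2.+1%:R + x * N2%:R = 0 ->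
  side_ok s x l1 F -> side_ok (scomp s (swap2 C)) x l2 (tr F) -> (2 <= mup x b)%N.
Proof.
move=> f0 Hb b0 fE F0 JE J0 N10 N20 xN1 xN2 S1 S2.
have [K [[h1 [h2 [g [parts stab]]]] _]] := bernstein_by_parts f0 Hb.
have [E EE] := boolp.choice (fun y : C => pow_exists (y - K%:R) F0).
pose W1 y := (V1 h1 h2 s y * E y) (N1 * K + l1.+1)%N (N2 * K + l2)%N.
pose W2 y := (V2 h1 h2 s y * E y) (N1 * K + l1)%N (N2 * K + l2.+1)%N.
pose c := J1 0%N 0%N * F 0%N 0%N ^+ K.
have c0 : c != 0 by rewrite mulf_neq0 ?expf_neq0.
have key y : b.[y] * c = (y - x) * (N1%:R * W1 y + N2%:R * W2 y).
  have := chart_coef parts fE F0 JE (EE y) (N1 * K + l1).+1 (N2 * K + l2).+1.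
  rewrite -!addnS !leqnn /= !subnn.
  have -> : (N1 * K.+1 + l1.+1 <= N1 * K + l1.+1)%N = false by rewrite mulnS; lia.
  rewrite /= addr0 -/(W1 y) addnS -/(W2 y) -!addnS.
  have -> : (J1 * F ^+ K * E y) 0%N 0%N = c.
    rewrite !row0M !row0X; have mul0 (u v : fps C) : (u * v) 0%N = u 0%N * v 0%N.
      by rewrite fpsM_recl big_ord0 addr0.
    rewrite !mul0; have -> : (F 0%N ^+ K) 0%N = F 0%N 0%N ^+ K.
      by elim: (K) => [|n IH]; rewrite ?expr0 // !exprS mul0 IH.
    by case: (EE y) => -> _ _; rewrite mulr1.
  have e1 : l1.+1%:R = - (x * N1%:R) by apply/eqP; rewrite -addr_eq0 xN1.
  have e2 : l2.+1%:R = - (x * N2%:R) by apply/eqP; rewrite -addr_eq0 xN2.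
  by move=> ->; rewrite !(natrD, natrM) e1 e2; ring.
have PT h i j : poly_fun (fun y => theta s y h i j) by exact: theta_poly_fun.
have PE i j : poly_fun (fun y => E y i j).
  apply: (pow_poly_fun F0 _ EE); apply: poly_funD; [exact: poly_funX|exact: poly_funC].
have [p1 Hp1] : poly_fun W1.
  apply: poly_fun2M => // i' j'; rewrite /V1; apply: poly_funD; [|apply: poly_funN];
  by apply: (@poly_fun2M C (fun=> _)) => // *; exact: poly_funC.
have [p2 Hp2] : poly_fun W2.
  apply: poly_fun2M => // i' j'; rewrite /V2; apply: poly_funD; [|apply: poly_funN];
  by apply: (@poly_fun2M C (fun=> _)) => // *; exact: poly_funC.
have bc : c *: b = ('X - x%:P) * (N1%:R *: p1 + N2%:R *: p2).
  by apply: poly_ext => y; rewrite !hornerE -Hp1 -Hp2 mulrC key.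
have bx : b.[x] = 0.
  by apply/eqP; have := key x; rewrite subrr mul0r => /eqP; rewrite mulf_eq0 (negbTE c0) orbF.
have W2x : W2 x = 0 by apply: (flat_residue parts stab fE F0 JE J0 N10 (EE x)).
(* The exchange of coordinates turns [V1] into [V2] up to sign, so the other divisor is treated by
   the same lemma. *)
have W1x : W1 x = 0.
  have fE' : pull (scomp s (swap2 C)) f = mono2 C N2 N1 * tr F.
    by rewrite -pull_comp fE -/(tr _) trM tr_mono2.
  have JE' : Jac (scomp s (swap2 C)) = mono2 C l2 l1 * (- tr J1).
    rewrite mulrN -tr_mono2 -trM -JE -trN.
    by rewrite /Jac /= -!/(tr _) !d1_tr !d2_tr -!trM -trB; congr tr; ring.
  have := @flat_residue (scomp s (swap2 C)) b K h1 h2 g x N2 N1 l2 l1 (tr F) (- tr J1) (tr (E x))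
    parts stab fE' _ JE' _ N20 (tr_pow (EE x)) xN2 xN1 bx S2.
  rewrite fps2N !trE oppr_eq0 => /(_ F0 J0).
  have -> : V2 h1 h2 (scomp s (swap2 C)) x = - tr (V1 h1 h2 s x).
    rewrite /V1 /V2 -trN /theta -!pull_comp /= -!/(tr _) !d1_tr -!trM -trB; congr tr; ring.
  by rewrite mulNr -trM fps2N trE => /eqP; rewrite oppr_eq0 => /eqP.
rewrite mup_geq // -(@dvdpZr _ c) // bc expr2 dvdp_mul //.
by rewrite dvdp_XsubCl /root !hornerE -Hp1 -Hp2 W1x W2x !mulr0 addr0.
Qed.
End Residues.

(** * Classes of constructible sets and the measure of arcs *)

Section Classes.
Variable C : numClosedFieldType.
Notation M := (motring C).

Definition seq_of_row n (v : 'rV[C]_n) : seq C := [seq v 0 i | i <- enum 'I_n].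
Lemma size_seq_of_row n (v : 'rV[C]_n) : size (seq_of_row v) = n.
Proof. by rewrite size_map size_enum_ord. Qed.
Lemma seq_of_rowK n (v : 'rV[C]_n) : row_of_seq n (seq_of_row v) = v.
Proof. by apply/rowP => i; rewrite mxE (nth_map i) ?size_enum_ord // nth_ord_enum. Qed.
Lemma row_of_seqK n (s : seq C) : size s = n -> seq_of_row (row_of_seq n s) = s.
Proof. by move=> ss; apply: (@row_of_seq_inj C n); rewrite ?size_seq_of_row // seq_of_rowK. Qed.

Section Reg.
Variables (n : nat) (S : set 'rV[C]_n).
(** A single quotient of polynomials valid on all of [S]: the maps between spaces of jets used below
    have such global formulas. *)
Definition reg (h : 'rV[C]_n -> C) := exists p q : {mpoly C[n]}, forall v, S v -> peval q v != 0 /\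
  h v = peval p v / peval q v.
Lemma pevalD (p q : {mpoly C[n]}) v : peval (p + q) v = peval p v + peval q v. Proof. exact: mevalD. Qed.
Lemma pevalM (p q : {mpoly C[n]}) v : peval (p * q) v = peval p v * peval q v. Proof. exact: mevalM. Qed.
Lemma peval1 v : peval (1 : {mpoly C[n]}) v = 1. Proof. exact: meval1. Qed.
Lemma pevalC c v : peval (c%:MP : {mpoly C[n]}) v = c. Proof. exact: mevalC. Qed.
Lemma reg_eq h k : (forall v, S v -> h v = k v) -> reg k -> reg h.
Proof. by move=> E [p [q H]]; exists p, q => v Sv; have [? ?] := H v Sv; rewrite E. Qed.
Lemma reg_poly p : reg (peval p).
Proof. by exists p, 1 => v _; rewrite peval1 oner_neq0 divr1. Qed.
Lemma regC c : reg (fun=> c).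
Proof. by apply: (reg_eq _ (reg_poly c%:MP)) => v _; rewrite pevalC. Qed.
Lemma reg_coord i : reg (fun v => v 0 i).
Proof. by apply: (reg_eq _ (reg_poly 'X_i)) => v _; rewrite /peval mevalXU. Qed.
Lemma regD h k : reg h -> reg k -> reg (fun v => h v + k v).
Proof.
move=> [p [q H]] [p' [q' H']]; exists (p * q' + p' * q), (q * q') => v Sv.
have [q0 ->] := H v Sv; have [q0' ->] := H' v Sv.
by rewrite pevalD !pevalM mulf_neq0 // addf_div.
Qed.
Lemma regM h k : reg h -> reg k -> reg (fun v => h v * k v).
Proof.
move=> [p [q H]] [p' [q' H']]; exists (p * p'), (q * q') => v Sv.
have [q0 ->] := H v Sv; have [q0' ->] := H' v Sv.
by rewrite !pevalM mulf_neq0 // mulf_div.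
Qed.
Lemma regV h : (forall v, S v -> h v != 0) -> reg h -> reg (fun v => (h v)^-1).
Proof.
move=> h0 [p [q H]]; exists q, p => v Sv; have [q0 E] := H v Sv; rewrite E invf_div; split=> //.
by have := h0 v Sv; rewrite E mulf_eq0 negb_or => /andP[].
Qed.
Lemma reg_sum I (r : seq I) (P : pred I) (h : I -> 'rV[C]_n -> C) : (forall i, P i -> reg (h i)) ->
  reg (fun v => \sum_(i <- r | P i) h i v).
Proof.
move=> H; elim: r => [|i r IH]; first by apply: (reg_eq _ (regC 0)) => v _; rewrite big_nil.
case: (boolP (P i)) => Pi; last by apply: (reg_eq _ IH) => v _; rewrite big_cons (negbTE Pi).
by apply: (reg_eq _ (regD (H i Pi) IH)) => v _; rewrite big_cons Pi.
Qed.
Lemma reg_prod I (r : seq I) (h : I -> 'rV[C]_n -> C) : (forall i, reg (h i)) ->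
  reg (fun v => \prod_(i <- r) h i v).
Proof.
move=> H; elim: r => [|i r IH]; first by apply: (reg_eq _ (regC 1)) => v _; rewrite big_nil.
by apply: (reg_eq _ (regM (H i) IH)) => v _; rewrite big_cons.
Qed.
Lemma regX h k : reg h -> reg (fun v => h v ^+ k).
Proof.
move=> H; elim: k => [|k IH]; first by apply: (reg_eq _ (regC 1)) => v _; rewrite expr0.
by apply: (reg_eq _ (regM H IH)) => v _; rewrite exprS.
Qed.
End Reg.

Lemma reg_comp n m (S : set 'rV[C]_n) (phi : 'rV[C]_n -> 'rV[C]_m) (p : {mpoly C[m]}) :
  (forall k, reg S (fun v => phi v 0 k)) -> reg S (fun v => peval p (phi v)).
Proof.
move=> H; apply: (reg_eq (k := fun v => \sum_(mm <- msupp p) p@_mm * \prod_i (phi v 0 i) ^+ mm i)).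
  by move=> v _; rewrite /peval mevalE.
by apply: reg_sum => mm _; apply: regM; [exact: regC|apply: reg_prod => i; apply: regX].
Qed.

(** Total on sets, with the default 0 off the locally closed ones, so that sums over pieces carry no
    proofs in their terms. *)
Definition mc n (S : set 'rV[C]_n) : M :=
  if pselect (locally_closed S) is left lcS then mclass (quasi_affine lcS) else 0.

Lemma mcE n (S : set 'rV[C]_n) (lcS : locally_closed S) : mc S = mclass (quasi_affine lcS).
Proof. by rewrite /mc; case: pselect => // lc'; rewrite (Prop_irrelevance lc' lcS). Qed.

Lemma regular_map_affine n m (S : set 'rV[C]_n) (T : set 'rV[C]_m) (phi : 'rV[C]_n -> 'rV[C]_m) :
  (forall v, S v -> T (phi v)) -> (forall k, reg S (fun v => phi v 0 k)) ->
  regular_map (quasi_affine_atlas S) (quasi_affine_atlas T) (fun s => seq_of_row (phi (row_of_seq n s))).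
Proof.
move=> ST Hreg; split.
  move=> s [c]; rewrite mem_seq1 => /eqP -> /= [ss Ss]; exists (Chart [set s | size s = m /\ T (row_of_seq m s)] (row_of_seq m)).
    by rewrite mem_seq1.
  by rewrite /= size_seq_of_row seq_of_rowK; split=> //; apply: ST.
move=> c d; rewrite !mem_seq1 => /eqP -> /eqP -> /=; split.
  exists [set 1] => s [ss Ss]; split=> [H|/(_ 1 erefl)/eqP]; last by rewrite peval1 oner_eq0.
  by case: H => /=; rewrite size_seq_of_row seq_of_rowK; split=> //; apply: ST.
move=> k s [[ss Ss] _]; have [p [q H]] := Hreg k; have [q0 _] := H _ Ss.
by exists p, q; split=> // t [[_ St] _] _; rewrite seq_of_rowK; have [_ ->] := H _ St.
Qed.

Lemma mc_iso n m (S : set 'rV[C]_n) (T : set 'rV[C]_m) (phi : 'rV[C]_n -> 'rV[C]_m) (psi : 'rV[C]_m -> 'rV[C]_n) :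
  locally_closed S -> locally_closed T ->
  (forall v, S v -> T (phi v)) -> (forall w, T w -> S (psi w)) ->
  (forall v, S v -> psi (phi v) = v) -> (forall w, T w -> phi (psi w) = w) ->
  (forall k, reg S (fun v => phi v 0 k)) -> (forall k, reg T (fun w => psi w 0 k)) -> mc S = mc T.
Proof.
move=> lcS lcT ST TS K1 K2 R1 R2; rewrite !mcE; apply/mot_ofP/meq_iso => /=.
exists (fun s => seq_of_row (phi (row_of_seq n s))), (fun s => seq_of_row (psi (row_of_seq m s))).
split; [exact: regular_map_affine|exact: regular_map_affine| |].
  by move=> s [c]; rewrite mem_seq1 => /eqP -> /= [ss Ss]; rewrite seq_of_rowK K1 // row_of_seqK.
by move=> s [c]; rewrite mem_seq1 => /eqP -> /= [ss Ss]; rewrite seq_of_rowK K2 // row_of_seqK.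
Qed.

Definition zeros n (p : {mpoly C[n]}) : set 'rV[C]_n := [set v | peval p v = 0].

Lemma lc_zeros n (S : set 'rV[C]_n) p : locally_closed S -> locally_closed (S `&` zeros p).
Proof.
move=> [Z [W [[I HI] HW ->]]]; exists (Z `&` zeros p), W; split=> //; last first.
  by rewrite eqEsubset; split=> v /=; tauto.
exists (I `|` [set p]) => v _; split.
  by move=> [/(HI v Logic.I) Zv pv] q [/Zv //|-> //].
by move=> H; split; [apply/(HI v Logic.I) => q Iq; apply: H; left|apply: H; right].
Qed.
Lemma lc_nzeros n (S : set 'rV[C]_n) p : locally_closed S -> locally_closed (S `&` ~` zeros p).
Proof.
move=> [Z [W [HZ [I HI] ->]]]; exists Z, (W `|` zeros p); split=> //; last first.
  by rewrite eqEsubset; split=> v /=; tauto.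
exists [set q * p | q in I] => v _; split.
  move=> [/(HI v Logic.I) Wv|pv] _ [q Iq <-]; rewrite pevalM; first by rewrite Wv ?mul0r.
  by rewrite [peval p _]pv mulr0.
move=> H; have [pv|/eqP pv] := pselect (peval p v = 0); [by right|left].
apply/(HI v Logic.I) => q Iq; have /eqP : peval (q * p) (id v) = 0 by apply: H; exists q.
by rewrite pevalM mulf_eq0 (negbTE pv) orbF => /eqP.
Qed.

Lemma mc_scissor n (S : set 'rV[C]_n) p : locally_closed S ->
  mc S = mc (S `&` zeros p) + mc (S `&` ~` zeros p).
Proof.
move=> lcS; have lc1 := lc_zeros p lcS; have lc2 := lc_nzeros p lcS.
rewrite (mcE lcS) (mcE lc1) (mcE lc2); rewrite [RHS](esym (mot_ofD _ _)).
have iso_refl (X : variety C) : isomorphic X X by exists id, id; split=> //; exact: (variety_change (varietyP X)).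
apply/mot_ofP; apply: (@meq_scissor C _ _ _ [set s | peval p (row_of_seq n s) = 0]).
- by move=> c /=; rewrite mem_seq1 => /eqP -> /=; exists [set p] => s _; split=> [H q -> //|]; apply.
- rewrite [X in isomorphic _ X](_ : _ = quasi_affine lc1 :> atlas C (seq C)); first exact: iso_refl.
  rewrite /= /quasi_affine_atlas; congr [:: Chart _ _].
  by rewrite eqEsubset; split=> s /=; rewrite /zeros /=; tauto.
rewrite [X in isomorphic _ X](_ : _ = quasi_affine lc2 :> atlas C (seq C)); first exact: iso_refl.
rewrite /= /quasi_affine_atlas; congr [:: Chart _ _].
by rewrite eqEsubset; split=> s /=; rewrite /zeros /=; tauto.
Qed.

Lemma mc_set0 n : mc (@set0 'rV[C]_n) = 0.
Proof.
have lc0 : locally_closed (@set0 'rV[C]_n).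
  by exists setT, setT; split; [exists set0|exists set0|rewrite setDT].
have := mc_scissor 1 lc0; rewrite !set0I => E.
by apply: (addrI (mc set0)); rewrite addr0; exact: esym E.
Qed.

Definition line_bundle n (S : set 'rV[C]_n) : set 'rV[C]_(n + 1) := [set v | S (lsubmx v)].

Lemma mc_line n (S : set 'rV[C]_n) : locally_closed S -> mc (line_bundle S) = mc S * Lef C.
Proof.
move=> lcS; have lcL : locally_closed (line_bundle S).
  case: lcS => [Z [W [[I HI] [J HJ] ->]]].
  pose up (p : {mpoly C[n]}) : {mpoly C[n + 1]} := p \mPo [tuple 'X_(lshift 1 i) | i < n].
  have upE p v : peval (up p) v = peval p (lsubmx v).
    rewrite /peval /up comp_mpoly_meval; apply: meval_eq => i.
    by rewrite tnth_map tnth_ord_tuple mevalXU mxE.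
  exists [set v | Z (lsubmx v)], [set v | W (lsubmx v)]; split.
  - exists [set up p | p in I] => v _ /=; rewrite (HI (lsubmx v) Logic.I); split.
      by move=> H _ [p Ip <-]; rewrite upE; apply: H.
    by move=> H p Ip; rewrite -[LHS]upE; apply: H; exists p.
  - exists [set up p | p in J] => v _ /=; rewrite (HJ (lsubmx v) Logic.I); split.
      by move=> H _ [p Ip <-]; rewrite upE; apply: H.
    by move=> H p Ip; rewrite -[LHS]upE; apply: H; exists p.
  - by rewrite eqEsubset; split.
rewrite (mcE lcL) (mcE lcS) [RHS](esym (mot_ofM _ _)); apply/mot_ofP.
apply: (@meq_prod C (quasi_affine lcS) (affine_variety C 1)) => /=.
pose phi (s : seq C) := (take n s, drop n s); pose psi (st : seq C * seq C) := st.1 ++ st.2.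
have rowl (s : seq C) : size s = (n + 1)%N -> row_of_seq n (take n s) = lsubmx (row_of_seq (n + 1) s).
  by move=> ss; apply/rowP => i; rewrite !mxE nth_take.
have rowr (s : seq C) i : (row_of_seq 1 (drop n s)) 0 i = (row_of_seq (n + 1) s) 0 (rshift n i).
  by rewrite !mxE nth_drop.
exists phi, psi; split.
- split.
    move=> s [c]; rewrite mem_seq1 => /eqP -> /= [ss Ss].
    eexists; first by rewrite /prod_atlas /= mem_seq1; exact: eqxx.
    by rewrite /= size_take size_drop ss rowl //; split; split=> //; [case: ltnP; lia|lia].
  move=> c d; rewrite /prod_atlas /= !mem_seq1 => /eqP -> /eqP -> /=; split.
    exists [set 1] => s [ss Ss]; split=> [H|/(_ 1 erefl)/eqP]; last by rewrite peval1 oner_eq0.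
    by case: H; rewrite /= size_take size_drop ss rowl //; split; split=> //; [case: ltnP; lia|lia].
  move=> k s _; exists 'X_k, 1; rewrite peval1 oner_neq0; split=> // t [[st _] _] _.
  rewrite peval1 divr1 /peval mevalXU -[k]splitK; case: (fintype.split k) => i /=.
    by rewrite row_mxEl rowl // mxE.
  by rewrite row_mxEr rowr.
- split.
    move=> [s t] [c]; rewrite /prod_atlas /= mem_seq1 => /eqP -> /= [[ss Ss] [st _]].
    eexists; first by rewrite mem_seq1; exact: eqxx.
    rewrite /= size_cat ss st; split=> //; rewrite /line_bundle /= -rowl ?size_cat ?ss ?st //.
    by rewrite take_size_cat.
  move=> c d; rewrite /prod_atlas /= !mem_seq1 => /eqP -> /eqP -> /=; split.
    exists [set 1] => -[s t] /= [[ss Ss] [st _]]; split=> [H|/(_ 1 erefl)/eqP]; last by rewrite peval1 oner_eq0.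
    case: H; rewrite /= size_cat ss st; split=> //; rewrite /line_bundle /= -rowl ?size_cat ?ss ?st //.
    by rewrite take_size_cat.
  move=> k [s t] _; exists 'X_k, 1; rewrite peval1 oner_neq0; split=> // -[s' t'] /= [[[ss _] [st _]] _] _.
  rewrite peval1 divr1 /peval mevalXU /= -[k]splitK; case: (fintype.split k) => i /=.
    by rewrite row_mxEl !mxE /psi /= nth_cat ss ltn_ord.
  by rewrite row_mxEr !mxE /psi /= nth_cat ss ltnNge leq_addr /= addKn.
- by move=> s _; rewrite /psi /= cat_take_drop.
move=> [s t] [c]; rewrite /prod_atlas /= mem_seq1 => /eqP -> /= [[ss _] _].
by rewrite /phi /psi /= take_size_cat // drop_size_cat.
Qed.

Lemma mc_point : mc [set: 'rV[C]_0] = 1.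
Proof.
by rewrite (mcE (@locally_closedT C 0)); apply/mot_ofP; exact: meq_point.
Qed.
End Classes.

(** * Constructible sets and piecewise isomorphisms *)

Section Constructible.
Variable C : numClosedFieldType.
Notation M := (motring C).
Implicit Types (beta gamma : seq bool -> bool).

Section OneSpace.
Variable n : nat.
Implicit Types (ps qs : seq {mpoly C[n]}) (S A B : set 'rV[C]_n) (p : {mpoly C[n]}).

(* Sum of the classes of the parts of S on which the vanishing pattern of ps satisfies beta. *)
Fixpoint sumcls ps beta S : M := if ps is p :: ps' then
    sumcls ps' (fun bs => beta (true :: bs)) (S `&` zeros p) +
    sumcls ps' (fun bs => beta (false :: bs)) (S `&` ~` zeros p)
  else if beta [::] then mc S else 0.

Definition bits ps (v : 'rV[C]_n) : seq bool := [seq peval p v == 0 | p <- ps].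

Lemma bits_zero p v : zeros p v -> (peval p v == 0) = true. Proof. by move/eqP. Qed.
Lemma bits_nzero p v : (~` zeros p) v -> (peval p v == 0) = false.
Proof. by move=> H; apply/negP => /eqP. Qed.

Lemma sumcls_split ps beta S p : locally_closed S ->
  sumcls ps beta S = sumcls ps beta (S `&` zeros p) + sumcls ps beta (S `&` ~` zeros p).
Proof.
elim: ps beta S => [|q ps IH] beta S lcS /=; first by case: (beta _); [exact: mc_scissor|rewrite addr0].
rewrite (IH _ _ (lc_zeros q lcS)) (IH _ _ (lc_nzeros q lcS)) (setIAC S (zeros q) (zeros p)) (setIAC S (zeros q) (~` zeros p)) (setIAC S (~` zeros q) (zeros p)) (setIAC S (~` zeros q) (~` zeros p)) addrACA.
by [].
Qed.

Lemma sumcls_ext ps beta gamma S : locally_closed S ->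
  (forall v, S v -> beta (bits ps v) = gamma (bits ps v)) -> sumcls ps beta S = sumcls ps gamma S.
Proof.
elim: ps beta gamma S => [|q ps IH] beta gamma S lcS H /=.
  have [[v Sv]|S0] := pselect (exists v, S v); first by rewrite (H v Sv).
  have -> : S = set0 by rewrite eqEsubset; split=> v // Sv; case: S0; exists v.
  by rewrite mc_set0 !if_same.
congr (_ + _); apply: IH; try exact: lc_zeros; try exact: lc_nzeros.
  by move=> v [Sv qv]; have := H v Sv; rewrite /= bits_zero.
by move=> v [Sv qv]; have := H v Sv; rewrite /= bits_nzero.
Qed.

Lemma sumcls_true ps S : locally_closed S -> sumcls ps (fun=> true) S = mc S.
Proof.
elim: ps S => [|q ps IH] S lcS //=.
by rewrite !IH; [rewrite -mc_scissor|exact: lc_nzeros|exact: lc_zeros].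
Qed.
Lemma sumcls_false ps S : sumcls ps (fun=> false) S = 0.
Proof. by elim: ps S => [|q ps IH] S //=; rewrite !IH addr0. Qed.

Lemma sumcls_take ps qs beta S : locally_closed S ->
  sumcls (ps ++ qs) (fun bs => beta (take (size ps) bs)) S = sumcls ps beta S.
Proof.
elim: ps beta S => [|q ps IH] beta S lcS /=.
  have -> : (fun bs => beta (take 0 bs)) = fun=> beta [::] by apply: funext => bs; rewrite take0.
  by case: (beta _); [exact: sumcls_true|exact: sumcls_false].
by congr (_ + _); [apply: (IH (fun bs => beta (true :: bs)))|apply: (IH (fun bs => beta (false :: bs)))];
  [exact: lc_zeros|exact: lc_nzeros].
Qed.

Lemma sumcls_drop ps qs beta S : locally_closed S ->
  sumcls (ps ++ qs) (fun bs => beta (drop (size ps) bs)) S = sumcls qs beta S.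
Proof.
elim: ps S => [|q ps IH] S lcS /=.
  by congr sumcls; apply: funext => bs; rewrite drop0.
by rewrite IH; [rewrite IH; [rewrite -sumcls_split|exact: lc_nzeros]|exact: lc_zeros].
Qed.

Lemma sumcls_or ps beta gamma S : locally_closed S ->
  (forall v, S v -> ~~ (beta (bits ps v) && gamma (bits ps v))) ->
  sumcls ps (fun bs => beta bs || gamma bs) S = sumcls ps beta S + sumcls ps gamma S.
Proof.
elim: ps beta gamma S => [|q ps IH] beta gamma S lcS H /=.
  have [[v Sv]|S0] := pselect (exists v, S v).
    by have := H v Sv; rewrite /=; case: (beta _); case: (gamma _); rewrite //= ?addr0 ?add0r.
  have -> : S = set0 by rewrite eqEsubset; split=> v // Sv; case: S0; exists v.
  by rewrite mc_set0 !if_same addr0.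
rewrite (IH (fun bs => beta (true :: bs)) (fun bs => gamma (true :: bs))); last 2 first.
- exact: lc_zeros.
- by move=> v [Sv qv]; have := H v Sv; rewrite /= bits_zero.
rewrite (IH (fun bs => beta (false :: bs)) (fun bs => gamma (false :: bs))); first by rewrite addrACA.
  exact: lc_nzeros.
by move=> v [Sv qv]; have := H v Sv; rewrite /= bits_nzero.
Qed.

Definition rep A ps beta := forall v, A v <-> beta (bits ps v).
Definition constr A := exists ps beta, rep A ps beta.
(** The value computed from any presentation of [A] by vanishing patterns; [rep_unique] makes the
    choice irrelevant, and 0 is the default when there is no presentation. *)
Definition cl A : M := xget 0 [set c | exists ps beta, rep A ps beta /\ c = sumcls ps beta setT].

Lemma lcT : locally_closed [set: 'rV[C]_n]. Proof. exact: locally_closedT. Qed.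

Lemma bits_cat ps qs v : bits (ps ++ qs) v = bits ps v ++ bits qs v.
Proof. exact: map_cat. Qed.
Lemma take_bits ps qs v : take (size ps) (bits (ps ++ qs) v) = bits ps v.
Proof. by rewrite bits_cat take_size_cat // size_map. Qed.
Lemma drop_bits ps qs v : drop (size ps) (bits (ps ++ qs) v) = bits qs v.
Proof. by rewrite bits_cat drop_size_cat // size_map. Qed.

(** The concatenated list of polynomials refines both presentations, and on its patterns the two
    conditions agree. *)
Lemma rep_unique A ps qs beta gamma : rep A ps beta -> rep A qs gamma ->
  sumcls ps beta setT = sumcls qs gamma setT.
Proof.
move=> R1 R2; rewrite -(@sumcls_take ps qs beta _ lcT) -(@sumcls_drop ps qs gamma _ lcT).
apply: sumcls_ext lcT _ => v _; rewrite take_bits drop_bits.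
by apply/idP/idP => /= [/R1/R2|/R2/R1].
Qed.

Lemma cl_rep A ps beta : rep A ps beta -> cl A = sumcls ps beta setT.
Proof.
move=> R; rewrite /cl; case: xgetP => [c _ [qs [gamma [R' ->]]]|/(_ (sumcls ps beta setT)) []].
  exact: rep_unique R' R.
by exists ps, beta.
Qed.

Lemma rep_common A B : constr A -> constr B -> exists ps beta gamma, rep A ps beta /\ rep B ps gamma.
Proof.
move=> [ps [beta R1]] [qs [gamma R2]]; exists (ps ++ qs), (fun bs => beta (take (size ps) bs)),
  (fun bs => gamma (drop (size ps) bs)); split=> v.
  by rewrite take_bits.
by rewrite drop_bits.
Qed.

Lemma constrU A B : constr A -> constr B -> constr (A `|` B).
Proof.
move=> HA HB; have [ps [b [c [R1 R2]]]] := rep_common HA HB; exists ps, (fun bs => b bs || c bs) => v.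
by split=> [[/R1 ->|/R2 ->]|/orP[/R1|/R2]]; rewrite ?orbT //; [left|right].
Qed.
Lemma constrI A B : constr A -> constr B -> constr (A `&` B).
Proof.
move=> HA HB; have [ps [b [c [R1 R2]]]] := rep_common HA HB; exists ps, (fun bs => b bs && c bs) => v.
by split=> [[/R1 -> /R2 ->]|/andP[/R1 ? /R2]].
Qed.
Lemma constrC A : constr A -> constr (~` A).
Proof.
move=> [ps [b R]]; exists ps, (fun bs => ~~ b bs) => v; split=> [H|/negP H /R //].
by apply/negP => /R.
Qed.
Lemma constr_zeros p : constr (zeros p).
Proof. by exists [:: p], (fun bs => head true bs) => v; rewrite /= /zeros; split=> [/eqP|/eqP]. Qed.
Lemma constrT : constr setT.
Proof. by exists [::], (fun=> true). Qed.

Lemma clU A B : constr A -> constr B -> A `&` B = set0 -> cl (A `|` B) = cl A + cl B.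
Proof.
move=> HA HB AB; have [ps [b [c [R1 R2]]]] := rep_common HA HB.
rewrite (cl_rep R1) (cl_rep R2) (@cl_rep _ ps (fun bs => b bs || c bs)).
  apply: sumcls_or lcT _ => v _; apply/negP => /andP[/R1 Av /R2 Bv].
  by have : (A `&` B) v by []; rewrite AB.
by move=> v; split=> [[/R1 ->|/R2 ->]|/orP[/R1|/R2]]; rewrite ?orbT //; [left|right].
Qed.

Lemma sumcls_sub ps beta S A : locally_closed S -> locally_closed A -> (forall S', locally_closed S' -> locally_closed (S' `&` A)) ->
  (forall v, S v -> beta (bits ps v) -> A v) -> sumcls ps beta S = sumcls ps beta (S `&` A).
Proof.
move=> + lcA lcI; elim: ps beta S => [|q ps IH] beta S lcS H /=.
  case E : (beta [::]) => //; congr mc; rewrite eqEsubset; split=> [v Sv|v []//].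
  by split=> //; apply: (H v Sv); rewrite /= E.
rewrite ![S `&` A `&` _]setIAC -!IH //; try exact: lc_zeros; try exact: lc_nzeros.
  by move=> v [Sv qv]; have := H v Sv; rewrite /= bits_nzero.
by move=> v [Sv qv]; have := H v Sv; rewrite /= bits_zero.
Qed.

Lemma lc_setI A B : locally_closed A -> locally_closed B -> locally_closed (A `&` B).
Proof.
move=> [Z [W [[I HI] [J HJ] ->]]] [Z' [W' [[I' HI'] [J' HJ'] ->]]].
exists (Z `&` Z'), (W `|` W'); split.
- exists (I `|` I') => v _; split=> [[/(HI v Logic.I) h /(HI' v Logic.I) h'] p [/h|/h'] //|H].
  by split; [apply/(HI v Logic.I)|apply/(HI' v Logic.I)] => p Ip; apply: H; [left|right].
- exists [set q | exists p p', [/\ J p, J' p' & q = p * p']] => v _; split.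
    move=> [/(HJ v Logic.I) h|/(HJ' v Logic.I) h] _ [p [p' [Jp Jp' ->]]]; rewrite pevalM.
      by rewrite h ?mul0r.
    by rewrite (h p') ?mulr0.
  move=> H; have [Wv|Wv] := pselect (W v); [by left|right].
  apply/(HJ' v Logic.I) => p' Jp'; apply: contrapT => /eqP p'0; apply: Wv.
  apply/(HJ v Logic.I) => p Jp; have /eqP := H (p * p') (ex_intro _ p (ex_intro _ p' (And3 Jp Jp' erefl))).
  by rewrite pevalM mulf_eq0 (negbTE p'0) orbF => /eqP.
by rewrite eqEsubset; split=> v /=; tauto.
Qed.

Lemma cl_mc A : locally_closed A -> constr A -> cl A = mc A.
Proof.
move=> lcA [ps [beta R]]; rewrite (cl_rep R) (@sumcls_sub _ _ _ A) //.
- rewrite setTI -(sumcls_true ps lcA); apply: sumcls_ext => // v /R -> //.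
- exact: lcT.
- by move=> S lcS; apply: lc_setI.
by move=> v _ /R.
Qed.

Lemma cl_set0 : cl set0 = 0.
Proof. by rewrite (@cl_rep _ [::] (fun=> false)) // => v; split. Qed.
End OneSpace.

Section Transport.
Variables (n m : nat) (S : set 'rV[C]_n) (S' T0 : set 'rV[C]_m).
Variables (phi : 'rV[C]_n -> 'rV[C]_m) (psi : 'rV[C]_m -> 'rV[C]_n).
Hypotheses (cS : constr S) (cT : constr T0).
Hypotheses (S'E : forall w, S' w <-> T0 w /\ S (psi w)).
Hypotheses (SS' : forall v, S v -> S' (phi v)).
Hypotheses (K1 : forall v, S v -> psi (phi v) = v) (K2 : forall w, S' w -> phi (psi w) = w).
Hypotheses (R1 : forall k, reg S (fun v => phi v 0 k)) (R2 : forall k, reg T0 (fun w => psi w 0 k)).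

Lemma sumcls_transport (rs : seq ({mpoly C[n]} * {mpoly C[m]})) (delta : seq bool -> bool) A B :
  locally_closed A -> locally_closed B ->
  (forall v, A v -> S v -> B (phi v)) -> (forall w, B w -> S' w -> A (psi w)) ->
  (forall pq, pq \in rs -> forall v, S v -> (peval pq.1 v == 0) = (peval pq.2 (phi v) == 0)) ->
  (forall v, A v -> delta (bits [seq pq.1 | pq <- rs] v) -> S v) ->
  (forall w, B w -> delta (bits [seq pq.2 | pq <- rs] w) -> S' w) ->
  sumcls [seq pq.1 | pq <- rs] delta A = sumcls [seq pq.2 | pq <- rs] delta B.
Proof.
elim: rs delta A B => [|[p q] rs IH] delta A B lcA lcB AB BA H HA HB /=.
  case E : (delta [::]) => //; have AS v : A v -> S v by move=> /HA; apply.
  have BS w : B w -> S' w by move=> /HB; apply.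
  apply: (mc_iso (phi := phi) (psi := psi)) => //.
  - by move=> v Av; apply: AB => //; apply: AS.
  - by move=> w Bw; apply: BA => //; apply: BS.
  - by move=> v Av; apply: K1; apply: AS.
  - by move=> w Bw; apply: K2; apply: BS.
  - move=> k; have [a [b Hab]] := R1 k; exists a, b => v Av; apply: Hab; exact: AS.
  - move=> k; have [a [b Hab]] := R2 k; exists a, b => w Bw; apply: Hab.
    by have [] := (S'E w).1 (BS w Bw).
have Hpq v : S v -> (peval p v == 0) = (peval q (phi v) == 0).
  by apply: (H (p, q)); rewrite inE eqxx.
have H' pq : pq \in rs -> forall v, S v -> (peval pq.1 v == 0) = (peval pq.2 (phi v) == 0).
  by move=> pqr; apply: H; rewrite inE pqr orbT.
have SP w : S' w -> S (psi w) by move=> /S'E [].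
congr (_ + _); apply: IH => //; try exact: lc_zeros; try exact: lc_nzeros.
- move=> v [Av pv] Sv; split; first exact: AB.
  by apply/eqP; rewrite -Hpq // bits_zero.
- move=> w [Bw qw] Sw; split; first exact: BA.
  by apply/eqP; rewrite Hpq ?K2 ?bits_zero //; apply: SP.
- by move=> v [Av pv]; have := HA v Av; rewrite /= bits_zero.
- by move=> w [Bw pw]; have := HB w Bw; rewrite /= bits_zero.
- move=> v [Av pv] Sv; split; first exact: AB.
  by apply/eqP; rewrite -Hpq // bits_nzero.
- move=> w [Bw qw] Sw; split; first exact: BA.
  by apply/eqP; rewrite Hpq ?K2 ?bits_nzero //; apply: SP.
- by move=> v [Av pv]; have := HA v Av; rewrite /= bits_nzero.
- by move=> w [Bw pw]; have := HB w Bw; rewrite /= bits_nzero.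
Qed.

Lemma reg_zero N (A : set 'rV[C]_N) h : reg A h -> exists p : {mpoly C[N]}, forall v, A v -> (h v == 0) = (peval p v == 0).
Proof.
move=> [p [q H]]; exists p => v Av; have [q0 ->] := H v Av.
by rewrite mulf_eq0 invr_eq0 (negbTE q0) orbF.
Qed.

(** Pulling the polynomials that define each side back to the other side yields two lists with equal
    vanishing patterns at corresponding points; [phi] and [psi] then match the pieces by
    isomorphisms. [T0] is a set on which [psi] is regular, while constructibility of [S'] is a
    conclusion. *)
Lemma transport : constr S' /\ cl S' = cl S.
Proof.
have [ps [beta RS]] := cS; have [qs [gamma RT]] := cT.
have [f Hf] := boolp.choice (fun p => reg_zero (reg_comp p R2)).
have [g Hg] := boolp.choice (fun q => reg_zero (reg_comp q R1)).
pose rs := [seq (p, f p) | p <- ps] ++ [seq (g q, q) | q <- qs].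
pose delta bs := beta (take (size ps) bs) && gamma (drop (size ps) bs).
have rs1 : [seq pq.1 | pq <- rs] = ps ++ [seq g q | q <- qs].
  by rewrite /rs map_cat -!map_comp; congr (_ ++ _); rewrite -[RHS]map_id; apply: eq_map.
have rs2 : [seq pq.2 | pq <- rs] = [seq f p | p <- ps] ++ qs.
  by rewrite /rs map_cat -!map_comp; congr (_ ++ _); rewrite -[RHS]map_id; apply: eq_map.
have d2 w : delta (bits [seq pq.2 | pq <- rs] w) = beta (bits [seq f p | p <- ps] w) && gamma (bits qs w).
  by rewrite rs2 /delta -{1 2}(size_map f ps) take_bits drop_bits.
have bf w : T0 w -> bits [seq f p | p <- ps] w = bits ps (psi w).
  by move=> Tw; rewrite /bits -map_comp; apply: eq_map => p /=; rewrite Hf.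
have Rep' : rep S' [seq pq.2 | pq <- rs] delta.
  move=> w; rewrite d2; split=> [/S'E [Tw /RS Sw]|/andP[Sw /RT Tw]].
    by rewrite bf // Sw; apply/RT.
  by apply/S'E; split=> //; apply/RS; rewrite -bf.
split; first by exists [seq pq.2 | pq <- rs], delta.
have Rep : rep S [seq pq.1 | pq <- rs] delta.
  move=> v; rewrite rs1 /delta take_bits drop_bits; split=> [Sv|/andP[/RS]//].
  apply/andP; split; first exact/RS.
  have [Tv _] := (S'E _).1 (SS' Sv); have -> : bits [seq g q | q <- qs] v = bits qs (phi v).
    by rewrite /bits -map_comp; apply: eq_map => q /=; rewrite Hg.
  exact/RT.
rewrite (cl_rep Rep) (cl_rep Rep'); apply/esym/sumcls_transport => //; try exact: lcT.
- move=> pq; rewrite mem_cat => /orP[] /mapP [p pin ->] v Sv /=.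
    by have [Tv _] := (S'E _).1 (SS' Sv); rewrite -Hf // K1.
  by rewrite -Hg.
- by move=> v _ /Rep.
by move=> w _ /Rep'.
Qed.
End Transport.

Definition up n (p : {mpoly C[n]}) : {mpoly C[n + 1]} := p \mPo [tuple 'X_(lshift 1 i) | i < n].
Lemma upE n (p : {mpoly C[n]}) v : peval (up p) v = peval p (lsubmx v).
Proof.
rewrite /peval /up comp_mpoly_meval; apply: meval_eq => i.
by rewrite tnth_map tnth_ord_tuple mevalXU mxE.
Qed.

Lemma cl_line n (A : set 'rV[C]_n) : constr A -> constr (line_bundle A) /\ cl (line_bundle A) = cl A * Lef C.
Proof.
move=> [ps [beta R]]; have R' : rep (line_bundle A) [seq up p | p <- ps] beta.
  move=> v; have -> : bits [seq up p | p <- ps] v = bits ps (lsubmx v); last exact: R.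
  by rewrite /bits -map_comp; apply: eq_map => p /=; rewrite upE.
split; first by exists [seq up p | p <- ps], beta.
rewrite (cl_rep R) (cl_rep R').
have -> : [set: 'rV[C]_(n + 1)] = line_bundle [set: 'rV[C]_n] by rewrite eqEsubset; split.
elim: ps beta [set: 'rV[C]_n] (lcT n) {R R'} => [|p ps IH] beta S lcS /=.
  by case: (beta _); rewrite ?mul0r // mc_line.
rewrite mulrDl -!IH; try exact: lc_zeros; try exact: lc_nzeros.
by congr (_ + _); congr sumcls; rewrite eqEsubset; split=> v; rewrite /line_bundle /zeros /= upE.
Qed.
End Constructible.

(** * Measurable sets of arcs and changes of variables *)

Section Arcs.
Variable C : numClosedFieldType.
Notation M := (motring C).
Notation Li := (Lef_inv C).
Notation arcs := (Defs.arc C).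
Implicit Types (A B T P : set (arcs)) (g : arcs) (N : nat).

Lemma Lef_invK : Lef C * Li = 1. Proof. exact: Lef_mulV. Qed.

(* The coefficients of both components are interleaved, so that truncations are initial segments. *)
Definition flat g k : C := if odd k then g.2 k./2 else g.1 k./2.
Definition jv N g : 'rV[C]_N := \row_(k < N) flat g k.
Definition unflat (s : nat -> C) : arcs := (Fps (fun k => s k.*2), Fps (fun k => s k.*2.+1)).
Lemma flatK s k : flat (unflat s) k = s k.
Proof.
rewrite -[k in RHS]odd_double_half /flat /=; case: (odd k) => //=.
Qed.
Definition arcv N (v : 'rV[C]_N) : arcs := unflat (fun k => if insub k is Some i then v 0 i else 0).
Lemma jv_arcv N (v : 'rV[C]_N) : jv N (arcv v) = v.
Proof. by apply/rowP => i; rewrite mxE /arcv flatK insubT //= => lt; congr (v _ _); apply: val_inj. Qed.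
Lemma jv_eq N g g' : (forall k, (k < N)%N -> flat g k = flat g' k) -> jv N g = jv N g'.
Proof. by move=> H; apply/rowP => i; rewrite !mxE H. Qed.
Lemma jvP N g g' k : jv N g = jv N g' -> (k < N)%N -> flat g k = flat g' k.
Proof. by move=> E lt; have := congr1 (fun v : 'rV_N => v 0 (Ordinal lt)) E; rewrite !mxE. Qed.

Definition arep N A (S : set 'rV[C]_N) := constr S /\ forall g, A g <-> S (jv N g).
Definition lvl N A := exists S, arep (N := N) A S.
Definition meas A := exists N, lvl N A.
(** One factor [Li] for each coefficient, constant terms included: the space of all arcs gets
    measure 1, and [arep_raise] shows that the level does not matter. *)
Definition mu A : M := xget 0 [set c | exists N S, arep (N := N) A S /\ c = cl S * Li ^+ N].

Lemma arep_raise N k A S : arep (N := N) A S ->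
  exists S', arep (N := N + k) A S' /\ cl S' * Li ^+ (N + k) = cl S * Li ^+ N.
Proof.
move=> HS; elim: k => [|k [S' [[cS' HS'] E]]]; first by rewrite addn0; exists S.
have -> : (N + k.+1 = N + k + 1)%N by rewrite addnS addn1.
have [cL clL] := cl_line cS'; exists (line_bundle S'); split.
  split=> // g; rewrite HS' /line_bundle /=; suff -> : lsubmx (jv (N + k + 1) g) = jv (N + k) g by [].
  by apply/rowP => i; rewrite !mxE.
by rewrite clL [in Li ^+ _]addn1 exprS -E mulrA -(mulrA _ (Lef C)) Lef_invK mulr1.
Qed.

Lemma arep_inj N A S S' : arep (N := N) A S -> arep A S' -> S = S'.
Proof.
move=> [_ H] [_ H']; rewrite eqEsubset; split=> v.
  by rewrite -[v]jv_arcv => /H/H'.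
by rewrite -[v]jv_arcv => /H'/H.
Qed.

Lemma mu_arep N A S : arep (N := N) A S -> mu A = cl S * Li ^+ N.
Proof.
move=> HS; rewrite /mu; case: xgetP => [c _ [K [S' [HS' ->]]]|/(_ (cl S * Li ^+ N)) []]; last by exists N, S.
have [T [HT ET]] := arep_raise K HS; have [T' [HT' ET']] := arep_raise N HS'.
move: T' HT' ET'; rewrite addnC => T' HT' ET'; rewrite -ET -ET'.
by rewrite (arep_inj HT HT').
Qed.

Lemma lvl_raise N K A : (N <= K)%N -> lvl N A -> lvl K A.
Proof. by move=> /subnKC <- [S HS]; have [S' [HS' _]] := arep_raise (K - N) HS; exists S'. Qed.
Lemma lvl_dep N A g g' : lvl N A -> jv N g = jv N g' -> A g -> A g'.
Proof. by move=> [S [_ H]] E /H; rewrite E => /H. Qed.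
Lemma lvlC N A : lvl N A -> lvl N (~` A).
Proof.
move=> [S [cS H]]; exists (~` S); split; first exact: constrC.
by move=> g; split=> H1 H2; apply: H1; apply/H.
Qed.
Lemma lvlI N A B : lvl N A -> lvl N B -> lvl N (A `&` B).
Proof.
move=> [S [cS H]] [S' [cS' H']]; exists (S `&` S'); split; first exact: constrI.
by move=> g; split=> -[/H a /H' b].
Qed.
Lemma lvl_ext N A B : (forall g, A g <-> B g) -> lvl N A -> lvl N B.
Proof. by move=> E; have -> : B = A by rewrite eqEsubset; split=> g /E. Qed.
Lemma lvl_flat N k : (k < N)%N -> lvl N [set g | flat g k = 0].
Proof.
move=> lt; exists (zeros 'X_(Ordinal lt)); split; first exact: constr_zeros.
by move=> g; rewrite /zeros /= /peval mevalXU mxE.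
Qed.
Lemma lvlT N : lvl N setT.
Proof. by exists setT; split=> //; exact: constrT. Qed.
Lemma lvl_all N n (Q : nat -> set (arcs)) : (forall k, (k < n)%N -> lvl N (Q k)) ->
  lvl N [set g | forall k, (k < n)%N -> Q k g].
Proof.
elim: n => [|n IH] H; first by apply: lvl_ext (lvlT N) => g; split.
apply: lvl_ext (lvlI (IH (fun k lt => H k (ltnW lt))) (H n (ltnSn n))) => g; split.
  by move=> [H1 H2] k; rewrite ltnS leq_eqVlt => /orP[/eqP ->|/H1].
by move=> H1; split=> [k lt|]; apply: H1 => //; exact: ltnW.
Qed.

Lemma meas_ext A B : (forall g, A g <-> B g) -> meas A -> meas B.
Proof. by move=> E [N H]; exists N; apply: lvl_ext H. Qed.
Lemma mu_ext A B : (forall g, A g <-> B g) -> mu A = mu B.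
Proof. by move=> E; have -> : A = B by rewrite eqEsubset; split=> g /E. Qed.
Lemma meas_common A B : meas A -> meas B -> exists N, lvl N A /\ lvl N B.
Proof.
move=> [N HA] [K HB]; exists (maxn N K).
by split; [apply: lvl_raise HA; rewrite leq_maxl|apply: lvl_raise HB; rewrite leq_maxr].
Qed.
Lemma measC A : meas A -> meas (~` A).
Proof. by move=> [N H]; exists N; exact: lvlC. Qed.
Lemma measI A B : meas A -> meas B -> meas (A `&` B).
Proof. by move=> HA HB; have [N [H1 H2]] := meas_common HA HB; exists N; exact: lvlI. Qed.
Lemma measU A B : meas A -> meas B -> meas (A `|` B).
Proof. by move=> HA HB; rewrite -[A `|` B]setCK setCU; apply/measC/measI; exact: measC. Qed.
Lemma measT : meas setT. Proof. by exists 0; exact: lvlT. Qed.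

Lemma mu_add A B : meas A -> meas B -> (forall g, A g -> ~ B g) -> mu (A `|` B) = mu A + mu B.
Proof.
move=> HA HB AB; have [N [[S HS] [S' HS']]] := meas_common HA HB.
have [cS H] := HS; have [cS' H'] := HS'.
rewrite (mu_arep HS) (mu_arep HS') -mulrDl -clU //.
  apply: mu_arep; split; first exact: constrU.
  by move=> g; split=> -[/H|/H']; [left|right|left|right].
by rewrite eqEsubset; split=> // v []; rewrite -[v]jv_arcv => /H a /H' /(AB _ a).
Qed.
Lemma mu_set0 : mu set0 = 0.
Proof.
rewrite (@mu_arep 0 set0 set0) ?cl_set0 ?mul0r //; split=> //.
by exists [::], (fun=> false) => v; split.
Qed.
Lemma mu_split A B : meas A -> meas B -> mu A = mu (A `&` B) + mu (A `&` ~` B).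
Proof.
move=> HA HB; rewrite -mu_add; first by rewrite -setIUr setUv setIT.
- exact: measI.
- by apply: measI => //; exact: measC.
by move=> g [_ Bg] [].
Qed.

Definition afun (h : arcs -> C) := exists N (p : {mpoly C[N]}), forall g, h g = peval p (jv N g).
Lemma afun_eq h k : h =1 k -> afun k -> afun h.
Proof. by move=> E [N [p H]]; exists N, p => g; rewrite E. Qed.
Lemma afun_raise h N (p : {mpoly C[N]}) K : (N <= K)%N -> (forall g, h g = peval p (jv N g)) ->
  exists q : {mpoly C[K]}, forall g, h g = peval q (jv K g).
Proof.
move=> le H; exists (p \mPo [tuple 'X_(widen_ord le i) | i < N]) => g.
rewrite H /peval comp_mpoly_meval; apply: meval_eq => i.
by rewrite tnth_map tnth_ord_tuple mevalXU !mxE.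
Qed.
Lemma afun2 h k : afun h -> afun k -> exists N (p q : {mpoly C[N]}),
  forall g, h g = peval p (jv N g) /\ k g = peval q (jv N g).
Proof.
move=> [N [p Hp]] [K [q Hq]]; have [p' Hp'] := afun_raise (leq_maxl N K) Hp.
by have [q' Hq'] := afun_raise (leq_maxr N K) Hq; exists (maxn N K), p', q'.
Qed.
Lemma afunC c : afun (fun=> c).
Proof. by exists 0, c%:MP => g; rewrite pevalC. Qed.
Lemma afunD h k : afun h -> afun k -> afun (fun g => h g + k g).
Proof.
move=> Hh Hk; have [N [p [q H]]] := afun2 Hh Hk; exists N, (p + q) => g.
by have [-> ->] := H g; rewrite pevalD.
Qed.
Lemma afunM h k : afun h -> afun k -> afun (fun g => h g * k g).
Proof.
move=> Hh Hk; have [N [p [q H]]] := afun2 Hh Hk; exists N, (p * q) => g.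
by have [-> ->] := H g; rewrite pevalM.
Qed.
Lemma afunN h : afun h -> afun (fun g => - h g).
Proof. by move=> H; apply: afun_eq (afunM (afunC (-1)) H) => g; rewrite mulN1r. Qed.
Lemma afun_sum I (r : seq I) (Q : pred I) (h : I -> arcs -> C) : (forall i, Q i -> afun (h i)) ->
  afun (fun g => \sum_(i <- r | Q i) h i g).
Proof.
move=> H; elim: r => [|i r IH]; first by apply: afun_eq (afunC 0) => g; rewrite big_nil.
case E : (Q i); last by apply: afun_eq IH => g; rewrite big_cons E.
by apply: afun_eq (afunD (H i E) IH) => g; rewrite big_cons E.
Qed.
Lemma afunX h n : afun h -> afun (fun g => h g ^+ n).
Proof.
move=> H; elim: n => [|n IH]; first by apply: afun_eq (afunC 1) => g; rewrite expr0.
by apply: afun_eq (afunM H IH) => g; rewrite exprS.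
Qed.
Lemma afun_prod I (r : seq I) (h : I -> arcs -> C) : (forall i, afun (h i)) ->
  afun (fun g => \prod_(i <- r) h i g).
Proof.
move=> H; elim: r => [|i r IH]; first by apply: afun_eq (afunC 1) => g; rewrite big_nil.
by apply: afun_eq (afunM (H i) IH) => g; rewrite big_cons.
Qed.
Lemma afun_flat k : afun (fun g => flat g k).
Proof. by exists k.+1, 'X_ord_max => g; rewrite /peval mevalXU mxE. Qed.
Lemma afun_peval n (p : {mpoly C[n]}) (h : arcs -> 'rV[C]_n) :
  (forall i, afun (fun g => h g 0 i)) -> afun (fun g => peval p (h g)).
Proof.
move=> H; apply: (@afun_eq _ (fun g => \sum_(m <- msupp p) p@_m * \prod_(i < n) h g 0 i ^+ m i)).
  by move=> g; rewrite /peval mevalE.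
by apply: afun_sum => m _; apply: afunM; [exact: afunC|apply: afun_prod => i; exact: afunX].
Qed.

Lemma meas0 h : afun h -> meas [set g | h g = 0].
Proof.
move=> [N [p H]]; exists N, (zeros p); split; first exact: constr_zeros.
by move=> g; rewrite /= H.
Qed.
Lemma meas_bits (hs : seq (arcs -> C)) (beta : seq bool -> bool) : (forall i, (i < size hs)%N -> afun (nth (fun=> 0) hs i)) ->
  meas [set g | beta [seq h g == 0 | h <- hs]].
Proof.
elim: hs beta => [|h hs IH] beta H.
  have [b|nb] := boolP (beta [::]); first by apply: meas_ext measT => g; split.
  by apply: meas_ext (measC measT) => g; split=> [/(_ Logic.I)|gb] //; case/negP: nb.
have H' i : (i < size hs)%N -> afun (nth (fun=> 0) hs i) by apply: (H i.+1).
have Hh := meas0 (H 0 isT); have Ht := IH (fun bs => beta (true :: bs)) H'.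
have Hf := IH (fun bs => beta (false :: bs)) H'.
apply: meas_ext (measU (measI Hh Ht) (measI (measC Hh) Hf)) => g /=; split.
  by move=> [[/eqP -> //]|[/eqP/negbTE -> //]].
by case: eqP => h0 b; [left|right].
Qed.
Lemma meas_comp P (Phi : arcs -> arcs) : meas P -> (forall k, afun (fun g => flat (Phi g) k)) ->
  meas [set g | P (Phi g)].
Proof.
move=> [N [S [[ps [beta R]] H]]] HPhi.
apply: meas_ext (@meas_bits [seq (fun g => peval p (jv N (Phi g))) | p <- ps] beta _).
  by move=> g /=; rewrite H R /bits -map_comp.
move=> i; rewrite size_map => lt; rewrite (nth_map 0) //.
by apply: afun_peval => j; apply: afun_eq (HPhi j) => g; rewrite mxE.
Qed.

Definition afps (H : arcs -> fps C) := forall k, afun (fun g => H g k).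
Lemma afps_pair H K : afps H -> afps K -> forall k, afun (fun g => flat (H g, K g) k).
Proof.
by move=> HH HK k; rewrite /flat; case: (odd k) => /=; [exact: HK|exact: HH].
Qed.
Lemma afps1 : afps fst.
Proof. by move=> k; apply: afun_eq (afun_flat k.*2) => g; rewrite /flat odd_double doubleK. Qed.
Lemma afps2 : afps snd.
Proof. by move=> k; apply: afun_eq (afun_flat k.*2.+1) => g; rewrite /flat /= odd_double /= uphalf_double. Qed.
Lemma afpsC c : afps (fun=> c). Proof. by move=> k; exact: afunC. Qed.
Lemma afpsM H K : afps H -> afps K -> afps (fun g => H g * K g).
Proof.
move=> HH HK k; apply: (@afun_eq _ (fun g => \sum_(i < k.+1) H g i * K g (k - i)%N)) => //.
by apply: afun_sum => i _; apply: afunM.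
Qed.
Lemma afpsX H n : afps H -> afps (fun g => H g ^+ n).
Proof.
move=> HH; elim: n => [|n IH] k; first by apply: afun_eq (afpsC 1 k) => g; rewrite expr0.
by apply: afun_eq (afpsM HH IH k) => g; rewrite exprS.
Qed.
Lemma meas_order H n : afps H -> meas [set g | has_order (H g) n].
Proof.
move=> HH; have Hk m : meas [set g | forall k, (k < m)%N -> H g k = 0].
  elim: m => [|m IH]; first by apply: meas_ext measT => g; split.
  apply: meas_ext (measI IH (meas0 (HH m))) => g; split.
    by move=> [H1 H2] k; rewrite ltnS leq_eqVlt => /orP[/eqP ->|/H1].
  by move=> H1; split=> [k lt|]; apply: H1 => //; exact: ltnW.
by apply: meas_ext (measI (Hk n) (measC (meas0 (HH n)))) => g.
Qed.
Lemma meas_ge H n : afps H -> meas [set g | forall k, (k < n)%N -> H g k = 0].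
Proof.
move=> HH; elim: n => [|m IH]; first by apply: meas_ext measT => g; split.
apply: meas_ext (measI IH (meas0 (HH m))) => g; split.
  by move=> [H1 H2] k; rewrite ltnS leq_eqVlt => /orP[/eqP ->|/H1].
by move=> H1; split=> [k lt|]; apply: H1 => //; exact: ltnW.
Qed.

Section Areg.
Variables (N : nat) (A : set (arcs)).
(** Regularity is required only at the jets of arcs of [A], so that denominators such as the
    constant term of a unit may vanish elsewhere. *)
Definition areg (h : arcs -> C) := exists k : 'rV[C]_N -> C,
  reg [set v | exists2 g, A g & v = jv N g] k /\ forall g, A g -> h g = k (jv N g).
Lemma areg_eq h k : (forall g, A g -> h g = k g) -> areg k -> areg h.
Proof. by move=> E [k' [R H]]; exists k'; split=> // g Ag; rewrite E ?H. Qed.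
Lemma aregC c : areg (fun=> c).
Proof. by exists (fun=> c); split=> //; exact: regC. Qed.
Lemma areg_flat k : (k < N)%N -> areg (fun g => flat g k).
Proof.
move=> lt; exists (fun v => v 0 (Ordinal lt)); split; first exact: reg_coord.
by move=> g _; rewrite mxE.
Qed.
Lemma aregD h k : areg h -> areg k -> areg (fun g => h g + k g).
Proof.
move=> [h' [R H]] [k' [R' H']]; exists (fun v => h' v + k' v); split; first exact: regD.
by move=> g Ag; rewrite H ?H'.
Qed.
Lemma aregM h k : areg h -> areg k -> areg (fun g => h g * k g).
Proof.
move=> [h' [R H]] [k' [R' H']]; exists (fun v => h' v * k' v); split; first exact: regM.
by move=> g Ag; rewrite H ?H'.
Qed.
Lemma aregN h : areg h -> areg (fun g => - h g).
Proof. by move=> H; apply: areg_eq (aregM (aregC (-1)) H) => g _; rewrite mulN1r. Qed.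
Lemma aregV h : (forall g, A g -> h g != 0) -> areg h -> areg (fun g => (h g)^-1).
Proof.
move=> h0 [h' [R H]]; exists (fun v => (h' v)^-1); split; last by move=> g Ag; rewrite H.
by apply: regV => // v [g Ag ->]; rewrite -H ?h0.
Qed.
Lemma areg_sum n (h : nat -> arcs -> C) : (forall i, (i < n)%N -> areg (h i)) ->
  areg (fun g => \sum_(i < n) h i g).
Proof.
elim: n => [|n IH] H; first by apply: areg_eq (aregC 0) => g _; rewrite big_ord0.
apply: areg_eq (aregD (IH (fun i lt => H i (ltnW lt))) (H n (ltnSn n))) => g _.
by rewrite big_ord_recr.
Qed.
Definition aregs a (U : arcs -> fps C) := forall k, (k < a)%N -> areg (fun g => U g k).
Variable a : nat.
Lemma aregsD U V : aregs a U -> aregs a V -> aregs a (fun g => U g + V g).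
Proof. by move=> HU HV k lt; apply: aregD; [exact: HU|exact: HV]. Qed.
Lemma aregsN U : aregs a U -> aregs a (fun g => - U g).
Proof. by move=> HU k lt; apply: aregN; exact: HU. Qed.
Lemma aregsM U V : aregs a U -> aregs a V -> aregs a (fun g => U g * V g).
Proof.
move=> HU HV k lt; apply: (@areg_eq _ (fun g => \sum_(i < k.+1) U g i * V g (k - i)%N)) => //.
apply: (@areg_sum k.+1 (fun i g => U g i * V g (k - i)%N)) => i; rewrite ltnS => le.
by apply: aregM; [apply: HU|apply: HV]; lia.
Qed.
Lemma aregsC c : aregs a (fun=> c). Proof. by move=> k _; exact: aregC. Qed.
Lemma aregsX U n : aregs a U -> aregs a (fun g => U g ^+ n).
Proof.
move=> HU; elim: n => [|n IH] k lt; first by apply: areg_eq (aregsC 1 lt) => g _; rewrite expr0.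
by apply: areg_eq (aregsM HU IH lt) => g _; rewrite exprS.
Qed.
Lemma aregs_inv U V : (forall g, A g -> U g * V g = 1) -> aregs a U -> aregs a V.
Proof.
move=> UV HU; elim/ltn_ind => k IH lt.
have U0 g : A g -> U g 0%N != 0.
  move=> Ag; have := congr1 (fun h : fps C => h 0%N) (UV g Ag).
  by rewrite fpsM_recl big_ord0 addr0 fps1; apply: contra_eq_neq => ->; rewrite mul0r eq_sym oner_eq0.
apply: (@areg_eq _ (fun g => (U g 0%N)^-1 * ((k == 0%N)%:R - \sum_(i < k) U g i.+1 * V g (k - i.+1)%N))).
  move=> g Ag; have := congr1 (fun h : fps C => h k) (UV g Ag); rewrite fpsM_recl fps1 => /eqDB <-.
  by rewrite mulKf ?U0.
apply: aregM; first by apply: aregV => //; apply: HU; lia.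
apply: aregD; first exact: aregC.
apply: aregN; apply: (@areg_sum k (fun i g => U g i.+1 * V g (k - i.+1)%N)) => i lti.
by apply: aregM; [apply: HU; lia|apply: IH; lia].
Qed.
End Areg.

Section Iso.
Variables (N d : nat) (A B T : set (arcs)) (Phi Psi : arcs -> arcs).
Notation K := (N + d)%N.
Hypotheses (lA : lvl N A) (lT : lvl K T).
Hypothesis BE : forall g, B g <-> T g /\ A (Psi g).
Hypothesis AB : forall g, A g -> B (Phi g).
Hypothesis K1 : forall g, A g -> forall k, (k < N)%N -> flat (Psi (Phi g)) k = flat g k.
Hypothesis K2 : forall g, B g -> forall k, (k < K)%N -> flat (Phi (Psi g)) k = flat g k.
Hypothesis R1 : forall k, (k < K)%N -> areg N A (fun g => flat (Phi g) k).
Hypothesis R2 : forall k, (k < N)%N -> areg K T (fun g => flat (Psi g) k).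

(** Change of variables with Jacobian of order [d]: [N] coefficients on one side correspond to
    [N + d] on the other. The two maps need to be inverse only up to these truncations, and [T] is a
    set of known level on which [Psi] is regular. *)
Lemma mu_iso : meas B /\ mu B = mu A * Li ^+ d.
Proof.
have [S [cS HS]] := lA; have [T0 [cT HT]] := lT.
have dPhi g g' : A g -> A g' -> jv N g = jv N g' -> jv K (Phi g) = jv K (Phi g').
  move=> Ag Ag' E; apply: jv_eq => k lt; have [h [_ Hh]] := R1 lt.
  by rewrite !Hh // E.
have dPsi g g' : T g -> T g' -> jv K g = jv K g' -> jv N (Psi g) = jv N (Psi g').
  move=> Tg Tg' E; apply: jv_eq => k lt; have [h [_ Hh]] := R2 lt.
  by rewrite !Hh // E.
have dB g g' : jv K g = jv K g' -> B g -> B g'.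
  move=> E /BE [Tg Ag]; have Tg' := lvl_dep lT E Tg.
  by apply/BE; split=> //; apply: lvl_dep lA _ Ag; apply: dPsi.
pose phi (v : 'rV[C]_N) := jv K (Phi (arcv v)); pose psi (w : 'rV[C]_K) := jv N (Psi (arcv w)).
have SA v : S v <-> A (arcv v) by rewrite HS jv_arcv.
have TT w : T0 w <-> T (arcv w) by rewrite HT jv_arcv.
have [cS' clS'] : constr [set w : 'rV_K | B (arcv w)] /\ cl [set w : 'rV_K | B (arcv w)] = cl S.
  apply: (@transport C N K S [set w : 'rV_K | B (arcv w)] T0 phi psi cS cT).
  - by move=> w /=; rewrite BE TT HS.
  - by move=> v /SA /AB /=; apply: dB; rewrite jv_arcv.
  - move=> v /SA Av; rewrite /psi /phi -[RHS]jv_arcv.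
    have E : jv K (arcv (jv K (Phi (arcv v)))) = jv K (Phi (arcv v)) by rewrite jv_arcv.
    have [T1 _] := (BE _).1 (AB Av).
    by rewrite (dPsi _ _ (lvl_dep lT (esym E) T1) T1 E); apply: jv_eq => k; apply: K1.
  - move=> w Bw; rewrite /psi /phi -[RHS]jv_arcv.
    have E : jv N (arcv (jv N (Psi (arcv w)))) = jv N (Psi (arcv w)) by rewrite jv_arcv.
    have [_ A1] := (BE _).1 Bw.
    by rewrite (dPhi _ _ (lvl_dep lA (esym E) A1) A1 E); apply: jv_eq => k; apply: K2.
  - move=> k; have [h [[p [q Rh]] Hh]] := R1 (ltn_ord k); exists p, q => v /SA Av.
    rewrite /phi mxE Hh // jv_arcv; apply: Rh; exists (arcv v) => //; by rewrite jv_arcv.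
  - move=> k; have [h [[p [q Rh]] Hh]] := R2 (ltn_ord k); exists p, q => v /TT Av.
    rewrite /psi mxE Hh // jv_arcv; apply: Rh; exists (arcv v) => //; by rewrite jv_arcv.
have rB : arep (N := K) B [set w : 'rV_K | B (arcv w)].
  by split=> // g; split; apply: dB; rewrite jv_arcv.
split; first by exists K, [set w : 'rV_K | B (arcv w)].
by rewrite (mu_arep rB) (mu_arep (conj cS HS)) clS' exprD mulrA.
Qed.
End Iso.

Lemma flat1 g k : g.1 k = flat g k.*2. Proof. by rewrite /flat odd_double doubleK. Qed.
Lemma flat2 g k : g.2 k = flat g k.*2.+1. Proof. by rewrite /flat /= odd_double /= uphalf_double. Qed.

Lemma meas_even A : meas A -> exists a0, forall a, (a0 <= a)%N -> lvl a.*2 A.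
Proof. by move=> [N H]; exists N => a le; apply: lvl_raise H; lia. Qed.
Lemma lvl_even_dep a A g g' : lvl a.*2 A -> (forall k, (k < a)%N -> g.1 k = g'.1 k) ->
  (forall k, (k < a)%N -> g.2 k = g'.2 k) -> A g -> A g'.
Proof.
move=> lA H1 H2; apply: lvl_dep lA _; apply: jv_eq => k lt; rewrite /flat.
by case: ifP => _; [apply: H2|apply: H1]; lia.
Qed.

Section Triangular.
Variables (a : nat) (P : set (arcs)) (T : set (fps C)) (E E' D : fps C -> fps C).
Notation T1 := [set g : arcs | T g.1].
Hypotheses (lP : lvl a.*2 P) (lT : lvl a.*2 T1) (PT : forall g, P g -> T g.1).
Hypothesis EE' : forall u, T u -> E u * E' u = 1.
Hypotheses (RE : aregs a.*2 T1 a (fun g => E g.1)) (RE' : aregs a.*2 T1 a (fun g => E' g.1)).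
Hypothesis RD : aregs a.*2 T1 a (fun g => D g.1).

(** The map [(u, w) -> (u, E(u) w + D(u))] with [E(u)] a unit has a unit as Jacobian, so [mu_iso]
    applies with [d = 0]. Shears and multiplications by units are both of this form. *)
Lemma mu_triang : meas [set g | T g.1 /\ P (g.1, E g.1 * g.2 + D g.1)] /\
  mu [set g | T g.1 /\ P (g.1, E g.1 * g.2 + D g.1)] = mu P.
Proof.
pose Psi g : arcs := (g.1, E g.1 * g.2 + D g.1).
pose Phi g : arcs := (g.1, E' g.1 * (g.2 - D g.1)).
have KK g : T g.1 -> Psi (Phi g) = g.
  by case: g => u w Tu; rewrite /Psi /Phi /=; congr (_, _); rewrite mulrA EE' // mul1r subrK.
have KK' g : T g.1 -> Phi (Psi g) = g.
  by case: g => u w Tu; rewrite /Psi /Phi /=; congr (_, _); rewrite addrK mulrA (mulrC (E' u)) EE' // mul1r.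
have r1 : aregs a.*2 T1 a (fun g => g.1).
  by move=> k lt; apply: areg_eq (areg_flat T1 (k := k.*2) _); [move=> g _; exact: flat1|lia].
have r2 : aregs a.*2 T1 a (fun g => g.2).
  by move=> k lt; apply: areg_eq (areg_flat T1 (k := k.*2.+1) _); [move=> g _; exact: flat2|lia].
have fl (U V : arcs -> fps C) : aregs a.*2 T1 a U -> aregs a.*2 T1 a V ->
    forall k, (k < a.*2)%N -> areg a.*2 T1 (fun g => flat (U g, V g) k).
  by move=> HU HV k lt; rewrite /flat; case: (odd k) => /=; [apply: HV|apply: HU]; lia.
have := @mu_iso a.*2 0 P [set g | T g.1 /\ P (Psi g)] T1 Phi Psi; rewrite expr0 mulr1 addn0; apply=> //.
- by move=> g Pg; have Tg := PT Pg; split=> //; rewrite KK.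
- by move=> g Pg k _; rewrite KK //; apply: PT.
- by move=> g [Tg _] k _; rewrite KK'.
- move=> k lt; have [h [[p [q R]] H]] : areg a.*2 T1 (fun g => flat (Phi g) k).
    by apply: fl lt => //; apply: aregsM => //; apply: aregsD => //; apply: aregsN.
  exists h; split=> [|g /PT]; last exact: H.
  by exists p, q => v [g Pg ->]; apply: R; exists g => //; exact: PT.
by apply: fl => //; apply: aregsD => //; apply: aregsM.
Qed.
End Triangular.

Definition psub (psi u : fps C) : fps C := Fps (fun k => \sum_(i < k.+1) psi i * (u ^+ i) k).

Lemma mu_shear psi P : meas P -> (forall g, P g -> g.1 0%N = 0) ->
  mu [set g : arcs | g.1 0%N = 0 /\ P (g.1, g.2 + psub psi g.1)] = mu P.
Proof.
move=> mP P0; have [a0 Ha] := meas_even mP; pose a := a0.+1.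
have := @mu_triang a P [set u | u 0%N = 0] (fun=> 1) (fun=> 1) (psub psi).
case=> //.
- by apply: Ha; rewrite /a; lia.
- by apply: lvl_ext (@lvl_flat a.*2 0 _) => [g|]; rewrite // /flat.
- by move=> u _; rewrite mulr1.
- exact: aregsC.
- exact: aregsC.
- move=> k lt; apply: (@areg_sum _ _ k.+1 (fun i g => psi i * (g.1 ^+ i) k)) => i _.
  apply: aregM; first exact: aregC.
  apply: (@aregsX _ _ a (fun g => g.1)) => // j ltj.
  by apply: areg_eq (areg_flat _ (k := j.*2) _); [move=> g _; exact: flat1|lia].
by move=> _ <-; apply: mu_ext => g /=; rewrite mul1r.
Qed.

Definition tX : fps C := fps_mono 1 1.
Lemma tXM (f : fps C) k : (tX * f) k = if k is k'.+1 then f k' else 0.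
Proof. by rewrite fps_monoM; case: k => //= k; rewrite mul1r subn1. Qed.
Lemma tXnM i (f : fps C) k : (tX ^+ i * f) k = if (i <= k)%N then f (k - i)%N else 0.
Proof.
elim: i k => [|i IH] k; first by rewrite mul1r subn0.
by rewrite exprS -mulrA tXM; case: k => // k; rewrite IH.
Qed.
Definition tail (f : fps C) : fps C := Fps (fun k => f k.+1).
Lemma tX_tail (f : fps C) : f 0%N = 0 -> tX * tail f = f.
Proof. by move=> f0; apply: fpsP => -[|k]; rewrite tXM. Qed.
Lemma tail_tX (f : fps C) : tail (tX * f) = f.
Proof. by apply: fpsP => k; rewrite fpsE tXM. Qed.

Lemma mu_shift P : meas P -> (forall g, P g -> g.2 0%N = 0) ->
  mu P = mu [set g | P (g.1, tX * g.2)] * Li.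
Proof.
move=> mP P0; have mQ : meas [set g | P (g.1, tX * g.2)].
  apply: (meas_comp (Phi := fun g => (g.1, tX * g.2)) mP); apply: afps_pair; first exact: afps1.
  by apply: afpsM; [exact: afpsC|exact: afps2].
have [a Ha] := meas_even mQ.
(* Level [2a + 1] sees [u_0, ..., u_a] and [w_0, ..., w_(a-1)], and level [2a + 2] sees [w_a] as
   well: multiplication of [w] by [t] matches them. *)
have := @mu_iso a.*2.+1 1 [set g | P (g.1, tX * g.2)] P [set g : arcs | g.2 0%N = 0]
  (fun g => (g.1, tX * g.2)) (fun g => (g.1, tail g.2)).
case=> //=.
- by apply: lvl_raise (Ha a (leqnn a)).
- by rewrite addn1; apply: lvl_ext (@lvl_flat a.*2.+2 1 _).
- move=> [u w] /=; split=> [Pg|[w0]]; last by rewrite tX_tail.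
  by have w0 := P0 _ Pg; split=> //; rewrite tX_tail.
- by move=> [u w] _ k _ /=; rewrite tail_tX.
- by move=> [u w] Pg k _ /=; rewrite tX_tail //; exact: P0 Pg.
- move=> k lt; rewrite /flat; case ok: (odd k) => /=; last first.
    by apply: areg_eq (areg_flat _ (k := k) _); [move=> g _; rewrite /flat ok|lia].
  apply: (@areg_eq _ _ _ (fun g => if k./2 is k'.+1 then g.2 k' else 0)).
    by move=> g _; rewrite tXM.
  case e : k./2 => [|k']; first exact: aregC.
  by apply: areg_eq (areg_flat _ (k := k'.*2.+1) _); [move=> g _; exact: flat2|lia].
- move=> k lt; rewrite /flat; case ok: (odd k) => /=; last first.
    by apply: areg_eq (areg_flat _ (k := k) _); [move=> g _; rewrite /flat ok|lia].
  apply: areg_eq (areg_flat _ (k := k.+2) _); first by move=> g _; rewrite /flat /= negbK ok.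
  by lia.

Qed.

Lemma mu_shift_iter i P : meas P -> (forall g, P g -> forall k, (k < i)%N -> g.2 k = 0) ->
  mu P = mu [set g | P (g.1, tX ^+ i * g.2)] * Li ^+ i.
Proof.
elim: i P => [|i IH] P mP P0.
  by rewrite expr0 mulr1; apply: mu_ext => -[u w] /=; rewrite mul1r.
rewrite mu_shift //; last by move=> g Pg; exact: P0.
rewrite IH.
- rewrite -mulrA -exprSr; congr (_ * _); apply: mu_ext => g /=.
  by rewrite mulrA -exprS.
- apply: (meas_comp (Phi := fun g => (g.1, tX * g.2)) mP); apply: afps_pair; first exact: afps1.
  by apply: afpsM; [exact: afpsC|exact: afps2].
by move=> g /P0 /= H k lt; have := H k.+1 lt; rewrite tXM.
Qed.

Lemma mu_swap P : meas P -> mu [set g | P (g.2, g.1)] = mu P.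
Proof.
move=> mP; have [a Ha] := meas_even mP.
have r (A : set (arcs)) k : (k < a.*2)%N -> areg a.*2 A (fun g => flat (g.2, g.1) k).
  move=> lt; rewrite /flat; case ok : (odd k) => /=.
    by apply: areg_eq (areg_flat _ (k := k./2.*2) _); [move=> g _; exact: flat1|lia].
  by apply: areg_eq (areg_flat _ (k := k./2.*2.+1) _); [move=> g _; exact: flat2|lia].
have := @mu_iso a.*2 0 P [set g | P (g.2, g.1)] setT (fun g => (g.2, g.1)) (fun g => (g.2, g.1)).
rewrite addn0 expr0 mulr1; case=> //=.
- exact: Ha.
- exact: lvlT.
- by move=> [u w]; split=> // -[].
- by move=> [u w].
- by move=> k; exact: r.
by move=> k; exact: r.
Qed.

Lemma has_orderP (u : fps C) i : has_order u i -> u = tX ^+ i * Fps (fun k => u (i + k)%N).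
Proof.
elim: i u => [|i IH] u [u0 ui]; first by rewrite mul1r; apply: fpsP => k.
rewrite exprS -mulrA -[LHS]tX_tail; last exact: u0.
congr (_ * _); rewrite (IH (tail u)); last by split=> [k lt|//]; apply: u0.
by congr (_ * _); apply: fpsP => k.
Qed.

(** Multiplication by [u] is multiplication by [t^i], which costs [Li^i], followed by multiplication
    by the unit [u / t^i], which preserves the measure. *)
Lemma mu_blowup i P : meas P ->
  (forall g, P g -> has_order g.1 i /\ forall k, (k < i)%N -> g.2 k = 0) ->
  mu P = mu [set g | has_order g.1 i /\ P (g.1, g.1 * g.2)] * Li ^+ i.
Proof.
move=> mP PH; rewrite (@mu_shift_iter i) //; last by move=> g /PH [].
congr (_ * _); set P1 := [set g | _].
have mP1 : meas P1.
  apply: (meas_comp (Phi := fun g => (g.1, tX ^+ i * g.2)) mP); apply: afps_pair; first exact: afps1.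
  by apply: afpsM; [exact: afpsC|exact: afps2].
have [a0 Ha] := meas_even mP1; pose a := a0.+1; have lP1 : lvl a.*2 P1 by apply: Ha; rewrite /a.
(* The unit [u / t^i] is cut off after [a] coefficients in order to depend on finitely many
   coefficients of [u]. The set [P1] does not see the difference. *)
pose E (u : fps C) : fps C := Fps (fun k => if (k < a)%N then u (i + k)%N else 0).
have /boolp.choice [inv Hinv] : forall h : fps C, exists h', h 0%N != 0 -> h * h' = 1.
  move=> h; have [h0|h0] := eqVneq (h 0%N) 0; first by exists 0.
  by have [h' H] := fps_inv (mulfV h0); exists h'.
have E0 u : has_order u i -> E u * inv (E u) = 1.
  by move=> [_ /eqP ui]; apply: Hinv; rewrite fpsE /a /= addn0.
pose T := [set u : fps C | has_order u i].
have RE N : (((a + i).*2) <= N)%N -> aregs N [set g : arcs | T g.1] (a + i) (fun g => E g.1).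
  move=> le k lt; rewrite /E; case ka: (k < a)%N; last first.
    by apply: areg_eq (aregC _ _ 0) => g _; rewrite fpsE ka.
  apply: areg_eq (areg_flat _ (k := (i + k).*2) _); first by move=> g _; rewrite fpsE ka flat1.
  by lia.
have := @mu_triang (a + i) P1 T E (fun u => inv (E u)) (fun=> 0).
case=> //.
- by apply: Ha; rewrite /a; lia.
- apply: lvl_ext (lvlI (@lvl_all _ i (fun k => [set g | flat g k.*2 = 0]) _) (lvlC (@lvl_flat _ i.*2 _))).
  + move=> g /=; rewrite /T /has_order /= -flat1; split=> -[H1 H2]; split=> // k lt.
      by rewrite flat1; exact: H1.
    by rewrite -flat1; exact: H1.
  + by move=> k lt; apply: lvl_flat; lia.
  by rewrite /a; lia.
- by move=> g /PH [].
- exact: RE.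
- by apply: (@aregs_inv _ _ _ (fun g => E g.1)) => [g /E0|]; last exact: RE.
- exact: aregsC.
move=> _ <-; apply: mu_ext => -[u w] /=.
have dep : has_order u i -> P1 (u, E u * w + 0) <-> P (u, u * w).
  move=> ou; rewrite addr0; have -> : P (u, u * w) <-> P1 (u, Fps (fun k => u (i + k)%N) * w).
    by rewrite /P1 /= mulrA -has_orderP.
  have ag : agree_upto a.-1 (E u * w) (Fps (fun k => u (i + k)%N) * w).
    by apply: agree_mul => k lt //; rewrite /E !fpsE ifT // /a ltnS.
  by split; apply: (lvl_even_dep lP1) => //= k lt; rewrite ag // -ltnS.
by split=> -[ou H]; split=> //; apply/(dep ou).
Qed.

Definition box i j : set arcs := [set g : arcs | (forall k, (k < i)%N -> g.1 k = 0) /\ forall k, (k < j)%N -> g.2 k = 0].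
Lemma meas_box i j : meas (box i j).
Proof. by apply: measI; [apply: (meas_ge _ afps1)|apply: (meas_ge _ afps2)]. Qed.
Lemma mu_setT : mu setT = 1.
Proof.
have -> : 1 = cl [set: 'rV[C]_0] * Li ^+ 0.
  by rewrite expr0 mulr1 cl_mc ?mc_point //; [exact: locally_closedT|exact: constrT].
by apply: mu_arep; split=> //; exact: constrT.
Qed.
Lemma mu_box i j : mu (box i j) = Li ^+ (i + j).
Proof.
have H0 j' : mu (box 0 j') = Li ^+ j'.
  rewrite (@mu_shift_iter j'); [|exact: meas_box|by move=> g []].
  rewrite -[RHS]mul1r -mu_setT; congr (_ * _); apply: mu_ext => g; split=> // _; split=> //= k lt.
  by rewrite tXnM leqNgt lt.
rewrite -mu_swap; last exact: meas_box.
rewrite (@mu_shift_iter i); first last.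
- by move=> g [].
- apply: (meas_comp (Phi := fun g => (g.2, g.1)) (meas_box i j)).
  by apply: afps_pair; [exact: afps2|exact: afps1].
rewrite addnC exprD -(H0 j) -[mu (box 0 j)]mu_swap; last exact: meas_box.
congr (_ * _); apply: mu_ext => g /=; rewrite /box /=; split=> [[_ H]|[_ H]]; split=> // k lt.
by rewrite tXnM leqNgt lt.
Qed.
End Arcs.

(** * Series along arcs; measures of cells and of root cells *)

Section Evaluation.
Variable C : numClosedFieldType.
Notation M := (motring C).
Notation Li := (Lef_inv C).
Notation arcs := (Defs.arc C).
Notation S := (fps (fps C)).
Implicit Types (F G : S) (g : arcs) (A P : set arcs) (psi h : fps C).

Definition ev F g : fps C := fps_subst F g.1 g.2.

Lemma afps_ev F : afps (ev F).
Proof.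
move=> k; apply: (@afun_eq _ _ (fun g => \sum_(i < k.+1) \sum_(j < k.+1) F i j * (g.1 ^+ i * g.2 ^+ j) k)) => //.
apply: afun_sum => i _; apply: afun_sum => j _; apply: afunM; first exact: afunC.
by apply: (afpsM (afpsX i (@afps1 C)) (afpsX j (@afps2 C))).
Qed.

Lemma constr_comp n m (T : set 'rV[C]_n) (phi : 'rV[C]_m -> 'rV[C]_n) : constr T ->
  (forall k, reg setT (fun w => phi w 0 k)) -> constr [set w | T (phi w)].
Proof.
move=> [ps [beta R]] Rphi; have [f Hf] := boolp.choice (fun p => reg_zero (reg_comp p Rphi)).
exists [seq f p | p <- ps], beta => w; rewrite /= R; suff -> : bits ps (phi w) = bits [seq f p | p <- ps] w by [].
by rewrite /bits -map_comp; apply: eq_map => p /=; rewrite Hf.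
Qed.

(** If [A] depends only on the first [N] coefficients, it can be tested on arcs whose other
    coefficients are zero, and this is a constructible condition on the [N] coefficients. *)
Lemma lvl_of_meas N A : meas A -> (forall g g', jv N g = jv N g' -> A g -> A g') -> lvl N A.
Proof.
move=> [K [T [cT HT]]] dep; exists [set v : 'rV[C]_N | A (arcv v)]; split; last first.
  by move=> g; split; apply: dep; rewrite jv_arcv.
have := @constr_comp K N T (fun v => jv K (arcv v)) cT; case=> [k|ps [beta R]].
  have [lt|ge] := ltnP k N; last first.
    apply: reg_eq (regC _ 0) => v _; rewrite mxE /arcv flatK.
    by case: insubP => //= u; rewrite ltnNge ge.
  by apply: reg_eq (reg_coord _ (Ordinal lt)) => v _; rewrite mxE /arcv flatK insubT //=.
by exists ps, beta => v; rewrite -R /= HT.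
Qed.

Lemma meas_locus F n : meas (contact_locus F n).
Proof.
have m0 H : afps H -> meas [set g : arcs | H g 0%N = 0] by move=> HH; apply: meas0.
apply: meas_ext (measI (measI (m0 _ (@afps1 C)) (m0 _ (@afps2 C))) (meas_order n (@afps_ev F))) => g.
by split=> [[[? ?] ?]|[? ? ?]].
Qed.

Lemma locus_dep F n g g' : agree_upto n g.1 g'.1 -> agree_upto n g.2 g'.2 ->
  contact_locus F n g -> contact_locus F n g'.
Proof.
move=> E1 E2 [c1 c2 [H1 H2]]; have E := agree_subst F E1 E2.
split; rewrite -?E1 -?E2 //; split=> [k lt|]; rewrite -E //; first exact: H1.
exact: ltnW.
Qed.

(** In [jet] the first component precedes the second, here the coefficients are interleaved; the
    reordering is a regular bijection, to which [transport] applies. *)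
Lemma zeta_mu F n : motivic_zeta F n = mu (contact_locus F n).
Proof.
rewrite /motivic_zeta fpsE /cylinder_measure -mcE mul2n; set A := contact_locus F n.
have lA : lvl n.+1.*2 A.
  apply: lvl_of_meas (meas_locus F n) _ => g g' E; apply: locus_dep => k le.
    by rewrite !flat1; apply: jvP E _; lia.
  by rewrite !flat2; apply: jvP E _; lia.
have [T [cT HT]] := lA; rewrite (mu_arep (conj cT HT)); congr (_ * _).
pose arcw (w : 'rV[C]_(n.+1 + n.+1)) : arcs :=
  (Fps (fun k => if insub k is Some i then w 0 (lshift n.+1 i) else 0),
   Fps (fun k => if insub k is Some i then w 0 (rshift n.+1 i) else 0)).
have jarc w : jet n (arcw w) = w.
  apply/rowP => i; rewrite -(splitK i); case: (fintype.split i) => j /=.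
    by rewrite row_mxEl mxE /= fpsE insubT //= => lt; congr (w _ (lshift _ _)); apply: val_inj.
  by rewrite row_mxEr mxE /= fpsE insubT //= => lt; congr (w _ (rshift _ _)); apply: val_inj.
have jdep g g' : jet n g = jet n g' -> A g -> A g'.
  move=> E; apply: locus_dep => k le; have lt : (k < n.+1)%N by [].
    by have := congr1 (fun v : 'rV__ => v 0 (lshift _ (Ordinal lt))) E; rewrite /= !row_mxEl !mxE.
  by have := congr1 (fun v : 'rV__ => v 0 (rshift _ (Ordinal lt))) E; rewrite /= !row_mxEr !mxE.
have SE w : (jet n @` A) w <-> A (arcw w).
  split=> [[g Ag <-]|Aw]; last by exists (arcw w).
  by apply: jdep Ag; rewrite jarc.
have [cS clS] : constr (jet n @` A) /\ cl (jet n @` A) = cl T.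
  apply: (@transport _ _ _ T (jet n @` A) setT (fun v => jet n (arcv v)) (fun w => jv n.+1.*2 (arcw w))) => //.
  - exact: constrT.
  - by move=> w; rewrite SE HT; split=> [|[]].
  - by move=> v Tv; exists (arcv v) => //; apply/HT; rewrite jv_arcv.
  - move=> v Tv; rewrite -[RHS]jv_arcv; apply: jv_eq => k lt; rewrite /flat.
    by case ok : (odd k); rewrite /= fpsE insubT ?jarc /=; try lia; move=> lt'; rewrite ?row_mxEr ?row_mxEl mxE.
  - move=> w _; rewrite -[RHS]jarc; apply/rowP => i; rewrite -(splitK i); case: (fintype.split i) => j /=.
      have lt : (j.*2 < n.+1.*2)%N by have := ltn_ord j; lia.
      rewrite /jet !row_mxEl !mxE [in LHS]flat1 /arcv flatK.
      by case: insubP => [k _ kE|]; [rewrite mxE kE -flat1|rewrite lt].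
    have lt : (j.*2.+1 < n.+1.*2)%N by have := ltn_ord j; lia.
    rewrite /jet !row_mxEr !mxE [in LHS]flat2 /arcv flatK.
    by case: insubP => [k _ kE|]; [rewrite mxE kE -flat2|rewrite lt].
  - move=> i; rewrite -(splitK i); case: (fintype.split i) => j /=.
      have lt : (j.*2 < n.+1.*2)%N by have := ltn_ord j; lia.
      by apply: reg_eq (reg_coord _ (Ordinal lt)) => v _; rewrite row_mxEl mxE flat1 /arcv flatK insubT.
    have lt : (j.*2.+1 < n.+1.*2)%N by have := ltn_ord j; lia.
    by apply: reg_eq (reg_coord _ (Ordinal lt)) => v _; rewrite row_mxEr mxE flat2 /arcv flatK insubT.
  move=> i; apply: reg_eq (_ : reg _ (fun w => if odd i then w 0 (rshift n.+1 (inord i./2)) else w 0 (lshift n.+1 (inord i./2)))).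
    move=> w _; rewrite mxE /flat; have := ltn_ord i; case: (odd i) => lt; rewrite /= fpsE insubT /=; try lia.
      by move=> lt'; congr (w _ (rshift _ _)); apply: val_inj; rewrite /= inordK //; lia.
    by move=> lt'; congr (w _ (lshift _ _)); apply: val_inj; rewrite /= inordK //; lia.
  by case: (odd i); exact: reg_coord.
by rewrite -clS cl_mc //; exact: contact_jets_locally_closed.
Qed.

(** A series in one variable read as a series in [z1] alone. An arc thereby becomes a substitution,
    and evaluation along arcs inherits from [pull] that it is a ring morphism compatible with
    composition. *)
Definition xlift (h : fps C) : S := Fps (fun k => fps_const (h k)).
Lemma lift_row h i : xlift h i = fps_const (h i). Proof. by []. Qed.
Lemma liftE h i j : xlift h i j = h i *+ (j == 0%N).
Proof. by rewrite lift_row fps_constE. Qed.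
Lemma lift_inj : injective xlift.
Proof. by move=> h k E; apply: fpsP => i; have := congr1 (fun F : S => F i 0%N) E; rewrite /= !liftE. Qed.
Lemma lift_zmod : zmod_morphism xlift.
Proof. by move=> h k; apply: fpsP => i; rewrite fpsB !lift_row fpsB rmorphB. Qed.
HB.instance Definition _ := GRing.isZmodMorphism.Build (fps C) S xlift lift_zmod.
Lemma lift_monoid : monoid_morphism xlift.
Proof.
split=> [|h k]; apply: fpsP => i.
  by rewrite lift_row !fps1; case: eqP => _; rewrite ?rmorph1 ?rmorph0.
by rewrite lift_row !fpsM rmorph_sum; apply: eq_bigr => j _; rewrite rmorphM !lift_row.
Qed.
HB.instance Definition _ := GRing.isMonoidMorphism.Build (fps C) S xlift lift_monoid.

Lemma pull_ext (s t : subst2 C) : sX s = sX t -> sY s = sY t -> pull s = pull t.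
Proof. by move=> E1 E2; apply: funext => F; rewrite /pull E1 E2. Qed.

Definition centered g := g.1 0%N = 0 /\ g.2 0%N = 0.
Lemma lift_tge (h : fps C) : h 0%N = 0 -> tge 1 (xlift h).
Proof. by move=> h0 i j ij; rewrite liftE (_ : i = 0%N) ?h0 ?mul0rn //; lia. Qed.
Definition asub g (cg : centered g) := Subst2 (lift_tge cg.1) (lift_tge cg.2).

Lemma ev_pull g (cg : centered g) F : pull (asub cg) F = xlift (ev F g).
Proof.
apply: fps2P => k l; rewrite liftE (@pullE C (k + l)) //=.
have E i j : (xlift g.1 ^+ i * xlift g.2 ^+ j) k l = (g.1 ^+ i * g.2 ^+ j) k *+ (l == 0%N).
  by rewrite -!rmorphXn -rmorphM liftE.
have [l0|l0] := eqVneq l 0%N; last first.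
  by rewrite big1 // => i _; rewrite big1 // => j _; rewrite E (negbTE l0) mulr0.
rewrite {}l0 in E *; rewrite addn0 mulr1n; apply: eq_bigr => i _; apply: eq_bigr => j _.
by rewrite E mulr1n.
Qed.

Lemma evM F G g : centered g -> ev (F * G) g = ev F g * ev G g.
Proof.
move=> cg; apply: lift_inj; rewrite -(ev_pull cg) (rmorphM (pull (asub cg))) /= !(ev_pull cg).
by rewrite (rmorphM xlift).
Qed.
Lemma evD F G g : centered g -> ev (F + G) g = ev F g + ev G g.
Proof.
move=> cg; apply: lift_inj; rewrite -(ev_pull cg) (rmorphD (pull (asub cg))) /= !(ev_pull cg).
by rewrite (rmorphD xlift).
Qed.
Lemma evX F n g : centered g -> ev (F ^+ n) g = ev F g ^+ n.
Proof.
move=> cg; apply: lift_inj; rewrite -(ev_pull cg) (rmorphXn (pull (asub cg))) /= (ev_pull cg).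
by rewrite (rmorphXn xlift).
Qed.
Lemma ev_mono2 i j g : centered g -> ev (mono2 C i j) g = g.1 ^+ i * g.2 ^+ j.
Proof. by move=> cg; apply: lift_inj; rewrite -(ev_pull cg) pull_mono rmorphM !rmorphXn. Qed.
Lemma ev_X g : centered g -> ev (mono2 C 1 0) g = g.1.
Proof. by move=> cg; rewrite (ev_mono2 _ _ cg) expr1 expr0 mulr1. Qed.
Lemma ev_Y g : centered g -> ev (mono2 C 0 1) g = g.2.
Proof. by move=> cg; rewrite (ev_mono2 _ _ cg) expr1 expr0 mul1r. Qed.
Lemma ev_cst c g : centered g -> ev (cst c) g = fps_const c.
Proof.
move=> cg; apply: lift_inj; rewrite -(ev_pull cg) pull_cst; apply: fps2P => i j.
by rewrite liftE cstE fps_constE.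
Qed.
Lemma ev0 F g : centered g -> ev F g 0%N = F 0%N 0%N.
Proof.
move=> [c1 c2]; rewrite /ev /fps_subst fpsE !big_ord_recl !big_ord0 !addr0 !expr0 mulr1.
by rewrite -[RHS]mulr1; congr (_ * _); rewrite fps1.
Qed.
Lemma ev_lift psi g : ev (xlift psi) g = psub psi g.1.
Proof.
apply: fpsP => k; rewrite /ev /fps_subst /psub !fpsE; apply: eq_bigr => i _.
rewrite big_ord_recl big1 ?addr0 => [|j _]; last by rewrite liftE mulr0n mul0r.
by rewrite liftE expr0 mulr1.
Qed.
Lemma ev_comp s F g : centered g -> ev (pull s F) g = ev F (ev (sX s) g, ev (sY s) g).
Proof.
move=> cg; have cT : centered (ev (sX s) g, ev (sY s) g).
  by split; rewrite /= ev0 //; [apply: sX1|apply: sY1].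
apply: lift_inj; rewrite -(ev_pull cg) -(ev_pull cT) pull_comp.
by rewrite (@pull_ext (scomp s (asub cg)) (asub cT)) //= ev_pull.
Qed.

Lemma psub0 (psi u : fps C) : psi 0%N = 0 -> u 0%N = 0 -> psub psi u 0%N = 0.
Proof. by move=> p0 u0; rewrite /psub fpsE big_ord_recl big_ord0 p0 mul0r addr0. Qed.
Lemma psub_const c (u : fps C) : psub (fps_const c) u = fps_const c.
Proof.
apply: fpsP => k; rewrite /psub fpsE big_ord_recl big1 ?addr0 => [|j _]; last by rewrite fps_constE mulr0n mul0r.
have -> : (u ^+ (ord0 : 'I_k.+1)) k = (k == 0%N)%:R by rewrite -fps1.
by rewrite !fps_constE mulr1n mulr_natr.
Qed.

Lemma shear_tge psi : psi 0%N = 0 -> tge 1 (mono2 C 0 1 + xlift psi).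
Proof. by move=> p0; apply: tgeD; [exact: tge_mono2_1|exact: lift_tge]. Qed.
Definition shear psi (p0 : psi 0%N = 0) := Subst2 (@tge_mono2_1 C 1 0 isT) (shear_tge p0).
Lemma ev_shear psi (p0 : psi 0%N = 0) F g : centered g ->
  ev (pull (shear p0) F) g = ev F (g.1, g.2 + psub psi g.1).
Proof.
by move=> cg; rewrite (ev_comp _ _ cg) [sX _]/(mono2 C 1 0) [sY _]/(mono2 C 0 1 + xlift psi) (evD _ _ cg)
  (ev_X cg) (ev_Y cg) ev_lift.
Qed.
Lemma ev_swap F g : centered g -> ev (tr F) g = ev F (g.2, g.1).
Proof.
by move=> cg; rewrite (ev_comp _ _ cg) [sX _]/(mono2 C 0 1) [sY _]/(mono2 C 1 0) (ev_X cg) (ev_Y cg).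
Qed.

Lemma has_orderM (h k : fps C) m n : has_order h m -> has_order k n ->
  has_order (h * k) (m + n) /\ (h * k) (m + n)%N = h m * k n.
Proof.
move=> [h0 hm] [k0 kn]; have [H1 H2] := fps_low h0 k0; split=> //; split=> //.
by rewrite H2; apply/eqP; rewrite mulf_neq0 //; exact/eqP.
Qed.
Lemma has_order_uniq (h : fps C) m n : has_order h m -> has_order h n -> m = n.
Proof.
move=> [h0 hm] [k0 kn]; apply/eqP; case: ltngtP => // lt; first by case: hm; exact: k0.
by case: kn; exact: h0.
Qed.
Lemma has_orderX (h : fps C) m n : has_order h m -> has_order (h ^+ n) (n * m) /\ (h ^+ n) (n * m)%N = h m ^+ n.
Proof.
move=> H; elim: n => [|n [IH1 IH2]].
  by rewrite mul0n !expr0 fps1; split=> //; split=> //; apply/eqP; exact: oner_neq0.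
by rewrite exprS mulSn exprS -IH2; apply: has_orderM.
Qed.
Lemma has_order_ex (h : fps C) n : (exists2 k, h k <> 0 & (k <= n)%N) -> exists2 m, has_order h m & (m <= n)%N.
Proof.
move=> [k hk le]; have [|m hm lm] := @fps_eq0P C h; first by move=> h0; rewrite h0 fps0 in hk.
exists m; first by split=> //; exact/eqP.
by apply: leq_trans le; rewrite leqNgt; apply/negP => /lm.
Qed.
Lemma has_order_divl (h k : fps C) m n : has_order h m -> has_order (h * k) (m + n) -> has_order k n.
Proof.
move=> hm hk; have [k0|k0] := pselect (k = 0).
  by case: hk => _; rewrite k0 mulr0 fps0.
have [r kr lr] := fps_eq0P k0; have kr' : has_order k r by split=> //; exact/eqP.
have [H _] := has_orderM hm kr'; have /eqP := has_order_uniq H hk.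
by rewrite eqn_add2l => /eqP <-.
Qed.
Lemma has_order0 (h : fps C) : has_order h 0 <-> h 0%N <> 0.
Proof. by split=> [[]|]. Qed.

Definition cell i j : set arcs := [set g | has_order g.1 i /\ has_order g.2 j].
Lemma meas_cell i j : meas (cell i j).
Proof. by apply: measI; [exact: (meas_order _ (@afps1 C))|exact: (meas_order _ (@afps2 C))]. Qed.
Definition cellr i j : set arcs := [set g : arcs | has_order g.1 i /\ forall k, (k < j)%N -> g.2 k = 0].
Lemma meas_cellr i j : meas (cellr i j).
Proof. by apply: measI; [exact: (meas_order _ (@afps1 C))|exact: (meas_ge _ (@afps2 C))]. Qed.

Lemma ge_succ (h : fps C) n : (forall k, (k < n.+1)%N -> h k = 0) <-> (forall k, (k < n)%N -> h k = 0) /\ h n = 0.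
Proof.
split=> [H|[H1 H2] k]; first by split=> [k lt|]; apply: H => //; exact: ltnW.
by rewrite ltnS leq_eqVlt => /orP[/eqP ->|/H1].
Qed.

Lemma mu_cellr i j : mu (cellr i j) = (1 - Li) * Li ^+ (i + j).
Proof.
have := mu_split (meas_box C i j) (meas0 (@afps1 C i)).
have -> : mu (box i j `&` [set g : arcs | g.1 i = 0]) = mu (box i.+1 j).
  by apply: mu_ext => g; split=> [[[H1 H2] H3]|[/ge_succ [H1 H3] H2]] //; split=> //; exact/ge_succ.
have -> : mu (box i j `&` ~` [set g : arcs | g.1 i = 0]) = mu (cellr i j).
  by apply: mu_ext => g; split=> [[[H1 H2] H3]|[[H1 H3] H2]].
rewrite (mu_box C i.+1) addSn exprS => H.
by have -> : mu (cellr i j) = Li ^+ (i + j) - Li * Li ^+ (i + j);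
  [rewrite -[X in X - _](mu_box C i j) H addrAC subrr add0r|ring].
Qed.
Lemma mu_cell i j : mu (cell i j) = (1 - Li) ^+ 2 * Li ^+ (i + j).
Proof.
have := mu_split (meas_cellr i j) (meas0 (@afps2 C j)).
have -> : mu (cellr i j `&` [set g : arcs | g.2 j = 0]) = mu (cellr i j.+1).
  by apply: mu_ext => g; split=> [[[H1 H2] H3]|[H1 /ge_succ [H2 H3]]] //; split=> //; exact/ge_succ.
have -> : mu (cellr i j `&` ~` [set g : arcs | g.2 j = 0]) = mu (cell i j).
  by apply: mu_ext => g; split=> [[[H1 H2] H3]|[H1 [H2 H3]]].
move=> H; have -> : mu (cell i j) = mu (cellr i j) - mu (cellr i j.+1).
  by rewrite H addrAC subrr add0r.
by rewrite !mu_cellr addnS exprS; ring.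
Qed.

Section RootChart.
Variables (p q al be : nat) (c : C).
Definition Troot g : arcs :=
  (g.1 ^+ p * (fps_const c + g.2) ^+ al, g.1 ^+ q * (fps_const c + g.2) ^+ be).
Lemma Troot_order l g : c != 0 -> has_order g.1 l -> g.2 0%N = 0 ->
  [/\ has_order (Troot g).1 (p * l), has_order (Troot g).2 (q * l),
     (Troot g).1 (p * l)%N = g.1 l ^+ p * c ^+ al & (Troot g).2 (q * l)%N = g.1 l ^+ q * c ^+ be].
Proof.
move=> c0 ol w0; have E : (fps_const c + g.2) 0%N = c by rewrite fpsD w0 addr0 fps_constE.
have oc : has_order (fps_const c + g.2) 0 by apply/has_order0; rewrite E; exact/eqP.
have H r e : has_order (g.1 ^+ r * (fps_const c + g.2) ^+ e) (r * l) /\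
    (g.1 ^+ r * (fps_const c + g.2) ^+ e) (r * l)%N = g.1 l ^+ r * c ^+ e.
  have [H1 E1] := has_orderX r ol; have [H2 E2] := has_orderX e oc.
  by rewrite muln0 in H2 E2; have := has_orderM H1 H2; rewrite addn0 E1 E2 E.
by split; have [] := H p al; have [] := H q be.
Qed.
End RootChart.

Definition root_cell p q c l : set arcs := [set g : arcs | [/\ has_order g.1 (p * l), has_order g.2 (q * l) &
  g.2 (q * l)%N ^+ p = c * g.1 (p * l)%N ^+ q]].

(* al and be are Bezout coefficients: Troot is then a bijection onto the root cells. *)
Definition root_chart p q al be := (p * be = q * al + 1)%N /\ forall c l P, c != 0 -> (0 < l)%N -> meas P ->
  (forall g, P g -> root_cell p q c l g) ->
  mu P = mu [set g : arcs | [/\ has_order g.1 l, g.2 0%N = 0 & P (Troot p q al be c g)]] * Li ^+ ((p + q).-1 * l).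

Lemma meas_blow P i : meas P -> meas [set g : arcs | has_order g.1 i /\ P (g.1, g.1 * g.2)].
Proof.
move=> mP; apply: measI; first exact: (meas_order _ (@afps1 C)).
apply: (meas_comp (Phi := fun g => (g.1, g.1 * g.2)) mP); apply: afps_pair; first exact: afps1.
by apply: afpsM; [exact: afps1|exact: afps2].
Qed.
Lemma meas_swap P : meas P -> meas [set g : arcs | P (g.2, g.1)].
Proof.
move=> mP; apply: (meas_comp (Phi := fun g => (g.2, g.1)) mP); apply: afps_pair; first exact: afps2.
exact: afps1.
Qed.

(** After the blowup [(u, w) -> (u, u w)] the arcs of the root cell have [w(0) = c]; the translation
    by [c] is a shear with constant [psi]. *)
Lemma root_chart11 : root_chart 1 1 0 1.
Proof.
split=> // c l P c0 l0 mP PH; rewrite (@mu_blowup C l) // => [|g /PH [H1 [H2 _] _]]; last first.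
  by rewrite mul1n in H1 H2; split.
rewrite addn1 mul1n; congr (_ * _); rewrite -(@mu_shear C (fps_const c)); last 2 first.
- exact: meas_blow.
- by move=> g [[H _] _]; exact: H.
apply: mu_ext => -[u w] /=; rewrite psub_const /Troot /= !expr1 expr0 mulr1 addrC.
split=> [[u0 [ou HP]]|[ou w0 HP]]; last by split; [case: ou => H _; apply: H|split].
split=> //.
have [_ _] := PH _ HP; rewrite /= !mul1n !expr1; case: ou => u_lt /eqP ul.
have z : forall k, (k < 0)%N -> (fps_const c + w) k = 0 by [].
have [_] := fps_low u_lt z; rewrite addn0 fpsD fps_constE => ->.
by rewrite mulrC => /(mulIf ul); rewrite -[RHS]addr0 => /addrI.
Qed.

Lemma root_chart_right p q al be : (0 < p)%N -> (0 < q)%N -> root_chart p q al be -> root_chart p (p + q) al (al + be).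
Proof.
move=> p0 q0 [Bz H]; split=> [|c l P c0 l0 mP PH]; first by lia.
rewrite (@mu_blowup C (p * l)) // => [|g /PH [H1 [H2 _] _]]; last first.
  by split=> // k lt; apply: H2; rewrite mulnDl; lia.
rewrite (H c l) //; last 2 first.
- exact: meas_blow.
- move=> g [o1 /PH [_ /=]]; rewrite mulnDl => o2 E; have o3 := has_order_divl o1 o2; split=> //.
  move: E; have [_ ->] := has_orderM o1 o3; case: o1 => _ /eqP A0.
  rewrite exprMn exprD mulrCA => /mulfI; apply; exact: expf_neq0.
rewrite -mulrA -exprD; congr (_ * _ ^+ _); last by rewrite -mulnDl; congr (_ * _)%N; lia.
apply: mu_ext => g; have E : (Troot p q al be c g).1 * (Troot p q al be c g).2 = (Troot p (p + q) al (al + be) c g).2.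
  by rewrite /Troot /= !exprD; ring.
split=> [[o1 w0 [_ HP]]|[o1 w0 HP]].
  by split=> //; move: HP; rewrite E.
split=> //; split; first by have [] := @Troot_order p q al be c l g c0 o1 w0.
by rewrite E.
Qed.

Lemma root_chart_left p q al be : (0 < p)%N -> (0 < q)%N -> root_chart p q al be -> root_chart (q + p) q (al + be) be.
Proof.
move=> p0 q0 [Bz H]; split=> [|c l P c0 l0 mP PH]; first by lia.
rewrite -mu_swap // (@mu_blowup C (q * l)); first last.
- by move=> g /PH [/= [H1 _] H2 _]; split=> // k lt; apply: H1; rewrite mulnDl; lia.
- exact: meas_swap.
rewrite -mu_swap; last by apply: meas_blow; exact: meas_swap.
rewrite (H c l) //; last 2 first.
- by apply: meas_swap; apply: meas_blow; exact: meas_swap.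
- move=> g /= [o1 /PH [/=]]; rewrite mulnDl => o2 _ E; have o3 := has_order_divl o1 o2; split=> //.
  move: E; have [_ ->] := has_orderM o1 o3; case: o1 => _ /eqP A0.
  rewrite exprMn exprD mulrCA => /mulfI; apply; exact: expf_neq0.
rewrite -mulrA -exprD; congr (_ * _ ^+ _); last by rewrite -mulnDl; congr (_ * _)%N; lia.
apply: mu_ext => g; have E : (Troot p q al be c g).2 * (Troot p q al be c g).1 = (Troot (q + p) q (al + be) be c g).1.
  by rewrite /Troot /= !exprD; ring.
split=> [[o1 w0 /= [_ HP]]|[o1 w0 HP]].
  by split=> //; move: HP; rewrite E.
split=> //=; split; first by have [] := @Troot_order p q al be c l g c0 o1 w0.
by rewrite E.
Qed.

(** Euclid's algorithm on [(p, q)]: each subtraction is one blowup, and the Bezout exponents are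
    updated along with it. *)
Lemma root_chart_exists p q : (0 < p)%N -> (0 < q)%N -> coprime p q -> exists al be, root_chart p q al be.
Proof.
have [n] := ubnP (p + q); elim: n p q => // n IH p q le p0 q0 co.
have [lt|lt|E] := ltngtP p q.
- have [||||al [be H]] := IH p (q - p)%N; try lia.
    by move: co; rewrite -{1}(subnKC (ltnW lt)) /coprime gcdnDl.
  by exists al, (al + be)%N; rewrite -(subnKC (ltnW lt)); apply: root_chart_right => //; lia.
- have [||||al [be H]] := IH (p - q)%N q; try lia.
    by move: co; rewrite -{1}(subnKC (ltnW lt)) /coprime gcdnC gcdnDl gcdnC.
  by exists (al + be)%N, be; rewrite -(subnKC (ltnW lt)); apply: root_chart_left => //; lia.
by move: co; rewrite E /coprime gcdnn => /eqP ->; exists 0, 1; exact: root_chart11.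
Qed.

(** By the Bezout relation [Troot] sends every [(u, w)] with [ord u = l] and [w(0) = 0] into the
    root cell, so the set to be measured is [cellr l 1]. *)
Lemma mu_root_cell p q al be c l : root_chart p q al be -> c != 0 -> (0 < l)%N ->
  meas (root_cell p q c l) /\ mu (root_cell p q c l) = (1 - Li) * Li * Li ^+ ((p + q) * l).
Proof.
move=> [Bz H] c0 l0; have mR : meas (root_cell p q c l).
  have m3 : meas [set g : arcs | g.2 (q * l)%N ^+ p - c * g.1 (p * l)%N ^+ q = 0].
    apply: meas0; apply: afunD; first by apply: afunX; exact: afps2.
    by apply: afunN; apply: afunM; [exact: afunC|apply: afunX; exact: afps1].
  apply: meas_ext (measI (measI (meas_order (p * l) (@afps1 C)) (meas_order (q * l) (@afps2 C))) m3) => g.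
  split=> [[[H1 H2] /eqP H3]|[H1 H2 H3]]; first by split=> //; apply/eqP; rewrite -subr_eq0.
  by split=> //=; apply/eqP; rewrite subr_eq0; apply/eqP.
split=> //; rewrite (H c l _ c0 l0 mR (fun g => id)).
rewrite (@mu_ext _ _ (cellr l 1)) => [|g].
  rewrite mu_cellr -!mulrA -exprD -exprS; congr (_ * Li ^+ _).
  have pq : (0 < p + q)%N by rewrite addn_gt0; case: (posnP p) Bz => // ->; rewrite mul0n addn1.
  by rewrite -(prednK pq) mulSn /=; lia.
split=> [[o1 w0 _]|[o1 w0]]; first by split=> // -[].
have {}w0 := w0 0%N isT; split=> //.
have [H1 H2 E1 E2] := @Troot_order p q al be c l g c0 o1 w0; split=> //.
rewrite E1 E2 !exprMn -!exprM (mulnC q p) (mulnC be p) Bz (mulnC al q) addn1 exprS; ring.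
Qed.
End Evaluation.

Lemma big_widen (V : nmodType) (f : nat -> V) m n : (m <= n)%N -> (forall i, (m <= i)%N -> f i = 0) ->
  \sum_(i < n) f i = \sum_(i < m) f i.
Proof.
move=> /subnKC <- H; rewrite big_split_ord /= [X in _ + X]big1 ?addr0 // => i _.
by apply: H; rewrite leq_addr.
Qed.

(** * Generating series *)

Section Poles.
Variable C : numClosedFieldType.
Notation M := (motring C).
Notation Li := (Lef_inv C).
Notation Z := (fps M).
Implicit Types (z y : Z) (K N : nat).

Lemma Lef_powN K : Lef_pow C (- K%:Z) = Li ^+ K. Proof. by case: K. Qed.

Lemma is_polyM z y : is_polynomial z -> is_polynomial y -> is_polynomial (z * y).
Proof.
move=> [m H] [n H']; exists (m + n)%N => k le; rewrite fpsM big1 // => i _.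
by have [lt|ge] := ltnP i m; [rewrite H' ?mulr0 //; lia|rewrite H ?mul0r].
Qed.
Lemma is_poly_mono c n : is_polynomial (fps_mono c n : Z).
Proof. by exists n.+1 => k lt; rewrite fps_monoE; case: eqP => [e|]; rewrite ?mulr0n //; lia. Qed.

Variable s0 : rat.
(* 1 if 1 - L^-K U^N has its pole at s0 *)
Definition hit K N : nat := - K%:~R / N%:R == s0.
Definition PO z m := pole_order_at_most z s0 m.

Lemma row0_mul z y : (z * y) 0%N = z 0%N * y 0%N.
Proof. by rewrite fpsM_recl big_ord0 addr0. Qed.

Lemma pole_factor0 (ab : int * nat) : (0 < ab.2)%N -> pole_factor C ab 0%N = 1.
Proof. by move=> h; rewrite /pole_factor fpsB fps1 fps_monoE eq_sym (gtn_eqF h) mulr0n subr0. Qed.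

(** The product of the factors has constant term 1 and so is invertible in [M[[U]]]; possible zero
    divisors of [M] do no harm. *)
Lemma PO_intro z (P : seq (int * nat)) m : all (fun ab : int * nat => 0 < ab.2)%N P ->
  (count (fun ab : int * nat => (ab.1)%:~R / (ab.2)%:R == s0) P <= m)%N ->
  is_polynomial (z * \prod_(ab <- P) pole_factor C ab) -> PO z m.
Proof.
move=> hP hc hz; set Q := \prod_(ab <- P) pole_factor C ab.
have Q0 : Q 0%N = 1.
  rewrite /Q; elim: P hP {hc hz Q} => [|ab P IH] /=; first by rewrite big_nil fps1.
  by move=> /andP[h1 h2]; rewrite big_cons row0_mul pole_factor0 // IH // mulr1.
have Q1 : Q 0%N * 1 = 1 by rewrite Q0 mulr1.
have [g Qg] := fps_inv Q1; exists 1, (fun=> z * Q), (fun=> g); split=> //.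
  by move=> _; exists P; split=> //; rewrite mulrC.
by rewrite big_ord1 -mulrA Qg mulr1.
Qed.

Lemma PO_le z m n : (m <= n)%N -> PO z m -> PO z n.
Proof.
move=> le [N [p [g [H1 H2 H3]]]]; exists N, p, g; split=> // i.
by have [P [? c ?]] := H2 i; exists P; split=> //; apply: leq_trans le.
Qed.

Lemma PO_poly z m : is_polynomial z -> PO z m.
Proof. by move=> hz; apply: (@PO_intro z [::]); rewrite ?big_nil ?mulr1. Qed.

Lemma PO0 m : PO 0 m. Proof. by apply: PO_poly; exists 0 => k _. Qed.

Lemma PO_add z y m : PO z m -> PO y m -> PO (z + y) m.
Proof.
move=> [N [p [g [H1 H2 ->]]]] [K [q [h [H1' H2' ->]]]].
exists (N + K)%N, (fun i => match fintype.split i with inl j => p j | inr j => q j end),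
  (fun i => match fintype.split i with inl j => g j | inr j => h j end); split.
- by move=> i; case: (fintype.split i).
- by move=> i; case: (fintype.split i).
rewrite big_split_ord; congr (_ + _); apply: eq_bigr => i _.
  by rewrite (unsplitK (inl i)).
by rewrite (unsplitK (inr i)).
Qed.

Lemma PO_mul c z m : is_polynomial c -> PO z m -> PO (c * z) m.
Proof.
move=> hc [N [p [g [H1 H2 ->]]]]; exists N, (fun i => c * p i), g; split=> //.
  by move=> i; exact: is_polyM.
by rewrite mulr_sumr; apply: eq_bigr => i _; rewrite mulrA.
Qed.

Lemma count1 K N : count (fun ab : int * nat => (ab.1)%:~R / (ab.2)%:R == s0) [:: (- K%:Z, N)] = hit K N.
Proof. by rewrite /= addn0 rmorphN. Qed.

Lemma PO_recurrence z K N n0 : (0 < N)%N -> (forall n, (n0 <= n)%N -> z (n + N)%N = Li ^+ K * z n) ->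
  PO z (hit K N).
Proof.
move=> N0 H; apply: (@PO_intro z [:: (- K%:Z, N)]); rewrite ?count1 //= ?N0 //.
exists (n0 + N)%N => n le; rewrite big_seq1 /pole_factor Lef_powN mulrBr mulr1 fpsB mulrC fps_monoM.
have le' : (N <= n)%N by lia.
by rewrite /= le' -H ?subnK ?subrr //; lia.
Qed.

Lemma PO_lumps z (w : nat -> M) d r K : (0 < d)%N -> (0 < r)%N ->
  (forall n, z n = if (d %| n)%N && (0 < n)%N then w (n %/ d)%N else 0) ->
  (forall l, (0 < l)%N -> w (l + r)%N = Li ^+ K * w l) -> PO z (hit K (d * r)).
Proof.
move=> d0 r0 Hz Hw; apply: (@PO_recurrence z K (d * r)%N 1); first by rewrite muln_gt0 d0.
move=> n n1; rewrite !Hz dvdn_addl ?dvdn_mulr // addn_gt0 n1 andbT.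
case: ifP => [dn|]; last by rewrite mulr0.
rewrite divnDr ?dvdn_mulr // mulKn // Hw //.
by case/dvdnP: dn n1 => e ->; rewrite muln_gt0 mulnK // => /andP[].
Qed.

Section Cone.
Variables (k a h : nat).
Hypotheses (a0 : (0 < a)%N) (h0 : (0 < h)%N).
Implicit Types Om : nat -> nat -> bool.

(* The cells with orders (i, j) in Om, when ord F = a i + h j there. *)
Definition gs Om : Z := Fps (fun n => \sum_(i < n.+1) \sum_(j < n.+1)
  if Om i j && (a * i + h * j == n)%N then Li ^+ (k * i + j) else 0).

Lemma gsE Om n B : (n < B)%N -> gs Om n = \sum_(i < B) \sum_(j < B)
  if Om i j && (a * i + h * j == n)%N then Li ^+ (k * i + j) else 0.
Proof.
move=> lt; rewrite fpsE; pose f i j := if Om i j && (a * i + h * j == n)%N then Li ^+ (k * i + j) else 0 : M.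
have fj i j : (n < j)%N -> f i j = 0 by move=> ltj; rewrite /f; case: eqP => [e|]; rewrite ?andbF //; nia.
have fi i j : (n < i)%N -> f i j = 0 by move=> lti; rewrite /f; case: eqP => [e|]; rewrite ?andbF //; nia.
rewrite (@big_widen _ (fun i => \sum_(j < B) f i j) n.+1) //; last first.
  by move=> i lti; rewrite big1 // => j _; exact: fi.
by apply: eq_bigr => i _; rewrite (@big_widen _ (f i) n.+1 B lt) //; exact: fj.
Qed.

Lemma gs_ext Om Om' : (forall i j, Om i j = Om' i j) -> gs Om = gs Om'.
Proof. by move=> E; apply: fpsP => n; apply: eq_bigr => i _; apply: eq_bigr => j _; rewrite E. Qed.

Lemma gs_split Om P : gs Om = gs (fun i j => Om i j && P i j) + gs (fun i j => Om i j && ~~ P i j).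
Proof.
apply: fpsP => n; rewrite fpsD !fpsE -big_split; apply: eq_bigr => i _; rewrite -big_split; apply: eq_bigr => j _ /=.
by case: (Om i j); case: (P i j); rewrite /= ?addr0 ?add0r.
Qed.

Lemma big_shift (f : nat -> M) p B : \sum_(i < p + B) (if (p <= i)%N then f (i - p)%N else 0) = \sum_(i < B) f i.
Proof.
rewrite big_split_ord /= big1 ?add0r => [|i _]; last by rewrite leqNgt ltn_ord.
by apply: eq_bigr => i _; rewrite leq_addr addKn.
Qed.

Lemma gs_shift Om p q : fps_mono (Li ^+ (k * p + q)) (a * p + h * q) * gs Om =
  gs (fun i j => [&& (p <= i)%N, (q <= j)%N & Om (i - p)%N (j - q)%N]).
Proof.
apply: fpsP => n; rewrite fps_monoM (@gsE _ n (p + (q + n.+1))); last by lia.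
pose f i j : M := if Om i j && (a * (i + p) + h * (j + q) == n)%N then Li ^+ (k * (i + p) + (j + q)) else 0.
transitivity (\sum_(i < p + (q + n.+1)) (if (p <= i)%N then \sum_(j < p + (q + n.+1))
   (if (q <= j)%N then f (i - p)%N (j - q)%N else 0) else 0)); last first.
  apply: eq_bigr => i _; case: leqP => pi; last by rewrite big1.
  by apply: eq_bigr => j _; case: leqP => qj //; rewrite /f !subnK.
rewrite (big_shift (fun i => \sum_(j < p + (q + n.+1)) if (q <= j)%N then f i (j - q)%N else 0)).
have E i : \sum_(j < p + (q + n.+1)) (if (q <= j)%N then f i (j - q)%N else 0) = \sum_(j < p + n.+1) f i j.
  by rewrite addnCA; exact: (big_shift (f i)).
under eq_bigr do rewrite E.
have fz i j : (n < i)%N || (n < j)%N -> f i j = 0.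
  by move=> lt; rewrite /f; case: eqP => [e|]; rewrite ?andbF //; nia.
rewrite (@big_widen _ (fun i => \sum_(j < p + n.+1) f i j) n.+1); last 2 first.
- by lia.
- by move=> i lti; rewrite big1 // => j _; rewrite fz // lti.
transitivity (\sum_(i < n.+1) \sum_(j < n.+1) f i j); last first.
  apply: eq_bigr => i _; apply: esym; apply: (@big_widen _ (f i)) => [|j ltj]; first by lia.
  by rewrite fz // ltj orbT.
case: ifP => le; last first.
  rewrite big1 // => i _; rewrite big1 // => j _; rewrite /f; case: eqP => [e|]; rewrite ?andbF //; nia.
rewrite (@gsE _ _ n.+1); last by lia.
rewrite mulr_sumr; apply: eq_bigr => i _; rewrite mulr_sumr; apply: eq_bigr => j _; rewrite /f.
have -> : (a * i + h * j == n - (a * p + h * q))%N = (a * (i + p) + h * (j + q) == n)%N by apply/eqP/eqP; nia.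
by case: ifP => _; rewrite ?mulr0 // -exprD; congr (Li ^+ _); nia.
Qed.

Lemma gs_bounded Om B : (forall i j, Om i j -> (i < B)%N && (j < B)%N) -> is_polynomial (gs Om).
Proof.
move=> H; exists (a * B + h * B)%N => n le; rewrite fpsE big1 // => i _; rewrite big1 // => j _.
case: ifP => // /andP[/H /andP[ib jb] /eqP e]; nia.
Qed.

(** The factor of the first ray removes the translate of the cone by [(p1, q1)] and leaves a strip
    along the second ray; the factor of the second ray cuts this strip down to a bounded set. The
    determinant [D] is arbitrary, so the cone need not be unimodular. *)
Lemma PO_cone p1 q1 p2 q2 : (0 < p1)%N -> (0 < q2)%N -> (p2 * q1 < p1 * q2)%N ->
  PO (gs (fun i j => (q1 * i < p1 * j)%N && (p2 * j < q2 * i)%N))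
     (hit (k * p1 + q1) (a * p1 + h * q1) + hit (k * p2 + q2) (a * p2 + h * q2)).
Proof.
move=> p10 q20 lt; set Om := fun i j : nat => _; pose D := (p1 * q2 - p2 * q1)%N.
have DE : (p1 * q2 = D + p2 * q1)%N by rewrite /D; lia.
have D0 : (0 < D)%N by rewrite /D; lia.
pose F K N : Z := 1 - fps_mono (Li ^+ K) N.
have e1 : F (k * p1 + q1)%N (a * p1 + h * q1)%N * gs Om = gs (fun i j => Om i j && ~~ (D + p2 * j < q2 * i)%N).
  rewrite /F mulrBl mul1r gs_shift [X in X - _](gs_split _ (fun i j => (D + p2 * j < q2 * i)%N)).
  rewrite [X in X + _ - _](@gs_ext _ (fun i j => [&& (p1 <= i)%N, (q1 <= j)%N & Om (i - p1)%N (j - q1)%N])).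
    by rewrite addrAC subrr add0r.
  move=> i j; rewrite /Om; apply/idP/idP.
    move=> /andP[/andP[h1 h2] h3].
    have f1 : (p1 * (D + p2 * j) < p1 * (q2 * i))%N by rewrite ltn_pmul2l.
    have f2 : (p2 * (q1 * i) <= p2 * (p1 * j))%N by rewrite leq_mul2l (ltnW h1) orbT.
    have f3 : (q1 * (D + p2 * j) <= q1 * (q2 * i))%N by rewrite leq_mul2l (ltnW h3) orbT.
    have f4 : (q2 * (q1 * i) <= q2 * (p1 * j))%N by rewrite leq_mul2l (ltnW h1) orbT.
    have le1 : (p1 <= i)%N by rewrite -(leq_pmul2r D0); nia.
    have le2 : (q1 <= j)%N by rewrite -(leq_pmul2r D0); nia.
    rewrite le1 le2 !mulnBr /=; apply/andP; split; nia.
  move=> /and3P[le1 le2]; rewrite !mulnBr => /andP[h1 h2]; apply/andP; split; [apply/andP; split|]; nia.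
have e2 : F (k * p2 + q2)%N (a * p2 + h * q2)%N * gs (fun i j => Om i j && ~~ (D + p2 * j < q2 * i)%N) =
    gs (fun i j => Om i j && ~~ (D + p2 * j < q2 * i)%N && ~~ (D + q1 * i < p1 * j)%N).
  rewrite /F mulrBl mul1r gs_shift [X in X - _](gs_split _ (fun i j => (D + q1 * i < p1 * j)%N)).
  rewrite [X in X + _ - _](@gs_ext _ (fun i j => [&& (p2 <= i)%N, (q2 <= j)%N &
      Om (i - p2)%N (j - q2)%N && ~~ (D + p2 * (j - q2) < q2 * (i - p2))%N])).
    by rewrite addrAC subrr add0r.
  move=> i j; rewrite /Om; apply/idP/idP.
    move=> /andP[/andP[/andP[h1 h2] h3] h4].
    have f1 : (q2 * (D + q1 * i) < q2 * (p1 * j))%N by rewrite ltn_pmul2l.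
    have f2 : (q1 * (p2 * j) <= q1 * (q2 * i))%N by rewrite leq_mul2l (ltnW h2) orbT.
    have f3 : (p2 * (D + q1 * i) <= p2 * (p1 * j))%N by rewrite leq_mul2l (ltnW h4) orbT.
    have f4 : (p1 * (p2 * j) <= p1 * (q2 * i))%N by rewrite leq_mul2l (ltnW h2) orbT.
    have le1 : (p2 <= i)%N by rewrite -(leq_pmul2r D0); nia.
    have le2 : (q2 <= j)%N by rewrite -(leq_pmul2r D0); nia.
    by rewrite le1 le2 !mulnBr /=; apply/andP; split; [apply/andP; split|]; nia.
  move=> /and3P[le1 le2]; rewrite !mulnBr => /andP[/andP[h1 h2] h3].
  by apply/andP; split; [apply/andP; split; [apply/andP; split|]|]; nia.
apply: (@PO_intro _ [:: (- (k * p1 + q1)%:Z, a * p1 + h * q1)%N; (- (k * p2 + q2)%:Z, a * p2 + h * q2)%N]).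
- by rewrite /= !addn_gt0 !muln_gt0 a0 h0 p10 q20 orbT.
- by rewrite /= addn0 !rmorphN.
rewrite big_cons big_seq1 /pole_factor !Lef_powN -/(F _ _) -[1 - fps_mono (Li ^+ (k * p2 + q2)) _]/(F _ _).
rewrite /= mulrA [gs Om * _]mulrC e1 mulrC e2.
apply: (@gs_bounded _ (p1 + p2 + q1 + q2).+1) => i j /andP[/andP[_]]; rewrite -!leqNgt => h2 h1.
have f1 : (p1 * (q2 * i) <= p1 * (D + p2 * j))%N by rewrite leq_mul2l h2 orbT.
have f2 : (p2 * (p1 * j) <= p2 * (D + q1 * i))%N by rewrite leq_mul2l h1 orbT.
have f3 : (q1 * (q2 * i) <= q1 * (D + p2 * j))%N by rewrite leq_mul2l h2 orbT.
have f4 : (q2 * (p1 * j) <= q2 * (D + q1 * i))%N by rewrite leq_mul2l h1 orbT.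
have b1 : (i <= p1 + p2)%N by rewrite -(leq_pmul2r D0); nia.
have b2 : (j <= q1 + q2)%N by rewrite -(leq_pmul2r D0); nia.
by apply/andP; split; lia.
Qed.
End Cone.
End Poles.

(** * Newton polygons *)

Section Newton.
Variable C : numClosedFieldType.
Notation S := (fps (fps C)).
Implicit Types (F G : S) (psi : fps C) (p q a h i j m n : nat).

Definition wge p q n F := forall i j, (p * i + q * j < n)%N -> F i j = 0.

Lemma wgeM p q m n F G : wge p q m F -> wge p q n G -> wge p q (m + n) (F * G).
Proof.
move=> HF HG i j lt; rewrite fps2M big1 // => x _; rewrite big1 // => y _.
have [l1|l1] := ltnP (p * x + q * y) m; first by rewrite HF ?mul0r.
rewrite HG ?mulr0 //; have := ltn_ord x; have := ltn_ord y; nia.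
Qed.
Lemma wgeD p q n F G : wge p q n F -> wge p q n G -> wge p q n (F + G).
Proof. by move=> HF HG i j lt; rewrite fps2D HF // HG // addr0. Qed.
Lemma wgeW p q m n F : (m <= n)%N -> wge p q n F -> wge p q m F.
Proof. by move=> le H i j lt; apply: H; lia. Qed.
Lemma wge_mono2 p q x y : wge p q (p * x + q * y) (mono2 C x y).
Proof. by move=> i j lt; rewrite mono2E; case: andP => // -[/eqP ? /eqP ?]; subst; lia. Qed.

Lemma coef_expand F N i j : (i <= N)%N -> (j <= N)%N ->
  F i j = \sum_(x < N.+1) \sum_(y < N.+1) F x y * mono2 C x y i j.
Proof.
move=> iN jN; have iN' : (i < N.+1)%N by []. have jN' : (j < N.+1)%N by [].
rewrite (bigD1 (Ordinal iN')) //= [X in _ + X]big1 ?addr0; last first.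
  move=> x ne; rewrite big1 // => y _; rewrite mono2E.
  by rewrite (_ : (i == x) = false) ?mulr0 //; apply/eqP => e; case/eqP: ne; apply: val_inj.
rewrite (bigD1 (Ordinal jN')) //= mono2E !eqxx mulr1 big1 ?addr0 // => y ne.
rewrite mono2E eqxx /= (_ : (j == y) = false) ?mulr0 //.
by apply/eqP => e; case/eqP: ne; apply: val_inj.
Qed.

Section Shear.
Variables (p q : nat) (psi : fps C) (psi0 : psi 0%N = 0).

Lemma wge_lift d : (forall i, psi i != 0 -> (d <= p * i)%N) -> wge p q d (xlift psi).
Proof.
move=> H i j lt; rewrite liftE; case: eqP => [j0|]; rewrite ?mulr0n //.
by apply/eqP; rewrite mulr1n; apply/negPn/negP => /H; lia.
Qed.

Lemma shear_weak n F : (forall i, psi i != 0 -> (q <= p * i)%N) -> wge p q n F -> wge p q n (pull (shear psi0) F).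
Proof.
move=> H HF i j lt; rewrite (@pullE C (i + j)) // big1 // => x _; rewrite big1 // => y _.
have [l1|l1] := ltnP (p * x + q * y) n; first by rewrite HF ?mul0r.
have HY : wge p q q (mono2 C 0 1 + xlift psi).
  apply: wgeD; last exact: wge_lift.
  by have := @wge_mono2 p q 0 1; rewrite muln0 muln1.
have HYX b : wge p q (q * b) ((mono2 C 0 1 + xlift psi) ^+ b).
  by elim: b => [|b IH]; [rewrite muln0|rewrite exprS mulnS; apply: wgeM].
have HX : wge p q (p * x + 0) (mono2 C 1 0 ^+ x).
  by rewrite mono2X mul1n mul0n; have := @wge_mono2 p q x 0; rewrite muln0.
by rewrite (wgeM HX (HYX y)) ?mulr0 //=; lia.
Qed.

(** [w + psi(u)] and [w] differ by terms of weight above [q], so only terms of [F] above the lowest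
    line can change. *)
Lemma shear_strict n F : (forall i, psi i != 0 -> (q < p * i)%N) -> wge p q n F ->
  forall i j, (p * i + q * j <= n)%N -> pull (shear psi0) F i j = F i j.
Proof.
move=> H HF i j le; rewrite (@pullE C (i + j)) // [RHS](@coef_expand _ (i + j)) ?leq_addr ?leq_addl //.
apply: eq_bigr => x _; apply: eq_bigr => y _.
have [l1|l1] := ltnP (p * x + q * y) n; first by rewrite HF ?mul0r.
congr (_ * _); set Y := mono2 C 0 1 + xlift psi.
have HL : wge p q q.+1 (xlift psi) by apply: wge_lift.
have HM : wge p q q (mono2 C 0 1) by have := @wge_mono2 p q 0 1; rewrite muln0 muln1.
have HY : wge p q q Y by apply: wgeD => //; apply: wgeW HL.
have HYX b : wge p q (q * b) (Y ^+ b).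
  by elim: b => [|b IH]; [rewrite muln0|rewrite exprS mulnS; apply: wgeM].
have HR b : wge p q (q * b).+1 (Y ^+ b - mono2 C 0 b).
  elim: b => [|b IH]; first by rewrite expr0 mono200 subrr.
  have -> : Y ^+ b.+1 - mono2 C 0 b.+1 = mono2 C 0 1 * (Y ^+ b - mono2 C 0 b) + xlift psi * Y ^+ b.
    by rewrite mulrBr mono2MM addnC addn1 exprS {1}/Y mulrDl; ring.
  apply: wgeD; first by rewrite mulnS -addnS; apply: wgeM.
  by rewrite mulnS -addSn; apply: wgeM.
have HX : wge p q (p * x) (mono2 C x 0) by have := @wge_mono2 p q x 0; rewrite muln0 addn0.
have := wgeM HX (HR y) (i := i) (j := j); rewrite mulrBr mono2MM add0n addn0 => HH.
have E : (mono2 C x 0 * Y ^+ y - mono2 C x y) i j = 0 by apply: HH; lia.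
move: E; rewrite fps2D fps2N => /eqP; rewrite subr_eq0 => /eqP <-.
by rewrite [sX _]/(mono2 C 1 0) mono2X mul1n mul0n.
Qed.
End Shear.

Lemma pull_shear0 (e0 : (0 : fps C) 0%N = 0) F : pull (shear e0) F = F.
Proof.
apply: fps2P => i j; rewrite (@pullE C (i + j)) // [RHS](@coef_expand _ (i + j)) ?leq_addr ?leq_addl //.
apply: eq_bigr => x _; apply: eq_bigr => y _.
have x0 : sY (shear e0) = mono2 C 0 1.
  by apply: fps2P => k l; rewrite [sY _]/(mono2 C 0 1 + xlift 0) fps2D liftE fps0 mul0rn addr0.
rewrite [sX _]/(mono2 C 1 0) x0 !mono2X mono2MM.
by rewrite !mul1n !mul0n addn0.
Qed.

Lemma pull_lift s psi : sX s = mono2 C 1 0 -> pull s (xlift psi) = xlift psi.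
Proof.
move=> Xs; apply: fps2P => i j; rewrite (@pullE C (i + j)) // [RHS](@coef_expand _ (i + j)) ?leq_addr ?leq_addl //.
apply: eq_bigr => x _; apply: eq_bigr => y _; rewrite liftE.
case: eqP => [->|_]; last by rewrite mulr0n !mul0r.
by rewrite Xs mono2X !expr0 mulr1 mul1n mul0n.
Qed.

Lemma shear_comp psi (phi : fps C) (p0 : psi 0%N = 0) (q0 : phi 0%N = 0) (r0 : (psi + phi) 0%N = 0) F :
  pull (shear q0) (pull (shear p0) F) = pull (shear r0) F.
Proof.
rewrite pull_comp; apply: (congr1 (fun k => k F)); apply: pull_ext => /=.
  by rewrite pull_mono expr1 expr0 mulr1.
rewrite rmorphD /= pull_mono expr1 expr0 mul1r pull_lift //= raddfD /=; ring.
Qed.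

(* (a, h) is the upper end of the compact edge with normal vector (p, q). *)
Record ray p q a h F : Prop := Ray {
  ray_p : (0 < p)%N; ray_q : (0 < q)%N; ray_co : coprime p q; ray_v : F a h != 0;
  ray_ge : forall i j, F i j != 0 -> (p * a + q * h <= p * i + q * j)%N;
  ray_gt : forall i j, F i j != 0 -> (h < j)%N -> (p * a + q * h < p * i + q * j)%N;
  ray_low : exists i j, [/\ (j < h)%N, F i j != 0 & (p * i + q * j = p * a + q * h)%N] }.

(* (a, h) is the lower end of the edge, or the vertex, with normal vector (p, q). *)
Record vertex p q a h F : Prop := Vertex {
  vertex_v : F a h != 0;
  vertex_ge : forall i j, F i j != 0 -> (p * a + q * h <= p * i + q * j)%N;
  vertex_gt : forall i j, F i j != 0 -> (j < h)%N -> (p * a + q * h < p * i + q * j)%N }.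

Lemma vertex_wge p q a h F : vertex p q a h F -> wge p q (p * a + q * h) F.
Proof. by move=> [_ H _] i j lt; apply/eqP/negPn/negP => /H; lia. Qed.

Lemma shear_vertex p q a h F psi (psi0 : psi 0%N = 0) : (forall i, psi i != 0 -> (q < p * i)%N) ->
  vertex p q a h F -> vertex p q a h (pull (shear psi0) F).
Proof.
move=> Hpsi V; have E := shear_strict psi0 Hpsi (vertex_wge V); case: V => [v ge gt].
split; first by rewrite E.
  by move=> i j; case: leqP => // lt; rewrite E ?(ltnW lt) // => /ge; lia.
by move=> i j + jh; case: ltnP => // le; rewrite E // => /gt; lia.
Qed.

(** Among the points below [(a, h)] one is chosen with least [(i - a) / (h - j)], and this fraction
    in lowest terms is [q/p]. That the edge is steeper than [(p0, q0)] and lies below the points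
    above height [h] follows from the vertex property. *)
Lemma next_ray p0 q0 a h F : (0 < p0)%N -> vertex p0 q0 a h F ->
  (forall i j, (j < h)%N -> F i j = 0) \/ exists p q, ray p q a h F /\ (q0 * p < q * p0)%N.
Proof.
move=> p00 [v ge gt].
pose Pr i j := (j < h)%N /\ F i j != 0.
have Pa i j : Pr i j -> (a < i)%N by move=> [jh /gt H]; have := H jh; nia.
have [[i1 [j1 P1]]|no] := pselect (exists i j, Pr i j); last first.
  by left=> i j jh; apply/eqP/negPn/negP => Fij; apply: no; exists i, j.
(* Multiplied by [h!] the slopes become natural numbers, so a least one exists. *)
right; pose c j := (h`! %/ (h - j))%N; pose val i j := ((i - a) * c j)%N.
have cE j : (j < h)%N -> (c j * (h - j) = h`!)%N.
  by move=> jh; rewrite divnK // dvdn_fact // subn_gt0 jh leq_subr.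
have ex : exists n, `[< exists i j, Pr i j /\ n = val i j >] by exists (val i1 j1); apply/asboolP; exists i1, j1.
have [n /asboolP [i [j [[jh Fij] ->]]] mn] := ex_minnP ex.
have ai : (a < i)%N by apply: (Pa i j).
have slope i' j' : Pr i' j' -> ((i - a) * (h - j') <= (i' - a) * (h - j))%N.
  move=> P'; have [jh' _] := P'; have le : (val i j <= val i' j')%N.
    by apply: mn; apply/asboolP; exists i', j'.
  rewrite /val in le; have f0 := fact_gt0 h; rewrite -(leq_pmul2r f0).
  have e1 := cE j jh; have e2 := cE j' jh'.
  have -> : ((i - a) * (h - j') * h`! = (i - a) * c j * ((h - j) * (h - j')))%N by rewrite -e1; ring.
  have -> : ((i' - a) * (h - j) * h`! = (i' - a) * c j' * ((h - j) * (h - j')))%N by rewrite -e2; ring.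
  by rewrite leq_mul2r le orbT.
pose d := gcdn (h - j) (i - a).
have d0 : (0 < d)%N by rewrite gcdn_gt0 subn_gt0 jh.
have /dvdnP [p pE] : (d %| h - j)%N by exact: dvdn_gcdl.
have /dvdnP [q qE] : (d %| i - a)%N by exact: dvdn_gcdr.
have pgt : (0 < p)%N by case: p pE => //; lia.
have qgt : (0 < q)%N by case: q qE => //; lia.
have steep : (q0 * p < q * p0)%N.
  have := gt i j Fij jh => lt; rewrite -(ltn_pmul2r d0).
  have -> : (q0 * p * d = q0 * (h - j))%N by rewrite pE mulnA.
  have -> : (q * p0 * d = p0 * (i - a))%N by rewrite qE; ring.
  by nia.
have slope' i' j' : Pr i' j' -> (q * (h - j') <= p * (i' - a))%N.
  move=> /slope; rewrite pE qE => le; rewrite -(leq_pmul2r d0).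
  rewrite mulnAC (_ : (p * (i' - a) * d = (i' - a) * (p * d))%N) //.
  by rewrite mulnCA mulnA.
have up i' j' : F i' j' != 0 -> (h < j')%N -> (p * a + q * h < p * i' + q * j')%N.
  move=> /ge H lt; have [le|l1] := leqP a i'; first by nia.
  have l2 : (p0 * (a - i') <= q0 * (j' - h))%N by nia.
  suff : (p * (a - i') < q * (j' - h))%N by nia.
  rewrite -(ltn_pmul2r p00); apply: (@leq_ltn_trans (p * (q0 * (j' - h)))%N).
    by rewrite -mulnA leq_mul2l (mulnC _ p0) l2 orbT.
  rewrite mulnCA mulnA [ltnRHS]mulnAC ltn_mul2r subn_gt0 lt; exact: steep.
exists p, q; split=> //; split=> //.
- by rewrite /coprime -(eqn_pmul2r d0) mul1n muln_gcdl -pE -qE.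
- move=> i' j' F'; have [l1|l1|e] := ltngtP j' h.
  + have Pr' : Pr i' j' by []. have := slope' _ _ Pr'; have := Pa _ _ Pr'; nia.
  + exact/ltnW/up.
  by have := ge _ _ F'; rewrite e !leq_add2r !leq_mul2l => /orP[/eqP|->]; [lia|rewrite orbT].
exists i, j; split=> //; have : (q * (h - j) = p * (i - a))%N by rewrite pE qE; ring.
by nia.
Qed.

(* (a', h') is the lower end of the edge and Q its polynomial, read upwards from (a', h'). *)
Record face p q a h a' h' L F (Q : {poly C}) : Prop := Face {
  face_ray : ray p q a h F;
  face_L : (0 < L)%N; face_a : a' = (a + q * L)%N; face_h : h = (h' + p * L)%N;
  face_size : size Q = L.+1; face_0 : Q`_0 != 0;
  face_F : forall l, (l <= L)%N -> Q`_l = F (a' - q * l)%N (h' + p * l)%N;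
  face_on : forall i j, F i j != 0 -> (p * i + q * j = p * a + q * h)%N ->
    exists l, [/\ (l <= L)%N, i = (a' - q * l)%N & j = (h' + p * l)%N] }.

Lemma face_exists p q a h F : ray p q a h F -> exists a' h' L Q, face p q a h a' h' L F Q.
Proof.
move=> R; have [p0 q0 co v ge gt [i1 [j1 [jh1 F1 E1]]]] := R.
pose on l := (p * l <= h)%N && (F (a + q * l)%N (h - p * l)%N != 0).
have onP i j : F i j != 0 -> (p * i + q * j = p * a + q * h)%N ->
    exists l, [/\ on l, i = (a + q * l)%N & j = (h - p * l)%N].
  move=> Fij E; have jh : (j <= h)%N by rewrite leqNgt; apply/negP => /(gt _ _ Fij); lia.
  have ai : (a <= i)%N by nia.
  have e : (p * (i - a) = q * (h - j))%N by nia.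
  have : (p %| h - j)%N by rewrite -(Gauss_dvdr _ co) -e dvdn_mulr.
  case/dvdnP => l lE; have e' : (i - a = q * l)%N.
    by apply/eqP; rewrite -(eqn_pmul2l p0) e lE; apply/eqP; ring.
  exists l; have iE : i = (a + q * l)%N by lia.
  have jE : j = (h - p * l)%N by nia.
  by split=> //; rewrite /on -iE -jE Fij andbT; nia.
have ex : exists l, on l by exists 0; rewrite /on !muln0 addn0 subn0 v.
have bnd l : on l -> (l <= h)%N by move=> /andP[le _]; nia.
have [L onL maxL] := ex_maxnP ex bnd.
have L0 : (0 < L)%N.
  have [l [onl iE jE]] := onP _ _ F1 E1; apply: leq_trans (maxL _ onl).
  by case: l onl iE jE => //; lia.
have /andP[pL FL] := onL; pose h' := (h - p * L)%N; pose a' := (a + q * L)%N.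
exists a', h', L, (\poly_(l < L.+1) F (a' - q * l)%N (h' + p * l)%N).
have hE : h = (h' + p * L)%N by rewrite /h'; lia.
split=> //.
- by rewrite size_poly_eq //= /a' -hE addnK.
- by rewrite coef_poly /= !muln0 subn0 addn0.
- by move=> l le; rewrite coef_poly ltnS le.
move=> i j Fij E; have [l [onl iE jE]] := onP _ _ Fij E; have le := maxL _ onl.
by exists (L - l)%N; split; rewrite ?leq_subr // mulnBr /a' /h'; nia.
Qed.

Lemma face_vertex p q a h a' h' L F Q : face p q a h a' h' L F Q ->
  [/\ vertex p q a' h' F, (p * a' + q * h' = p * a + q * h)%N & (h' < h)%N].
Proof.
move=> [[p0 q0 co v ge gt low] L0 aE hE sz Q0 FQ on].
have E : (p * a' + q * h' = p * a + q * h)%N by rewrite aE hE; ring.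
split=> //; last by nia.
split; first by have := FQ 0 (leq0n L); rewrite !muln0 subn0 addn0 => <-.
  by move=> i j /ge; rewrite E.
move=> i j Fij lt; rewrite ltn_neqAle E ge // andbT; apply/eqP => e.
by have [l [_ _ jE]] := on _ _ Fij (esym e); lia.
Qed.
End Newton.

(** * Multiplicities and translations of polynomials *)

Section PolyFacts.
Variable C : numClosedFieldType.
Implicit Types (g : {poly C}) (x c : C).

Lemma mup_cofactor x m g : g.[x] != 0 -> mup x (('X - x%:P) ^+ m * g) = m.
Proof. by move=> gx; rewrite mupMl ?mup_XsubCX ?eqxx. Qed.

Lemma mup_comp_shift x c g : g != 0 -> mup x (g \Po ('X + c%:P)) = mup (x + c) g.
Proof.
move=> g0; have [q qx {1}->] := mup_decomp (x + c) g0.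
rewrite comp_polyM rmorphXn /= comp_polyB comp_polyX comp_polyC.
have -> : 'X + c%:P - (x + c)%:P = 'X - x%:P :> {poly C} by rewrite rmorphD /=; ring.
by rewrite mup_cofactor // horner_comp hornerD hornerX hornerC.
Qed.

Lemma mup_add_le c c' g : g != 0 -> c != c' -> (mup c g + mup c' g <= (size g).-1)%N.
Proof.
move=> g0 ne; pose q := ('X - c%:P) ^+ mup c g * ('X - c'%:P) ^+ mup c' g.
have q0 : q != 0 by rewrite mulf_neq0 // expf_neq0 // polyXsubC_eq0.
have /dvdp_leq : q %| g.
  apply: dvdp_mup => // x; rewrite mupM ?expf_neq0 ?polyXsubC_eq0 // !mup_XsubCX.
  case: (eqVneq c x) => [cx|_]; case: (eqVneq c' x) => [cx'|_]; rewrite ?addn0 ?add0n ?cx ?cx' //.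
  by rewrite cx cx' eqxx in ne.
move=> /(_ g0); rewrite size_Mmonic ?expf_neq0 ?polyXsubC_eq0 ?monic_exp ?monicXsubC //.
by rewrite !size_exp_XsubC addSn addnS /= => le; rewrite -ltnS prednK // size_poly_gt0.
Qed.

Lemma mup_gt0 c g : g != 0 -> (0 < mup c g)%N = root g c.
Proof. by move=> g0; rewrite -XsubC_dvd // dvdp_XsubCl. Qed.

Lemma mup_le_size c g : g != 0 -> (mup c g <= (size g).-1)%N.
Proof.
move=> g0; have ne : c != c + 1 by rewrite -subr_eq0 opprD addNKr oppr_eq0 oner_eq0.
by have := mup_add_le g0 ne; lia.
Qed.

(** Such a [g] is [d (X - c)^h], with coefficient [- d h c] at [X^(h-1)]. Once this coefficient has
    been removed, no nonzero root has full multiplicity. *)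
Lemma full_root_coef c g h : (0 < h)%N -> size g = h.+1 -> mup c g = h -> c != 0 -> g`_h.-1 != 0.
Proof.
move=> h0 sz mh c0; have g0 : g != 0 by rewrite -size_poly_gt0 sz.
have [q qc gE] := mup_decomp c g0; have q0 : q != 0 by apply: contraNneq qc => ->; rewrite horner0.
have sq : size q = 1%N.
  have := sz; rewrite {1}gE mh mulrC size_Mmonic ?monic_exp ?monicXsubC // size_exp_XsubC.
  by have := size_poly_gt0 q; rewrite q0; lia.
move/eqP/size_poly1P: sq gE => [d d0 ->]; rewrite mh => ->.
rewrite mulrC mul_polyC coefZ mulf_neq0 // -(prednK h0) /= addrC -rmorphN /= exprDn coef_sum.
rewrite (bigD1 (Ordinal (ltnSn h.-1.+1) : 'I_h.-1.+2)) //= subnn expr0 mul1r binn mulr1n coefXn.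
rewrite (_ : (h.-1 == h.-1.+1) = false) ?add0r; last by apply/eqP; lia.
have lt : (h.-1 < h.-1.+2)%N by lia.
rewrite (bigD1 (Ordinal lt)) /=; last by apply/eqP => /(congr1 val) /=; lia.
rewrite subSnn expr1 binSn coefMn coefCM coefXn eqxx mulr1 big1 ?addr0.
  by rewrite mulrn_eq0 negb_or oppr_eq0 c0.
move=> i /andP[n1 n2]; rewrite coefMn -rmorphXn /= coefCM coefXn.
rewrite (_ : (h.-1 == i) = false) ?mulr0 ?mul0rn //; apply/eqP => e.
by case/eqP: n2; apply: val_inj.
Qed.
End PolyFacts.

(** * Shears by a monomial and the implicit function theorem *)

Section ShearMono.
Variable C : numClosedFieldType.
Notation S := (fps (fps C)).
Implicit Types (F G : S) (psi : fps C) (p q a h i j m n : nat) (c : C).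

Section OneShear.
Variables (c : C) (q : nat).
Hypothesis m0 : fps_mono c q 0%N = 0.

Lemma shear_mono_pow x b i j : (mono2 C 1 0 ^+ x * (mono2 C 0 1 + xlift (fps_mono c q)) ^+ b) i j =
  if (j <= b)%N && (x + q * (b - j) == i)%N then c ^+ (b - j) *+ 'C(b, j) else 0.
Proof.
have -> : xlift (fps_mono c q) = cst c * mono2 C q 0.
  apply: fps2P => k l; rewrite liftE cstM mono2E fps_monoE.
  by case: (k == q); case: (l == 0%N); rewrite /= ?mulr1n ?mulr0n ?mulr1 ?mulr0 ?mul0rn.
rewrite addrC exprDn mulr_sumr fps2_sum.
have E k : (mono2 C 1 0 ^+ x * ((cst c * mono2 C q 0) ^+ (b - k) * mono2 C 0 1 ^+ k *+ 'C(b, k))) i j =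
    (c ^+ (b - k) *+ 'C(b, k)) * mono2 C (x + q * (b - k)) k i j.
  have -> : mono2 C 1 0 ^+ x * ((cst c * mono2 C q 0) ^+ (b - k) * mono2 C 0 1 ^+ k *+ 'C(b, k)) =
      cst (c ^+ (b - k) *+ 'C(b, k)) * mono2 C (x + q * (b - k)) k.
    rewrite exprMn !mono2X rmorphMn rmorphXn /= !mul1n !mul0n -(mulr_natr (cst c ^+ _)) -mulrnAr.
    have <- : mono2 C x 0 * mono2 C (q * (b - k)) 0 * mono2 C 0 k = mono2 C (x + q * (b - k)) k.
      by rewrite !mono2MM addn0 addn0.
    by rewrite -[_ *+ 'C(b, k)]mulr_natr; ring.
  by rewrite cstM.
under eq_bigr do rewrite E.
case: (leqP j b) => jb /=; last first.
  by rewrite big1 // => k _; rewrite mono2E (_ : (j == k) = false) ?andbF ?mulr0 //; have := ltn_ord k; lia.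
have lt : (j < b.+1)%N by [].
rewrite (bigD1 (Ordinal lt)) //= [X in _ + X]big1 ?addr0; last first.
  move=> k ne; rewrite mono2E (_ : (j == k) = false) ?andbF ?mulr0 //.
  by apply/eqP => e; case/eqP: ne; apply: val_inj.
by rewrite mono2E eqxx andbT eq_sym; case: eqP; rewrite ?mulr1 ?mulr0.
Qed.

Lemma shear_mono_coef F i j : (0 < q)%N -> pull (shear m0) F i j = \sum_(b < (i + j).+1)
  if (j <= b)%N && (q * (b - j) <= i)%N then F (i - q * (b - j))%N b * (c ^+ (b - j) *+ 'C(b, j)) else 0.
Proof.
move=> q0; rewrite (@pullE C (i + j)) // exchange_big; apply: eq_bigr => b _ /=.
under eq_bigr do rewrite shear_mono_pow.
case: (leqP j b) => jb /=; last by rewrite big1 // => x _; rewrite mulr0.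
case: leqP => le; last first.
  rewrite big1 // => x _; rewrite (_ : (_ == i) = false) ?mulr0 //; lia.
have lt : (i - q * (b - j) < (i + j).+1)%N by lia.
rewrite (bigD1 (Ordinal lt)) //= subnK // eqxx big1 ?addr0 // => x ne.
rewrite (_ : (_ == i) = false) ?mulr0 //; apply/eqP => e.
by case/eqP: ne; apply: val_inj => /=; lia.
Qed.
End OneShear.

(** The polynomial of the part of the line of weight [(1, q)] through [(a, h)] that reaches down to
    height 0. For an edge it contains the factor [X^h'], so that the shear by [c u^q] acts on it as
    a translation. *)
Definition gpoly a q h F : {poly C} := \poly_(j < h.+1) F (a + q * (h - j))%N j.

Lemma gpoly_shear c a q h F (m0 : fps_mono c q 0%N = 0) : (0 < q)%N ->
  (forall i j, F i j != 0 -> (h < j)%N -> (a + q * h < i + q * j)%N) ->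
  gpoly a q h (pull (shear m0) F) = gpoly a q h F \Po ('X + c%:P).
Proof.
move=> q0 gt; apply/polyP => j; rewrite coef_poly coef_comp_poly.
have coefXc b : (('X + c%:P) ^+ b)`_j = if (j <= b)%N then c ^+ (b - j) *+ 'C(b, j) else 0.
  rewrite addrC exprDn coef_sum.
  have E (k : 'I_b.+1) : (c%:P ^+ (b - k) * 'X^k *+ 'C(b, k))`_j = if j == k then c ^+ (b - k) *+ 'C(b, k) else 0.
    by rewrite coefMn -rmorphXn /= coefCM coefXn; case: eqP; rewrite ?mulr1 ?mulr0 ?mul0rn.
  under eq_bigr do rewrite E.
  case: leqP => jb; last by rewrite big1 // => k _; case: eqP => // e; have := ltn_ord k; lia.
  have lt : (j < b.+1)%N by [].
  rewrite (bigD1 (Ordinal lt)) //= eqxx big1 ?addr0 // => k ne; case: eqP => // e.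
  by case/eqP: ne; apply: val_inj.
under [RHS]eq_bigr do rewrite coefXc.
pose f b := if (j <= b)%N then (gpoly a q h F)`_b * (c ^+ (b - j) *+ 'C(b, j)) else 0.
transitivity (\sum_(b < h.+1) f b); last first.
  have sz : (size (gpoly a q h F) <= h.+1)%N by exact: size_poly.
  rewrite -(subnKC sz) big_split_ord /= [X in _ + X]big1 ?addr0.
    by apply: eq_bigr => b _; rewrite /f; case: ifP; rewrite ?mulr0.
  by move=> b _; rewrite /f nth_default ?mul0r ?if_same //=; lia.
rewrite ltnS; case: leqP => jh; last first.
  by rewrite big1 // => b _; rewrite /f leqNgt (leq_trans _ jh) //; have := ltn_ord b; lia.
set i := (a + q * (h - j))%N; rewrite shear_mono_coef //.
have hle : (h.+1 <= (i + j).+1)%N by rewrite /i; nia.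
rewrite -(subnKC hle) big_split_ord /= [X in _ + X]big1 ?addr0; last first.
  move=> b _; case: ifP => // /andP[jb le]; apply/eqP; rewrite mulf_eq0; apply/orP; left.
  have e1 : (q * (h.+1 + b - j) + q * j = q * (h.+1 + b))%N by rewrite -mulnDr subnK.
  have e2 : (q * (h - j) + q * j = q * h)%N by rewrite -mulnDr subnK.
  by apply/negPn/negP => /gt /(_ (leq_addr _ _)); rewrite /i in le *; lia.
apply: eq_bigr => b _; rewrite /f; case: leqP => jb //=; have bh : (b <= h)%N by have := ltn_ord b; lia.
rewrite coef_poly ltnS bh ifT; last by rewrite /i; nia.
by congr (F _ _ * _); rewrite /i; nia.
Qed.

Lemma psub_tX (u : fps C) : psub u (tX C) = u.
Proof.
apply: fpsP => k; rewrite /psub fpsE (bigD1 ord_max) //= big1 ?addr0.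
  by rewrite -[tX C ^+ k]mulr1 tXnM leqnn subnn fps1 mulr1.
move=> i ne; rewrite -[tX C ^+ i]mulr1 tXnM fps1; case: leqP => le; last by rewrite mulr0.
rewrite (_ : (_ == 0)%N = false) ?mulr0 //; apply/eqP => e.
by case/eqP: ne; apply: val_inj => /=; lia.
Qed.

(** With [F = H0(u) + w H1(u, w)] the equation becomes a recursion: a new coefficient of [phi]
    enters the product [w H1] for the first time multiplied by [F 0 1]. *)
Lemma implicit_function F : F 0%N 0%N = 0 -> F 0%N 1%N != 0 ->
  exists phi : fps C, phi 0%N = 0 /\ ev F (tX C, phi) = 0.
Proof.
move=> F00 F01; pose H0 : fps C := Fps (fun i => F i 0%N); pose H1 : S := Fps (fun i => Fps (fun j => F i j.+1)).
have FE : F = xlift H0 + mono2 C 0 1 * H1.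
  apply: fps2P => i j; rewrite fps2D liftE mono2M /= subn0.
  by case: j => [|j]; rewrite /= ?mulr1n ?addr0 // mulr0n add0r subn1.
pose step k (g : nat -> C) := if k is k'.+1 then
  - (H0 k + \sum_(i < k') g i.+1 * ev H1 (tX C, Fps g) (k' - i)%N) / F 0%N 1%N else 0.
have loc n g g' : (forall k, (k < n)%N -> g k = g' k) -> step n g = step n g'.
  case: n => [|n] E; first by [].
  rewrite /step; suff -> : \sum_(i < n) g i.+1 * ev H1 (tX C, Fps g) (n - i)%N = \sum_(i < n) g' i.+1 * ev H1 (tX C, Fps g') (n - i)%N by [].
  apply: eq_bigr => i _; rewrite E; last by have := ltn_ord i; lia.
  congr (_ * _); apply: (@agree_subst _ (n - i) H1 (tX C) (tX C) (Fps g) (Fps g')) => // k le.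
  by apply: E; lia.
have [g Hg] := course_of_values 0 loc; exists (Fps g); have g0 : g 0%N = 0 by rewrite Hg.
split=> //; have cg : centered (tX C, Fps g) by split=> //; rewrite /= /tX fps_monoE.
have E10 : ev H1 (tX C, Fps g) 0%N = F 0%N 1%N by rewrite (ev0 _ cg).
have HgS k : g k.+1 = - (H0 k.+1 + \sum_(i < k) g i.+1 * ev H1 (tX C, Fps g) (k - i)%N) / F 0%N 1%N by rewrite Hg.
rewrite FE (evD _ _ cg) (evM _ _ cg) ev_lift (ev_Y cg) psub_tX /=.
have H00 : H0 0%N = 0 by [].
move: (ev H1 (tX C, Fps g)) (H0) E10 HgS H00 => E1 H E10 HgS H00; apply: fpsP => k; rewrite fpsD fpsM fps0.
have FgE j : Fps g j = g j by [].
case: k => [|k]; first by rewrite big_ord_recl big_ord0 addr0 FgE g0 mul0r addr0.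
rewrite big_ord_recl big_ord_recr /= FgE g0 mul0r add0r /bump /= add1n subnn E10 FgE HgS divfK //.
have -> : \sum_(i < k) Fps g (1 + i)%N * E1 (k.+1 - (1 + i))%N = \sum_(i < k) g i.+1 * E1 (k - i)%N.
  by apply: eq_bigr => i _; rewrite FgE add1n subSS.
by ring.
Qed.

Lemma d2_lift psi : fps_d2 (xlift psi) = 0.
Proof. by apply: fps2P => i j; rewrite d2E liftE mul0rn. Qed.

Lemma iter_d2_shear psi (p0 : psi 0%N = 0) n F :
  iter n (@fps_d2 C) (pull (shear p0) F) = pull (shear p0) (iter n (@fps_d2 C) F).
Proof.
elim: n => // n IH; rewrite !iterS IH (chain_rule _ _ (d2_der C)) /= d2D d2_lift !d2_mono2.
by rewrite mulr0n mulr0 add0r addr0 mulr1.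
Qed.

Lemma iter_d2_low n F i : (iter n (@fps_d2 C) F i 0%N == 0) = (F i n == 0).
Proof.
suff H j : exists2 e, (0 < e)%N & iter n (@fps_d2 C) F i j = F i (n + j)%N *+ e.
  by have [e e0 ->] := H 0; rewrite addn0 mulrn_eq0 eqn0Ngt e0.
elim: n j => [|n IH] j; first by exists 1.
have [e e0 E] := IH j.+1; exists (e * j.+1)%N; first by rewrite muln_gt0 e0.
by rewrite iterS d2E E -mulrnA addnS.
Qed.
End ShearMono.

(** * Shears that make the next edge tame *)

Section Normalize.
Variable C : numClosedFieldType.
Notation S := (fps (fps C)).
Implicit Types (F G : S) (psi : fps C) (p q a h i j m n : nat) (c : C).

Lemma coef_comp_shift (g : {poly C}) c j h : (size g <= h.+1)%N ->
  (g \Po ('X + c%:P))`_j = \sum_(b < h.+1) if (j <= b)%N then g`_b * (c ^+ (b - j) *+ 'C(b, j)) else 0.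
Proof.
move=> sz; rewrite coef_comp_poly.
have coefXc b : (('X + c%:P) ^+ b)`_j = if (j <= b)%N then c ^+ (b - j) *+ 'C(b, j) else 0.
  rewrite addrC exprDn coef_sum.
  have E (k : 'I_b.+1) : (c%:P ^+ (b - k) * 'X^k *+ 'C(b, k))`_j = if j == k then c ^+ (b - k) *+ 'C(b, k) else 0.
    by rewrite coefMn -rmorphXn /= coefCM coefXn; case: eqP; rewrite ?mulr1 ?mulr0 ?mul0rn.
  under eq_bigr do rewrite E.
  case: leqP => jb; last by rewrite big1 // => k _; case: eqP => // e; have := ltn_ord k; lia.
  have lt : (j < b.+1)%N by [].
  rewrite (bigD1 (Ordinal lt)) //= eqxx big1 ?addr0 // => k ne; case: eqP => // e.
  by case/eqP: ne; apply: val_inj.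
under [LHS]eq_bigr do rewrite coefXc.
rewrite -(subnKC sz) big_split_ord /= [X in _ = _ + X]big1 ?addr0.
  by apply: eq_bigr => b _; case: ifP; rewrite ?mulr0.
by move=> b _; rewrite nth_default ?mul0r ?if_same //; lia.
Qed.

Lemma sum_top2 (f : nat -> C) h : (0 < h)%N -> \sum_(b < h.+1) f b = \sum_(b < h.-1) f b + f h.-1 + f h.
Proof. by case: h => // h _; rewrite !big_ord_recr. Qed.

Lemma tXn_eq0 n (f : fps C) : tX C ^+ n * f = 0 -> f = 0.
Proof.
by move=> H; apply: fpsP => k; have := congr1 (fun u : fps C => u (k + n)%N) H; rewrite /= tXnM leq_addl addnK.
Qed.

Lemma ev_row0 F i : ev F (tX C, 0) i = F i 0%N.
Proof.
rewrite /ev /fps_subst fpsE /=.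
transitivity (\sum_(x < i.+1) F x 0%N * (tX C ^+ x) i).
  apply: eq_bigr => x _; rewrite big_ord_recl big1 ?addr0 => [|y _]; first by rewrite expr0 mulr1.
  by rewrite exprS mul0r mulr0 fps0 mulr0.
rewrite (bigD1 ord_max) //= big1 ?addr0.
  by rewrite -[tX C ^+ i]mulr1 tXnM leqnn subnn fps1 mulr1.
move=> x ne; rewrite -[tX C ^+ x]mulr1 tXnM fps1; case: leqP => le; last by rewrite mulr0.
rewrite (_ : (_ == 0)%N = false) ?mulr0 //; apply/eqP => e.
by case/eqP: ne; apply: val_inj => /=; lia.
Qed.

Definition blow q := Subst2 (@tge_mono2_1 C 1 0 isT) (@tge_mono2_1 C q 1 (ltn_addl q (ltnSn 0))).

Lemma blow_coef q F m j : pull (blow q) F m j = if (q * j <= m)%N then F (m - q * j)%N j else 0.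
Proof.
rewrite (@pullE C (m + j)) // exchange_big /=.
have E x y : (mono2 C 1 0 ^+ x * mono2 C q 1 ^+ y) m j = ((m == x + q * y) && (j == y))%N%:R.
  by rewrite !mono2X mono2MM mono2E !mul1n mul0n.
under eq_bigr do under eq_bigr do rewrite E.
have lt : (j < (m + j).+1)%N by lia.
rewrite (bigD1 (Ordinal lt)) //= [X in _ + X]big1 ?addr0; last first.
  move=> y ne; rewrite big1 // => x _; rewrite (_ : (j == y) = false) ?andbF ?mulr0 //.
  by apply/eqP => e; case/eqP: ne; apply: val_inj.
case: leqP => le; last first.
  by rewrite big1 // => x _; rewrite (_ : (m == _) = false) ?mulr0 //; lia.
have ltx : (m - q * j < (m + j).+1)%N by lia.
rewrite (bigD1 (Ordinal ltx)) //= subnK // !eqxx mulr1 big1 ?addr0 // => x ne.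
rewrite (_ : (m == _) = false) ?mulr0 //; apply/eqP => e.
by case/eqP: ne; apply: val_inj => /=; lia.
Qed.

Lemma iter_d2_blow q n F : iter n (@fps_d2 C) (pull (blow q) F) = pull (blow q) (iter n (@fps_d2 C) F) * mono2 C (q * n) 0.
Proof.
elim: n => [|n IH]; first by rewrite muln0 mono200 mulr1.
rewrite !iterS IH d2M d2_mono2 mulr0n mulr0 addr0 (chain_rule _ _ (d2_der C)) [sX _]/(mono2 C 1 0) [sY _]/(mono2 C q 1).
by rewrite !d2_mono2 mulr0n mulr0 add0r mulr1n -mulrA mono2MM mulnS addn0.
Qed.

Lemma iter_d2_mono q n F : iter n (@fps_d2 C) (mono2 C q 0 * F) = mono2 C q 0 * iter n (@fps_d2 C) F.
Proof.
by elim: n => // n IH; rewrite !iterS IH d2M d2_mono2 mulr0n mul0r add0r.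
Qed.

Lemma fps_mono0 c q : (0 < q)%N -> fps_mono c q 0%N = 0 :> C.
Proof. by move=> q0; rewrite fps_monoE eq_sym (gtn_eqF q0). Qed.
Lemma tXn0 q (f : fps C) : (0 < q)%N -> (tX C ^+ q * f) 0%N = 0.
Proof. by move=> q0; rewrite tXnM leqNgt q0. Qed.

(* The root of the (h-1)-st w-derivative is moved to w = 0. *)
Lemma tschirnhausen a q h F : (0 < q)%N -> (0 < h)%N -> F a h != 0 -> wge 1 q (a + q * h) F ->
  (forall i j, F i j != 0 -> (h < j)%N -> (a + q * h < i + q * j)%N) ->
  exists psi, (forall i, psi i != 0 -> (q <= i)%N) /\ forall (p0 : psi 0%N = 0) i, pull (shear p0) F i h.-1 = 0.
Proof.
(* The leading term [c u^q] of the shear translates the edge polynomial so that its coefficient of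
   [X^(h-1)] vanishes. *)
move=> q0 h0 v ge gt; pose g := gpoly a q h F; pose c := - g`_h.-1 / (g`_h *+ h).
have gh : g`_h = F a h by rewrite coef_poly ltnSn subnn muln0 addn0.
have m0 := fps_mono0 c q0; pose F1 := pull (shear m0) F; have F1E : F1 = pull (shear m0) F by [].
have c_wt i : fps_mono c q i != 0 -> (q <= 1 * i)%N.
  by rewrite fps_monoE; case: (i =P q) => [->|_]; rewrite ?mul1n ?leqnn // mulr0n eqxx.
have ge1 : wge 1 q (a + q * h) F1 by exact: shear_weak.
have gE : gpoly a q h F1 = g \Po ('X + c%:P) by exact: gpoly_shear.
have szg : (size g <= h.+1)%N by exact: size_poly.
have F1h : F1 a h = F a h.
  have := congr1 (fun r : {poly C} => r`_h) gE; rewrite /= coef_poly ltnSn subnn muln0 addn0 (@coef_comp_shift g c h h) //.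
  rewrite big_ord_recr /= leqnn subnn binn mulr1 gh big1 ?add0r // => b _.
  by rewrite leqNgt ltn_ord.
have F1l : F1 (a + q)%N h.-1 = 0.
  have := congr1 (fun r : {poly C} => r`_h.-1) gE; rewrite /= coef_poly (@coef_comp_shift g c _ h) //.
  have -> : (h.-1 < h.+1)%N by lia.
  have -> : (h - h.-1 = 1)%N by lia.
  rewrite muln1 => ->.
  rewrite (sum_top2 (fun b => if (h.-1 <= b)%N then g`_b * (c ^+ (b - h.-1) *+ 'C(b, h.-1)) else 0) h0).
  rewrite big1 ?add0r => [|b _]; last by rewrite leqNgt ltn_ord.
  rewrite leqnn subnn binn mulr1 leq_pred -[X in (X - _)%N](prednK h0) subSnn expr1 -[X in 'C(X, _)](prednK h0) binSn (prednK h0) /c.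
  rewrite -(mulr_natr (_ / _)) -(mulr_natr g`_h); field.
  by rewrite gh v pnatr_eq0 -lt0n h0.
pose N := (a + q * h)%N.
(* The strict transform of [F1] under [w -> u^q w]. Its [(h-1)]-st derivative vanishes at the origin
   and has nonzero [w]-derivative there, so the implicit function theorem provides the remaining
   terms of the shear. *)
pose G1 : S := Fps (fun m => Fps (fun j => if (q * j <= m + N)%N then F1 (m + N - q * j)%N j else 0)).
have G1c m j : G1 m j = if (q * j <= m + N)%N then F1 (m + N - q * j)%N j else 0 by [].
clearbody F1 G1; have G1E : pull (blow q) F1 = mono2 C N 0 * G1.
  apply: fps2P => m j; rewrite blow_coef mono2M subn0 andbT; case: (leqP N m) => le.
    by rewrite G1c subnK.
  by case: leqP => // le'; apply: ge1; rewrite mul1n subnK.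
pose P := iter h.-1 (@fps_d2 C) G1.
have P00 : P 0%N 0%N = 0.
  apply/eqP; rewrite iter_d2_low; apply/eqP; rewrite G1c add0n.
  have -> : (q * h.-1 <= N)%N by rewrite /N; nia.
  by rewrite -[RHS]F1l; congr (F1 _ _); rewrite /N -{1}(prednK h0); nia.
have P01 : P 0%N 1%N != 0.
  have : iter h (@fps_d2 C) G1 0%N 0%N != 0.
    by rewrite iter_d2_low G1c add0n /N leq_addl addnK F1h.
  by rewrite -{1}(prednK h0) iterS d2E mulr1n.
have [phi [phi0 Pphi]] := implicit_function P00 P01.
have cg : centered (tX C, phi) by split=> //; rewrite /= /tX fps_monoE.
pose K := iter h.-1 (@fps_d2 C) F1; pose psi2 := tX C ^+ q * phi.
have Kev : ev K (tX C, psi2) = 0.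
  have E : pull (blow q) K * mono2 C (q * h.-1) 0 = mono2 C N 0 * P by rewrite -iter_d2_blow G1E iter_d2_mono.
  have := congr1 (fun H : S => ev H (tX C, phi)) E.
  rewrite /= !(evM _ _ cg) !(ev_mono2 _ _ cg) Pphi mulr0 expr0 mulr1 mulrC => /tXn_eq0.
  by rewrite (ev_comp _ _ cg) [sX _]/(mono2 C 1 0) [sY _]/(mono2 C q 1) (ev_X cg) (ev_mono2 _ _ cg) expr1.
have p20 : psi2 0%N = 0 by exact: tXn0.
exists (fps_mono c q + psi2); split=> [i|p0 i].
  rewrite leqNgt; apply: contra => lt; rewrite fpsD fps_monoE tXnM leqNgt lt addr0.
  by rewrite (ltn_eqF lt) mulr0n.
rewrite -(shear_comp m0 p20 p0) -F1E; apply/eqP; rewrite -iter_d2_low iter_d2_shear -/K -ev_row0.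
have c0 : centered (tX C, 0) by split=> //; rewrite /= /tX fps_monoE.
by rewrite (ev_shear p20 K c0) /= add0r psub_tX Kev fps0.
Qed.

Definition tame h (Q : {poly C}) := forall c, root Q c -> (2 * mup c Q <= h)%N.

(** The edge polynomial has degree [L] with [p L <= h], so for [p > 1] its degree is at most [h/2].
    Only edges of integral slope need a shear. *)
Lemma tame_steep p q a h a' h' L F Q : face p q a h a' h' L F Q -> (1 < p)%N -> tame h Q.
Proof.
move=> [_ L0 _ hE sz Q0 _ _] p1 c rc.
have Q0' : Q != 0 by rewrite -size_poly_gt0 sz.
have := mup_le_size c Q0'; rewrite sz /= => le; nia.
Qed.

Lemma face_gpoly q a h a' h' L F Q : face 1 q a h a' h' L F Q -> gpoly a q h F = 'X^h' * Q.
Proof.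
move=> [R L0 aE hE sz Q0 FQ on]; apply/polyP => j; rewrite coef_poly coefXnM.
case: (ltnP j h') => jh'.
  rewrite ltnS (_ : (j <= h)%N); last by lia.
  apply/eqP/negPn/negP => Fj; have [|l [_ _ jE]] := on _ _ Fj; last by lia.
  have : (q * (h - j) + q * j = q * h)%N by rewrite -mulnDr subnK //; lia.
  by lia.
case: (ltnP j h.+1) => jh; last by rewrite nth_default // sz; lia.
rewrite FQ; last by lia.
congr (F _ _); last by lia.
rewrite aE; have : (q * (h - j) + q * (j - h') = q * L)%N; [rewrite -mulnDr; congr (_ * _)%N; lia|].
move: (q * (h - j))%N (q * (j - h'))%N (q * L)%N => x y z; lia.
Qed.

Lemma face_root_neq0 p q a h a' h' L F Q c : face p q a h a' h' L F Q -> root Q c -> c != 0.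
Proof. by move=> [_ _ _ _ _ Q0 _ _] rc; apply: contraTneq rc => ->; rewrite /root horner_coef0. Qed.

Lemma face_poly_neq0 p q a h a' h' L F Q : face p q a h a' h' L F Q -> Q != 0.
Proof. by move=> [_ _ _ _ sz _ _ _]; rewrite -size_poly_gt0 sz. Qed.

Lemma face_mup q a h a' h' L F Q c : face 1 q a h a' h' L F Q -> c != 0 -> mup c (gpoly a q h F) = mup c Q.
Proof.
move=> fc c0; rewrite (face_gpoly fc) mupMr // /root hornerXn expf_eq0 (negbTE c0) andbF //.
Qed.

(* F has no term below (a, h), or the edge going down from (a, h) is tame. *)
Definition normal p0 q0 a h F := (forall i j, (j < h)%N -> F i j = 0) \/
  exists p q a' h' L Q, [/\ face p q a h a' h' L F Q, (q0 * p < q * p0)%N & tame h Q].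

(** A root [c] of multiplicity above [h/2] forces an integral slope [q], and the shear by [c u^q]
    moves it to 0. Since row [h - 1] was zero, its multiplicity is less than [h]: the edge persists,
    and the multiplicities of its nonzero roots are at most [h] minus that of [c]. One shear is
    enough. *)
Lemma normalize_small p0 q0 a h F : (0 < p0)%N -> (0 < h)%N -> vertex p0 q0 a h F -> (forall i, F i h.-1 = 0) ->
  exists psi, (forall i, psi i != 0 -> (q0 < p0 * i)%N) /\ forall p0' : psi 0%N = 0, normal p0 q0 a h (pull (shear p0') F).
Proof.
move=> p00 h0 V row0; have [no|[p [q [R steep]]]] := next_ray p00 V.
  by exists 0; split=> [i|p0']; [rewrite eqxx|rewrite pull_shear0; left].
have [a' [h' [L [Q fc]]]] := face_exists R.
have [tm|ntm] := pselect (tame h Q).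
  exists 0; split=> [i|p0']; first by rewrite eqxx.
  by rewrite pull_shear0; right; exists p, q, a', h', L, Q.
have [c [rc big]] : exists c, root Q c /\ (h < 2 * mup c Q)%N.
  apply: contrapT => H; apply: ntm => c rc; rewrite leqNgt; apply/negP => big.
  by apply: H; exists c.
have c0 := face_root_neq0 fc rc; have Qn := face_poly_neq0 fc.
have p1 : p = 1%N.
  apply/eqP; rewrite eqn_leq (ray_p R) andbT leqNgt; apply/negP => /(tame_steep fc) /(_ c rc); lia.
rewrite {}p1 in fc R steep; have q0' := ray_q R.
have gt i j : F i j != 0 -> (h < j)%N -> (a + q * h < i + q * j)%N by move=> F1 /(ray_gt R F1); rewrite !mul1n.
have ge : wge 1 q (a + q * h) F.
  by move=> i j lt; apply/eqP/negPn/negP => /(ray_ge R); rewrite mul1n; lia.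
have m0 := fps_mono0 c q0'.
have wt i : fps_mono c q i != 0 -> i = q by rewrite fps_monoE; case: (i =P q) => // _; rewrite mulr0n eqxx.
exists (fps_mono c q); split=> [i /wt ->|]; first by rewrite mulnC; rewrite muln1 in steep.
move=> m0'; rewrite (Prop_irrelevance m0' m0); set F' := pull _ F.
have wgeF : wge 1 q (a + q * h) F' by apply: shear_weak ge => i /wt ->; rewrite mul1n.
have gE : gpoly a q h F' = gpoly a q h F \Po ('X + c%:P) by exact: gpoly_shear.
set g := gpoly a q h F in gE *; have gh : g`_h = F a h by rewrite coef_poly ltnSn subnn muln0 addn0.
have szg : size g = h.+1.
  by apply/eqP; rewrite size_poly_eq //= subnn muln0 addn0 (ray_v R).
have g0 : g != 0 by rewrite -size_poly_gt0 szg.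
have szg' : size (gpoly a q h F') = h.+1 by rewrite gE size_comp_poly2 ?size_XaddC.
have g0' : gpoly a q h F' != 0 by rewrite -size_poly_gt0 szg'.
have mg : mup c g = mup c Q by apply: face_mup fc c0.
have mg0 : mup 0 (gpoly a q h F') = mup c g by rewrite gE mup_comp_shift ?add0r.
have mlt : (mup c g < h)%N.
  have := mup_le_size c g0; rewrite szg leq_eqVlt => /orP[/eqP e|//].
  have := full_root_coef h0 szg e c0; rewrite coef_poly (_ : (h.-1 < h.+1)%N) ?row0 ?eqxx //; lia.
have onF' j : (j <= h)%N -> F' (a + q * (h - j))%N j = (gpoly a q h F')`_j by move=> le; rewrite coef_poly ltnS le.
have geF' i j : F' i j != 0 -> (1 * a + q * h <= 1 * i + q * j)%N.
  move=> Fij; rewrite mul1n leqNgt; apply: contra Fij => lt; apply/eqP; exact: wgeF.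
have R' : ray 1 q a h F'.
  split=> //; first by rewrite coprime1n.
  - have := onF' h (leqnn h); rewrite subnn muln0 addn0 => ->.
    by have := lead_coef_eq0 (gpoly a q h F'); rewrite lead_coefE szg' => ->.
  - move=> i j Fij hj; rewrite ltn_neqAle geF' // andbT; apply: contra Fij => /eqP e.
    rewrite /F' shear_mono_coef // big1 // => b _; case: ifP => // /andP[jb le].
    rewrite (_ : F _ _ = 0) ?mul0r //; apply/eqP/negPn/negP => /gt H.
    have e1 : (q * (b - j) + q * j = q * b)%N by rewrite -mulnDr subnK.
    by have := H (leq_trans hj jb); rewrite !mul1n in e; lia.
  have [r r0 gr] := mup_decomp 0 g0'; exists (a + q * (h - mup c g))%N, (mup c g); split=> //.
    rewrite onF' ?(ltnW mlt) // gr mg0 subr0 coefXnM ltnn subnn -horner_coef0 //.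
  have e1 : (q * (h - mup c g) + q * mup c g = q * h)%N by rewrite -mulnDr subnK // ltnW.
  by lia.
have [a2 [h2 [L2 [Q2 fc2]]]] := face_exists R'.
right; exists 1%N, q, a2, h2, L2, Q2; split=> // x rx; have x0 := face_root_neq0 fc2 rx.
rewrite -(face_mup fc2 x0); have := mup_add_le g0' x0; rewrite szg' /= mg0 mg; lia.
Qed.

(** [q] is the first integral slope above [q0/p0]. If points of height less than [h] lie below the
    line of slope [q] through [(a, h)], the next edge has non-integral slope and is tame. Otherwise
    [tschirnhausen] clears row [h - 1] by a shear of order at least [q], and [normalize_small]
    finishes. *)
Lemma normalize p0 q0 a h F : (0 < p0)%N -> (0 < h)%N -> vertex p0 q0 a h F ->
  exists psi, (forall i, psi i != 0 -> (q0 < p0 * i)%N) /\ forall p0' : psi 0%N = 0, normal p0 q0 a h (pull (shear p0') F).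
Proof.
move=> p00 h0 V; pose q := (q0 %/ p0).+1.
have qgt : (q0 < p0 * q)%N by rewrite mulnC; exact: ltn_ceil.
have qle q' : (q0 < p0 * q')%N -> (q <= q')%N by rewrite mulnC -ltn_divLR.
have q_gt0 : (0 < q)%N by [].
clearbody q; have [low|high] := pselect (exists i j, [/\ (j < h)%N, F i j != 0 & (i + q * j < a + q * h)%N]).
  have [i [j [jh Fij lt]]] := low; have [no|[p [q1 [R steep]]]] := next_ray p00 V.
    by rewrite no ?eqxx in Fij.
  have [a' [h' [L [Q fc]]]] := face_exists R.
  exists 0; split=> [k|p0']; first by rewrite eqxx.
  rewrite pull_shear0; right; exists p, q1, a', h', L, Q; split=> //; apply: tame_steep fc _.
  rewrite ltn_neqAle eq_sym (ray_p R) andbT; apply/eqP => p1.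
  have := ray_ge R Fij; rewrite p1 in steep *; rewrite muln1 mulnC in steep.
  have := qle _ steep; nia.
have vge := vertex_ge V; have vgt := vertex_gt V.
have gt i j : F i j != 0 -> (h < j)%N -> (a + q * h < i + q * j)%N.
  move=> Fij hj; have [//|le] := ltnP (a + q * h) (i + q * j)%N.
  have l1 := vge _ _ Fij.
  have l2 : (p0 * (i + q * j) <= p0 * (a + q * h))%N by rewrite leq_mul2l le orbT.
  have l3 : (q0 * (j - h) < p0 * q * (j - h))%N by rewrite ltn_mul2r subn_gt0 hj.
  have jE := subnKC (ltnW hj); move: jE l3; set d := (j - h)%N; clearbody d => jE l3.
  by rewrite -jE !mulnDr !mulnA in l1 l2; lia.
have ge : wge 1 q (a + q * h) F.
  move=> i j; rewrite mul1n => lt; apply/eqP/negPn/negP => Fij.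
  have [jh|hj|e] := ltngtP j h; first by apply: high; exists i, j.
    by have := gt _ _ Fij hj; lia.
  by have := vge _ _ Fij; rewrite e leq_add2r leq_mul2l => /orP[/eqP|]; lia.
have [psi1 [w1 z1]] := tschirnhausen q_gt0 h0 (vertex_v V) ge gt.
have w1' i : psi1 i != 0 -> (q0 < p0 * i)%N.
  by move=> /w1 le; apply: leq_trans qgt _; rewrite leq_mul2l le orbT.
have nz psi : (forall i, psi i != 0 -> (q0 < p0 * i)%N) -> psi 0%N = 0.
  by move=> w; apply/eqP/negPn/negP => /w; rewrite muln0.
have p1 := nz _ w1'; have V1 := shear_vertex p1 w1' V.
have [psi2 [w2 H2]] := normalize_small p00 h0 V1 (z1 p1).
have p2 := nz _ w2; exists (psi1 + psi2); split=> [i|p0'].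
  rewrite fpsD.
  by have [e|/w1'//] := eqVneq (psi1 i) 0; rewrite e add0r; apply: w2.
by rewrite -(shear_comp p1 p2 p0'); exact: H2.
Qed.
End Normalize.

(** * Monomial charts at an edge *)

Section Charts.
Variable C : numClosedFieldType.
Notation S := (fps (fps C)).
Implicit Types (F G : S) (psi : fps C) (p q a h i j m n : nat) (c : C) (Q : {poly C}).

Definition colc Q : S := fps_const (pol Q).
Lemma colcE Q i j : colc Q i j = Q`_j *+ (i == 0%N).
Proof. by rewrite /colc fps_constE; case: eqP => _; rewrite ?mulr1n ?mulr0n. Qed.
Lemma colcM Q Q' : colc (Q * Q') = colc Q * colc Q'. Proof. by rewrite /colc !rmorphM. Qed.
Lemma colcX Q n : colc (Q ^+ n) = colc Q ^+ n. Proof. by rewrite /colc !rmorphXn. Qed.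
Lemma colc_row Q : colc Q 0%N = pol Q. Proof. by rewrite /colc fps_constE mulr1n. Qed.
Lemma d1_colc Q : fps_d1 (colc Q) = 0.
Proof. by apply: fps2P => i j; rewrite d1E colcE mulr0n mul0rn. Qed.
Lemma d2_colc Q : fps_d2 (colc Q) = colc Q^`().
Proof. by apply: fps2P => i j; rewrite d2E !colcE coef_deriv -!mulrnA mulnC. Qed.
Lemma zpoly_colc Q : zpoly (colc Q).
Proof.
move=> n; case: n => [|n]; first by exists Q; rewrite colc_row.
by exists 0; apply: fpsP => j; rewrite colcE mulr0n polE coef0.
Qed.
Lemma zpoly_mono2 i j : zpoly (mono2 C i j).
Proof.
move=> n; exists (if n == i then 'X^j else 0); apply: fpsP => k; rewrite mono2E polE.
by case: (n == i); rewrite ?coef0 //= coefXn.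
Qed.

Lemma jac_monomial_algebra (R : comNzRingType) (m1 m2 m3 m4 E A A' B B' : R) x y : m1 * m2 = E -> m3 * m4 = E ->
  m1 *+ x * A * (m2 * B') - m3 * A' * (m4 *+ y * B) = E * (x%:R * (A * B') - y%:R * (A' * B)).
Proof.
move=> E1 E2; rewrite -(mulr_natr m1) -(mulr_natr m4) mulrBr -{1}E1 -E2; ring.
Qed.

Lemma Jac_comp (s t : subst2 C) : Jac (scomp s t) = pull t (Jac s) * Jac t.
Proof.
rewrite /Jac /= rmorphB !rmorphM /= !(chain_rule t _ (d1_der C)) !(chain_rule t _ (d2_der C)).
by ring.
Qed.

Section Face.
Variables (p q a h a' h' L : nat) (F : S) (Q : {poly C}).
Hypothesis fc : face p q a h a' h' L F Q.

Lemma face_low l : (l <= L)%N -> (q * l <= a')%N.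
Proof. by move=> le; rewrite (face_a fc); nia. Qed.

Lemma face_weight l : (l <= L)%N -> (p * (a' - q * l) + q * (h' + p * l) = p * a + q * h)%N.
Proof.
move=> le; have le' := face_low le; have [_ E _] := face_vertex fc; rewrite -E mulnBr mulnDr mulnCA.
have : (p * (q * l) <= p * a')%N by rewrite leq_mul2l le' orbT.
by rewrite [in X in (_ <= X)%N -> _]mulnC; lia.
Qed.

(** [Phi] is arbitrary because the sum occurs twice: in the lowest row of a chart and in the leading
    coefficient along an arc. *)
Lemma face_sum (Phi : nat -> nat -> fps C) B : (p * a + q * h < B)%N ->
  \sum_(x < B) \sum_(y < B) (if (p * x + q * y == p * a + q * h)%N then fps_const (F x y) * Phi x y else 0) =
  \sum_(l < L.+1) fps_const Q`_l * Phi (a' - q * l)%N (h' + p * l)%N.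
Proof.
move=> lt; have [p0 q0] : (0 < p)%N /\ (0 < q)%N by case: (face_ray fc).
have E (l : 'I_L.+1) : fps_const Q`_l * Phi (a' - q * l)%N (h' + p * l)%N =
    \sum_(x < B) \sum_(y < B) (if (x == a' - q * l :> nat)%N && (y == h' + p * l :> nat)%N then
      fps_const Q`_l * Phi x y else 0).
  have le : (l <= L)%N by have := ltn_ord l; lia.
  have w := face_weight le.
  have xB : (a' - q * l < B)%N by nia. have yB : (h' + p * l < B)%N by nia.
  rewrite (bigD1 (Ordinal xB)) //= [X in _ + X]big1 ?addr0 => [|x ne]; last first.
    rewrite big1 // => y _; rewrite (_ : (x == _ :> nat) = false) //.
    by apply/eqP => e; case/eqP: ne; apply: val_inj.
  rewrite (bigD1 (Ordinal yB)) //= !eqxx /= big1 ?addr0 // => y ne.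
  rewrite (_ : (y == _ :> nat) = false) //.
  by apply/eqP => e; case/eqP: ne; apply: val_inj.
under [RHS]eq_bigr do rewrite E.
rewrite [RHS]exchange_big; apply: eq_bigr => x _; rewrite [RHS]exchange_big; apply: eq_bigr => y _ /=.
have no : (forall l, (l <= L)%N -> x = (a' - q * l)%N :> nat -> y = (h' + p * l)%N :> nat -> False) ->
    \sum_(l < L.+1) (if (x == a' - q * l :> nat)%N && (y == h' + p * l :> nat)%N then fps_const Q`_l * Phi x y else 0) = 0.
  move=> H; rewrite big1 // => l _; case: ifP => // /andP[/eqP e1 /eqP e2].
  by case: (H l) => //; have := ltn_ord l; lia.
case: (eqVneq (p * x + q * y)%N (p * a + q * h)%N) => [e|ne]; last first.
  rewrite no // => l le xE yE; case/eqP: ne; rewrite xE yE; exact: face_weight.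
have [Fz|Fn] := eqVneq (F x y) 0.
  rewrite Fz rmorph0 mul0r big1 // => l _; case: ifP => // /andP[/eqP e1 /eqP e2].
  rewrite (face_F fc); last by have := ltn_ord l; lia.
  by rewrite -e1 -e2 Fz rmorph0 mul0r.
have [l [le xE yE]] := face_on fc Fn e.
have lt' : (l < L.+1)%N by [].
rewrite (bigD1 (Ordinal lt')) //= xE yE !eqxx (face_F fc le) big1 ?addr0 // => k ne.
rewrite (_ : (_ && _) = false) //; apply/negP => /andP[_ /eqP e2].
by case/eqP: ne; apply: val_inj; rewrite /=; apply/eqP; rewrite -(eqn_pmul2l p0); apply/eqP; lia.
Qed.

Section MonomialChart.
Variables (al be : {poly C}).
Let p0 : (0 < p)%N. Proof. exact: ray_p (face_ray fc). Qed.
Let q0 : (0 < q)%N. Proof. exact: ray_q (face_ray fc). Qed.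

Lemma mchart_tge n Q' : (0 < n)%N -> tge 1 (mono2 C n 0 * colc Q').
Proof. by move=> n0; apply: tgeMr; apply: tge_mono2_1; rewrite addn0. Qed.
(** The substitution [(u^p al(w), u^q be(w))]. With [al = 1] and [be] linear it sees the whole
    exceptional line; with powers of [X + c] to Bezout exponents it is the chart at a root [c]. *)
Definition mchart := Subst2 (mchart_tge al p0) (mchart_tge be q0).

Lemma mchart_zpoly : bernstein_chart mchart.
Proof.
have r0 n Q' : (0 < n)%N -> (mono2 C n 0 * colc Q') 0%N = 0.
  by move=> n0; apply: fpsP => j; rewrite mono2M leqNgt n0.
move=> G; apply: zpoly_pull; first by apply: zpolyM; [exact: zpoly_mono2|exact: zpoly_colc].
- by apply: zpolyM; [exact: zpoly_mono2|exact: zpoly_colc].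
- exact: r0.
exact: r0.
Qed.

Lemma mchart_row G r : pull mchart G r = \sum_(x < r.+1) \sum_(y < r.+1)
  if (p * x + q * y == r)%N then fps_const (G x y) * pol (al ^+ x * be ^+ y) else 0.
Proof.
apply: fpsP => l; rewrite (@pullE C (r + l)) //.
pose f x y : C := if (p * x + q * y == r)%N then G x y * (al ^+ x * be ^+ y)`_l else 0.
have fz x y : (r < x)%N || (r < y)%N -> f x y = 0.
  by move=> H; rewrite /f; case: eqP => // e; nia.
transitivity (\sum_(x < (r + l).+1) \sum_(y < (r + l).+1) f x y).
  apply: eq_bigr => x _; apply: eq_bigr => y _.
  rewrite [sX _]/(mono2 C p 0 * colc al) [sY _]/(mono2 C q 0 * colc be) !exprMn !mono2X !mul0n mulrACA mono2MM.
  rewrite -!colcX -colcM mono2M addn0 subn0 andbT colcE /f subn_eq0.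
  by case: ltngtP => _; rewrite /= ?mulr0n ?mulr0.
rewrite (@big_widen _ (fun x => \sum_(y < (r + l).+1) f x y) r.+1) ?ltnS ?leq_addr //; last first.
  by move=> x lt; rewrite big1 // => y _; rewrite fz // lt.
rewrite fps_sum; apply: eq_bigr => x _; rewrite fps_sum (@big_widen _ (f x) r.+1) ?ltnS ?leq_addr //; last first.
  by move=> y lt; rewrite fz // lt orbT.
by apply: eq_bigr => y _; rewrite /f; case: ifP => _; rewrite ?fps_constM.
Qed.

Lemma mchart_face : exists G, pull mchart F = mono2 C (p * a + q * h) 0 * G /\
  G 0%N = \sum_(l < L.+1) fps_const Q`_l * pol (al ^+ (a' - q * l) * be ^+ (h' + p * l)).
Proof.
have [G GE] : exists G, pull mchart F = mono2 C (p * a + q * h) 0 * G.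
  apply: row_geP => r lt; rewrite mchart_row big1 // => x _; rewrite big1 // => y _.
  case: eqP => // e; have -> : F x y = 0 by apply/eqP/negPn/negP => /(ray_ge (face_ray fc)); lia.
  by rewrite rmorph0 mul0r.
exists G; split=> //; rewrite -(face_sum (fun x y => pol (al ^+ x * be ^+ y)) (ltnSn _)) -mchart_row GE.
by apply: fpsP => j; rewrite mono2M leqnn subnn subn0.
Qed.

Lemma Jac_mchart : Jac mchart = mono2 C (p + q).-1 0 * colc (p%:R *: (al * be^`()) - q%:R *: (al^`() * be)).
Proof.
rewrite /Jac [sX _]/(mono2 C p 0 * colc al) [sY _]/(mono2 C q 0 * colc be).
rewrite !d1M !d2M !d1_colc !d2_colc !d1_mono2 !d2_mono2 !mulr0n !mul0r !mulr0 !addr0 !add0r.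
have -> : colc (p%:R *: (al * be^`()) - q%:R *: (al^`() * be)) =
    p%:R * (colc al * colc be^`()) - q%:R * (colc al^`() * colc be).
  rewrite -!colcM /colc !scaler_nat !mulr_natl rmorphB !rmorphMn /= rmorphB !rmorphMn //.
have E1 : mono2 C p.-1 0 * mono2 C q 0 = mono2 C (p + q).-1 0 by rewrite mono2MM; congr mono2; lia.
have E2 : mono2 C p 0 * mono2 C q.-1 0 = mono2 C (p + q).-1 0 by rewrite mono2MM; congr mono2; lia.
exact: jac_monomial_algebra.
Qed.
End MonomialChart.

(** By the Bezout relation the monomials of the edge become powers of [c + w] with exponents [e + l]
    for a common [e], so the lowest row is [(c + w)^e Q(w + c)]. *)
Lemma root_face_row c al be : (p * be = q * al + 1)%N -> c != 0 ->
  exists G, pull (mchart (('X + c%:P) ^+ al) (('X + c%:P) ^+ be)) F = mono2 C (p * a + q * h) 0 * G /\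
    (forall j, (j < mup c Q)%N -> G 0%N j = 0) /\ G 0%N (mup c Q) != 0.
Proof.
move=> Bz c0; have [G [GE G0]] := mchart_face (('X + c%:P) ^+ al) (('X + c%:P) ^+ be).
exists G; split=> //; set e := (al * a' + be * h')%N.
have G0E : G 0%N = pol (('X + c%:P) ^+ e * (Q \Po ('X + c%:P))).
  rewrite G0 comp_polyE (face_size fc) mulr_sumr rmorph_sum; apply: eq_bigr => l _ /=.
  have le : (l <= L)%N by have := ltn_ord l; lia.
  have le' := face_low le.
  rewrite -polC -rmorphM -!exprM -exprD -scalerAr -exprD -mul_polyC; congr (pol (_ * _ ^+ _)).
  rewrite mulnBr mulnDr; have : (al * (q * l) <= al * a')%N by rewrite leq_mul2l le' orbT.
  have e1 : (be * (p * l) = al * (q * l) + l)%N by rewrite mulnA [(be * p)%N]mulnC Bz mulnDl mul1n; ring.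
  by rewrite e1 /e; lia.
have Q0 := face_poly_neq0 fc; have [r rc QE] := mup_decomp c Q0; set m := mup c Q in QE *.
have XE : ('X + c%:P) \Po 'X = 'X + c%:P :> {poly C} by rewrite comp_polyXr.
have E : ('X + c%:P) ^+ e * (Q \Po ('X + c%:P)) = 'X^m * (('X + c%:P) ^+ e * (r \Po ('X + c%:P))).
  rewrite {1}QE comp_polyM rmorphXn /= comp_polyB comp_polyX comp_polyC addrK; ring.
rewrite G0E E; split=> [j lt|]; rewrite polE coefXnM; first by rewrite lt.
rewrite ltnn subnn -horner_coef0 hornerM horner_exp horner_comp !hornerE mulf_neq0 //.
by rewrite expf_neq0.
Qed.
End Face.
End Charts.

(** * Roots of b at the edges and vertices of a Newton polygon *)

Section RootsOfB.
Variables (C : numClosedFieldType) (f : fps (fps C)) (b : {poly C}).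
Hypotheses (f0 : f <> 0) (Hb : bernstein_equation f b).
Notation S := (fps (fps C)).
Implicit Types (F G : S) (psi : fps C) (p q a h i j m n k : nat) (c x : C) (Q : {poly C}).

Definition state sg k F := [/\ (0 < k)%N, F = pull sg f & exists J : S, Jac sg = mono2 C k.-1 0 * J /\ J 0%N 0%N != 0].

Lemma exists_roots (g : {poly C}) : g != 0 -> exists rs, roots_of g rs.
Proof.
move=> g0; have [r gE] := closed_field_poly_normal g; exists (undup r); split; first exact: undup_uniq.
by move=> y; rewrite mem_undup {1}gE rootZ ?lead_coef_eq0 // root_prod_XsubC.
Qed.

(** In the chart [(u^p, u^q (w + v0))], which has degree [p], the lowest row of [f] is [g(w + v0)]
    with [g = X^h' Q(X^p)] of degree [h]. [simple_root] asks only for the number of distinct roots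
    of [g]. *)
Lemma ray_root_gen sg k F p q a h a' h' L Q x rs : state sg k F -> face p q a h a' h' L F Q ->
  (p * k + q)%:R + x * (p * a + q * h)%:R = 0 -> x < 0 ->
  uniq rs -> (forall z, root ('X^h' * (Q \Po 'X^p)) z = (z \in rs)) -> (1 < size rs)%N ->
  0 < (size rs)%:R + x * h%:R -> b.[x] = 0.
Proof.
move=> [k0 FE [J [JE J0]]] fc xE x0 urs rts rs1 pos.
have p0 := ray_p (face_ray fc); have q0 := ray_q (face_ray fc).
set g := 'X^h' * (Q \Po 'X^p) in rts.
have Qn := face_poly_neq0 fc.
have QXn : Q \Po 'X^p != 0 by rewrite comp_poly_eq0 // size_polyXn ltnS.
have gn : g != 0 by rewrite mulf_neq0 // -size_poly_eq0 size_polyXn.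
have szg : size g = h.+1.
  rewrite /g mulrC size_Mmonic ?monicXn // size_polyXn addnS /=.
  have := size_comp_poly Q 'X^p; rewrite size_polyXn (face_size fc) /= => e.
  have : (0 < size (Q \Po 'X^p))%N by rewrite size_poly_gt0.
  move: (size (Q \Po 'X^p)) e => sz e sz0; rewrite (face_h fc); lia.
(* The origin of the chart is moved off the roots of [g], since the complex power of the other
   factor of [f] is expanded there. *)
have /closed_nonrootP [v0 gv0] := gn.
have [G [GE G0]] := mchart_face fc 1 ('X + v0%:P); set tau := mchart fc 1 ('X + v0%:P) in GE.
have G0E : G 0%N = pol (g \Po ('X + v0%:P)).
  rewrite G0 /g comp_polyM rmorphXn /= comp_polyX -comp_polyA rmorphXn /= comp_polyX.
  rewrite comp_polyE (face_size fc) mulr_sumr rmorph_sum; apply: eq_bigr => l _ /=.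
  by rewrite -polC -rmorphM expr1n mul1r -scalerAr -exprM -exprD mul_polyC.
have row0 H : (pull tau H) 0%N = fps_const (H 0%N 0%N).
  by rewrite mchart_row !big_ord_recl !big_ord0 !addr0 !muln0 eqxx !expr0 mulr1 (rmorph1 (@pol C)) mulr1.
pose J1 := pull tau J * colc (p%:R%:P).
have JacE : Jac (scomp sg tau) = mono2 C (p * k + q).-1 0 * J1.
  rewrite Jac_comp JE (rmorphM (pull tau)) /= pull_mono [sX _]/(mono2 C p 0 * colc 1) expr0 mulr1.
  rewrite Jac_mchart -polyC1 derivC mul0r scaler0 subr0 derivD derivX derivC addr0 mul1r polyC1.
  rewrite exprMn mono2X mul0n -colcX expr1n {1}/colc (rmorph1 (@pol C)) rmorph1 mulr1.
  rewrite alg_polyC mulrACA -mulrA /J1 mulrA mulrA mono2MM addn0 -mulrA; congr (mono2 C _ 0 * _).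
  by case: k k0 {xE FE JE} => // k _ /=; nia.
have := @simple_root C f (scomp sg tau) b x (p * a + q * h) (p * k + q).-1 G J1 (g \Po ('X + v0%:P))
  [seq z - v0 | z <- rs] (J 0%N 0%N * p%:R) f0 Hb.
apply.
- by move=> H; rewrite -pull_comp; exact: mchart_zpoly.
- by rewrite -pull_comp -FE.
- exact: JacE.
- by rewrite lt0n; apply: contra_eqN xE => /eqP ->; rewrite mulr0 addr0 pnatr_eq0; lia.
- exact: G0E.
- by rewrite horner_comp hornerD hornerX hornerC add0r; exact: gv0.
- by rewrite row0M row0 colc_row polC -rmorphM.
- by rewrite mulf_neq0 // pnatr_eq0 -lt0n.
- by rewrite prednK // addn_gt0 q0 orbT.
- split; first by rewrite map_inj_uniq // => y z; apply: addIr.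
  move=> z; rewrite /root horner_comp hornerD hornerX hornerC -/(root g _) rts; apply/idP/mapP => [H|[y Hy ->]].
    by exists (z + v0); rewrite ?addrK.
  by rewrite subrK.
- by rewrite size_map.
- exact: x0.
by rewrite size_map size_comp_poly2 ?size_XaddC // szg.
Qed.

(** Otherwise a single root [v] would have multiplicity [h]. It is not 0 because [Q(0) <> 0] and [Q]
    is not constant. If it is nonzero, then [h' = 0], and the coefficient of [X^(h-1)], being
    nonzero, forces [p = 1]; then [Q] itself has a root of multiplicity [h], against tameness. *)
Lemma face_two_roots p q a h a' h' L F Q rs : face p q a h a' h' L F Q -> tame h Q -> (0 < h)%N ->
  roots_of ('X^h' * (Q \Po 'X^p)) rs -> (1 < size rs)%N.
Proof.
move=> fc tm h0 [urs rts]; set g := 'X^h' * _ in rts.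
have p0 := ray_p (face_ray fc).
have Qn := face_poly_neq0 fc.
have QXn : Q \Po 'X^p != 0 by rewrite comp_poly_eq0 // size_polyXn ltnS.
have gn : g != 0 by rewrite mulf_neq0 // -size_poly_eq0 size_polyXn.
have szg : size g = h.+1.
  rewrite /g mulrC size_Mmonic ?monicXn // size_polyXn addnS /=.
  have := size_comp_poly Q 'X^p; rewrite size_polyXn (face_size fc) /= => e.
  have : (0 < size (Q \Po 'X^p))%N by rewrite size_poly_gt0.
  move: (size (Q \Po 'X^p)) e => sz e sz0; rewrite (face_h fc); lia.
case: rs rts {urs} => [|v [|//]] rts.
  have /closed_rootP [z] : size g != 1%N by rewrite szg eqSS -lt0n.
  by rewrite rts in_nil.
have [r rv gE] := mup_decomp v gn; set m := mup v g in gE.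
have rn : r != 0 by apply: contraNneq rv => ->; rewrite horner0.
have szr : size r = 1%N.
  apply/eqP/negPn/negP => /closed_rootP [z rz].
  have : root g z by rewrite gE rootM rz orbT.
  rewrite rts inE => /eqP zv; by rewrite -zv -/(root r z) rz in rv.
have mh : m = h.
  have := szg; rewrite {1}gE mulrC size_Mmonic ?monic_exp ?monicXsubC // size_exp_XsubC szr; lia.
have [L0 hE] := (face_L fc, face_h fc).
have [v0|vn] := eqVneq v 0.
  have : mup 0 g = h' .
    have -> : g = ('X - 0%:P) ^+ h' * (Q \Po 'X^p) by rewrite polyC0 subr0.
    rewrite mup_cofactor // horner_comp hornerXn expr0n /= (gtn_eqF p0).
    by rewrite horner_coef0 (face_0 fc).
  rewrite -v0 -/m mh; nia.
have h'0 : h' = 0%N.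
  apply/eqP/negPn/negP => h'0; have : root g 0 by rewrite rootM /root hornerXn expr0n (negbTE h'0) eqxx.
  by rewrite rts inE eq_sym (negbTE vn).
have := full_root_coef h0 szg mh vn; rewrite /g h'0 mul1r coef_comp_poly_Xn //.
case: ifP; rewrite ?eqxx // => pd _.
have p1 : p = 1%N.
  have /dvdnP [e E] := pd; rewrite h'0 add0n in hE.
  have e1 : (p * L = e * p + 1)%N by clear -hE E h0; lia.
  by apply/eqP; rewrite -dvdn1 -(@dvdn_addr (e * p) _ 1) ?dvdn_mull // -e1 dvdn_mulr.
have : (2 * mup v Q <= h)%N.
  apply: tm; have : root g v by rewrite rts inE.
  by rewrite /g h'0 mul1r p1 /root horner_comp hornerXn expr1.
have gQ : g = Q by rewrite /g h'0 mul1r p1 comp_polyXr.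
by rewrite -gQ -/m mh; lia.
Qed.

(** With at least two roots it suffices that [2 + x h > 0], and for [x = -(pk + q)/(pa + qh)] this
    is the inequality assumed. *)
Lemma ray_root sg k F p q a h a' h' L Q x : state sg k F -> face p q a h a' h' L F Q -> tame h Q ->
  (h * (p * k + q) < 2 * (p * a + q * h))%N -> (p * k + q)%:R + x * (p * a + q * h)%:R = 0 -> b.[x] = 0.
Proof.
move=> st fc tm lt xE; have h0 : (0 < h)%N by have [_ _] := face_vertex fc; lia.
have p0 := ray_p (face_ray fc).
have N0 : 0 < (p * a + q * h)%:R :> C by rewrite ltr0n; lia.
have K0 : 0 < (p * k + q)%:R :> C.
  by rewrite ltr0n; have := ray_q (face_ray fc); lia.
have xV : x = - ((p * k + q)%:R / (p * a + q * h)%:R).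
  by apply: (mulIf (lt0r_neq0 N0)); rewrite mulNr divfK ?lt0r_neq0 //; apply/eqP; rewrite -addr_eq0 addrC xE.
have x0 : x < 0 by rewrite xV oppr_lt0 divr_gt0.
have gn : 'X^h' * (Q \Po 'X^p) != 0.
  rewrite mulf_neq0 // -?size_poly_eq0 ?size_polyXn // size_poly_eq0.
  by rewrite comp_poly_eq0 ?(face_poly_neq0 fc) // size_polyXn ltnS.
have [rs [urs rts]] := exists_roots gn; have rs1 := face_two_roots fc tm h0 (conj urs rts).
apply: (ray_root_gen st fc xE x0 urs rts rs1).
have xN : x * (p * a + q * h)%:R = - (p * k + q)%:R by apply/eqP; rewrite -addr_eq0 addrC xE.
have pos : 0 < 2%:R + x * h%:R.
  rewrite -(pmulr_lgt0 _ N0) mulrDl mulrAC xN mulNr subr_gt0 -!natrM ltr_nat mulnC; lia.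
by apply: lt_le_trans pos _; rewrite lerD2r ler_nat.
Qed.

Lemma axis_root_state sg k F a h x : state sg k F -> (0 < h)%N -> F a h != 0 -> (forall i j, (j < h)%N -> F i j = 0) ->
  1 + x * h%:R = 0 -> b.[x] = 0.
Proof.
move=> [k0 FE [J [JE J0]]] h0 v no xE.
have [G GE] : exists G, tr F = mono2 C h 0 * G.
  by apply: row_geP => i lt; apply: fpsP => j; rewrite trE no.
have H1 : pull (scomp sg (swap2 C)) f = mono2 C h 0 * G by rewrite -pull_comp -FE.
have H2 : G 0%N <> 0.
  move=> G0; have := congr1 (fun H : S => H h a) GE; rewrite /= trE mono2M leqnn subnn subn0 /= G0 fps0 => v0.
  by rewrite v0 eqxx in v.
have JE' : Jac (scomp sg (swap2 C)) = - (mono2 C 0 k.-1 * tr J).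
  rewrite Jac_comp JE -/(tr _) trM tr_mono2 /Jac [sX _]/(mono2 C 0 1) [sY _]/(mono2 C 1 0).
  by rewrite !d1_mono2 !d2_mono2 mulr0n mul0r sub0r !mulr1n mono2MM mono200 mulrN1.
have H3 : Jac (scomp sg (swap2 C)) 0%N <> 0.
  have e : (mono2 C 0 k.-1 * tr J) 0%N k.-1 = J 0%N 0%N by rewrite mono2M !leqnn !subnn trE.
  move=> H.
  have : Jac (scomp sg (swap2 C)) 0%N k.-1 = 0 by rewrite H fps0.
  by rewrite JE' !fpsN e => /eqP; rewrite oppr_eq0; exact/negP.
exact: axis_root f0 Hb h0 H1 H2 H3 xE.
Qed.

(** The root [r] of [X^D - r^D] is simple, its derivative there being [D r^(D-1)]. *)
Lemma mup_comp_Xn r (g : {poly C}) D : g != 0 -> r != 0 -> (0 < D)%N -> mup r (g \Po 'X^D) = mup (r ^+ D) g.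
Proof.
move=> g0 r0 D0; have [u uc {1}->] := mup_decomp (r ^+ D) g0; set m := mup _ g.
have [w wE] : exists w : {poly C}, 'X^D - (r ^+ D)%:P = ('X - r%:P) * w.
  have /factor_theorem [w wE] : root ('X^D - (r ^+ D)%:P) r by rewrite /root !hornerE subrr.
  by exists w; rewrite wE mulrC.
have wr : w.[r] != 0.
  have := congr1 (fun t : {poly C} => t^`().[r]) wE.
  rewrite /= derivB derivXn derivC subr0 derivM derivB derivX derivC subr0 mul1r.
  rewrite !hornerE subrr mul0r addr0 => <-.
  by rewrite hornerMn hornerXn mulrn_eq0 negb_or -lt0n D0 expf_neq0.
rewrite comp_polyM rmorphXn /= comp_polyB comp_polyX comp_polyC wE exprMn -mulrA mup_cofactor //.
by rewrite hornerM horner_exp horner_comp hornerXn mulf_neq0 // expf_neq0.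
Qed.

(** * Toric charts at a vertex and double roots *)

Section Toric.
Variables (p1 q1 p2 q2 : nat).
Hypotheses (n1 : (0 < p1 + p2)%N) (n2 : (0 < q1 + q2)%N).
(* A monomial substitution of degree p1 q2 - p2 q1: integration by parts does not need it to be
   birational. *)
Definition toric := Subst2 (@tge_mono2_1 C p1 p2 n1) (@tge_mono2_1 C q1 q2 n2).
Lemma toricE F m n : pull toric F m n = \sum_(x < (m + n).+1) \sum_(y < (m + n).+1)
  if (p1 * x + q1 * y == m)%N && (p2 * x + q2 * y == n)%N then F x y else 0.
Proof.
rewrite (@pullE C (m + n)) //; apply: eq_bigr => x _; apply: eq_bigr => y _.
rewrite [sX _]/(mono2 C p1 p2) [sY _]/(mono2 C q1 q2) !mono2X mono2MM mono2E ![(_ == _ + _)%N]eq_sym.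
by case: ifP => _; rewrite ?mulr1 ?mulr0.
Qed.
End Toric.

Lemma toric_tr p1 q1 p2 q2 (n1 : (0 < p1 + p2)%N) (n2 : (0 < q1 + q2)%N) (n1' : (0 < q2 + q1)%N)
  (n2' : (0 < p2 + p1)%N) F m n :
  pull (@toric q2 p2 q1 p1 n1' n2') (tr F) n m = pull (@toric p1 q1 p2 q2 n1 n2) F m n.
Proof.
rewrite !toricE exchange_big addnC; apply: eq_bigr => x _; apply: eq_bigr => y _ /=.
rewrite trE andbC; congr (if _ && _ then _ else _); congr (_ == _); exact: addnC.
Qed.

Definition edge p q A F (Gl : {poly C}) := forall l, Gl`_l = if (q * l <= A)%N then F (A - q * l)%N (A + p * l)%N else 0.

(** Along the line of weight [(p1, q1)] through [(A, A)] the exponent of [z2] grows by the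
    determinant [D] at each step, whence the substitution of [X^D]. *)
Lemma toric_row p1 q1 p2 q2 A F Gl (n1 : (0 < p1 + p2)%N) (n2 : (0 < q1 + q2)%N) n : (0 < q1)%N -> (0 < p1)%N -> coprime p1 q1 -> (p2 * q1 < p1 * q2)%N ->
  edge p1 q1 A F Gl ->
  pull (@toric p1 q1 p2 q2 n1 n2) F ((p1 + q1) * A)%N (n + (p2 + q2) * A)%N = (Gl \Po 'X^(p1 * q2 - p2 * q1))`_n.
Proof.
move=> q10 p10 co lt GlE; set D := (p1 * q2 - p2 * q1)%N; have D0 : (0 < D)%N by rewrite /D; lia.
have DE : (p1 * q2 = D + p2 * q1)%N by rewrite /D; lia.
rewrite coef_comp_poly_Xn // toricE; set B := (_ + _).+1.
have sol (x y : nat) : (p1 * x + q1 * y = (p1 + q1) * A)%N -> (p2 * x + q2 * y = n + (p2 + q2) * A)%N ->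
    exists l, [/\ n = (D * l)%N, x = (A - q1 * l)%N, (q1 * l <= A)%N & y = (A + p1 * l)%N].
  move=> e1 e2; clearbody D; have xA : (x <= A)%N.
    rewrite leqNgt; apply/negP => ltx; have lty : (y < A)%N by nia.
    have f1 : (p1 * (x - A) = q1 * (A - y))%N by nia.
    have f2 : (q2 * (A - y) <= p2 * (x - A))%N by nia.
    have f3 : (p1 * (q2 * (A - y)) <= p1 * (p2 * (x - A)))%N by rewrite leq_mul2l f2 orbT.
    have f4 : (p1 * (p2 * (x - A)) = p2 * (q1 * (A - y)))%N by rewrite mulnCA f1.
    rewrite f4 mulnA DE mulnDl -mulnA in f3.
    by have : (0 < D * (A - y))%N; [rewrite muln_gt0 D0 subn_gt0 lty|lia].
  have f1 : (p1 * (A - x) = q1 * (y - A))%N by nia.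
  have : (q1 %| A - x)%N by rewrite -(@Gauss_dvdr _ p1) 1?coprime_sym // f1 dvdn_mulr.
  case/dvdnP => l lE; have e3 : (y - A = p1 * l)%N.
    by apply/eqP; rewrite -(eqn_pmul2l q10) -f1 lE; apply/eqP; ring.
  have yA : (A <= y)%N by nia.
  have xE : x = (A - q1 * l)%N by lia.
  have yE : y = (A + p1 * l)%N by lia.
  have le : (q1 * l <= A)%N by lia.
  exists l; split=> //.
  have e4 : (q2 * (p1 * l) = D * l + p2 * (q1 * l))%N by rewrite mulnA [(q2 * p1)%N]mulnC DE mulnDl -mulnA.
  have e5 : (p2 * x + p2 * (q1 * l) = p2 * A)%N by rewrite -mulnDr xE subnK.
  by rewrite yE mulnDr e4 mulnDl in e2; lia.
case: ifP => [/dvdnP [l lE]|nd]; last first.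
  rewrite big1 // => x _; rewrite big1 // => y _; case: ifP => // /andP[/eqP e1 /eqP e2].
  by have [l [E _ _ _]] := sol _ _ e1 e2; rewrite E dvdn_mulr in nd.
have -> : (n %/ D = l)%N by rewrite lE mulnK.
rewrite GlE; case: leqP => le; last first.
  rewrite big1 // => x _; rewrite big1 // => y _; case: ifP => // /andP[/eqP e1 /eqP e2].
  have [l' [E _ le' _]] := sol _ _ e1 e2; have : (l = l')%N by apply/eqP; rewrite -(eqn_pmul2l D0) -E lE mulnC.
  by lia.
have w1 : (p1 * (A - q1 * l) + q1 * (A + p1 * l) = (p1 + q1) * A)%N.
  have : (p1 * (A - q1 * l) + p1 * (q1 * l) = p1 * A)%N by rewrite -mulnDr subnK.
  by rewrite mulnDr mulnDl (mulnCA q1); lia.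
have w2 : (p2 * (A - q1 * l) + q2 * (A + p1 * l) = n + (p2 + q2) * A)%N.
  have : (p2 * (A - q1 * l) + p2 * (q1 * l) = p2 * A)%N by rewrite -mulnDr subnK.
  have : (q2 * (p1 * l) = D * l + p2 * (q1 * l))%N by rewrite mulnA [(q2 * p1)%N]mulnC DE mulnDl -mulnA.
  by rewrite mulnDr mulnDl lE [(l * D)%N]mulnC; lia.
have xB : (A - q1 * l < B)%N by rewrite /B; nia.
have yB : (A + p1 * l < B)%N.
  have h1 : (q1 * (A + p1 * l) <= (p1 + q1) * A)%N by lia.
  by rewrite /B ltnS; nia.
rewrite (bigD1 (Ordinal xB)) //= [X in _ + X]big1 ?addr0; last first.
  move=> x ne; rewrite big1 // => y _; case: ifP => // /andP[/eqP e1 /eqP e2].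
  have [l' [E xE _ _]] := sol _ _ e1 e2; have ll : (l = l')%N by apply/eqP; rewrite -(eqn_pmul2l D0) -E lE mulnC.
  by case/eqP: ne; apply: val_inj; rewrite /= xE ll.
rewrite (bigD1 (Ordinal yB)) //= w1 w2 !eqxx /= big1 ?addr0 // => y ne; case: ifP => // /andP[/eqP e1 _].
case/eqP: ne; apply: val_inj => /=; apply/eqP; rewrite -(eqn_pmul2l q10); apply/eqP.
by move: e1; rewrite -w1; lia.
Qed.

(* Either the ray is an axis, or the polynomial of the edge ending at (A, A) has a root around which
   f^(-1/A) has nontrivial monodromy. *)
Definition edge_ok p q A F := (q = 0%N /\ p = 1%N) \/
  [/\ (0 < q)%N, (0 < p)%N, coprime p q & exists Gl bt, [/\ edge p q A F Gl, root Gl bt, bt != 0 & (mup bt Gl < A)%N]].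

Lemma nonintegral x m A (i : int) : 1 + x * A%:R = 0 -> (0 < m < A)%N -> x * m%:R <> i%:~R.
Proof.
move=> xE /andP[m0 mA] E.
have A0 : A%:R != 0 :> C by rewrite pnatr_eq0 -lt0n; lia.
have : m%:R = - (i * A%:Z)%:~R :> C.
  have : x * A%:R = -1 by apply/eqP; rewrite -addr_eq0 addrC xE.
  by move=> xA; rewrite intrM -E -[(A%:Z)%:~R]pmulrn -mulrA [m%:R * _]mulrC mulrA xA mulN1r opprK.
rewrite pmulrn -rmorphN => /intr_inj H.
have : (A %| m)%N by rewrite -[m]/`|m%:Z|%N H abszN abszM dvdn_mull.
by move/dvdn_leq => /(_ m0); lia.
Qed.

Lemma edge_side p1 q1 p2 q2 A F (n1 : (0 < p1 + p2)%N) (n2 : (0 < q1 + q2)%N) sg x (G : S) : bernstein_chart sg ->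
  (p2 * q1 < p1 * q2)%N -> edge_ok p1 q1 A F -> 1 + x * A%:R = 0 ->
  (forall n, G 0%N n = pull (@toric p1 q1 p2 q2 n1 n2) F ((p1 + q1) * A)%N (n + (p2 + q2) * A)%N) ->
  F A A != 0 -> side_ok sg x (p1 + q1).-1 G.
Proof.
move=> bc lt [[e1 e2]|[q10 p10 co [Gl [bt [GlE rbt bt0 mlt]]]]] xE HG v; first by left; rewrite e1 e2.
right; split=> //; set D := (p1 * q2 - p2 * q1)%N; have D0 : (0 < D)%N by rewrite /D; lia.
(* The toric chart replaces the edge polynomial by its composite with [X^D]: a [D]-th root of [bt]
   is a root of it with the same multiplicity. *)
have [r rD] : exists r : C, r ^+ D = bt by exists (D.-root bt); rewrite rootCK.
have r0 : r != 0 by apply: contraNneq bt0 => r0; rewrite -rD r0 expr0n (gtn_eqF D0).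
have Gl0 : Gl != 0.
  by apply: contraNneq v => H; have := GlE 0; rewrite H coef0 !muln0 leq0n subn0 addn0 => <-.
exists (Gl \Po 'X^D), r; split=> //.
- by apply: fpsP => n; rewrite HG (@toric_row p1 q1 p2 q2 A F Gl n1 n2 n q10 p10 co lt GlE).
- by rewrite /root horner_comp hornerXn rD.
- move=> i; rewrite mup_comp_Xn // rD; apply: nonintegral xE _.
  by rewrite mlt andbT mup_gt0.
Qed.

(** In the toric chart spanned by the two rays, [f] is [z1^N1 z2^N2] times a unit because [(A, A)]
    is the vertex between them. As [k = 1], each [N_i] is [A] times the corresponding Jacobian
    exponent plus one, so both divisors are resonant at [-1/A]. *)
Lemma double_vertex sg F A p1 q1 p2 q2 x : b != 0 -> state sg 1 F -> (0 < A)%N -> F A A != 0 ->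
  (p2 * q1 < p1 * q2)%N ->
  (forall i j, F i j != 0 -> (p1 * A + q1 * A <= p1 * i + q1 * j)%N /\ (p2 * A + q2 * A <= p2 * i + q2 * j)%N) ->
  edge_ok p1 q1 A F -> edge_ok q2 p2 A (tr F) -> 1 + x * A%:R = 0 -> (2 <= mup x b)%N.
Proof.
move=> b0 [_ FE [J [JE J0]]] A0 v lt ge e1 e2 xE; rewrite mono200 mul1r in JE.
have p10 : (0 < p1)%N by case: p1 lt {ge e1} => //; lia.
have q20 : (0 < q2)%N by case: q2 lt {ge e2} => //; lia.
have n1 : (0 < p1 + p2)%N by rewrite addn_gt0 p10.
have n2 : (0 < q1 + q2)%N by rewrite addn_gt0 q20 orbT.
have n1' : (0 < q2 + q1)%N by rewrite addnC. have n2' : (0 < p2 + p1)%N by rewrite addnC.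
pose tau := toric n1 n2; pose N1 := ((p1 + q1) * A)%N; pose N2 := ((p2 + q2) * A)%N.
pose G : S := Fps (fun m => Fps (fun n => pull tau F (m + N1)%N (n + N2)%N)).
have Gc m n : G m n = pull tau F (m + N1)%N (n + N2)%N by [].
have GE : pull tau F = mono2 C N1 N2 * G.
  apply: fps2P => m n; rewrite mono2M; case: ifP => [/andP[l1 l2]|/negP H]; first by rewrite Gc !subnK.
  rewrite toricE big1 // => i _; rewrite big1 // => j _; case: ifP => // /andP[/eqP E1 /eqP E2].
  apply/eqP/negPn/negP => /ge [g1 g2]; apply: H; apply/andP.
  by split; [apply: leq_trans (eq_leq E1)|apply: leq_trans (eq_leq E2)]; rewrite ?/N1 ?/N2 mulnDl.
have G00 : G 0%N 0%N = F A A.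
  rewrite Gc !add0n toricE.
  have sol i j : (p1 * i + q1 * j = N1)%N -> (p2 * i + q2 * j = N2)%N -> i = A /\ j = A.
    rewrite /N1 /N2 => h1 h2.
    have i1 : (p1 * q2 * i + q1 * q2 * j = (p1 * q2 + q1 * q2) * A)%N.
      by rewrite -mulnDl -[RHS]mulnAC -h1; ring.
    have i2 : (p2 * q1 * i + q1 * q2 * j = (p2 * q1 + q1 * q2) * A)%N.
      by rewrite [(p2 * q1)%N]mulnC -mulnDr -[RHS]mulnA -h2; ring.
    have iA : i = A by nia.
    split=> //; subst i; have [q10|q10] := posnP q1; last by nia.
    by nia.
  have AB : (A < (N1 + N2).+1)%N by rewrite /N1 /N2; nia.
  rewrite (bigD1 (Ordinal AB)) //= [X in _ + X]big1 ?addr0; last first.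
    move=> i ne; rewrite big1 // => j _; case: ifP => // /andP[/eqP E1 /eqP E2].
    by case/eqP: ne; apply: val_inj; have [] := sol _ _ E1 E2.
  rewrite (bigD1 (Ordinal AB)) //= -!mulnDl !eqxx /= big1 ?addr0 // => j ne; case: ifP => // /andP[/eqP E1 /eqP E2].
  by case/eqP: ne; apply: val_inj; have [] := sol _ _ E1 E2.
have E1 : mono2 C (p1.-1 + q1) (p2 + q2.-1) = mono2 C (p1 + q1).-1 (p2 + q2).-1 by congr mono2; lia.
have E2 : mono2 C (p1 + q1.-1) (p2.-1 + q2) *+ (p2 * q1) = mono2 C (p1 + q1).-1 (p2 + q2).-1 *+ (p2 * q1).
  have [z|q10] := posnP q1; first by rewrite z muln0 !mulr0n.
  have [z|p20] := posnP p2; first by rewrite z mul0n !mulr0n.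
  by congr (mono2 _ _ _ *+ _); lia.
pose d : C := (p1 * q2)%:R - (p2 * q1)%:R.
have dE : cst d = (p1 * q2)%:R - (p2 * q1)%:R :> S by rewrite /d rmorphB !rmorph_nat.
pose J1 := pull tau J * cst d.
have JacE : Jac (scomp sg tau) = mono2 C (p1 + q1).-1 (p2 + q2).-1 * J1.
  rewrite Jac_comp JE /J1 mulrCA; congr (_ * _); rewrite /Jac [sX _]/(mono2 C p1 p2) [sY _]/(mono2 C q1 q2).
  rewrite !d1_mono2 !d2_mono2 dE mulrBr !mulr_natr !mulrnAl !mulrnAr !mono2MM -!mulrnA E1.
  by rewrite [X in _ *+ X - _]mulnC [X in _ - _ *+ X]mulnC E2.
have J100 : J1 0%N 0%N != 0.
  rewrite /J1 mulrC cstM mulf_neq0 //; last first.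
    by rewrite (@pullE C 0) // !big_ord_recl !big_ord0 !addr0 !expr0 mulr1 -mono200 mono2E mulr1.
  by rewrite subr_eq0 eqr_nat; apply/eqP; lia.

have r0 m n : (0 < m)%N -> (mono2 C m n) 0%N = 0.
  by move=> m0; apply: fpsP => j; rewrite mono2E eq_sym (gtn_eqF m0).
have bc2 : bernstein_chart (scomp (scomp sg tau) (swap2 C)) \/ p2 = 0%N /\ q2 = 1%N.
  case: e2 => [[-> ->]|[p20 _ _ _]]; [by right|left=> H].
  rewrite -pull_comp -pull_comp pull_comp; apply: zpoly_pull => /=; rewrite -/(tr _) tr_mono2.
  - exact: zpoly_mono2.
  - exact: zpoly_mono2.
  - exact: r0.
  exact: r0.
have bc1 : bernstein_chart (scomp sg tau) \/ q1 = 0%N /\ p1 = 1%N.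
  case: e1 => [[-> ->]|[q10 _ _ _]]; [by right|left=> H].
  rewrite -pull_comp; apply: zpoly_pull => /=.
  - exact: zpoly_mono2.
  - exact: zpoly_mono2.
  - exact: r0.
  exact: r0.
have H1 : pull (scomp sg tau) f = mono2 C N1 N2 * G by rewrite -pull_comp -FE.
have H2 : G 0%N 0%N != 0 by rewrite G00.
have H3 : (0 < N1)%N by rewrite muln_gt0 addn_gt0 p10.
have H4 : (0 < N2)%N by rewrite muln_gt0 addn_gt0 q20 orbT.
have H5 : (p1 + q1).-1.+1%:R + x * N1%:R = 0.
  by rewrite prednK ?addn_gt0 ?p10 // /N1 natrM mulrCA -{1}[(p1 + q1)%:R]mulr1 -mulrDr xE mulr0.
have H6 : (p2 + q2).-1.+1%:R + x * N2%:R = 0.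
  by rewrite prednK ?addn_gt0 ?q20 ?orbT // /N2 natrM mulrCA -{1}[(p2 + q2)%:R]mulr1 -mulrDr xE mulr0.
have H7 : side_ok (scomp sg tau) x (p1 + q1).-1 G.
  case: bc1 => [bc|[-> ->]]; last by left.
  by apply: (@edge_side p1 q1 p2 q2 A F n1 n2) => // n; rewrite Gc add0n.
have H8 : side_ok (scomp (scomp sg tau) (swap2 C)) x (p2 + q2).-1 (tr G).
  case: bc2 => [bc|[-> ->]]; last by left.
  rewrite addnC; apply: (@edge_side q2 p2 q1 p1 A (tr F) n1' n2') => //; first by rewrite mulnC [ltnRHS]mulnC.
    move=> n; rewrite trE Gc add0n -(toric_tr n1 n2 n1' n2') /N1 /N2; congr (pull _ _ _ _); lia.
  by rewrite trE.
exact: (double_root f0 Hb b0 H1 H2 JacE J100 H3 H4 H5 H6 H7 H8).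
Qed.
End RootsOfB.

(** * Stratification of the arcs *)

Section Regions.
Variable C : numClosedFieldType.
Notation M := (motring C).
Notation Li := (Lef_inv C).
Notation arcs := (Defs.arc C).
Notation S := (fps (fps C)).
Implicit Types (F G : S) (g : arcs) (A : nat -> set arcs) (psi u v : fps C) (p q k i j m n a h L : nat) (c : C) (Q : {poly C}).

Definition vge u m := forall k, (k < m)%N -> u k = 0.

Lemma vgeM u v m n : vge u m -> vge v n -> vge (u * v) (m + n).
Proof. by move=> H1 H2; have [] := fps_low H1 H2. Qed.
Lemma vgeX u m n : vge u m -> vge (u ^+ n) (m * n).
Proof.
move=> H; elim: n => [|n IH]; first by rewrite muln0 => k.
by rewrite exprS mulnS; apply: vgeM.
Qed.
Lemma vge1 u : u 0%N = 0 -> vge u 1. Proof. by move=> u0 [|k]. Qed.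
Lemma has_order_vge u m : has_order u m -> vge u m. Proof. by case. Qed.

Lemma vge_monomial g m n i j : vge g.1 m -> vge g.2 n -> vge (g.1 ^+ i * g.2 ^+ j) (m * i + n * j).
Proof. by move=> H1 H2; apply: vgeM; apply: vgeX. Qed.

Lemma evE F g n : ev F g n = \sum_(i < n.+1) \sum_(j < n.+1) F i j * (g.1 ^+ i * g.2 ^+ j) n.
Proof. by []. Qed.

Lemma vge_ev F g m n N : vge g.1 m -> vge g.2 n -> (forall i j, F i j != 0 -> (N <= m * i + n * j)%N) -> vge (ev F g) N.
Proof.
move=> H1 H2 H t lt; rewrite evE big1 // => i _; rewrite big1 // => j _.
have [->|/H le] := eqVneq (F i j) 0; first by rewrite mul0r.
by rewrite (vge_monomial H1 H2) ?mulr0 //; apply: leq_trans lt le.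
Qed.

Lemma ev_dominant F g a h m n : vge g.1 m -> vge g.2 n -> (0 < m)%N -> (0 < n)%N -> F a h != 0 ->
  (g.1 ^+ a * g.2 ^+ h) (m * a + n * h)%N != 0 ->
  (forall i j, F i j != 0 -> (i, j) != (a, h) -> (m * a + n * h < m * i + n * j)%N) ->
  has_order (ev F g) (m * a + n * h).
Proof.
move=> H1 H2 m0 n0 v nz gt; split.
  apply: (@vge_ev F g m n) => // i j Fij; have [[-> ->] //|ne] := eqVneq (i, j) (a, h).
  by apply: ltnW; exact: gt.
have aN : (a < (m * a + n * h).+1)%N by nia.
have hN : (h < (m * a + n * h).+1)%N by nia.
rewrite evE (bigD1 (Ordinal aN)) //= (bigD1 (Ordinal hN)) //= big1 ?addr0 => [|j ne]; last first.
  have [->|Fj] := eqVneq (F a j) 0; first by rewrite mul0r.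
  rewrite (vge_monomial H1 H2) ?mulr0 //; apply: gt => //.
  by apply/eqP => -[e]; case/eqP: ne; apply: val_inj.
rewrite big1 ?addr0 => [|i ne]; first by apply/eqP; rewrite mulf_neq0.
rewrite big1 // => j _; have [->|Fj] := eqVneq (F i j) 0; first by rewrite mul0r.
rewrite (vge_monomial H1 H2) ?mulr0 //; apply: gt => //.
by apply/eqP => -[e _]; case/eqP: ne; apply: val_inj.
Qed.

Lemma cone_order F g a h p1 q1 p2 q2 i j : F a h != 0 ->
  (forall x y, F x y != 0 -> (p1 * a + q1 * h <= p1 * x + q1 * y)%N /\ (p2 * a + q2 * h <= p2 * x + q2 * y)%N) ->
  (p2 * q1 < p1 * q2)%N -> (q1 * i < p1 * j)%N -> (p2 * j < q2 * i)%N ->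
  has_order g.1 i -> has_order g.2 j -> has_order (ev F g) (a * i + h * j).
Proof.
move=> v ge lt c1 c2 o1 o2; rewrite (mulnC a) (mulnC h).
have i0 : (0 < i)%N by nia. have j0 : (0 < j)%N by nia.
apply: ev_dominant => //; [exact: has_order_vge|exact: has_order_vge| |].
  have [O1 E1] := has_orderX a o1; have [O2 E2] := has_orderX h o2.
  have [_ E] := has_orderM O1 O2; rewrite (mulnC i) (mulnC j) E E1 E2 mulf_neq0 // expf_neq0 //; apply/eqP.
    by case: o1.
  by case: o2.
move=> x y Fxy ne; have [w1 w2] := ge _ _ Fxy.
have D0 : (0 < p1 * q2 - p2 * q1)%N by rewrite subn_gt0.
rewrite -(ltn_pmul2l D0).
(* Inside the cone [(i, j)] is a positive combination of the rays, [D (i, j) = (q2 i - p2 j) (p1,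
   q1) + (p1 j - q1 i) (p2, q2)]. A point minimal for both rays is therefore the only minimum for
   the weight [(i, j)]. *)
have key (s t : nat) : ((p1 * q2 - p2 * q1) * (i * s + j * t) = (q2 * i - p2 * j) * (p1 * s + q1 * t) + (p1 * j - q1 * i) * (p2 * s + q2 * t))%N.
  apply/eqP; rewrite -(eqr_nat (Num.NumDomain.clone _ int)) !(natrD, natrM) !natrB ?(ltnW lt) ?(ltnW c1) ?(ltnW c2) // !natrM; apply/eqP; ring.
rewrite !key.
have A0 : (0 < q2 * i - p2 * j)%N by rewrite subn_gt0.
have B0 : (0 < p1 * j - q1 * i)%N by rewrite subn_gt0.
have [e1|n1] := eqVneq (p1 * a + q1 * h)%N (p1 * x + q1 * y)%N; last first.
  have w1' : (p1 * a + q1 * h < p1 * x + q1 * y)%N by rewrite ltn_neqAle n1.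
  by rewrite -addSn leq_add // ?ltn_pmul2l // leq_mul2l w2 orbT.
have [e2|n2] := eqVneq (p2 * a + q2 * h)%N (p2 * x + q2 * y)%N; last first.
  have w2' : (p2 * a + q2 * h < p2 * x + q2 * y)%N by rewrite ltn_neqAle n2.
  by rewrite -addnS leq_add // ?ltn_pmul2l // leq_mul2l w1 orbT.
case/eqP: ne; have xa : x = a.
  apply/eqP; rewrite -(eqn_pmul2l D0) -(eqr_nat (Num.NumDomain.clone _ int)) !natrM natrB ?(ltnW lt) // !natrM.
  move/(congr1 (fun n : nat => n%:R : int)): e1; move/(congr1 (fun n : nat => n%:R : int)): e2.
  rewrite !(natrD, natrM) => e2 e1; apply/eqP.
  have -> : (p1%:R * q2%:R - p2%:R * q1%:R) * x%:R = q2%:R * (p1%:R * x%:R + q1%:R * y%:R) - q1%:R * (p2%:R * x%:R + q2%:R * y%:R) :> int by ring.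
  by rewrite -e1 -e2; ring.
have yh : y = h.
  apply/eqP; rewrite -(eqn_pmul2l D0) -(eqr_nat (Num.NumDomain.clone _ int)) !natrM natrB ?(ltnW lt) // !natrM.
  move/(congr1 (fun n : nat => n%:R : int)): e1; move/(congr1 (fun n : nat => n%:R : int)): e2.
  rewrite !(natrD, natrM) => e2 e1; apply/eqP.
  have -> : (p1%:R * q2%:R - p2%:R * q1%:R) * y%:R = p1%:R * (p2%:R * x%:R + q2%:R * y%:R) - p2%:R * (p1%:R * x%:R + q1%:R * y%:R) :> int by ring.
  by rewrite -e1 -e2; ring.
by rewrite xa yh.
Qed.

Lemma face_order p q a h a' h' L F Q g l : face p q a h a' h' L F Q -> (0 < l)%N ->
  has_order g.1 (p * l) -> has_order g.2 (q * l) -> ~~ root Q (g.2 (q * l)%N ^+ p / g.1 (p * l)%N ^+ q) ->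
  has_order (ev F g) ((p * a + q * h) * l).
Proof.
move=> fc l0 o1 o2 nr; have R := face_ray fc; have p0 := ray_p R; have q0 := ray_q R.
have H1 := has_order_vge o1; have H2 := has_order_vge o2.
split.
  apply: (@vge_ev F g (p * l) (q * l)) => // i j /(ray_ge R) le.
  by rewrite mulnAC [(q * l * j)%N]mulnAC -mulnDl leq_mul2r le orbT.
set x := g.1 (p * l)%N in nr *; set y := g.2 (q * l)%N in nr *.
have x0 : x != 0 by apply/eqP; case: o1. have y0 : y != 0 by apply/eqP; case: o2.
have mon i j : (p * i + q * j = p * a + q * h)%N -> (g.1 ^+ i * g.2 ^+ j) ((p * a + q * h) * l)%N = x ^+ i * y ^+ j.
  move=> <-; have [O1 E1] := has_orderX i o1; have [O2 E2] := has_orderX j o2.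
  by have [_ E] := has_orderM O1 O2; rewrite -E1 -E2 -E; congr (fps_coef _ _); ring.
have B : (p * a + q * h < ((p * a + q * h) * l).+1)%N by rewrite ltnS leq_pmulr.
have := congr1 (fun u : fps C => u 0%N) (face_sum fc (fun i j => fps_const (x ^+ i * y ^+ j)) B).
rewrite !fps_sum /=.
have -> : \sum_(i < ((p * a + q * h) * l).+1) (\sum_(j < ((p * a + q * h) * l).+1)
   (if (p * i + q * j == p * a + q * h)%N then fps_const (F i j) * fps_const (x ^+ i * y ^+ j) else 0 : fps C)) 0%N =
   ev F g ((p * a + q * h) * l)%N.
  rewrite evE; apply: eq_bigr => i _; rewrite fps_sum; apply: eq_bigr => j _.
  case: ifP => [/eqP E|ne]; first by rewrite mon // -rmorphM fps_constE mulr1n.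
  have [->|Fij] := eqVneq (F i j) 0; first by rewrite mul0r.
  rewrite (vge_monomial H1 H2) ?mulr0 //; have := ray_ge R Fij.
  rewrite [(p * l * i)%N]mulnAC [(q * l * j)%N]mulnAC -mulnDl ltn_pmul2r // leq_eqVlt eq_sym ne //.
move=> ->; apply/eqP.
have -> : \sum_(i < L.+1) (fps_const Q`_i * fps_const (x ^+ (a' - q * i) * y ^+ (h' + p * i))) 0%N =
   x ^+ a' * y ^+ h' * Q.[y ^+ p / x ^+ q].
  rewrite horner_coef (face_size fc) mulr_sumr; apply: eq_bigr => i _.
  rewrite -rmorphM fps_constE mulr1n; have le := face_low fc (leq_ord i).
  rewrite -[in RHS](subnK le) exprD exprD expr_div_n -!exprM.
  have xx : x ^+ (q * i) != 0 by rewrite expf_neq0.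
  by field.
by rewrite !mulf_neq0 ?expf_neq0.
Qed.

(* A i is a region of arcs with first component of order i; the factor L^-((k-1)i) of ZR comes from
   the Jacobian. *)
Definition piece F A i n : set arcs := [set g : arcs | [/\ has_order g.1 i, g.2 0%N = 0, A i g & has_order (ev F g) n]].
Definition ZR F k A : fps M := Fps (fun n => \sum_(i < n) Li ^+ (k.-1 * i.+1) * mu (piece F A i.+1 n)).
(* p ord g.2 > q ord g.1, including g.2 = 0; likewise [from] for >=. *)
Definition beyond p q i : set arcs := [set g : arcs | forall j, (p * j <= q * i)%N -> g.2 j = 0].
Definition from p q i : set arcs := [set g : arcs | forall j, (p * j < q * i)%N -> g.2 j = 0].
Definition cone p1 q1 p2 q2 i : set arcs := [set g : arcs | exists j, [/\ (q1 * i < p1 * j)%N, (p2 * j < q2 * i)%N & has_order g.2 j]].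
Definition onroots p q (rs : seq C) i : set arcs := [set g : arcs | exists l c, [/\ i = (p * l)%N, c \in rs & root_cell p q c l g]].
Definition ongen p q Q i : set arcs := [set g : arcs | exists l, [/\ i = (p * l)%N, has_order g.1 (p * l), has_order g.2 (q * l) &
  ~~ root Q (g.2 (q * l)%N ^+ p / g.1 (p * l)%N ^+ q)]].
Definition mreg F A := forall i n, (0 < i)%N -> meas (piece F A i n).

Lemma mreg_meas F A : (forall i, (0 < i)%N -> meas (A i)) -> mreg F A.
Proof.
move=> H i n i0; have m0 : meas [set g : arcs | g.2 0%N = 0] by apply: meas0; exact: afps2.
apply: meas_ext (measI (measI (meas_order i (@afps1 C)) m0) (measI (H i i0) (meas_order n (@afps_ev C F)))) => g.
by split=> [[[? ?] [? ?]]|[? ? ? ?]].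
Qed.

Lemma meas_zeros (P : nat -> Prop) n : meas [set g : arcs | forall j, (j < n)%N -> P j -> g.2 j = 0].
Proof.
elim: n => [|n IH]; first by apply: meas_ext (@measT C) => g; split.
have [Pn|nP] := pselect (P n); last first.
  apply: meas_ext IH => g; split=> H j; last by move=> lt; apply: H; exact: ltnW.
  by rewrite ltnS leq_eqVlt => /orP[/eqP -> /nP|/H].
apply: meas_ext (measI IH (meas0 (@afps2 C n))) => g; split=> [[H1 H2] j|H].
  by rewrite ltnS leq_eqVlt => /orP[/eqP -> _|/H1].
by split=> [j lt|]; apply: H => //; exact: ltnW.
Qed.

Lemma meas_beyond p q i : (0 < p)%N -> meas (beyond p q i).
Proof.
move=> p0; apply: meas_ext (meas_zeros (fun j => (p * j <= q * i)%N) (q * i).+1) => g.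
by split=> H j; [move=> le; apply: H => //; nia|move=> _; exact: H].
Qed.
Lemma meas_from p q i : (0 < p)%N -> meas (from p q i).
Proof.
move=> p0; apply: meas_ext (meas_zeros (fun j => (p * j < q * i)%N) (q * i).+1) => g.
by split=> H j; [move=> le; apply: H => //; nia|move=> _; exact: H].
Qed.

Lemma ZR_split F k A A1 A2 : mreg F A1 -> mreg F A2 ->
  (forall i n g, (0 < i)%N -> has_order g.1 i -> g.2 0%N = 0 -> has_order (ev F g) n -> (A i g <-> A1 i g \/ A2 i g)) ->
  (forall i g, (0 < i)%N -> has_order g.1 i -> A1 i g -> A2 i g -> False) ->
  ZR F k A = ZR F k A1 + ZR F k A2.
Proof.
move=> m1 m2 H D; apply: fpsP => n; rewrite fpsD -big_split; apply: eq_bigr => i _ /=.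
rewrite -mulrDr -mu_add; [congr (_ * _)|exact: m1|exact: m2|].
  apply: mu_ext => g; split=> [[o1 z Ag o2]|[[o1 z Ag o2]|[o1 z Ag o2]]].
  - by have [/(_ Ag) [?|?] _] := H _ _ _ (ltn0Sn i) o1 z o2; [left|right].
  - by split=> //; apply/(H _ _ _ (ltn0Sn i) o1 z o2); left.
  - by split=> //; apply/(H _ _ _ (ltn0Sn i) o1 z o2); right.
by move=> g [o1 _ A1g _] [_ _ A2g _]; apply: D A1g A2g.
Qed.

Lemma ZR_ext F F' k A A' : (forall i n, (0 < i)%N -> mu (piece F A i n) = mu (piece F' A' i n)) -> ZR F k A = ZR F' k A'.
Proof. by move=> H; apply: fpsP => n; apply: eq_bigr => i _; rewrite H. Qed.

Lemma mu_bigU n (P : nat -> set arcs) : (forall i, (i < n)%N -> meas (P i)) ->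
  (forall i j g, (i < n)%N -> (j < n)%N -> P i g -> P j g -> i = j) ->
  meas [set g : arcs | exists i, (i < n)%N /\ P i g] /\ mu [set g : arcs | exists i, (i < n)%N /\ P i g] = \sum_(i < n) mu (P i).
Proof.
elim: n => [|n IH] m D.
  have e g : set0 g <-> exists i, (i < 0)%N /\ P i g by split=> [|[i []]].
  split; first by apply: meas_ext e _; apply: meas_ext (measC (@measT C)) => g; split=> //; exact.
  by rewrite big_ord0 -(mu_ext e) mu_set0.
have [] := IH; first by move=> i lt; apply: m; exact: ltnW.
  by move=> i j g l1 l2; apply: D; exact: ltnW.
move=> m1 e1; have m2 := m n (ltnSn n).
have e g : ([set g | exists i, (i < n)%N /\ P i g] `|` P n) g <-> exists i, (i < n.+1)%N /\ P i g.
  split=> [[[i [lt Pi]]|Pn]|[i [lt Pi]]]; [by exists i; split=> //; exact: ltnW|by exists n|].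
  by move: lt; rewrite ltnS leq_eqVlt => /orP[/eqP E|lt]; [right; rewrite -E|left; exists i].
split; first by apply: meas_ext e _; exact: measU.
rewrite big_ord_recr -(mu_ext e) mu_add // ?e1 // => g [i [lt Pi]] Pn.
by have := D i n g (ltnW lt) (ltnSn n) Pi Pn => E; rewrite E ltnn in lt.
Qed.
End Regions.

Lemma sum_multiples (V : nmodType) (f : nat -> V) p n : (0 < p)%N ->
  \sum_(i < n) (if (p %| i.+1)%N then f (i.+1 %/ p)%N else 0) = \sum_(l < n %/ p) f l.+1.
Proof.
move=> p0; elim: n => [|n IH]; first by rewrite div0n !big_ord0.
rewrite big_ord_recr IH /= divnS //; case: (p %| n.+1)%N; last by rewrite addr0 add0n.
by rewrite add1n big_ord_recr.
Qed.

(** * Contributions of cells, rays and root cells *)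

Section Strata.
Variable C : numClosedFieldType.
Notation M := (motring C).
Notation Li := (Lef_inv C).
Notation arcs := (Defs.arc C).
Notation S := (fps (fps C)).
Implicit Types (F G : S) (g : arcs) (A : nat -> set arcs) (psi u v : fps C) (p q k i j m n a h l L K d r : nat) (c : C) (Q : {poly C}).

Section Cells.
Variables (F : S) (A : nat -> set arcs) (Om : nat -> nat -> bool) (a h : nat).
Hypotheses (a0 : (0 < a)%N) (h0 : (0 < h)%N) (Om0 : forall j, Om 0%N j = false).
Hypothesis cells : forall i n g, (0 < i)%N -> has_order g.1 i -> g.2 0%N = 0 -> A i g -> has_order (ev F g) n ->
  exists j, Om i j /\ has_order g.2 j.
Hypothesis inside : forall i j g, (0 < i)%N -> has_order g.1 i -> Om i j -> has_order g.2 j ->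
  [/\ (0 < j)%N, A i g & has_order (ev F g) (a * i + h * j)].

Lemma cells_piece i n : (0 < i)%N -> meas (piece F A i n) /\
  mu (piece F A i n) = \sum_(j < n.+1) if Om i j && (a * i + h * j == n)%N then (1 - Li) ^+ 2 * Li ^+ (i + j) else 0.
Proof.
move=> i0; pose P j : set arcs := if Om i j && (a * i + h * j == n)%N then cell i j else set0.
have mP j : meas (P j).
  rewrite /P; case: ifP => _; first exact: meas_cell.
  by apply: meas_ext (measC (@measT C)) => g; split=> // H; exact: H.
have PE g : (exists j, (j < n.+1)%N /\ P j g) <-> piece F A i n g.
  split=> [[j [_]]|[o1 z Ag o2]].
    rewrite /P; case: ifP => // /andP[Oij /eqP E] [o1 o2].
    have [j0 Ag] := inside i0 o1 Oij o2; rewrite E => o3.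
    by split=> //; case: o2 => H _; exact: H.
  have [j [Oij oj]] := cells i0 o1 z Ag o2; have [j0 _ o3] := inside i0 o1 Oij oj.
  have E := has_order_uniq o3 o2; exists j; rewrite /P Oij E eqxx; split=> //.
  by rewrite ltnS -E; nia.
have [] := @mu_bigU C n.+1 P (fun j _ => mP j).
  move=> x y g _ _; rewrite /P; do 2![case: ifP => // _].
  by move=> [_ o1] [_ o2]; exact: has_order_uniq o1 o2.
move=> m1 e1; split; first exact: meas_ext PE m1.
rewrite -(mu_ext PE) e1; apply: eq_bigr => j _; rewrite /P; case: ifP => _; first exact: mu_cell.
exact: mu_set0.
Qed.

Lemma cells_mreg : mreg F A.
Proof. by move=> i n /(cells_piece n) []. Qed.

Lemma ZR_cells k : (0 < k)%N -> ZR F k A = fps_const ((1 - Li) ^+ 2) * gs C k a h Om.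
Proof.
move=> k0; apply: fpsP => n; rewrite fps_constM /ZR /gs 2!fpsE [in RHS]big_ord_recl [X in _ = _ * (X + _)]big1 ?add0r => [|j _]; last by rewrite Om0.
rewrite mulr_sumr; apply: eq_bigr => i _; have [_ ->] := cells_piece n (ltn0Sn i).
rewrite !mulr_sumr; apply: eq_bigr => j _; rewrite /= /bump /= add1n; case: ifP => _; last by rewrite !mulr0.
rewrite mulrCA -exprD; congr (_ * Li ^+ _).
by case: k k0 => // k' _ /=; nia.
Qed.
End Cells.

Lemma ZR_lump (s0 : rat) F k A d p r K (w : nat -> M) : (0 < p)%N -> (p <= d)%N -> (0 < r)%N ->
  (forall i n, (0 < i)%N -> mu (piece F A i n) = if (p %| i)%N && (n == d * (i %/ p))%N then w (i %/ p)%N else 0) ->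
  (forall l, (0 < l)%N -> w (l + r)%N = Li ^+ K * w l) -> PO s0 (ZR F k A) (hit s0 (k.-1 * (p * r) + K) (d * r)).
Proof.
move=> p0 pd r0 H wr; have d0 : (0 < d)%N by apply: leq_trans pd.
apply: (@PO_lumps C s0 _ (fun l => Li ^+ (k.-1 * (p * l)) * w l)) => //; last first.
  by move=> l l0; rewrite wr // !mulnDr !exprD; ring.
move=> n; rewrite /ZR fpsE; case: ifP => [/andP[/dvdnP [l nE] n0]|nd].
  have l0 : (0 < l)%N by move: n0; rewrite nE muln_gt0 => /andP[].
  have -> : (n %/ d)%N = l by rewrite nE mulnK.
  have pl : (0 < p * l)%N by rewrite muln_gt0 p0.
  have lt : ((p * l).-1 < n)%N by rewrite prednK // nE mulnC leq_mul2l pd orbT.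
  have eE : (n == d * l)%N = true by rewrite nE mulnC eqxx.
  rewrite (bigD1 (Ordinal lt)) //= prednK // H // dvdn_mulr // mulKn // eE big1 ?addr0 // => i ne.
  rewrite H //; case: ifP => [/andP[di /eqP E]|]; last by rewrite mulr0.
  case/eqP: ne; apply: val_inj => /=.
  have lE : l = (i.+1 %/ p)%N by apply/eqP; rewrite -(eqn_pmul2l d0) -E nE mulnC.
  by rewrite lE mulnC divnK.
rewrite big1 // => i _; rewrite H //; case: ifP => [/andP[_ /eqP E]|]; last by rewrite mulr0.
by have := ltn_ord i; rewrite {2}E => lt; rewrite E dvdn_mulr //= -E (leq_ltn_trans _ (ltn_ord i)) in nd.
Qed.

Section Roots.
Variables (p q al be : nat).
Hypotheses (rc : root_chart C p q al be) (p0 : (0 < p)%N) (q0 : (0 < q)%N).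

Definition gen_cell (rs : seq C) l : set arcs := [set g | cell (p * l) (q * l) g /\ forall c, c \in rs -> ~ root_cell p q c l g].

Lemma root_cell_uniq c c' l g : root_cell p q c l g -> root_cell p q c' l g -> c = c'.
Proof.
move=> [o1 _ e1] [_ _ e2]; apply: (@mulIf _ (g.1 (p * l)%N ^+ q)); last by rewrite -e1 -e2.
by rewrite expf_neq0 //; apply/eqP; case: o1.
Qed.

(** The cell and each root cell have measures that are constants times the same power of [Li], so
    removing root cells only changes the constant: the generic arcs of a ray form one geometric
    series. *)
Lemma mu_gen rs : uniq rs -> 0 \notin rs -> exists K : M, forall l, (0 < l)%N ->
  meas (gen_cell rs l) /\ mu (gen_cell rs l) = K * Li ^+ ((p + q) * l).
Proof.
elim: rs => [|c rs IH] /=.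
  move=> _ _; exists ((1 - Li) ^+ 2) => l l0.
  have e g : cell (p * l) (q * l) g <-> gen_cell [::] l g by split=> [|[]].
  by rewrite -(mu_ext e) mu_cell mulnDl; split=> //; apply: meas_ext e _; exact: meas_cell.
move=> /andP[cr urs]; rewrite inE negb_or eq_sym => /andP[c0 r0].
have [K HK] := IH urs r0; exists (K - (1 - Li) * Li) => l l0; have [m1 e1] := HK l l0.
have [m2 e2] := mu_root_cell rc c0 l0.
have E g : (gen_cell rs l `&` ~` root_cell p q c l) g <-> gen_cell (c :: rs) l g.
  split=> [[[H1 H2] H3]|[H1 H2]].
    by split=> // c'; rewrite inE => /orP[/eqP ->|/H2].
  by split; [split=> // c' ci; apply: H2; rewrite inE ci orbT|apply: H2; rewrite inE eqxx].
have E2 g : (gen_cell rs l `&` root_cell p q c l) g <-> root_cell p q c l g.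
  split=> [[]//|H]; split=> //; split; first by case: H.
  by move=> c' ci H'; rewrite (root_cell_uniq H H') ci in cr.
split; first by apply: meas_ext E _; exact: measI m1 (measC m2).
have := mu_split m1 m2; rewrite e1 (mu_ext E2) (mu_ext E) => H.
by rewrite mulrBl -e2 H addrAC subrr add0r.
Qed.

Lemma meas_onroots (rs : seq C) i : (0 < i)%N -> 0 \notin rs -> meas (onroots p q rs i).
Proof.
move=> i0; elim: rs => [|c rs IH]; first by move=> _; apply: meas_ext (measC (@measT C)) => g; split=> [H|[l [c []]]//]; case: H.
rewrite inE negb_or eq_sym => /andP[c0 /IH m1].
case: (boolP (p %| i)%N) => [/dvdnP [l lE]|nd]; last first.
  apply: meas_ext m1 => g; split=> -[l [c' [iE ci H]]].
    by exists l, c'; split=> //; rewrite inE ci orbT.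
  by rewrite iE dvdn_mulr in nd.
have l0 : (0 < l)%N by move: i0; rewrite lE muln_gt0 => /andP[].
apply: meas_ext (measU (proj1 (mu_root_cell rc c0 l0)) m1) => g; split=> [[H|[l' [c' [iE ci H]]]]|[l' [c' [iE]]]].
- by exists l, c; rewrite mulnC lE inE eqxx.
- by exists l', c'; rewrite inE ci orbT.
rewrite inE => /orP[/eqP ->|ci] H; last by right; exists l', c'.
left; have -> // : l = l'; by apply/eqP; rewrite -(eqn_pmul2l p0) -iE lE mulnC.
Qed.

Lemma onroots_split F k c (rs : seq C) : uniq (c :: rs) -> 0 \notin c :: rs ->
  ZR F k (onroots p q (c :: rs)) = ZR F k (onroots p q [:: c]) + ZR F k (onroots p q rs).
Proof.
move=> /= /andP[cr _] z; have zc : 0 \notin [:: c] by move: z; rewrite !inE !negb_or => /andP[->].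
have zr : 0 \notin rs by move: z; rewrite !inE !negb_or => /andP[].
apply: ZR_split.
- by apply: mreg_meas => i i0; exact: meas_onroots.
- by apply: mreg_meas => i i0; exact: meas_onroots.
- move=> i n g _ _ _ _; split=> [[l [c' [iE]]]|].
    rewrite inE => /orP[/eqP ->|ci] H; first by left; exists l, c; rewrite mem_head.
    by right; exists l, c'.
  by case=> -[l [c' [iE ci H]]]; exists l, c'; split=> //; move: ci; rewrite !inE ?in_nil ?orbF => ->; rewrite ?orbT.
move=> i g i0 o1 [l [c1 [iE]]]; rewrite inE => /eqP -> H [l' [c2 [iE' ci H']]].
have ll : l = l' by apply/eqP; rewrite -(eqn_pmul2l p0) -iE iE'.
by rewrite -ll in H'; rewrite (root_cell_uniq H H') ci in cr.
Qed.

Lemma PO_onroots (s0 : rat) F k (rs : seq C) m : uniq rs -> 0 \notin rs -> (forall c, c \in rs -> PO s0 (ZR F k (onroots p q [:: c])) m) ->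
  PO s0 (ZR F k (onroots p q rs)) m.
Proof.
elim: rs => [|c rs IH] u z H.
  have -> : ZR F k (onroots p q [::]) = 0; last exact: PO0.
  apply: fpsP => n; rewrite /ZR fpsE big1 // => i _; rewrite (@mu_ext C _ set0) ?mu_set0 ?mulr0 // => g.
  by split=> // -[_ _ [l [c []]]].
rewrite onroots_split //; apply: PO_add; first by apply: H; rewrite mem_head.
apply: IH; first by case/andP: u.
  by move: z; rewrite inE negb_or => /andP[].
by move=> c' ci; apply: H; rewrite inE ci orbT.
Qed.
End Roots.

Section OneFace.
Variables (p q a h a' h' L : nat) (F : S) (Q : {poly C}).
Hypothesis fc : face p q a h a' h' L F Q.
Let p0 : (0 < p)%N. Proof. exact: ray_p (face_ray fc). Qed.
Let q0 : (0 < q)%N. Proof. exact: ray_q (face_ray fc). Qed.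

Lemma face_weight_ge : (p <= p * a + q * h)%N.
Proof.
have hE := face_h fc; have L0 := face_L fc; have : (p <= h)%N by rewrite hE; nia.
nia.
Qed.

Lemma ongen_piece rs i n : roots_of Q rs -> (0 < i)%N ->
  (forall g, piece F (ongen p q Q) i n g <-> ((p %| i)%N && (n == (p * a + q * h) * (i %/ p))%N /\ gen_cell p q rs (i %/ p) g)).
Proof.
move=> [_ rts] i0 g; split=> [[o1 z [l [iE o1' o2 nr]] o3]|[/andP[/dvdnP [l lE] /eqP nE] [[o1 o2] H]]].
  have l0 : (0 < l)%N by move: i0; rewrite iE muln_gt0 => /andP[].
  have -> : (i %/ p = l)%N by rewrite iE mulKn.
  rewrite iE dvdn_mulr // (has_order_uniq o3 (face_order fc l0 o1' o2 nr)) eqxx; split=> //; split=> // c ci [_ _ E].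
  move: nr; rewrite E mulfK; first by rewrite rts ci.
  by rewrite expf_neq0 //; apply/eqP; case: o1'.
have l0 : (0 < l)%N by move: i0; rewrite lE muln_gt0 => /andP[].
have E : (i %/ p = l)%N by rewrite lE mulnK.
rewrite E in nE o1 o2 H; have iE : i = (p * l)%N by rewrite mulnC.
have nr : ~~ root Q (g.2 (q * l)%N ^+ p / g.1 (p * l)%N ^+ q).
  apply/negP; rewrite rts => ci; case: (H _ ci); split=> //; rewrite divfK //.
  by rewrite expf_neq0 //; apply/eqP; case: o1.
split; first by rewrite iE.
- by case: o2 => H2 _; apply: H2; rewrite muln_gt0 q0.
- by exists l.
by rewrite nE; exact: (face_order fc l0 o1 o2 nr).
Qed.

Lemma PO_ongen (s0 : rat) k al be rs : (0 < k)%N -> root_chart C p q al be -> roots_of Q rs ->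
  mreg F (ongen p q Q) /\ PO s0 (ZR F k (ongen p q Q)) (hit s0 (p * k + q) (p * a + q * h)).
Proof.
move=> k0 rc rts; have [urs rE] := rts.
have z : 0 \notin rs by rewrite -rE; apply/negP => /(face_root_neq0 fc); rewrite eqxx.
have [K HK] := mu_gen rc urs z.
have empty i n : (p %| i)%N && (n == (p * a + q * h) * (i %/ p))%N = false -> (0 < i)%N -> forall g, set0 g <-> piece F (ongen p q Q) i n g.
  by move=> e i0 g; split=> // /(ongen_piece n rts i0) []; rewrite e.
have full i n : (p %| i)%N && (n == (p * a + q * h) * (i %/ p))%N -> (0 < i)%N ->
    forall g, gen_cell p q rs (i %/ p) g <-> piece F (ongen p q Q) i n g.
  by move=> e i0 g; split=> [H|/(ongen_piece n rts i0) []//]; apply/(ongen_piece n rts i0).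
have lpos i : (p %| i)%N -> (0 < i)%N -> (0 < i %/ p)%N by move=> d i0; rewrite divn_gt0 // dvdn_leq.
split=> [i n i0|].
  case: (boolP ((p %| i)%N && (n == (p * a + q * h) * (i %/ p))%N)) => [e|/negbTE e].
    by apply: meas_ext (full _ _ e i0) _; case/andP: e => d _; case: (HK _ (lpos _ d i0)).
  by apply: meas_ext (empty _ _ e i0) _; apply: meas_ext (measC (@measT C)) => g; split=> // H; exact: H.
have -> : hit s0 (p * k + q) (p * a + q * h) = hit s0 (k.-1 * (p * 1) + (p + q)) ((p * a + q * h) * 1).
  by congr hit; [case: k k0 => // k' _ /=; nia|rewrite muln1].
apply: (@ZR_lump s0 F k _ (p * a + q * h) p 1 (p + q) (fun l => mu (gen_cell p q rs l))) => //.
- exact: face_weight_ge.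
- move=> i n i0; case: ifP => e; first by rewrite (mu_ext (full _ _ e i0)).
  by rewrite -(mu_ext (empty _ _ e i0)) mu_set0.
move=> l l0; have [_ ->] := HK _ l0; have [_ ->] := HK (l + 1)%N (ltn_addr 1 l0).
by rewrite mulnDr muln1 exprD; ring.
Qed.

Lemma ev_root_chart al be c g : g.1 0%N = 0 -> g.2 0%N = 0 ->
  ev (pull (mchart fc (('X + c%:P) ^+ al) (('X + c%:P) ^+ be)) F) g = ev F (Troot p q al be c g).
Proof.
move=> z1 z2; have cg : centered g by [].
rewrite ev_comp // [sX _]/(mono2 C p 0 * colc (('X + c%:P) ^+ al)) [sY _]/(mono2 C q 0 * colc (('X + c%:P) ^+ be)).
have cE n : ev (colc (('X + c%:P) ^+ n)) g = (fps_const c + g.2) ^+ n.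
  rewrite colcX evX //; congr (_ ^+ n).
  have -> : colc ('X + c%:P) = cst c + mono2 C 0 1.
    apply: fps2P => i j; rewrite fps2D colcE cstE mono2E coefD coefX coefC.
    by case: i => [|i]; case: j => [|[|j]] /=; rewrite ?mulr0n ?mulr1n ?add0r ?addr0.
  by rewrite evD // ev_cst // ev_Y.
by rewrite !evM // !ev_mono2 // !expr0 !mulr1 !cE.
Qed.

(** The Jacobian orders add up: [(k - 1) p l + (p + q - 1) l = (pk + q - 1) l], so in the new region
    [pk + q] takes the place of [k]. *)
Lemma ZR_root_chart k c al be : (0 < k)%N -> root_chart C p q al be -> c != 0 ->
  ZR F k (onroots p q [:: c]) =
  ZR (pull (mchart fc (('X + c%:P) ^+ al) (('X + c%:P) ^+ be)) F) (p * k + q) (beyond 1 0).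
Proof.
move=> k0 rc c0; set F' := pull _ _.
have N0 := face_weight_ge.
have evF g (z1 : g.1 0%N = 0) (z2 : g.2 0%N = 0) : ev F' g = _ := ev_root_chart al be c z1 z2.
clearbody F'.
have key l n : (0 < l)%N -> mu (piece F (onroots p q [:: c]) (p * l) n) = mu (piece F' (beyond 1 0) l n) * Li ^+ ((p + q).-1 * l).
  move=> l0; have [Bz H] := rc.
  have sub g : piece F (onroots p q [:: c]) (p * l) n g -> root_cell p q c l g.
    move=> [_ _ [l' [c' [lE ci R]]] _]; move: ci R; rewrite inE => /eqP -> R.
    by have -> // : l = l'; apply/eqP; rewrite -(eqn_pmul2l p0) lE.
  rewrite (H c l _ c0 l0 _ sub); last first.
    apply: mreg_meas; last by rewrite muln_gt0 p0.
    by move=> i i0; apply: (meas_onroots rc) => //; rewrite inE eq_sym.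
  congr (_ * _); apply: mu_ext => g; split=> [[o1 z [_ _ _ o2]]|[o1 z _ o2]].
    have z1 : g.1 0%N = 0 by case: o1 => H1 _; exact: H1.
    by split=> //; [move=> j; rewrite mul1n mul0n leqn0 => /eqP ->|rewrite evF].
  have z1 : g.1 0%N = 0 by case: o1 => H1 _; exact: H1.
  have [H1 H2 E1 E2] := @Troot_order C p q al be c l g c0 o1 z; split=> //; split=> //.
  - by case: H2 => H3 _; apply: H3; rewrite muln_gt0 q0.
  - exists l, c; rewrite mem_head; split=> //; split=> //.
    rewrite E1 E2 !exprMn -!exprM (mulnC q p) (mulnC be p) Bz (mulnC al q) addn1 exprS; ring.
  by rewrite -evF.
have key0 i n : ~~ (p %| i)%N -> mu (piece F (onroots p q [:: c]) i n) = 0.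
  move=> nd; rewrite (@mu_ext C _ set0) ?mu_set0 // => g; split=> // -[_ _ [l [c' [iE]]]].
  by rewrite iE dvdn_mulr in nd.
(* The sum in [ZR] runs up to [n], whereas only orders [p l <= n] come from the left side; the
   transformed series has order at least [p l], so the extra terms vanish. *)
have small l n : (0 < l)%N -> (n < p * l)%N -> mu (piece F' (beyond 1 0) l n) = 0.
  move=> l0 lt; rewrite (@mu_ext C _ set0) ?mu_set0 // => g; split=> // -[o1 z _ [_]].
  have z1 : g.1 0%N = 0 by case: o1 => H1 _; exact: H1.
  rewrite evF //; have [H1 H2 _ _] := @Troot_order C p q al be c l g c0 o1 z.
  case; apply: (@vge_ev C F _ (p * l) (q * l) (p * l)) => //; [exact: has_order_vge|exact: has_order_vge|].
  move=> i j /(ray_ge (face_ray fc)) le; rewrite mulnAC [(q * l * j)%N]mulnAC -mulnDl leq_mul2r; apply/orP; right.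
  exact: leq_trans le.
apply: fpsP => n; rewrite /ZR 2!fpsE.
pose T l := Li ^+ ((p * k + q).-1 * l) * mu (piece F' (beyond 1 0) l n).
have -> : \sum_(i < n) Li ^+ (k.-1 * i.+1) * mu (piece F (onroots p q [:: c]) i.+1 n) =
          \sum_(i < n) (if (p %| i.+1)%N then T (i.+1 %/ p)%N else 0).
  apply: eq_bigr => i _; case: ifP => [/dvdnP [l lE]|/negbT nd]; last by rewrite key0 // mulr0.
  have l0 : (0 < l)%N by case: l lE.
  rewrite lE mulnK // [(l * p)%N]mulnC key // /T mulrCA -exprD mulrC; congr (Li ^+ _ * _).
  by clear -k0 p0 q0; case: k k0 => // k' _ /=; nia.
rewrite (@sum_multiples _ T) //; apply: esym.
apply: (@big_widen _ (fun i => T i.+1)); first exact: leq_div.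
by move=> i le; rewrite /T small ?mulr0 // mulnC -ltn_divLR // ltnS.
Qed.
End OneFace.
End Strata.

(** * Cutting the arcs along the rays *)

Section Decompose.
Variable C : numClosedFieldType.
Notation M := (motring C).
Notation Li := (Lef_inv C).
Notation arcs := (Defs.arc C).
Notation S := (fps (fps C)).
Implicit Types (F G : S) (g : arcs) (A : nat -> set arcs) (psi u v : fps C) (p q k i j m n a h l L K d r : nat) (c : C) (Q : {poly C}).

Lemma vge_order u n : vge u n -> u <> 0 -> exists2 t, has_order u t & (n <= t)%N.
Proof.
move=> H /fps_eq0P [t ut low]; exists t; first by split=> //; exact/eqP.
by rewrite leqNgt; apply/negP => /H E; rewrite E eqxx in ut.
Qed.

Lemma beyondP p q i g : (0 < p)%N -> beyond p q i g -> forall j, has_order g.2 j -> (q * i < p * j)%N.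
Proof. by move=> p0 H j [_ nz]; rewrite ltnNge; apply/negP => /H. Qed.
Lemma order_beyond p q i g j : has_order g.2 j -> (q * i < p * j)%N -> beyond p q i g.
Proof. by move=> [H _] lt x le; apply: H; nia. Qed.

Lemma ZR_from p q a h a' h' L F Q k rs al be : face p q a h a' h' L F Q -> (0 < k)%N -> root_chart C p q al be -> roots_of Q rs ->
  ZR F k (from p q) = ZR F k (ongen p q Q) + ZR F k (onroots p q rs) + ZR F k (beyond p q).
Proof.
move=> fc k0 rc rts; have [urs rE] := rts; have p0 := ray_p (face_ray fc); have q0 := ray_q (face_ray fc).
have co := ray_co (face_ray fc).
have z : 0 \notin rs by rewrite -rE; apply/negP => /(face_root_neq0 fc); rewrite eqxx.
have [m1 _] := @PO_ongen C p q a h a' h' L F Q fc 0 k al be rs k0 rc rts.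
have m2 : mreg F (onroots p q rs) by apply: mreg_meas => i i0; exact: (meas_onroots rc p0).
have m3 : mreg F (beyond p q) by apply: mreg_meas => i i0; exact: meas_beyond.
pose A i : set arcs := ongen p q Q i `|` onroots p q rs i.
have onA i g : A i g -> exists l, i = (p * l)%N /\ has_order g.2 (q * l).
  by move=> [[l [iE _ o2 _]]|[l [c [iE _ [_ o2 _]]]]]; exists l.
rewrite (@ZR_split C F k (from p q) A (beyond p q)).
- congr (_ + _); apply: ZR_split => //.
  move=> i g i0 o1 [l [iE o1' o2 nr]] [l' [c [iE' ci [_ _ E]]]].
  have ll : l = l' by apply/eqP; rewrite -(eqn_pmul2l p0) -iE iE'.
  subst l'; move: nr; rewrite E mulfK ?rE ?ci // expf_neq0 //; apply/eqP; by case: o1'.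
- move=> i n i0; apply: meas_ext (measU (m1 i n i0) (m2 i n i0)) => g.
  by split=> [[[o1 z0 Ag o2]|[o1 z0 Ag o2]]|[o1 z0 [Ag|Ag] o2]]; [split=> //; left|split=> //; right|left|right].
- exact: m3.
- move=> i n g i0 o1 z0 o2; split=> [H|[/onA [l [iE [H _]]] j lt|H j lt]]; last 2 first.
  + by apply: H; move: lt; rewrite iE mulnCA ltn_pmul2l.
  + by apply: H; exact: ltnW.
  have [H'|nH] := pselect (beyond p q i g); [by right|left].
  have [j [jE gj]] : exists j, (p * j = q * i)%N /\ g.2 j <> 0.
    apply: contrapT => nex; apply: nH => j; rewrite leq_eqVlt => /orP[/eqP E|/H //].
    by apply: contrapT => gj; apply: nex; exists j.
  have /dvdnP [l lE] : (p %| i)%N by rewrite -(@Gauss_dvdr _ q) // -jE dvdn_mulr.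
  have iE : i = (p * l)%N by rewrite mulnC.
  have jl : j = (q * l)%N by apply/eqP; rewrite -(eqn_pmul2l p0) jE iE mulnCA.
  have oj : has_order g.2 (q * l) by rewrite -jl; split=> // x lt; apply: H; rewrite -jE ltn_pmul2l.
  have oi : has_order g.1 (p * l) by rewrite -iE.
  have x0 : g.1 (p * l)%N ^+ q != 0 by rewrite expf_neq0 //; apply/eqP; case: oi.
  case: (boolP (root Q (g.2 (q * l)%N ^+ p / g.1 (p * l)%N ^+ q))) => [rt|nr]; last by left; exists l.
  right; exists l, (g.2 (q * l)%N ^+ p / g.1 (p * l)%N ^+ q); split=> //; first by rewrite -rE.
  by split=> //; rewrite divfK.
move=> i g i0 o1 /onA [l [iE o2]] /(beyondP p0) /(_ _ o2); rewrite iE mulnCA ltnn //.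
Qed.

(** The open cone between the rays consists of cells on which [ord F] is linear by [cone_order]; the
    rest begins at the second ray and is left to the next edge. *)
Lemma PO_ray_cone (s0 : rat) F k p1 q1 p2 q2 a h : (0 < k)%N -> (0 < a)%N -> (0 < h)%N -> (0 < p1)%N -> (0 < p2)%N -> (p2 * q1 < p1 * q2)%N ->
  F a h != 0 -> (forall x y, F x y != 0 -> (p1 * a + q1 * h <= p1 * x + q1 * y)%N /\ (p2 * a + q2 * h <= p2 * x + q2 * y)%N) ->
  exists2 zc, ZR F k (beyond p1 q1) = zc + ZR F k (from p2 q2) &
    PO s0 zc (hit s0 (k * p1 + q1) (a * p1 + h * q1) + hit s0 (k * p2 + q2) (a * p2 + h * q2)).
Proof.
move=> k0 a0 h0 p10 p20 lt v ge; have q20 : (0 < q2)%N by case: q2 lt {ge} => //; rewrite muln0.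
pose Om i j := (q1 * i < p1 * j)%N && (p2 * j < q2 * i)%N.
have O0 j : Om 0%N j = false by rewrite /Om !muln0 ltn0 andbF.
have inside i j g : (0 < i)%N -> has_order g.1 i -> Om i j -> has_order g.2 j ->
    [/\ (0 < j)%N, cone p1 q1 p2 q2 i g & has_order (ev F g) (a * i + h * j)].
  move=> i0 o1 /andP[c1 c2] o2; split; [by nia|by exists j|exact: (cone_order v ge lt c1 c2 o1 o2)].
have cells i n g : (0 < i)%N -> has_order g.1 i -> g.2 0%N = 0 -> cone p1 q1 p2 q2 i g -> has_order (ev F g) n ->
    exists j, Om i j /\ has_order g.2 j.
  by move=> _ _ _ [j [c1 c2 o2]] _; exists j; rewrite /Om c1 c2.
exists (ZR F k (cone p1 q1 p2 q2)); last first.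
  rewrite (@ZR_cells C F (cone p1 q1 p2 q2) Om a h a0 h0 O0 cells inside k k0).
  apply: PO_mul; first exact: is_poly_mono.
  exact: PO_cone.
apply: ZR_split.
- exact: (@cells_mreg C F (cone p1 q1 p2 q2) Om a h a0 h0 cells inside).
- by apply: mreg_meas => i i0; exact: meas_from.
- move=> i n g i0 o1 z o2; split=> [H|[[j [c1 c2 o]]|H]].
  + have [H'|nH] := pselect (from p2 q2 i g); [by right|left].
    have [j [lj gj]] : exists j, (p2 * j < q2 * i)%N /\ g.2 j <> 0.
      apply: contrapT => nex; apply: nH => j lj.
      by apply: contrapT => gj; apply: nex; exists j.
    have [t ot tj] := @has_order_ex C g.2 j (ex_intro2 _ _ j gj (leqnn j)).
    exists t; split=> //; first exact: beyondP H _ ot.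
    by apply: leq_ltn_trans lj; rewrite leq_mul2l tj orbT.
  + exact: order_beyond o c1.
  by move=> j le; apply: H; nia.
by move=> i g i0 o1 [j [c1 c2 [_ gj]]] H; apply: gj; exact: H.
Qed.

(** Without a further edge the second ray is [(0, 1)], with denominator [1 - Li U^h]. Arcs with
    [w = 0] lie in no cell, but [F] vanishes along them since [h > 0]. *)
Lemma PO_axis_cone (s0 : rat) F k p q a h : (0 < k)%N -> (0 < a)%N -> (0 < h)%N -> (0 < p)%N ->
  F a h != 0 -> (forall x y, F x y != 0 -> (p * a + q * h <= p * x + q * y)%N /\ (h <= y)%N) ->
  PO s0 (ZR F k (beyond p q)) (hit s0 (k * p + q) (a * p + h * q) + hit s0 1 h).
Proof.
move=> k0 a0 h0 p0 v ge.
pose Om i j := (q * i < p * j)%N && (0 * j < 1 * i)%N.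
have O0 j : Om 0%N j = false by rewrite /Om !muln0 ltn0 andbF.
have ge' x y : F x y != 0 -> (p * a + q * h <= p * x + q * y)%N /\ (0 * a + 1 * h <= 0 * x + 1 * y)%N.
  by move=> /ge [? ?]; rewrite !mul0n !mul1n !add0n.
have lt : (0 * q < p * 1)%N by rewrite mul0n muln1.
have inside i j g : (0 < i)%N -> has_order g.1 i -> Om i j -> has_order g.2 j ->
    [/\ (0 < j)%N, beyond p q i g & has_order (ev F g) (a * i + h * j)].
  move=> i0 o1 /andP[c1 c2] o2; split; [by nia|exact: order_beyond o2 c1|exact: (cone_order v ge' lt c1 c2 o1 o2)].
have cells i n g : (0 < i)%N -> has_order g.1 i -> g.2 0%N = 0 -> beyond p q i g -> has_order (ev F g) n ->
    exists j, Om i j /\ has_order g.2 j.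
  move=> i0 o1 z H [_ nz]; have [j oj _] : exists2 j, has_order g.2 j & (0 <= j)%N.
    apply: (@vge_order g.2 0) => // g20; apply: nz; rewrite evE big1 // => x _; rewrite big1 // => y _.
    have [->|/ge [_ hy]] := eqVneq (F x y) 0; first by rewrite mul0r.
    by rewrite g20 expr0n (gtn_eqF (leq_trans h0 hy)) mulr0 fps0 mulr0.
  by exists j; rewrite /Om mul0n mul1n i0 andbT; split=> //; exact: beyondP H _ oj.
rewrite (@ZR_cells C F (beyond p q) Om a h a0 h0 O0 cells inside k k0).
apply: PO_mul; first exact: is_poly_mono.
by have := @PO_cone C s0 k a h a0 h0 p q 0 1 p0 isT lt; rewrite !muln0 add0n muln1.
Qed.

(** At height 0 the order of [F] is [a ord u] whatever [w] is. The bound [th] on [ord w] grows by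
    [q] when [ord u] grows by [p], so there is a single denominator. *)
Lemma PO_base (s0 : rat) F k p q a : (0 < k)%N -> (0 < a)%N -> (0 < p)%N -> F a 0%N != 0 ->
  (forall x y, F x y != 0 -> (p * a <= p * x + q * y)%N) ->
  PO s0 (ZR F k (beyond p q)) (hit s0 (p * k + q) (p * a)).
Proof.
move=> k0 a0 p0 v ge; pose th i := ((q * i) %/ p).+1.
have thP i j : (p * j <= q * i)%N = (j < th i)%N by rewrite /th ltnS leq_divRL // mulnC.
have -> : hit s0 (p * k + q) (p * a) = hit s0 (k.-1 * (1 * p) + (p + q)) (a * p).
  by congr hit; [case: k k0 => // k' _ /=; nia|exact: mulnC].
apply: (@ZR_lump C s0 F k _ a 1 p (p + q) (fun i => mu (cellr i (th i)))) => //; last first.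
  move=> l l0; have thS : th (l + p)%N = (th l + q)%N by rewrite /th mulnDr addnC divnMDl // addSn addnC.
  by rewrite !mu_cellr thS mulrCA -exprD; congr (_ * Li ^+ _); lia.
move=> i n i0; rewrite dvd1n divn1 /=.
have key g : has_order g.1 i -> beyond p q i g -> has_order (ev F g) (a * i).
  move=> o1 H; have := @ev_dominant C F g a 0 i (th i) (has_order_vge o1) _ i0 (ltn0Sn _) v.
  rewrite muln0 addn0 expr0 mulr1 mulnC; apply.
  - by move=> j; rewrite -thP => /H.
  - by have [_ E] := has_orderX a o1; rewrite E expf_neq0 //; apply/eqP; case: o1.
  move=> x y Fxy ne; rewrite (mulnC a); have := ge _ _ Fxy; have : (q * i < p * th i)%N by rewrite ltnNge thP ltnn.
  case: (posnP y) => [y0|y0 lt le].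
    rewrite y0 muln0 addn0 leq_pmul2l // muln0 addn0 => _ ax; rewrite ltn_pmul2l // ltn_neqAle ax andbT.
    by apply/eqP => E; case/eqP: ne; rewrite E y0.
  rewrite -(ltn_pmul2l p0); clear -le lt y0 p0 i0.
  have l1 : (q * i * y < p * th i * y)%N by rewrite ltn_pmul2r.
  have l2 : (i * (p * a) <= i * (p * x + q * y))%N by rewrite leq_mul2l le orbT.
  rewrite mulnCA [ltnRHS]mulnDr (mulnCA p i x); apply: leq_ltn_trans l2 _.
  by rewrite mulnDr ltn_add2l mulnCA mulnA [ltnRHS]mulnA.
case: eqP => [nE|ne].
  apply: mu_ext => g; split=> [[o1 z H _]|[o1 H]]; first by split=> // j; rewrite -thP => /H.
  have H' : beyond p q i g by move=> j; rewrite thP => /H.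
  by split=> //; [exact: H|rewrite nE; exact: key].
rewrite (@mu_ext C _ set0) ?mu_set0 // => g; split=> // -[o1 z H o2].
by case: ne; apply: has_order_uniq o2 _; exact: key.
Qed.

(** If [ord u = i], then every coefficient of [psi(u)] of index at most [q i / p] vanishes, so the
    shear maps the region to itself. *)
Lemma ZR_shear F k p q psi (psi0 : psi 0%N = 0) : (0 < p)%N -> (forall i, psi i != 0 -> (q < p * i)%N) ->
  ZR (pull (shear psi0) F) k (beyond p q) = ZR F k (beyond p q).
Proof.
move=> p0 H; apply: ZR_ext => i n i0.
have m1 : meas (piece F (beyond p q) i n) by apply: mreg_meas => // i' _; exact: meas_beyond.
have g10 g : has_order g.1 i -> g.1 0%N = 0 by case=> lo _; exact: lo.
rewrite -(@mu_shear C psi _ m1) => [|g [o1 _ _ _]]; last exact: g10.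
have low g j : has_order g.1 i -> (p * j <= q * i)%N -> psub psi g.1 j = 0.
  move=> o1 le; rewrite /psub fpsE big1 // => x _; have [->|/H lt] := eqVneq (psi x) 0; first by rewrite mul0r.
  by rewrite (@vgeX C g.1 i x (has_order_vge o1)) ?mulr0 //; nia.
apply: mu_ext => g; split=> [[o1 z B o2]|[z1 [/= o1 z B o2]]].
  split; first exact: g10.
  have cg : centered g by split; first exact: g10.
  rewrite ev_shear // in o2; split=> //=; last by move=> j le; rewrite fpsD B // low // addr0.
  by rewrite fpsD z low ?muln0 // addr0.
have z2 : g.2 0%N = 0 by move: z; rewrite fpsD low ?muln0 // addr0.
have cg : centered g by [].
split; [exact: o1|exact: z2| |by rewrite ev_shear].
by move=> j le; have := B j le; rewrite /= fpsD low // addr0.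
Qed.

Definition zeta F : fps M := Fps (fun n => mu (contact_locus F n)).

Lemma zetaE F : motivic_zeta F = zeta F.
Proof. by apply: fpsP => n; exact: zeta_mu. Qed.

Lemma zeta_swap F : zeta (tr F) = zeta F.
Proof.
apply: fpsP => n; rewrite -[RHS](mu_swap (meas_locus F n)); apply: mu_ext => g.
split=> -[z1 z2 o]; split; [exact: z2|exact: z1| |exact: z2|exact: z1|].
  by have o' : has_order (ev (tr F) g) n := o; rewrite (ev_swap F (conj z1 z2)) in o'.
suff o' : has_order (ev (tr F) g) n by exact: o'.
by rewrite (ev_swap F (conj z2 z1)).
Qed.

Lemma zeta_shear F psi (psi0 : psi 0%N = 0) : zeta (pull (shear psi0) F) = zeta F.
Proof.
apply: fpsP => n; rewrite -[RHS](@mu_shear C psi _ (meas_locus F n)) => [|g [z1 _ _]]; last exact: z1.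
apply: mu_ext => g.
have P0 (z1 : g.1 0%N = 0) : psub psi g.1 0%N = 0 by exact: psub0.
have E (z1 : g.1 0%N = 0) : (g.2 + psub psi g.1) 0%N = g.2 0%N by rewrite fpsD P0 // addr0.
split=> [[z1 z2 o]|[z1 [_ z2 o]]].
  split; [exact: z1|split; [exact: z1|by rewrite -z2 -(E z1)|]].
  by have o' : has_order (ev (pull (shear psi0) F) g) n := o; rewrite (ev_shear psi0 F (conj z1 z2)) in o'.
have z2' : g.2 0%N = 0 by rewrite -(E z1).
split; [exact: z1|exact: z2'|].
suff o' : has_order (ev (pull (shear psi0) F) g) n by exact: o'.
by rewrite (ev_shear psi0 F (conj z1 z2')).
Qed.

Lemma ZR1_union F A n : (forall i, (0 < i)%N -> meas (A i)) -> mu [set g : arcs | exists i, (i < n)%N /\ piece F A i.+1 n g] = ZR F 1 A n /\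
  meas [set g : arcs | exists i, (i < n)%N /\ piece F A i.+1 n g].
Proof.
move=> mA; have [] := @mu_bigU C n (fun i => piece F A i.+1 n).
- by move=> i _; apply: mreg_meas.
- by move=> i j g _ _ [o1 _ _ _] [o2 _ _ _]; have [] := has_order_uniq o1 o2.
by move=> m1 e1; split=> //; rewrite e1 /ZR fpsE; apply: eq_bigr => i _; rewrite mul0n expr0 mul1r.
Qed.

(** The ray itself belongs to the first part. The bounds [p <= W] and [q <= W] ensure that the order
    of [F] along an arc is at least the order of the component that indexes its piece, as the
    summation in [ZR] requires. *)
Lemma zeta_split F p q W : (0 < p)%N -> (0 < q)%N -> wge p q W F -> (p <= W)%N -> (q <= W)%N ->
  zeta F = ZR F 1 (from p q) + ZR (tr F) 1 (beyond q p).
Proof.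
move=> p0 q0 wF pW qW; apply: fpsP => n; rewrite fpsD.
have [e1 m1] := @ZR1_union F (from p q) n (fun i _ => @meas_from C p q i p0).
have [e2 m2] := @ZR1_union (tr F) (beyond q p) n (fun i _ => @meas_beyond C q p i q0).
rewrite -e1 -e2; move: m1 m2 {e1 e2}; set X := [set g | _]; set Y := [set g | _] => m1 m2.
have m2' := @meas_comp C _ (fun g => (g.2, g.1)) m2 (afps_pair (@afps2 C) (@afps1 C)).
rewrite -(mu_swap m2) -(mu_add m1 m2'); last first.
  move=> g [i [_ [o1 _ H _]]] [j [_ [o2 _ H2 _]]].
  have := beyondP q0 H2 o1; have [_ nz] := o2; case: ltnP => // le _; apply: nz.
  exact: H _ le.
apply: mu_ext => g; split=> [[z1 z2 o]|[[i [_ [o1 z2 _ o]]]|[i [_ [o1 z2 _ o]]]]]; last 2 first.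
- by split; [case: o1 => lo _; exact: lo|exact: z2|exact: o].
- have z1 : g.2 0%N = 0 by case: o1 => lo _; exact: lo.
  by split; [exact: z2|exact: z1|]; move: o; rewrite ev_swap; [exact|split].
have cg : centered g by [].
have wF' i j : F i j != 0 -> (W <= p * i + q * j)%N by move=> nz; rewrite leqNgt; apply/negP => /wF E; rewrite E eqxx in nz.
have ord_ge m t N : vge g.1 m -> vge g.2 t -> (forall i j, F i j != 0 -> (N <= m * i + t * j)%N) -> (N <= n)%N.
  move=> v1 v2 H; rewrite leqNgt; apply/negP => lt; have [_] := o; apply.
  exact: (vge_ev v1 v2 H lt).
have [[i [i0 oi H]]|nl] := pselect (exists i, [/\ (0 < i)%N, has_order g.1 i & from p q i g]).
  left; exists i.-1; rewrite prednK //; split; last by split.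
  rewrite ?prednK //; pose t := ((q * i + p.-1) %/ p)%N.
  have tP j : (j < t)%N -> (p * j < q * i)%N.
    by rewrite /t => lt; have := leq_divM (q * i + p.-1) p; nia.
  have tq : (q * i <= p * t)%N.
    have := divn_eq (q * i + p.-1) p; have := ltn_pmod (q * i + p.-1) p0; rewrite -/t; nia.
  apply: (@ord_ge i t i); first exact: has_order_vge.
    by move=> j /tP; exact: H.
  move=> x y /wF' le; rewrite -(leq_pmul2l p0); nia.
have [t [ot H]] : exists t, has_order g.2 t /\ forall j, (q * j <= p * t)%N -> g.1 j = 0.
  have [u0|/eqP u0] := eqVneq g.1 0; last first.
    have [i oi _] := @vge_order g.1 0 (fun j (lt : (j < 0)%N) => False_ind _ (notF lt)) u0.
    have i0 : (0 < i)%N by case: i oi => // -[_]; rewrite z1.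
    have [j [lj gj]] : exists j, (p * j < q * i)%N /\ g.2 j <> 0.
      apply: contrapT => nex; apply: nl; exists i; split=> // j lj.
      by apply: contrapT => gj; apply: nex; exists j.
    have [t ot tj] := @has_order_ex C g.2 j (ex_intro2 _ _ j gj (leqnn j)).
    by exists t; split=> // x le; case: oi => lo _; apply: lo; nia.
  have [w0|/eqP w0] := eqVneq g.2 0; last first.
    have [t ot _] := @vge_order g.2 0 (fun j (lt : (j < 0)%N) => False_ind _ (notF lt)) w0.
    by exists t; split=> // j _; rewrite u0 fps0.
  have [_] := o; case; rewrite -/(ev F g) evE big1 // => x _; rewrite big1 // => y _.
  have [->|/wF' le] := eqVneq (F x y) 0; first by rewrite mul0r.
  rewrite u0 w0; case: (posnP x) le => [->|x0]; last by rewrite expr0n (gtn_eqF x0) mul0r fps0 mulr0.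
  case: (posnP y) => [->|y0]; last by rewrite expr0 mul1r expr0n (gtn_eqF y0) fps0 mulr0.
  by rewrite !muln0; lia.
have t0 : (0 < t)%N by case: t ot {H} => // -[_]; rewrite z2.
right; exists t.-1; rewrite prednK //; split; last first.
  by split; [exact: ot|exact: z1|exact: H|rewrite ev_swap].
pose m := ((p * t) %/ q).+1.
have mq : (p * t <= q * m)%N.
  by have := divn_eq (p * t) q; have := ltn_pmod (p * t) q0; rewrite /m; nia.
apply: (@ord_ge m t t); last first.
- by move=> x y /wF' le; rewrite -(leq_pmul2l q0); nia.
- exact: has_order_vge.
move=> j lt; apply: H; have := leq_divM (p * t) q; rewrite /m ltnS in lt; nia.
Qed.
End Decompose.

(** * Edges ending on the diagonal; states under shears, swaps and root charts *)

Section Edges.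
Variable C : numClosedFieldType.
Notation S := (fps (fps C)).
Implicit Types (F G J : S) (psi : fps C) (p q a h i j n k l L : nat) (c x : C) (Q : {poly C}).

Lemma pull00 s F : pull s F 0%N 0%N = F 0%N 0%N.
Proof.
by rewrite (@pullE C 0) // !big_ord_recl !big_ord0 !addr0 !expr0 mulr1 -mono200 mono2E mulr1.
Qed.

Lemma left_edge p q a h A L F Q c : face p q a h A A L F Q -> root Q c -> (mup c Q < A)%N -> edge_ok p q A F.
Proof.
move=> fc rt lt; have R := face_ray fc; have p0 := ray_p R; have q0 := ray_q R.
right; split=> //; first exact: ray_co R.
exists Q, c; split=> //; last exact: face_root_neq0 fc rt.
move=> l; case: (leqP l L) => [le|lt'].
  by rewrite (face_F fc le) (face_low fc le).
rewrite nth_default ?(face_size fc) //; case: ifP => // le; apply/eqP; rewrite eq_sym; apply/eqP.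
have [->//|nz] := eqVneq (F (A - q * l)%N (A + p * l)%N) 0.
have E : (p * (A - q * l) + q * (A + p * l) = p * a + q * h)%N.
  have [_ <- _] := face_vertex fc; have : (p * (A - q * l) + p * (q * l) = p * A)%N by rewrite -mulnDr subnK.
  by rewrite mulnDr (mulnCA q); lia.
have [l' [le' _ /eqP]] := face_on fc nz E; rewrite eqn_add2l eqn_pmul2l // => /eqP e.
by rewrite e ltnNge le' in lt'.
Qed.

(** Seen from the other end, the edge polynomial is reversed and its roots are inverted. For [L < A]
    the degree bounds the multiplicity. Otherwise [p = 1] and [L = A], and tameness provides a
    second root, so no root has multiplicity [A]. *)
Lemma right_edge p q A a' h' L F Q : (0 < A)%N -> face p q A A a' h' L F Q -> tame A Q -> edge_ok q p A (tr F).
Proof.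
move=> A0 fc tm; have R := face_ray fc; have p0 := ray_p R; have q0 := ray_q R.
have L0 := face_L fc; have aE := face_a fc; have hE := face_h fc; have Qn := face_poly_neq0 fc.
have LA : (p * L <= A)%N by lia.
pose Gr : {poly C} := \poly_(l < L.+1) Q`_(L - l).
have edgeG : edge q p A (tr F) Gr.
  move=> l; rewrite coef_poly ltnS; case: (leqP l L) => [le|lt].
    rewrite (leq_trans _ LA) ?leq_mul2l ?le ?orbT // trE (face_F fc (leq_subr _ _)).
    congr (F _ _); rewrite mulnBr; have := leq_mul (leqnn q) le; have := leq_mul (leqnn p) le; nia.
  case: ifP => // le; rewrite trE; have [->//|nz] := eqVneq (F (A + q * l)%N (A - p * l)%N) 0.
  have E : (p * (A + q * l) + q * (A - p * l) = p * A + q * A)%N.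
    have : (q * (A - p * l) + q * (p * l) = q * A)%N by rewrite -mulnDr subnK.
    by rewrite mulnDr (mulnCA p); lia.
  have [l' [le' /eqP + _]] := face_on fc nz E; rewrite aE => /eqP e.
  have : (q * l <= q * L)%N by lia.
  by rewrite leq_pmul2l // leqNgt lt.
have GrE c : c != 0 -> Gr.[c^-1] * c ^+ L = Q.[c].
  move=> c0; rewrite horner_poly mulr_suml horner_coef (face_size fc) [RHS](reindex_inj rev_ord_inj).
  apply: eq_bigr => l _; rewrite /= subSS -mulrA; congr (_ * _).
  have -> : c ^+ L = c ^+ (L - l) * c ^+ l by rewrite -exprD subnK ?leq_ord.
  by rewrite exprVn mulrCA mulVf ?mulr1 // expf_neq0.
have Gr0 : Gr != 0.
  apply/eqP => E; have := congr1 (fun g : {poly C} => g`_L) E; rewrite coef_poly ltnSn subnn coef0 => e.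
  by have := face_0 fc; rewrite e eqxx.
have szG : (size Gr <= L.+1)%N by exact: size_poly.
have rootG c : root Q c -> root Gr c^-1 /\ c^-1 != 0.
  move=> rt; have c0 := face_root_neq0 fc rt; rewrite invr_eq0 c0; split=> //.
  have /eqP := GrE c c0; rewrite (rootP rt) mulf_eq0 expf_eq0 (negbTE c0) andbF orbF; by move/eqP/rootP.
have nconst : size Q != 1%N by rewrite (face_size fc); case: L L0 {fc aE hE LA Gr edgeG GrE Gr0 szG rootG}.
right; split=> //; first by rewrite coprime_sym; exact: ray_co R.
have [c1 r1] := closed_rootP _ nconst; have [g1 n1] := rootG _ r1.
exists Gr, c1^-1; split=> //.
have le1 := mup_le_size c1^-1 Gr0.
have [lt|ge] := ltnP L A; first by apply: leq_ltn_trans le1 (leq_ltn_trans _ lt); case: (size Gr) szG.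
have p1 : p = 1%N by nia.
have [c2 [r2 ne]] : exists c2, root Q c2 /\ c2 != c1.
  apply: contrapT => nex; have [u ur QE] := mup_decomp c1 Qn.
  have : size u == 1%N.
    apply: contrapT => /negP /closed_rootP [c2 r2]; apply: nex; exists c2.
    split; first by rewrite QE rootM r2 orbT.
    by apply: contraNneq ur => <-; exact/eqP/rootP.
  move=> /eqP su; have := congr1 (fun g : {poly C} => size g) QE.
  have un : u != 0 by rewrite -size_poly_eq0 su.
  rewrite /= mulrC size_Mmonic ?monic_exp ?monicXsubC // size_exp_XsubC su (face_size fc) /= => E.
  by have := tm _ r1; lia.
have [g2 n2] := rootG _ r2.
have nei : c1^-1 != c2^-1 by rewrite (inj_eq invr_inj) eq_sym.
have m2 : (0 < mup c2^-1 Gr)%N by rewrite mup_gt0.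
apply: (@leq_trans (mup c1^-1 Gr + mup c2^-1 Gr)); first by rewrite -addn1 leq_add2l.
apply: leq_trans (mup_add_le Gr0 nei) _; apply: leq_trans (leq_trans (leq_pmull L p0) LA).
by case: (size Gr) szG.
Qed.

End Edges.

Section States.
Variables (C : numClosedFieldType) (f : fps (fps C)).
Notation S := (fps (fps C)).
Implicit Types (F J : S) (psi : fps C) (p q a h k L : nat) (c : C) (Q : {poly C}).
Notation state := (state f).

Lemma Jac_shear psi (psi0 : psi 0%N = 0) : Jac (shear psi0) = 1.
Proof.
rewrite /Jac [sX _]/(mono2 C 1 0) [sY _]/(mono2 C 0 1 + xlift psi) d1_mono2 d2_mono2 mulr0n mul0r subr0 mulr1n mul1r.
apply: fps2P => i j; rewrite d2E fps2D mono2E liftE /= mulr0n addr0 -mono200 mono2E eqSS.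
by case: (i == 0%N); case: j => [|j]; rewrite /= ?mulr1n ?mul0rn.
Qed.

Lemma state_shear sg k F psi (psi0 : psi 0%N = 0) : state sg k F -> state (scomp sg (shear psi0)) k (pull (shear psi0) F).
Proof.
move=> [k0 FE [J [JE J0]]]; split; [exact: k0|rewrite FE; exact: pull_comp|].
exists (pull (shear psi0) J); rewrite pull00; split; last exact: J0.
rewrite Jac_comp JE (rmorphM (pull (shear psi0))) /= pull_mono expr0 mulr1 Jac_shear mulr1; congr (_ * _).
by rewrite [sX _]/(mono2 C 1 0) mono2X mul1n.
Qed.

Lemma state_swap sg F : state sg 1 F -> state (scomp sg (swap2 C)) 1 (tr F).
Proof.
move=> [k0 FE [J [JE J0]]]; split; [exact: k0|rewrite FE; exact: pull_comp|].
exists (- tr J); rewrite fps2N trE oppr_eq0; split; last exact: J0.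
rewrite Jac_comp JE mono200 !mul1r -/(tr _) /Jac [sX _]/(mono2 C 0 1) [sY _]/(mono2 C 1 0).
by rewrite !d1_mono2 !d2_mono2 mulr0n mul0r sub0r !mulr1n mono2MM mono200 mulrN1.
Qed.

Lemma state_root sg k F p q a h a' h' L Q c al be (fc : face p q a h a' h' L F Q) : state sg k F ->
  (p * be = q * al + 1)%N -> c != 0 ->
  state (scomp sg (mchart fc (('X + c%:P) ^+ al) (('X + c%:P) ^+ be))) (p * k + q)
    (pull (mchart fc (('X + c%:P) ^+ al) (('X + c%:P) ^+ be)) F).
Proof.
move=> [k0 FE [J [JE J0]]] Bz c0; have p0 := ray_p (face_ray fc); have q0 := ray_q (face_ray fc).
set A1 := ('X + c%:P) ^+ al; set B1 := ('X + c%:P) ^+ be; pose tau := mchart fc A1 B1.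
split; [by rewrite addn_gt0 q0 orbT|exact: (etrans (congr1 (pull _) FE) (pull_comp _ _ _))|].
pose D := p%:R *: (A1 * B1^`()) - q%:R *: (A1^`() * B1).
exists (pull tau J * colc (A1 ^+ k.-1 * D)); split.
  rewrite Jac_comp JE (rmorphM (pull (mchart fc A1 B1))) /= pull_mono [sX _]/(mono2 C p 0 * colc A1) expr0 mulr1.
  rewrite Jac_mchart -/D exprMn mono2X mul0n -colcX -/tau.
  have -> : (p * k + q).-1 = (p * k.-1 + (p + q).-1)%N by clear -k0 p0 q0; case: k k0 => // k _ /=; nia.
  have -> : mono2 C (p * k.-1 + (p + q).-1) 0 = mono2 C (p * k.-1) 0 * mono2 C (p + q).-1 0 by rewrite mono2MM.
  rewrite colcM; move: (mono2 C (p * k.-1) 0) (mono2 C (p + q).-1 0) (colc (A1 ^+ k.-1)) (colc D) (pull tau J).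
  by move=> x1 x2 x3 x4 x5; ring.
have -> : (pull tau J * colc (A1 ^+ k.-1 * D)) 0%N 0%N = J 0%N 0%N * (A1 ^+ k.-1 * D)`_0.
  by rewrite fps2M !big_ord_recl !big_ord0 !addr0 subn0 pull00 colcE mulr1n.
rewrite -horner_coef0 mulf_neq0 // hornerM horner_exp mulf_neq0 ?expf_neq0 //.
  by rewrite /A1 horner_exp !hornerE expf_neq0.
have cX n : c * (('X + c%:P) ^+ n)^`().[0] = c ^+ n *+ n.
  rewrite deriv_exp hornerMn derivD derivX derivC addr0 mul1r horner_exp !hornerE.
  by case: n => [|n]; rewrite ?mulr0n ?mulr0 // mulrnAr -exprS.
(* The two terms are [p be] and [q al] times [c^(al + be)]; the Bezout relation makes their
   difference nonzero, so the Jacobian has no further zero at the origin. *)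
have E : c * D.[0] = c ^+ (al + be).
  have e1 : A1.[0] = c ^+ al by rewrite /A1 horner_exp !hornerE.
  have e2 : B1.[0] = c ^+ be by rewrite /B1 horner_exp !hornerE.
  have -> : c * D.[0] = p%:R * (A1.[0] * (c * B1^`().[0])) - q%:R * ((c * A1^`().[0]) * B1.[0]).
    by rewrite /D hornerD hornerN !hornerZ !hornerM; move: A1.[0] B1.[0] A1^`().[0] B1^`().[0] => *; ring.
  rewrite e1 e2 !cX -!(mulr_natr (c ^+ _)).
  have -> (u v w z : C) (y t : C) : u * (v * (w * y)) - z * (v * t * w) = v * w * (u * y - z * t) by ring.
  by rewrite -exprD -!natrM Bz natrD addrAC subrr add0r mulr1.
by apply: contraTneq isT => D0; move: E; rewrite D0 mulr0 => /eqP; rewrite eq_sym expf_eq0 (negbTE c0) andbF.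
Qed.
End States.

(** * Induction on the height *)

Section Claim.
Variables (C : numClosedFieldType) (f : fps (fps C)) (b : {poly C}).
Hypotheses (f0 : f <> 0) (Hb : bernstein_equation f b) (b0 : b != 0).
Variable s0 : rat.
Notation S := (fps (fps C)).
Implicit Types (F G J : S) (psi : fps C) (p q a h i j n k l L K N : nat) (c : C) (Q : {poly C}).
Notation state := (state f).
Notation x := (ratr s0 : C).
Notation m := (mup x b).

Lemma hitE K N : (0 < N)%N -> hit s0 K N = (K%:R + x * N%:R == 0) :> nat.
Proof.
move=> N0; rewrite /hit; congr (nat_of_bool _).
have -> : K%:R + x * N%:R = ratr (K%:R + s0 * N%:R) :> C by rewrite rmorphD rmorphM !rmorph_nat.
rewrite fmorph_eq0; have Nn : N%:R != 0 :> rat by rewrite pnatr_eq0 -lt0n.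
rewrite -(inj_eq (mulIf Nn)) mulrVK ?unitfE // -pmulrn eq_sym -addr_eq0 addrC //.
Qed.

Lemma hit_le K N : (0 < N)%N -> (K%:R + x * N%:R = 0 -> b.[x] = 0) -> (hit s0 K N <= m)%N.
Proof.
move=> N0 H; rewrite hitE //; case: eqP => // /H rt.
by rewrite mup_gt0 //; exact/rootP.
Qed.

(** A hit of the ray [(p, q)] means [p (k + x a) + q (1 + x h) = 0]. The rays being independent, two
    hits give [1 + x h = 0] and [k + x a = 0], hence [a = k h]. *)
Lemma two_hits k a h p1 q1 p2 q2 : (0 < a)%N -> (0 < p1)%N -> (0 < q2)%N -> (0 < h)%N -> (p2 * q1 < p1 * q2)%N ->
  (hit s0 (p1 * k + q1) (p1 * a + q1 * h) <= m)%N -> (hit s0 (p2 * k + q2) (p2 * a + q2 * h) <= m)%N ->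
  ((k * h)%N = a -> 1 + x * h%:R = 0 -> (2 <= m)%N) ->
  (hit s0 (p1 * k + q1) (p1 * a + q1 * h) + hit s0 (p2 * k + q2) (p2 * a + q2 * h) <= m)%N.
Proof.
move=> a0 p10 q20 h0 lt.
rewrite !hitE ?addn_gt0 ?muln_gt0 ?a0 ?p10 ?q20 ?h0 ?orbT //.
case: eqP => E1; case: eqP => E2 //= _ _ H.
have D0 : (p1 * q2)%:R - (p2 * q1)%:R != 0 :> C by rewrite subr_eq0 eqr_nat; apply/eqP; lia.
have e1 : 1 + x * h%:R = 0.
  apply: (mulfI D0); rewrite mulr0.
  have -> : ((p1 * q2)%:R - (p2 * q1)%:R) * (1 + x * h%:R) = p1%:R * ((p2 * k + q2)%:R + x * (p2 * a + q2 * h)%:R) -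
     p2%:R * ((p1 * k + q1)%:R + x * (p1 * a + q1 * h)%:R) by rewrite !(natrD, natrM); ring.
  by rewrite E1 E2 !mulr0 subrr.
have e2 : k%:R + x * a%:R = 0.
  apply: (mulfI D0); rewrite mulr0.
  have -> : ((p1 * q2)%:R - (p2 * q1)%:R) * (k%:R + x * a%:R) = q2%:R * ((p1 * k + q1)%:R + x * (p1 * a + q1 * h)%:R) -
     q1%:R * ((p2 * k + q2)%:R + x * (p2 * a + q2 * h)%:R) by rewrite !(natrD, natrM); ring.
  by rewrite E1 E2 !mulr0 subrr.
apply: H => //; apply/eqP; rewrite -(eqr_nat C) natrM.
have xh : x * h%:R = -1 by apply/eqP; rewrite -addr_eq0 addrC e1.
have kE : k%:R = - (x * a%:R) by apply/eqP; rewrite -addr_eq0 e2.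
by rewrite kE mulNr mulrAC xh mulN1r opprK.
Qed.

(* If k h < a, the two rays at (a, h) have different ratios; otherwise the chart is obtained from the
   original coordinates by shears and swaps only. *)
Definition claim h := forall sg k F p q p0 q0 a, state sg k F -> (0 < p)%N -> (0 < p0)%N -> (q * p0 <= q0 * p)%N -> (0 < a)%N ->
  vertex p0 q0 a h F -> wge p q (p * a + q * h) F -> (k * h < a)%N \/ (k = 1%N /\ (p0 <= q0)%N) ->
  (hit s0 (p * k + q) (p * a + q * h) <= m)%N -> (a = h -> edge_ok p q a F) ->
  PO s0 (ZR F k (beyond p q)) m.

Lemma wgeE p q n F i j : wge p q n F -> F i j != 0 -> (n <= p * i + q * j)%N.
Proof. by move=> H nz; rewrite leqNgt; apply/negP => /H E; rewrite E eqxx in nz. Qed.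

(** Generic arcs of the ray give its own denominator. At a root the induction applies with [pk + q],
    [pa + qh] and the multiplicity for [k], [a] and [h], where the assumption on multiplicities is
    the condition [k h < a]. Beyond the ray it applies to the lower end of the edge. *)
Lemma PO_from H sg k F p q a h a' h' L Q : (forall h, (h < H)%N -> claim h) -> state sg k F -> face p q a h a' h' L F Q ->
  (h <= H)%N -> (0 < a')%N -> (hit s0 (p * k + q) (p * a + q * h) <= m)%N ->
  (forall c, root Q c -> ((p * k + q) * mup c Q < p * a + q * h)%N /\ (mup c Q < H)%N) ->
  (k * h' < a')%N \/ (k = 1%N /\ (p <= q)%N) -> PO s0 (ZR F k (from p q)) m.
Proof.
move=> IH st fc hH a'0 hit_m rts dp; have [k0 _ _] := st.
have R := face_ray fc; have p0 := ray_p R; have q0 := ray_q R.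
have [V Veq h'h] := face_vertex fc; have Qn := face_poly_neq0 fc.
have [al [be rc]] := root_chart_exists C p0 q0 (ray_co R).
have [rs rsE] := exists_roots Qn; have [urs rE] := rsE.
have z : 0 \notin rs by rewrite -rE; apply/negP => /(face_root_neq0 fc); rewrite eqxx.
rewrite (ZR_from fc k0 rc rsE); apply: PO_add; first apply: PO_add.
- have [_ P1] := PO_ongen fc s0 k0 rc rsE; exact: PO_le P1.
- apply: (PO_onroots rc p0 urs z) => c ci; have rt : root Q c by rewrite rE.
  have c0 := face_root_neq0 fc rt; have [lt mH] := rts c rt.
  rewrite (ZR_root_chart fc k0 rc c0); have [Bz _] := rc.
  have st' := state_root fc st Bz c0.
  have [G [GE [Glow Gm]]] := root_face_row fc Bz c0.
  apply: (IH _ mH _ _ _ 1%N 0%N 1%N 0%N (p * a + q * h)%N st') => //.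
  + by apply: leq_trans lt.
  + split.
    * by rewrite GE mono2M leqnn leq0n subnn subn0.
    * move=> i j; rewrite GE mono2M; case: ifP => [/andP[le _] _|_ /eqP //]; by rewrite !mul1n !mul0n !addn0.
    * move=> i j; rewrite GE mono2M; case: ifP => [/andP[le _]|_ /eqP //]; rewrite subn0 !mul1n !mul0n !addn0 => nz jm.
      rewrite ltn_neqAle le andbT; apply: contraNneq nz => <-; rewrite subnn; apply/eqP; exact: Glow.
  + move=> i j; rewrite !mul1n !mul0n !addn0 => lti; rewrite GE mono2M leqNgt lti //.
  + by left.
  + by rewrite !mul1n !mul0n !addn0.
  by move=> _; left.
apply: (IH h' _ sg k F p q p q a' st) => //.
- exact: leq_trans hH.
- by rewrite -Veq in hit_m *; exact: vertex_wge.
- by rewrite Veq.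
(* For a lower end [(a', a')] with [k = 1] the bound on multiplicities reads [mup c Q < a']: every
   root of the edge carries nontrivial monodromy. *)
move=> E; subst h'; have nc : size Q != 1%N by rewrite (face_size fc); have := face_L fc; clear; case: L.
have [c rt] := closed_rootP _ nc; have [lt _] := rts c rt.
have lt' : (mup c Q < a')%N; last exact: (@left_edge C p q a h a' L F Q c fc rt lt').
case: dp => [|[k1 _]]; first by rewrite ltnNge leq_pmull.
by move: lt; rewrite -Veq k1 muln1 -mulnDl ltn_pmul2l // addn_gt0 p0.
Qed.

(** Induction on the height. The normalizing shear has only terms beyond [(p0, q0)], hence beyond
    [(p, q)], so it changes neither the region nor the coefficients on the line of weight [(p, q)]
    through [(a, h)]. *)
Lemma claimP h : claim h.
Proof.
have [H le] : exists H, (h < H)%N by exists h.+1.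
elim: H h le => // H IH h; rewrite ltnS => hH sg k F p q p0 q0 a st p1 p01 lepq a0 V W dp hm eo.
have [k0 _ _] := st; have [h0|h0] := posnP h.
  subst h; rewrite !muln0 !addn0 in W hm.
  apply: PO_le hm _; apply: PO_base => //; first exact: vertex_v V.
  by move=> i j; exact: wgeE.
have [psi [psiE nrm]] := normalize p01 h0 V.
have psi0 : psi 0%N = 0 by apply/eqP/negPn/negP => /psiE; rewrite muln0.
have psiE' i : psi i != 0 -> (q < p * i)%N by move=> /psiE; nia.
rewrite -(@ZR_shear C F k p q psi psi0 p1 psiE').
have {}nrm := nrm psi0.
have {}V := shear_vertex psi0 psiE V.
have st' := state_shear psi0 st.
have eo' : a = h -> edge_ok p q a (pull (shear psi0) F).
  move=> ah; case: (eo ah) => [|[q1 p2 co [Gl [bt [GlE ? ? ?]]]]]; [by left|right; split=> //].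
  exists Gl, bt; split=> // l; rewrite GlE; case: ifP => // le.
  rewrite (@shear_strict C p q psi psi0 _ F psiE' W) // -ah; nia.
have {}W : wge p q (p * a + q * h) (pull (shear psi0) F).
  by apply: shear_weak W => // i /psiE' /ltnW.
move: (pull (shear psi0) F) (scomp sg (shear psi0)) nrm V st' eo' W => {F st eo psi psiE psi0 psiE'} F {}sg nrm V st eo W.
have v := vertex_v V.
case: nrm => [low|[p' [q' [a' [h' [L [Q [fc lt tm]]]]]]]].
  have axis : (hit s0 1 h <= m)%N by apply: hit_le => //; exact: (axis_root_state f0 Hb st h0 v low).
  have ge x y : F x y != 0 -> (p * a + q * h <= p * x + q * y)%N /\ (h <= y)%N.
    by move=> nz; split; [exact: wgeE W nz|rewrite leqNgt; apply/negP => /(low x) E; rewrite E eqxx in nz].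
  apply: PO_le (PO_axis_cone s0 k0 a0 h0 p1 v ge).
  have := @two_hits k a h p q 0 1 a0 p1 isT h0; rewrite !mul0n !mul1n !add0n muln1 => two.
  rewrite [(k * p)%N]mulnC [(a * p)%N]mulnC [(h * q)%N]mulnC; apply: two => // khE xE; have ah : a = h.
    by case: dp => [|[k1 _]]; [rewrite khE ltnn|rewrite -khE k1 mul1n].
  have k1 : k = 1%N by apply/eqP; rewrite -(eqn_pmul2r h0) mul1n khE ah.
  clear khE; subst k a; apply: (@double_vertex C f b f0 Hb sg F h p q 0 1 x b0 st h0 v) => //; first by rewrite mul0n muln1.
    by move=> i j /ge [? ?]; rewrite !mul0n !mul1n.
    exact: eo.
  by left.
have R := face_ray fc; have p'0 := ray_p R; have q'0 := ray_q R.
have [V' Veq h'h] := face_vertex fc.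
have lt' : (p' * q < p * q')%N by nia.
(* If [k = 1] instead of [k h < a], the inequality comes from [p' < q']: the new edge is steeper
   than [(p0, q0)], whose slope is at least 1. *)
have deep' : (h * (p' * k + q') < 2 * (p' * a + q' * h))%N.
  case: dp => [lt2|[k1 le]]; last first.
    by have pq : (p' < q')%N; [nia|rewrite k1; nia].
  have : (p' * (k * h) < p' * a)%N by rewrite ltn_pmul2l.
  by nia.
have hm' : (hit s0 (p' * k + q') (p' * a + q' * h) <= m)%N.
  apply: hit_le; first by rewrite addn_gt0 muln_gt0 p'0 a0.
  exact: (ray_root f0 Hb st fc tm deep').
have ge x y : F x y != 0 -> (p * a + q * h <= p * x + q * y)%N /\ (p' * a + q' * h <= p' * x + q' * y)%N.
  by move=> nz; split; [exact: wgeE W nz|exact: (ray_ge R nz)].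
have [zc -> POc] := @PO_ray_cone C s0 F k p q p' q' a h k0 a0 h0 p1 p'0 lt' v ge.
apply: PO_add.
  apply: PO_le POc; rewrite (mulnC k) (mulnC a) (mulnC h) (mulnC k) (mulnC a) (mulnC h).
  apply: two_hits => // khE xE; have ah : a = h.
    by case: dp => [|[k1 _]]; [rewrite khE ltnn|rewrite -khE k1 mul1n].
  have k1 : k = 1%N by apply/eqP; rewrite -(eqn_pmul2r h0) mul1n khE ah.
  clear khE; subst k a; apply: (@double_vertex C f b f0 Hb sg F h p q p' q' x b0 st h0 v lt' ge (eo erefl) _ xE).
  exact: right_edge h0 fc tm.
apply: (PO_from IH st fc hH) => //.
- by rewrite (face_a fc) ltn_addr.
(* Tameness, [2 mup c Q <= h], turns [deep'] into the condition [k h < a] of the chart at [c]. *)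
- move=> c rt; have le := tm _ rt; split; last by apply: leq_trans hH; lia.
  by nia.
case: dp => [lt2|[k1 le]]; last by right; split=> //; nia.
left; apply: leq_ltn_trans (leq_mul (leqnn k) (ltnW h'h)) _; apply: leq_trans lt2 _.
by rewrite (face_a fc) leq_addr.
Qed.
End Claim.

(** * The start: the tangent cone *)

Section Start.
Variables (C : numClosedFieldType) (f : fps (fps C)) (b : {poly C}).
Hypotheses (f0 : f <> 0) (Hb : bernstein_equation f b) (b0 : b != 0).
Variable s0 : rat.
Notation S := (fps (fps C)).
Implicit Types (F G J : S) (psi : fps C) (p q a h i j n k l L K N : nat) (c r : C) (Q P : {poly C}).
Notation state := (state f).
Notation x := (ratr s0 : C).
Notation m := (mup x b).

Lemma state_shear1 psi (psi0 : psi 0%N = 0) : state (shear psi0) 1 (pull (shear psi0) f).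
Proof.
split=> [//| |]; first by [].
exists 1; split; first by rewrite Jac_shear mono200 mulr1.
by rewrite -mono200 mono2E oner_neq0.
Qed.

Lemma zeta_axis F : (forall i j, F i j != 0 -> (0 < i)%N) -> zeta F = ZR F 1 (beyond 1 0).
Proof.
move=> Fi; apply: fpsP => n.
have [<- _] := @ZR1_union C F (beyond 1 0) n (fun i _ => @meas_beyond C 1 0 i isT).
apply: mu_ext => g; split=> [[z1 z2 o]|[i [_ [o1 z2 _ o]]]]; last first.
  by split; [case: o1 => lo _; exact: lo|exact: z2|exact: o].
have [u0|/eqP u0] := eqVneq g.1 0.
  have [_] := o; case; rewrite -/(ev F g) evE big1 // => i _; rewrite big1 // => j _.
  have [->|/Fi i0] := eqVneq (F i j) 0; first by rewrite mul0r.
  by rewrite u0 expr0n (gtn_eqF i0) mul0r fps0 mulr0.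
have [i oi _] := @vge_order C g.1 0 (fun j (lt : (j < 0)%N) => False_ind _ (notF lt)) u0.
have i0 : (0 < i)%N by case: i oi => // -[_]; rewrite z1.
exists i.-1; rewrite prednK //; split; last first.
  by split; [exact: oi|exact: z2|move=> j; rewrite mul1n mul0n leqn0 => /eqP ->|exact: o].
rewrite leqNgt; apply/negP => lt; have [_] := o; apply.
apply: (@vge_ev C F g i 1 i (has_order_vge oi) (vge1 z2)) => // y j /Fi y0; nia.
Qed.

(** The lowest homogeneous part is a multiple of [u^h w^a]: the tangent lines are among the axes. *)
Definition monomial_form h a G := G h a != 0 /\ forall i j, G i j != 0 -> (i, j) != (h, a) -> (h + a < i + j)%N.

Lemma monomial_form_wge h a G : monomial_form h a G -> wge 1 1 (h + a) G.
Proof.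
move=> [v gt] i j; rewrite !mul1n => lt; apply/eqP/negPn/negP => nz.
have [[e1 e2]|ne] := eqVneq (i, j) (h, a); first by rewrite e1 e2 ltnn in lt.
by have := gt _ _ nz ne; lia.
Qed.

Lemma monomial_form_vertex h a G : monomial_form h a G -> vertex 1 1 h a G /\ vertex 1 1 a h (tr G).
Proof.
move=> [v gt]; split; split=> [|i j|i j]; rewrite ?trE //.
- rewrite !mul1n; have [[-> ->] //|ne nz] := eqVneq (i, j) (h, a); exact: ltnW (gt _ _ nz ne).
- by rewrite !mul1n => nz lt; apply: gt => //; apply/eqP => -[_ e]; rewrite e ltnn in lt.
- rewrite !mul1n (addnC a) (addnC i); have [[-> ->] //|ne nz] := eqVneq (j, i) (h, a); exact: ltnW (gt _ _ nz ne).
by rewrite !mul1n (addnC a) (addnC i) => nz lt; apply: gt => //; apply/eqP => -[e _]; rewrite e ltnn in lt.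
Qed.

Lemma monomial_form_shear h a G psi (psi0 : psi 0%N = 0) : (forall i, psi i != 0 -> (1 < 1 * i)%N) -> monomial_form h a G ->
  monomial_form h a (pull (shear psi0) G).
Proof.
move=> H mf; have W := monomial_form_wge mf; have [v gt] := mf.
have E := @shear_strict C 1 1 psi psi0 (h + a) G H W.
split; first by rewrite E ?mul1n.
move=> i j + ne; case: ltnP => // le; rewrite E ?mul1n // => nz.
by have := gt _ _ nz ne; rewrite ltnNge le.
Qed.

(** The weight [(1, 1)] is not normal to an edge here, and cutting at it could introduce a
    denominator foreign to [b]: for [u w^2] the first blowup suggests [-2/3]. The first cut is made
    at the edge going down from [(h, a)], and the arcs on its other side are treated after a
    swap. *)
Lemma PO_monomial_form sg G h a : state sg 1 G -> (0 < a)%N -> monomial_form h a G -> PO s0 (zeta G) m.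
Proof.
move=> st a0 mf; have [V _] := monomial_form_vertex mf.
have [psi [psiE nrm]] := normalize (isT : (0 < 1)%N) a0 V.
have psi0 : psi 0%N = 0 by apply/eqP/negPn/negP => /psiE.
have {}mf := monomial_form_shear psi0 psiE mf.
have {}nrm := nrm psi0; have {}st := state_shear psi0 st.
rewrite -(zeta_shear G psi0).
move: (pull (shear psi0) G) (scomp sg (shear psi0)) mf nrm st => {V psiE psi0 psi} {}G {}sg mf nrm st.
have [V V'] := monomial_form_vertex mf; have [v _] := mf.
have st' := state_swap st.
have v' : tr G a h != 0 by rewrite trE.
case: nrm => [low|[p [q [a' [h' [L [Q [fc lt tm]]]]]]]].
  rewrite -zeta_swap zeta_axis => [|i j]; last first.
    rewrite trE => nz; rewrite lt0n; apply/eqP => i0; subst i; by rewrite low ?eqxx in nz.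
  apply: (@claimP C f b f0 Hb b0 s0 h _ 1%N _ 1%N 0%N 1%N 1%N a st') => //.
  + move=> i j; rewrite trE !mul1n !mul0n !addn0 => ia; exact: low.
  + by right.
  + by rewrite !mul1n !mul0n !addn0; apply: (hit_le b0) => //; exact: (axis_root_state f0 Hb st a0 v low).
  by move=> _; left.
rewrite mul1n muln1 in lt; have R := face_ray fc; have p0 := ray_p R; have q0 := ray_q R.
have lt2 : (a * (p * 1 + q) < 2 * (p * h + q * a))%N by nia.
have hm : (hit s0 (p * 1 + q) (p * h + q * a) <= m)%N.
  apply: (hit_le b0); first by rewrite addn_gt0 !muln_gt0 q0 a0 orbT.
  exact: (ray_root f0 Hb st fc tm lt2).
have W : wge p q (p * h + q * a) G.
  by move=> i j lti; apply/eqP/negPn/negP => /(ray_ge R); rewrite leqNgt lti.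
rewrite (@zeta_split C G p q _ p0 q0 W); [|nia|nia].
apply: PO_add.
  apply: (@PO_from C f b s0 a sg 1 G p q h a a' h' L Q (fun h _ => @claimP C f b f0 Hb b0 s0 h) st fc) => //.
  - by rewrite (face_a fc) addn_gt0 muln_gt0 q0 (face_L fc) orbT.
  - by move=> c rt; have := tm _ rt; split; nia.
  by right; split=> //; exact: ltnW.
(* The region is bounded by the ray [(q, p)], of slope less than 1, but the next edge is sought
   beyond [(1, 1)], which the monomial lowest part permits. For this reason [claim] carries two
   weights. *)
apply: (@claimP C f b f0 Hb b0 s0 h _ 1%N _ q p 1%N 1%N a st') => //.
- by rewrite muln1 mul1n; exact: ltnW.
- move=> i j; rewrite trE addnC [X in (_ < X)%N -> _]addnC => lti; exact: W.
- by right.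
- by move: hm; rewrite !muln1 (addnC p) (addnC (p * h)%N).
by move=> ah; subst h; exact: (right_edge a0 fc tm).
Qed.

(** The tangent cone is an edge of weight [(1, 1)] from [(0, n)] on. On its other side, after a
    swap, the vertex has height 0, so nothing but the candidate [-2/n] can arise there. *)
Lemma PO_transversal sg F n a' h' L Q : state sg 1 F -> (0 < n)%N -> wge 1 1 n F -> face 1 1 0 n a' h' L F Q ->
  (forall c, root Q c -> (2 * mup c Q < n)%N) -> (2%:R + x * n%:R = 0 -> b.[x] = 0) -> PO s0 (zeta F) m.
Proof.
move=> st n0 W fc rts bx; have v : F 0%N n != 0 := ray_v (face_ray fc).
have hm : (hit s0 (1 * 1 + 1) (1 * 0 + 1 * n) <= m)%N by rewrite !mul1n add0n; exact: (hit_le b0 n0 bx).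
rewrite (@zeta_split C F 1 1 n) //; apply: PO_add.
  apply: (@PO_from C f b s0 n sg 1 F 1 1 0 n a' h' L Q (fun h _ => @claimP C f b f0 Hb b0 s0 h) st fc) => //.
  - by rewrite (face_a fc) add0n mul1n; exact: face_L fc.
  - by move=> c rt; have := rts _ rt; split; lia.
  by right.
apply: (@claimP C f b f0 Hb b0 s0 0 _ 1%N _ 1%N 1%N 1%N 1%N n (state_swap st)) => //.
- split; rewrite ?trE // => i j; rewrite trE => nz; rewrite !mul1n addn0 leqNgt; apply/negP => lt.
  by rewrite W ?eqxx // in nz; rewrite !mul1n addnC.
- by move=> i j; rewrite trE !mul1n addn0 addnC => lt; apply: W; rewrite !mul1n.
- by left; rewrite muln0.
  by move: hm; rewrite !mul1n add0n addn0.
by move=> e; rewrite e in n0.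
Qed.

Lemma coef_XaddC_exp c n j : (('X + c%:P) ^+ n)`_j = if (j <= n)%N then c ^+ (n - j) *+ 'C(n, j) else 0.
Proof.
have := @coef_comp_shift C 'X^n c j n; rewrite size_polyXn leqnn => /(_ isT).
rewrite (rmorphXn (comp_poly ('X + c%:P))) /= comp_polyX => ->; rewrite (bigD1 ord_max) //= coefXn eqxx mul1r big1 ?addr0 // => i ne.
by case: ifP => // _; rewrite coefXn (_ : _ == _ = false) ?mul0r //; apply/negbTE.
Qed.

(** The reversed polynomial of [d X^h (X - r)^L] is a constant times [(X - r^-1)^L]; reversal is the
    effect of a swap on the tangent cone. *)
Lemma coef_reverse_power (d r : C) h L j : r != 0 -> (j <= h + L)%N ->
  ('X^h * (('X - r%:P) ^+ L * d%:P))`_(h + L - j) =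
  d * (- r) ^+ L * (if (j <= L)%N then (- r^-1) ^+ (L - j) *+ 'C(L, j) else 0).
Proof.
move=> r0 le; rewrite coefXnM coefMC -polyCN coef_XaddC_exp.
have [jL|Lj] := leqP j L; last by rewrite (_ : (_ < h)%N) ?mulr0 //; lia.
rewrite (_ : (_ < h)%N = false); last by lia.
rewrite (_ : (h + L - j - h = L - j)%N); last by lia.
rewrite leq_subr subKn // bin_sub // -(subnK jL) exprD subnK //.
have e : (- r) ^+ (L - j) * (- r^-1) ^+ (L - j) = 1 by rewrite -exprMn mulrNN mulfV ?expr1n.
rewrite -(mulr_natr ((- r) ^+ j)) -(mulr_natr ((- r^-1) ^+ (L - j))).
move: ((- r) ^+ (L - j)) ((- r^-1) ^+ (L - j)) ((- r) ^+ j) ('C(L, j)%:R : C) e => t1 t2 t3 t4 e.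
by rewrite -[LHS]mul1r -e; ring.
Qed.

Lemma gpoly_tr n F j : (j <= n)%N -> (gpoly 0 1 n (tr F))`_j = (gpoly 0 1 n F)`_(n - j).
Proof.
move=> le; rewrite !coef_poly ltnS le ltnS leq_subr trE !mul1n !add0n; congr (F _ _).
by rewrite subKn.
Qed.

Lemma gpoly_monomial n a d F : wge 1 1 n F -> (a <= n)%N -> d != 0 -> gpoly 0 1 n F = d *: 'X^a -> monomial_form (n - a) a F.
Proof.
move=> W le d0 E.
have co j : (j <= n)%N -> F (n - j)%N j = d *+ (j == a).
  move=> lj; have := congr1 (fun P => P`_j) E; rewrite coef_poly ltnS lj mul1n add0n => ->.
  by rewrite coefZ coefXn mulr_natr.
split; first by rewrite co // eqxx.
move=> i j nz ne; rewrite subnK // ltnNge; apply/negP => lij; case/negP: nz; apply/eqP.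
have [lt|ge] := ltnP (i + j) n; first by apply: W; rewrite !mul1n.
have ij : i = (n - j)%N by lia.
rewrite ij co; last by lia.
case: eqP => // ja; case/eqP: ne; by rewrite ij ja.
Qed.

Lemma above_line F n i j : F i j != 0 -> (n < j)%N -> (0 + 1 * n < i + 1 * j)%N.
Proof. by move=> _ lt; lia. Qed.

Lemma small_root i j h k n : (0 < j)%N -> (i + j <= k.-1)%N -> n.+1 = (k + h)%N -> (i <= h)%N -> (2 * i < n)%N.
Proof. by lia. Qed.

Lemma line_shear_wge c n F (m0 : fps_mono c 1 0%N = 0) : wge 1 1 n F -> wge 1 1 n (pull (shear m0) F).
Proof. by apply: shear_weak => -[|i]; rewrite fps_monoE ?mulr0n ?eqxx. Qed.

Lemma wge_tr n F : wge 1 1 n F -> wge 1 1 n (tr F).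
Proof. by move=> W i j; rewrite trE !mul1n addnC => lt; apply: W; rewrite !mul1n. Qed.

(** The cases are one, two or more tangent lines, that is, roots of [P]. One or two lines can be
    made axes. Three roots give [3 - 2 > 0] in the degree argument at [-2/n]; and since 0 has
    maximal multiplicity and there is a third root, each other root has multiplicity less than
    [n/2]. *)
Lemma PO_regular sg F n : state sg 1 F -> (0 < n)%N -> wge 1 1 n F -> F 0%N n != 0 ->
  (forall c, (mup c (gpoly 0 1 n F) <= mup 0 (gpoly 0 1 n F))%N) -> PO s0 (zeta F) m.
Proof.
move=> st n0 W v; set P := gpoly 0 1 n F => Pmax.
have Pn : P`_n = F 0%N n by rewrite coef_poly ltnSn subnn muln0.
have szP : size P = n.+1.
  apply/eqP; rewrite eqn_leq size_poly /=; rewrite ltnNge; apply/negP => /leq_sizeP /(_ n (leqnn n)).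
  by rewrite Pn; move/eqP: v.
have P0 : P != 0 by rewrite -size_poly_gt0 szP.
have [u u0 PE] := mup_decomp 0 P0; set h := mup 0 P in PE Pmax.
rewrite polyC0 subr0 in PE.
have un : u != 0 by apply: contraNneq u0 => ->; rewrite horner0.
have szu : (n.+1 = size u + h)%N by rewrite -szP PE mulrC size_Mmonic ?monicXn // size_polyXn addnS.
have [/eqP /size_poly1P [d d0 uE]|/closed_rootP [r ru]] := eqVneq (size u) 1%N.
  have hn : h = n by move: szu; rewrite uE size_polyC d0; lia.
  apply: (PO_monomial_form st n0 (h := n - n)); apply: (@gpoly_monomial n n d) => //.
  by rewrite -/P PE uE hn mulrC mul_polyC.
have r0 : r != 0 by apply: contraNneq u0 => rz; rewrite rz in ru.
have mupu c : c != 0 -> mup c P = mup c u.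
  by move=> c0; rewrite PE mupMr // /root hornerXn expf_eq0 (negbTE c0) andbF.
have h0 : (0 < h)%N.
  have := Pmax r; rewrite mupu //; have : (0 < mup r u)%N by rewrite mup_gt0.
  exact: leq_trans.
have [w w0 uE] := mup_decomp r un; set L := mup r u in uE.
have wn : w != 0 by apply: contraNneq w0 => ->; rewrite horner0.
have [/eqP /size_poly1P [d d0 wE]|/closed_rootP [r3 r3w]] := eqVneq (size w) 1%N.
  have nE : n = (h + L)%N.
    have := congr1 (fun g : {poly C} => size g) uE; rewrite /= wE mulrC mul_polyC size_scale // size_exp_XsubC => E.
    by move: szu; rewrite E addSn addnC => -[].
  have L0 : (0 < L)%N by rewrite mup_gt0.
  have W' := wge_tr W.
  (* Two tangent lines, [P = d X^h (X - r)^L]: one is an axis already, and after the swap the other,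
     now at [r^-1], is moved to 0 by a shear. *)
  pose d' := d * (- r) ^+ L; have d'0 : d' != 0 by rewrite mulf_neq0 // expf_neq0 // oppr_eq0.
  have GE : gpoly 0 1 n (tr F) = d' *: ('X + (- r^-1)%:P) ^+ L.
    apply/polyP => j; rewrite coefZ coef_XaddC_exp; case: (leqP j n) => [le|lt]; last first.
      rewrite nth_default; last by apply: leq_trans (size_poly _ _) lt.
      by rewrite (_ : (j <= L)%N = false) ?mulr0 //; clear -lt nE; lia.
    rewrite gpoly_tr // -/P PE uE wE nE; exact: coef_reverse_power (leq_trans le (eq_leq nE)).
  rewrite -zeta_swap; have m0 : fps_mono (r^-1) 1 0%N = 0 :> C by rewrite fps_monoE.
  rewrite -(zeta_shear (tr F) m0).
  have st2 := state_shear m0 (state_swap st).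
  have W2 : wge 1 1 n (pull (shear m0) (tr F)) by exact: line_shear_wge W'.
  have Ln : (L <= n)%N by rewrite nE leq_addl.
  have GE2 : gpoly 0 1 n (pull (shear m0) (tr F)) = d' *: 'X^L.
    rewrite (gpoly_shear m0 isT (@above_line (tr F) n)).
    by rewrite GE comp_polyZ rmorphXn /= comp_polyD comp_polyX comp_polyC -addrA -polyCD subrr polyC0 addr0.
  exact: (PO_monomial_form st2 L0 (gpoly_monomial W2 Ln d'0 GE2)).
have r3r : r3 != r by apply: contraNneq w0 => <-.
have r3u : root u r3 by rewrite uE rootM r3w orbT.
have r30 : r3 != 0 by apply: contraNneq u0 => rz; rewrite rz in r3u.
have R : ray 1 1 0 n F.
  split=> //; first by move=> i j nz; rewrite !mul1n add0n leqNgt; apply/negP => lt; rewrite W ?eqxx // in nz; rewrite !mul1n.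
    by move=> i j _ lt; rewrite !mul1n add0n; exact: leq_trans lt (leq_addl _ _).
  have su : (1 < size u)%N.
    have l1 : (0 < mup r u)%N by rewrite mup_gt0.
    by have := leq_trans l1 (mup_le_size r un); case: (size u) => [|[]].
  have hn : (h < n)%N by move: su szu; case: (size u) => [|[|t]] // _; rewrite addSn => -[->]; rewrite addSn ltnS leq_addl.
  exists (n - h)%N, h; split=> //; last by rewrite !mul1n add0n subnK // ltnW.
  have := congr1 (fun g : {poly C} => g`_h) PE; rewrite coef_poly ltnS (ltnW hn) mul1n add0n coefXnM ltnn subnn => ->.
  by rewrite -horner_coef0.
have [a' [h' [L' [Q fc]]]] := face_exists R.
have PQ : P = 'X^h' * Q := face_gpoly fc.
apply: (@PO_transversal sg F n a' h' L' Q) => //.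
  move=> c rt; have c0 := face_root_neq0 fc rt.
  rewrite -(face_mup fc c0) -/P.
  have [c' [c'0 ru' ne]] : exists c', [/\ c' != 0, root u c' & c != c'].
    have [->|ne] := eqVneq c r; [by exists r3; split=> //; rewrite eq_sym|by exists r].
  have l1 : (0 < mup c' u)%N by rewrite mup_gt0.
  have l2 := mup_add_le un ne; rewrite -mupu // in l2; exact: small_root l1 l2 szu (Pmax c).
move=> xE; have [rs [urs rsE]] := exists_roots P0.
have rE z : root ('X^h' * (Q \Po 'X^1)) z = (z \in rs) by rewrite expr1 comp_polyXr -PQ rsE.
have sz3 : (2 < size rs)%N.
  apply: (@uniq_leq_size _ [:: 0; r; r3]).
    by rewrite /= !inE !negb_or (eq_sym 0 r) (eq_sym 0 r3) (eq_sym r r3) r0 r30 r3r.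
  move=> z; rewrite !inE -rsE => /or3P [] /eqP ->; last 2 first.
  - by rewrite PE rootM ru orbT.
  - by rewrite PE rootM r3u orbT.
  by rewrite -mup_gt0.
have xn : x * n%:R = - 2%:R by apply/eqP; rewrite -addr_eq0 addrC xE.
have x0 : x < 0.
  have nn : 0 < n%:R :> C by rewrite ltr0n.
  by rewrite -(pmulr_llt0 _ nn) xn oppr_lt0 ltr0n.
apply: (ray_root_gen f0 Hb st fc _ x0 urs rE (ltnW sz3)).
  by rewrite !mul1n add0n.
by rewrite xn subr_gt0 ltr_nat.
Qed.

Lemma max_root P : P != 0 -> exists r, forall c, (mup c P <= mup r P)%N.
Proof.
move=> P0; pose R k := `[< exists c, mup c P = k >].
have exR : exists k, R k by exists (mup 0 P); apply/asboolP; exists 0.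
have bR k : R k -> (k <= size P)%N.
  by move=> /asboolP [c <-]; apply: leq_trans (mup_le_size c P0) (leq_pred _).
have [k /asboolP [r rk] kmax] := ex_maxnP exR bR.
by exists r => c; rewrite rk; apply: kmax; apply/asboolP; exists c.
Qed.

Theorem zeta_pole : f 0%N 0%N = 0 -> PO s0 (zeta f) m.
Proof.
move=> f00; pose R k := `[< exists i j, (i + j)%N = k /\ f i j != 0 >].
have exR : exists k, R k.
  apply: contrapT => nex; apply: f0; apply: fps2P => i j; apply: contrapT => nz; apply: nex.
  by exists (i + j)%N; apply/asboolP; exists i, j; split=> //; exact/eqP.
have [n /asboolP [i0 [j0 [ijn nz]]] nmin] := ex_minnP exR.
have W : wge 1 1 n f.
  move=> i j; rewrite !mul1n => lt; apply/eqP/negPn/negP => nz'.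
  have : (n <= i + j)%N by apply: nmin; apply/asboolP; exists i, j.
  by rewrite leqNgt lt.
have n0 : (0 < n)%N.
  by rewrite lt0n; apply: contraNneq nz => n0; move: ijn; rewrite n0; case: i0 j0 => [|?] [|?] // _; apply/eqP.
have P0 : gpoly 0 1 n f != 0.
  apply/eqP => E; have := congr1 (fun g : {poly C} => g`_j0) E; rewrite coef_poly coef0 ltnS -ijn leq_addl.
  by rewrite mul1n add0n addnK => e; rewrite e eqxx in nz.
(* A direction that is not tangent is made an axis, so that after the swap the tangent cone has full
   degree [n] in [w]; then a tangent line of greatest multiplicity is moved to [w = 0]. *)
have /closed_nonrootP [c cP] := P0.
have m1 : fps_mono c 1 0%N = 0 :> C by rewrite fps_monoE.
have st1 := state_shear1 m1; have W1 := line_shear_wge m1 W.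
have v1 : pull (shear m1) f n 0%N != 0.
  have := congr1 (fun g : {poly C} => g`_0) (gpoly_shear m1 isT (@above_line f n)).
  by rewrite coef_poly subn0 mul1n add0n /= => ->; rewrite -horner_coef0 horner_comp !hornerE; exact: cP.
rewrite -(zeta_shear f m1) -zeta_swap.
have v2 : tr (pull (shear m1) f) 0%N n != 0 by rewrite trE.
move: (tr (pull (shear m1) f)) (state_swap st1) (wge_tr W1) v2 => F2 st2 W2 v2.
have P2n : (gpoly 0 1 n F2)`_n != 0 by rewrite coef_poly ltnSn subnn muln0.
have P20 : gpoly 0 1 n F2 != 0 by apply: contraNneq P2n => ->; rewrite coef0.
have sz2 : size (gpoly 0 1 n F2) = n.+1.
  apply/eqP; rewrite eqn_leq size_poly /= ltnNge; apply/negP => /leq_sizeP /(_ n (leqnn n)).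
  by move/eqP: P2n.
have [r rmax] := max_root P20.
have m2 : fps_mono r 1 0%N = 0 :> C by rewrite fps_monoE.
have GE := gpoly_shear m2 isT (@above_line F2 n).
rewrite -(zeta_shear F2 m2); apply: (PO_regular (state_shear m2 st2) n0 (line_shear_wge m2 W2)).
  have := congr1 (fun g : {poly C} => g`_n) GE; rewrite coef_poly ltnSn subnn muln0 => ->.
  have sz : size (gpoly 0 1 n F2 \Po ('X + r%:P)) = n.+1 by rewrite size_comp_poly2 ?size_XaddC.
  have := lead_coef_eq0 (gpoly 0 1 n F2 \Po ('X + r%:P)); rewrite lead_coefE sz /= => ->.
  by rewrite -size_poly_eq0 sz.
by move=> c'; rewrite GE (mup_comp_shift c' r P20) (mup_comp_shift 0 r P20) add0r; exact: rmax.
Qed.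
End Start.

Theorem corollaryD (R : realType) (f : fps (fps R[i]))
    (f_holomorphic : convergent f) (f_neq0 : f <> 0) (f_at_x : f 0%N 0%N = 0)
    (b : {poly R[i]}) (b_bernstein_sato : is_bernstein_sato f b) (s0 : rat) :
  exists2 m : nat, is_pole_order (motivic_zeta f) s0 m &
                   (m <= mup (ratr s0 : R[i]) b)%N.
Proof.
have [b_monic Hb _] := b_bernstein_sato; have b0 := monic_neq0 b_monic.
have := zeta_pole f_neq0 Hb b0 s0 f_at_x; rewrite -zetaE => pole.
pose at_most k := `[< pole_order_at_most (motivic_zeta f) s0 k >].
have ex : exists k, at_most k by exists (mup (ratr s0) b); exact/asboolP.
have [k /asboolP k_pole k_min] := ex_minnP ex.
exists k; last by apply: k_min; exact/asboolP.
by split=> // k' /asboolP; exact: k_min.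
Qed.
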